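(* Let $X$ be a reflexive separable Banach space, $Y$ a Banach space with separable dual $Y^*$, $M$ a cylindrical orthogonal martingale-valued measure on $X^*$ satisfying the standing assumptions, and $\Phi\in\Lambda(M,X,Y)$. Assume that $$\forall A\in\mathcal A:\qquad \int_{\Omega\times[0,T]\times A}\|\Phi Q_M\Phi^*\|_{\mathcal L(Y^*,Y)}\,d\mu_M<\infty .$$ Then $N=\int\Phi\,dM$ has a unique quadratic variation $\langle\!\langle N\rangle\!\rangle$, and it is given by $$\langle\!\langle N\rangle\!\rangle(C)=\int_C\|\Phi Q_M\Phi^*\|_{\mathcal L(Y^*,Y)}\,d\langle\!\langle M\rangle\!\rangle\qquad\mathbb P\text{-a.e.}$$ In particular $$\frac{d\langle\!\langle N\rangle\!\rangle}{d\langle\!\langle M\rangle\!\rangle}=\|\Phi Q_M\Phi^*\|_{\mathcal L(Y^*,Y)}\ \ \mathbb P\text{-a.e.},\qquad \frac{d\mu_N}{d\mu_M}=\|\Phi Q_M\Phi^*\|_{\mathcal L(Y^*,Y)},\qquad Q_N=\frac{\Phi Q_M\Phi^*}{\|\Phi Q_M\Phi^*\|_{\mathcal L(Y^*,Y)}} .$$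
   Context: Setting. $(\Omega,\mathcal F,\mathbb P)$ is a complete probability space with a filtration $(\mathcal F_t)_{t\ge0}$ satisfying the usual conditions; $T>0$ is fixed; $\mathcal P_T$ is the predictable $\sigma$-algebra on $\Omega\times[0,T]$. $U$ is a Hausdorff topological space homeomorphic to a Borel subset of the real line, and $\mathcal A$ is a ring of Borel subsets of $U$. A map on $\Omega\times[0,T]\times U$ is called predictable if it is $\mathcal P_T\otimes\mathcal B(U)$-measurable. $\mathcal M^2_T$ is the Banach space of real c\`adl\`ag mean-zero square integrable martingales on $[0,T]$ with norm $\|m\|_{\mathcal M^2}=\sup_{t\in[0,T]}(\mathbb E|m(t)|^2)^{1/2}$; $\langle\cdot\rangle$ and $\langle\cdot,\cdot\rangle$ denote predictable quadratic (co)variation of real martingales. A cylindrical random variable on $X^*$ is a linear continuous map $X^*\to L^0(\Omega,\mathcal F,\mathbb P)$ (convergence in probability). Cylindrical orthogonal martingale-valued measure on $X^*$: a family $M=(M(t,A):t\ge0,A\in\mathcal A)$ of cylindrical random variables on $X^*$ such that (1) $M(0,A)x^*=0$ a.s. for all $A\in\mathcal A$, $x^*\in X^*$; (2) for all $A\in\mathcal A$, $x^*\in X^*$, $(M(t,A)x^* )_{t}$ is a c\`adl\`ag mean-zero square integrable martingale; (3) for all $t>0$, $x^*\in X^*$, $M(t,\cdot)x^*:\mathcal A\to L^2(\Omega,\mathcal F,\mathbb P)$ is a $\sigma$-finite $L^2$-valued measure: it is finitely additive, and there are sets $U_n\uparrow U$ (independent of $t$) with $\mathcal B(U_n)\subseteq\mathcal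 A$ for each $n$, such that it is bounded and countably additive in $L^2$ on each $\mathcal B(U_n)$ and $M(t,A)x^*=L^2\text{-}\lim_n M(t,A\cap U_n)x^*$ for $A\in\mathcal A$; (4) $\langle M(A)x^*,M(B)x^*\rangle_t=0$ for all $t>0$, $x^*\in X^*$ and disjoint $A,B\in\mathcal A$. Write $M((s,t],A)x^*=M(t,A)x^*-M(s,A)x^*$. Standing assumptions on $M$. The intensity measures $\nu_{x^*}$ are the random predictable $\sigma$-finite measures on $\mathbb R_+\times U$ with $\nu_{x^*}([0,t]\times A)=\langle M(A)x^*\rangle_t$ a.s. $M$ has a unique quadratic variation $\langle\!\langle M\rangle\!\rangle$: a random measure on $\mathbb R_+\times U$ with $\langle\!\langle M\rangle\!\rangle([0,t]\times A)<\infty$ a.s. for $t\ge0$, $A\in\mathcal A$, and minimal among all random measures $\zeta$ with $\nu_{x^*}\le\zeta$ for every $\|x^*\|=1$. Moreover a.s. $\sup_{A\in\mathcal A}\langle\!\langle M\rangle\!\rangle([0,T]\times A)<\infty$. Then there is $Q_M:\Omega\times[0,T]\times U\to\mathcal L(X^*,X)$ ($X^{**}=X$), weakly predictable, positive and symmetric with norm $1$ $\langle\!\langle M\rangle\!\rangle$-a.e., such that a.s. $\langle M(A)x_1^*,M(A)x_2^*\rangle_t=\int_{[0,t]\times A}\langle Q_Mx_1^*,x_2^*\rangle\,d\langle\!\langle M\rangle\!\rangle$. The Dol\'eans measure is $\mu_M(C)=\mathbb E\int_{[0,T]\times U}\mathbf 1_C\,d\langle\!\langle M\rangle\!\rangle$,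 $C\in\mathcal P_T\otimes\mathcal B(U)$. For $N$ (a cylindrical orthogonal martingale-valued measure on $Y^*$, on $[0,T]$), the objects $\langle\!\langle N\rangle\!\rangle$ (a random measure on $[0,T]\times U$), $\mu_N$ and $Q_N$ (with values in $\mathcal L(Y^*,Y^{**})$, identities holding $\mu_N$-a.e.) are defined by the same requirements with $N$, $Y^*$ in place of $M$, $X^*$. Integrands. $L(M,T,X,Y)$ is the space of families $\Phi(\omega,t,u)\in\mathcal L(X,Y)$ such that $\langle Q_M\Phi^*y_1^*,\Phi^*y_2^*\rangle_{X,X^*}$ is predictable for all $y_1^*,y_2^*\in Y^*$ and, for each $A\in\mathcal A$, $$\rho_{M,A}(\Phi)=\sup_{\|y^*\|\le1}\Big[\int_{\Omega\times[0,T]\times A}\langle Q_M\Phi^*y^*,\Phi^*y^*\rangle_{X,X^*}\,d\mu_M\Big]^{1/2}<\infty.$$ Put $d_M(\Phi,\Psi)=\sum_n2^{-n}\frac{\rho_{M,U_n}(\Phi-\Psi)}{1+\rho_{M,U_n}(\Phi-\Psi)}$; families at $d_M$-distance $0$ are identified. A simple family is $\Phi=\sum_{i=1}^N\mathbf 1_{F_i\times(s_i,t_i]\times A_i}S_i$ with $S_i\in\mathcal L(X,Y)$, $F_i\in\mathcal F_{s_i}$, $A_i\in\mathcal A$, where for $i\ne j$ either $(s_i,t_i]\cap(s_j,t_j]=\emptyset$, or $(s_i,t_i]=(s_j,t_j]$ and $A_i\cap A_j=\emptyset$. $\Lambda(M,X,Y)$ is the $d_M$-closure in $L(M,T,X,Y)$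 of the set of simple families. Integral. For simple $\Phi$, $I^\Phi_t(A)y^*=\sum_{i=1}^N\mathbf 1_{F_i}M((t\wedge s_i,t\wedge t_i],A\cap A_i)(S_i^*y^* )$. For $\Phi\in\Lambda(M,X,Y)$, $I^\Phi(A)y^*=\lim_nI^{\Phi_n}(A)y^*$ in $\mathcal M^2_T$, for any simple $\Phi_n$ with $d_M(\Phi_n,\Phi)\to0$. $\int\Phi\,dM:=(I^\Phi_t(A):t\in[0,T],A\in\mathcal A)$.
   Formalization: It is assumed explicitly that N = ∫Φ dM is a cylindrical orthogonal martingale-valued measure on Y* over [0,T] (same sets U_n); orthogonality of M for each single x* does not imply this for N, and without it N may have no intensity measures. *)

(* Defs.v *)
From HB Require Import structures.
From mathcomp Require Import all_boot all_order all_algebra.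
From mathcomp Require Import all_classical all_reals all_analysis.
From mathcomp Require Import measurable_realfun.

Set Implicit Arguments.
Unset Strict Implicit.
Unset Printing Implicit Defensive.

Import Order.TTheory GRing.Theory Num.Theory.
Import numFieldNormedType.Exports.

Local Open Scope classical_set_scope.
Local Open Scope ring_scope.

Definition contlin_pred (R : realType) (V W : normedModType R) :
  {pred (V -> W)} := fun f => `[< linear f /\ continuous f >].

Arguments contlin_pred {R} V W.

Record contlin (R : realType) (V W : normedModType R) := Contlin {
  contlin_fun :> V -> W;
  contlin_funP : contlin_fun \in contlin_pred V W }.

Section contlin_module.
Context (R : realType) (V W : normedModType R).

HB.instance Definition _ := [isSub for @contlin_fun R V W].
HB.instance Definition _ := [Choice of contlin V W by <:].

Fact contlin_submod_closed : submod_closed (contlin_pred V W).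
Proof.
split=> [|a f g /asboolP[lf cf] /asboolP[lg cg]]; apply/asboolP; split.
- by move=> a x y; rewrite /= scaler0 addr0.
- exact: cst_continuous.
- move=> b x y; rewrite !fctE lf lg !scalerDr !scalerA (mulrC a b).
  by rewrite addrACA.
- move=> x; apply: (@continuousD _ _ _ (fun z => a *: f z) g); last exact: cg.
  by apply: continuousZr; exact: cf.
Qed.

HB.instance Definition _ :=
  GRing.isSubmodClosed.Build R (V -> W) (contlin_pred V W) contlin_submod_closed.
HB.instance Definition _ := [SubChoice_isSubLmodule of contlin V W by <:].

Definition op_norm (f : contlin V W) : R :=
  sup [set `|f x| | x in [set x | `|x| <= 1]].

Lemma contlin_linear (f : contlin V W) : linear f.
Proof. by have /asboolP[] := contlin_funP f. Qed.

Lemma contlin_continuous (f : contlin V W) : continuous f.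
Proof. by have /asboolP[] := contlin_funP f. Qed.

HB.instance Definition _ (f : contlin V W) :=
  GRing.isLinear.Build R V W _ (contlin_fun f) (contlin_linear f).

Lemma contlinP (f g : contlin V W) : (forall x, f x = g x) -> f = g.
Proof. by move=> fg; apply/val_inj/funext. Qed.

Lemma contlin_bounded (f : contlin V W) :
  exists2 M : R, 0 <= M & forall x, `|f x| <= M * `|x|.
Proof.
have /linear_bounded_continuous/linear_boundedP fb := @contlin_continuous f.
by have [M M0 Mf] := pinfty_ex_gt0 fb; exists M; rewrite ?ltW.
Qed.

Lemma op_norm_has_sup (f : contlin V W) :
  has_sup [set `|f x| | x in [set x | `|x| <= 1]].
Proof.
split; first by exists `|f 0|, 0; rewrite //= normr0.
have [M M0 Mf] := contlin_bounded f; exists M => _ [x /= x1 <-].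
by rewrite (le_trans (Mf x))// ler_piMr.
Qed.

Lemma op_norm_ub (f : contlin V W) x : `|x| <= 1 -> `|f x| <= op_norm f.
Proof.
by move=> x1; apply: sup_upper_bound; [exact: op_norm_has_sup|exists x].
Qed.

Lemma op_norm_ge0 (f : contlin V W) : 0 <= op_norm f.
Proof. by apply: (le_trans (normr_ge0 (f 0))); rewrite op_norm_ub// normr0. Qed.

Lemma op_norm_le (f : contlin V W) (M : R) :
  (forall x, `|x| <= 1 -> `|f x| <= M) -> op_norm f <= M.
Proof.
move=> fM; apply: ge_sup; first exact: (op_norm_has_sup f).1.
by move=> _ [x /= x1 <-]; exact: fM.
Qed.

Lemma op_normP (f : contlin V W) x : `|f x| <= op_norm f * `|x|.
Proof.
have [->|x0] := eqVneq x 0; first by rewrite linear0 !normr0 mulr0.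
have nx : 0 < `|x| by rewrite normr_gt0.
have /op_norm_ub : `|(`|x|^-1 *: x)| <= 1.
  by rewrite normrZ normfV normr_id mulVf// gt_eqF.
move=> /(_ f); rewrite linearZ normrZ normfV normr_id.
by rewrite ler_pdivrMl// mulrC.
Qed.

Lemma op_normD (f g : contlin V W) : op_norm (f + g) <= op_norm f + op_norm g.
Proof.
apply: op_norm_le => x x1; rewrite (le_trans (ler_normD _ _))//.
by rewrite lerD// op_norm_ub.
Qed.

Lemma op_normZ (a : R) (f : contlin V W) : op_norm (a *: f) = `|a| * op_norm f.
Proof.
have le b (g : contlin V W) : op_norm (b *: g) <= `|b| * op_norm g.
  by apply: op_norm_le => x x1; rewrite normrZ ler_wpM2l// op_norm_ub.
apply/eqP; rewrite eq_le le/=; have [->|a0] := eqVneq a 0.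
  by rewrite normr0 mul0r op_norm_ge0.
rewrite -ler_pdivlMl ?normr_gt0// -normfV.
by rewrite -[in leLHS](scale1r f) -(mulVf a0) -scalerA le.
Qed.

Lemma op_norm_eq0 (f : contlin V W) : op_norm f = 0 -> f = 0.
Proof.
move=> f0; apply: contlinP => x; apply/eqP; rewrite -normr_le0.
by rewrite (le_trans (op_normP f x))// f0 mul0r.
Qed.

HB.instance Definition _ := @Lmodule_isNormed.Build R (contlin V W)
  op_norm op_normD op_normZ op_norm_eq0.

End contlin_module.

Section operators.
Context (R : realType).

Fact contlin_comp_subproof (V W Z : normedModType R) (g : contlin W Z)
  (f : contlin V W) : (g \o f : V -> Z) \in contlin_pred V Z.
Proof.
apply/asboolP; split=> [a x y|x]; first by rewrite /= !linearP.
by apply: continuous_comp; exact: contlin_continuous.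
Qed.

Definition contlin_comp (V W Z : normedModType R) (g : contlin W Z)
  (f : contlin V W) : contlin V Z := Contlin (contlin_comp_subproof g f).

Definition dual (V : normedModType R) : normedModType R := contlin V R^o.

Lemma dual_norm_le (V : normedModType R) (f : dual V) x :
  `|f x| <= `|f| * `|x|.
Proof. exact: (op_normP f). Qed.

Lemma bounded_contlin (V W : normedModType R) (f : V -> W) (M : R) :
  linear f -> (forall x, `|f x| <= M * `|x|) -> f \in contlin_pred V W.
Proof.
move=> lf fM; apply/asboolP; split=> //.
pose lfm := GRing.isLinear.Build R V W _ f lf.
pose g : {linear V -> W} := HB.pack f lfm.
apply: (@bounded_linear_continuous _ _ _ g); apply/linear_boundedP.
exists M; split=> [|r Mr x]; first exact: num_real.
by rewrite (le_trans (fM x))// ler_wpM2r// ltW.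
Qed.

Fact adjoint_subproof (V W : normedModType R) (S : contlin V W) :
  (fun f : dual W => contlin_comp f S : dual V)
    \in contlin_pred (dual W) (dual V).
Proof.
apply: (@bounded_contlin _ _ _ `|S|) => [a f g|f]; first exact: contlinP.
apply: op_norm_le => x x1; rewrite (le_trans (dual_norm_le f (S x)))// mulrC.
by rewrite ler_wpM2r// op_norm_ub.
Qed.

Definition adjoint (V W : normedModType R) (S : contlin V W) :
  contlin (dual W) (dual V) := Contlin (adjoint_subproof S).

Fact eval_subproof (V : normedModType R) (x : V) :
  (fun f : dual V => f x : R^o) \in contlin_pred (dual V) R^o.
Proof.
apply: (@bounded_contlin _ _ _ `|x|) => [//|f].
by rewrite mulrC; exact: dual_norm_le.
Qed.

Definition eval_at (V : normedModType R) (x : V) : dual (dual V) :=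
  Contlin (eval_subproof x).

Fact bidual_subproof (V : normedModType R) :
  @eval_at V \in contlin_pred V (dual (dual V)).
Proof.
apply: (@bounded_contlin _ _ _ 1) => [a x y|x].
  by apply: contlinP => f; rewrite /= linearP.
rewrite mul1r; apply: op_norm_le => f f1 /=.
by rewrite (le_trans (dual_norm_le f x))// ler_piMl.
Qed.

Definition to_bidual (V : normedModType R) : contlin V (dual (dual V)) :=
  Contlin (@bidual_subproof V).

Definition reflexive_space (V : normedModType R) :=
  forall f : dual (dual V), exists x, f = to_bidual V x.

Definition separable (V : normedModType R) :=
  exists2 D : set V, countable D & dense D.

End operators.

Local Open Scope ereal_scope.

Notation borelType U := (g_sigma_algebraType (@open U)).

Section sets.
Context (R : realType).

Definition halfline : set R := [set t | (0 <= t)%R].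

Definition horizon (T : R) : set R := [set t | (0 <= t <= T)%R].

Definition homeomorphic_to_borel (U : topologicalType) :=
  exists (f : U -> R) (B : set R), [/\ measurable B, set_bij setT B f,
    continuous f &
    forall O : set U, open O -> exists2 V : set R, open V & f @` O = B `&` V].

Definition borel_ring (U : ptopologicalType)
    (rA : set (set (borelType U))) :=
  setring rA /\ rA `<=` measurable.

Definition exhausting (U : ptopologicalType)
    (rA : set (set (borelType U))) (U_ : (set U)^nat) :=
  [/\ {homo U_ : m n / (m <= n)%N >-> m `<=` n}, \bigcup_n U_ n = setT,
    (forall n, measurable (U_ n : set (borelType U))) &
    forall n (B : set (borelType U)), measurable B -> B `<=` U_ n -> rA B].

End sets.

Section processes.
Context (R : realType) (d : measure_display) (Omega : measurableType d).
Context (P : probability Omega R) (F : R -> set (set Omega)).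

Definition usual_conditions :=
  [/\ measure_is_complete P,
    forall t, (0 <= t)%R -> sigma_algebra setT (F t) /\ F t `<=` measurable,
    forall s t, (0 <= s <= t)%R -> F s `<=` F t,
    forall t, (0 <= t)%R -> \bigcap_(s in [set s | (t < s)%R]) F s `<=` F t &
    P.-negligible `<=` F 0%R].

(* [J] is the time set, either [halfline] or [horizon T].  The sets
   below generate the predictable sigma-algebra on Omega * J; on all of
   Omega * R they generate a sigma-algebra whose trace on Omega * J is the
   predictable one. *)
Definition predictable_rect (J : set R) : set (set (Omega * R)) :=
  [set C | (exists2 A, F 0%R A & C = A `*` [set 0%R]) \/
    exists s t A, [/\ (0 <= s < t)%R, J t, F s A &
      C = A `*` [set r | (s < r <= t)%R]]].

Local Notation predType J := (g_sigma_algebraType (predictable_rect J)).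

Definition predictable_process (J : set R) (V : R -> Omega -> \bar R) :=
  measurable_fun ([set z | J z.2] : set (predType J))
    (fun z => V z.2 z.1 : \bar R).

Definition cadlag (J : set R) (f : R -> R) := forall t, J t ->
  f @ within [set s | J s /\ (t < s)%R] (nbhs t) --> f t /\
  exists l : R, f @ within [set s | J s /\ (s < t)%R] (nbhs t) --> l.

Definition martingale (J : set R) (m : R -> Omega -> R) :=
  [/\ forall t, J t -> forall B, measurable B -> F t (m t @^-1` B),
    forall t, J t -> P.-integrable setT (EFin \o m t) &
    forall s t, J s -> J t -> (s <= t)%R -> forall A, F s A ->
      \int[P]_(w in A) (m t w)%:E = \int[P]_(w in A) (m s w)%:E].

Definition L2norm (f : Omega -> R) : \bar R := 'N[P]_2%:E [EFin \o f].

Definition L2_martingale (J : set R) (m : R -> Omega -> R) :=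
  [/\ martingale J m, forall t, J t -> 'E_P[m t] = 0,
    forall t, J t -> L2norm (m t) < +oo &
    {ae P, forall w, cadlag J (m ^~ w)}].

Definition M2norm (T : R) (m : R -> Omega -> R) : \bar R :=
  ereal_sup [set L2norm (m t) | t in horizon T].

(* [V] is a version of the predictable covariation <m1, m2> on [J]. *)
Definition covariation (J : set R) (m1 m2 V : R -> Omega -> R) :=
  [/\ predictable_process J (fun t w => (V t w)%:E),
    {ae P, forall w, V 0%R w = 0%R},
    {ae P, forall w, cadlag J (V ^~ w) /\
      forall t, J t -> bounded_variation 0%R t (V ^~ w)} &
    martingale J (fun t w => m1 t w * m2 t w - V t w)%R].

Definition cylindrical_rv (E : normedModType R) (Z : E -> Omega -> R) :=
  [/\ forall x, measurable_fun setT (Z x),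
    forall (a : R) x y,
      {ae P, forall w, Z (a *: x + y)%R w = (a * Z x w + Z y w)%R} &
    forall x (e : R), (0 < e)%R ->
      P [set w | (e <= `|Z y w - Z x w|)%R] @[y --> x] --> 0].

Context (U : ptopologicalType) (rA : set (set (borelType U))).
Context (U_ : (set U)^nat).

Definition sigma_finite_L2_measure (mu : set U -> Omega -> R) :=
  [/\ forall A, rA A -> measurable_fun setT (mu A) /\ L2norm (mu A) < +oo,
    forall A B, rA A -> rA B -> A `&` B = set0 ->
      {ae P, forall w, mu (A `|` B) w = (mu A w + mu B w)%R},
    forall n, exists c : R, forall B : set (borelType U), measurable B ->
      B `<=` U_ n -> L2norm (mu B) <= c%:E,
    forall n (B : (set (borelType U))^nat),
      (forall k, measurable (B k) /\ B k `<=` U_ n) -> trivIset setT B ->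
      L2norm (fun w => mu (\bigcup_k B k) w - \sum_(k < m) mu (B k) w)%R
        @[m --> \oo] --> 0 &
    forall A, rA A ->
      L2norm (fun w => mu A w - mu (A `&` U_ n) w)%R @[n --> \oo] --> 0].

(* [M t A x] is M(t, A)x, for x in the normed space [E], in practice a dual. *)
Definition orthogonal_mvm (E : normedModType R) (J : set R)
    (M : R -> set U -> E -> Omega -> R) :=
  [/\ forall t A, J t -> rA A -> cylindrical_rv (M t A),
    forall A x, rA A -> {ae P, forall w, M 0%R A x w = 0%R},
    forall A x, rA A -> L2_martingale J (fun t => M t A x),
    forall t x, J t -> (0 < t)%R ->
      sigma_finite_L2_measure (fun A => M t A x) &
    forall A B x, rA A -> rA B -> A `&` B = set0 ->
      covariation J (fun t => M t A x) (fun t => M t B x) (fun _ _ => 0%R)].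

(* Random measures on J * U are kernels that do not charge the complement. *)
Definition carried_by (J : set R)
    (zeta : R.-ker Omega ~> (R * borelType U)%type) :=
  forall w, zeta w (~` (J `*` setT)) = 0.

(* For every predictable W >= 0, the process of the integrals of W over
   [0, t] * U is predictable. *)
Definition predictable_random_measure (J : set R)
    (nu : R.-ker Omega ~> (R * borelType U)%type) :=
  forall W : predType J * borelType U -> \bar R,
    measurable_fun ([set z | J z.1.2] : set (predType J * borelType U)) W ->
    (forall z, 0 <= W z) ->
    predictable_process J (fun t w =>
      \int[nu w]_(p in `[0%R, t]%classic `*` setT) W (w, p.1, p.2)).

Definition intensity_measure (E : normedModType R) (J : set R)
    (M : R -> set U -> E -> Omega -> R) (x : E)
    (nu : R.-ker Omega ~> (R * borelType U)%type) :=
  [/\ carried_by J nu, predictable_random_measure J nu,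
    {ae P, forall w, sigma_finite setT (nu w)} &
    forall A, rA A -> exists2 V,
      covariation J (fun t => M t A x) (fun t => M t A x) V &
      forall t, J t ->
        {ae P, forall w, nu w (`[0%R, t]%classic `*` A) = (V t w)%:E}].

Definition rm_le (nu zeta : R.-ker Omega ~> (R * borelType U)%type) :=
  {ae P, forall w, forall C, measurable C -> nu w C <= zeta w C}.

Definition intensity_majorant (E : normedModType R) (J : set R)
    (M : R -> set U -> E -> Omega -> R)
    (zeta : R.-ker Omega ~> (R * borelType U)%type) :=
  carried_by J zeta /\
  forall x : E, `|x|%R = 1%R ->
    exists2 nu, intensity_measure J M x nu & rm_le nu zeta.

(* The quadratic variation is the least random measure, up to P-null sets,
   that dominates all intensity measures of the unit sphere. *)
Definition quadratic_variation (E : normedModType R) (J : set R)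
    (M : R -> set U -> E -> Omega -> R)
    (zeta : R.-ker Omega ~> (R * borelType U)%type) :=
  [/\ forall t A, J t -> rA A ->
      {ae P, forall w, zeta w (`[0%R, t]%classic `*` A) < +oo},
    intensity_majorant J M zeta &
    forall zeta', intensity_majorant J M zeta' -> rm_le zeta zeta'].

Definition unique_quadratic_variation (E : normedModType R) (J : set R)
    (M : R -> set U -> E -> Omega -> R)
    (zeta : R.-ker Omega ~> (R * borelType U)%type) :=
  quadratic_variation J M zeta /\
  forall zeta', quadratic_variation J M zeta' ->
    {ae P, forall w, forall C, measurable C -> zeta' w C = zeta w C}.

Context (T : R).

Local Notation predSpace := (predType (horizon T) * borelType U)%type.

Definition slab (A : set U) : set (Omega * R * U) :=
  [set z | horizon T z.1.2 /\ A z.2].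

Definition doleans (zeta : R.-ker Omega ~> (R * borelType U)%type)
    (C : set predSpace) : \bar R :=
  \int[P]_w \int[zeta w]_(p in horizon T `*` setT) (\1_C (w, p.1, p.2))%:E.

(* Almost surely, [prop] holds almost everywhere for the measure [zeta w]. *)
Definition ae_random (zeta : R.-ker Omega ~> (R * borelType U)%type)
    (prop : set (Omega * R * U)) :=
  {ae P, forall w, {ae zeta w, forall p, prop (w, p.1, p.2)}}.

(* [Q] takes its values in L(E, W), where W is paired with E by [pair]; [ae]
   is the sense in which positivity, symmetry and norm one hold. *)
Definition variation_operator (E W : normedModType R) (pair : W -> E -> R)
    (ae : set (set (Omega * R * U))) (J : set R)
    (M : R -> set U -> E -> Omega -> R)
    (zeta : R.-ker Omega ~> (R * borelType U)%type)
    (Q : Omega * R * U -> contlin E W) :=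
  [/\ forall x1 x2, measurable_fun (slab setT : set predSpace)
        (fun z => pair (Q z x1) x2 : R),
    ae [set z | slab setT z ->
      [/\ forall x, (0 <= pair (Q z x) x)%R,
        forall x1 x2, pair (Q z x1) x2 = pair (Q z x2) x1 &
        `|Q z|%R = 1%R]] &
    forall A x1 x2, rA A -> exists2 V,
      covariation J (fun t => M t A x1) (fun t => M t A x2) V &
      forall t, horizon T t -> {ae P, forall w, (V t w)%:E =
        \int[zeta w]_(p in `[0%R, t]%classic `*` A)
          (pair (Q (w, p.1, p.2) x1) x2)%:E}].

Definition is_density d' (S : measurableType d') (D : set S)
    (nu mu : set S -> \bar R) (f : S -> R) :=
  measurable_fun D f /\ forall C, measurable C -> C `<=` D ->
    nu C = \int[mu]_(p in C) (f p)%:E.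

Context (X Y : normedModType R).
Context (M : R -> set U -> dual X -> Omega -> R).

Section integrands.
Context (muM : set predSpace -> \bar R).
Context (Q : Omega * R * U -> contlin (dual X) X).
Implicit Types Phi Psi : Omega * R * U -> contlin X Y.

Definition qform Phi (y1 y2 : dual Y) (z : Omega * R * U) : R :=
  adjoint (Phi z) y2 (Q z (adjoint (Phi z) y1)).

Definition rho (A : set U) Phi : \bar R :=
  ereal_sup [set (\int[muM]_(z in slab A) (qform Phi y y z)%:E) `^ 2^-1
            | y in [set y : dual Y | (`|y| <= 1)%R]].

Definition integrand Phi :=
  (forall y1 y2, measurable_fun (slab setT : set predSpace)
    (qform Phi y1 y2)) /\
  forall A, rA A -> rho A Phi < +oo.

(* [contract r] is r / (1 + |r|), with [contract +oo = 1]. *)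
Definition dist Phi Psi : \bar R :=
  \sum_(0 <= n <oo)
    ((2 ^- n)%R * contract (rho (U_ n) (fun z => Phi z - Psi z)%R))%:E.

End integrands.

(* [sf_event i], ]sf_start i, sf_end i], [sf_mark i] and [sf_op i] are the
   F_i, ]s_i, t_i], A_i and S_i of a simple family. *)
Record simple_family := SimpleFamily {
  sf_size : nat;
  sf_event : 'I_sf_size -> set Omega;
  sf_start : 'I_sf_size -> R;
  sf_end : 'I_sf_size -> R;
  sf_mark : 'I_sf_size -> set U;
  sf_op : 'I_sf_size -> contlin X Y }.

Implicit Types f : simple_family.

Definition sf_interval f i : set R :=
  [set r | (sf_start i < r <= @sf_end f i)%R].

Definition simple f :=
  (forall i : 'I_(sf_size f), [/\ (0 <= sf_start i < sf_end i)%R,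
    (sf_end i <= T)%R, F (sf_start i) (sf_event i) & rA (sf_mark i)]) /\
  (forall i j : 'I_(sf_size f), i != j ->
    sf_interval i `&` sf_interval j = set0 \/
    sf_interval i = sf_interval j /\ sf_mark i `&` sf_mark j = set0).

Definition sf_fun f (z : Omega * R * U) : contlin X Y :=
  (\sum_(i < sf_size f)
    \1_(sf_event i `*` sf_interval i `*` sf_mark i) z *: sf_op i)%R.

Definition simple_integral f (t : R) (A : set U) (y : dual Y) (w : Omega) : R :=
  (\sum_(i < sf_size f) \1_(sf_event i) w *
    (M (Num.min t (sf_end i)) (A `&` sf_mark i) (adjoint (sf_op i) y) w -
     M (Num.min t (sf_start i)) (A `&` sf_mark i) (adjoint (sf_op i) y) w))%R.

Section integral.
Context (muM : set predSpace -> \bar R).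
Context (Q : Omega * R * U -> contlin (dual X) X).
Context (Phi : Omega * R * U -> contlin X Y).

Definition approximates (Phi_ : nat -> simple_family) :=
  (forall n, simple (Phi_ n)) /\
  dist muM Q (sf_fun (Phi_ n)) Phi @[n --> \oo] --> 0.

Definition integrable_family :=
  integrand muM Q Phi /\ exists Phi_, approximates Phi_.

Definition stochastic_integral (N : R -> set U -> dual Y -> Omega -> R) :=
  forall A y, rA A -> L2_martingale (horizon T) (fun t => N t A y) /\
    forall Phi_, approximates Phi_ ->
      M2norm T (fun t w => simple_integral (Phi_ n) t A y w - N t A y w)%R
        @[n --> \oo] --> 0.

Definition PhiQPhi (z : Omega * R * U) : contlin (dual Y) Y :=
  contlin_comp (Phi z) (contlin_comp (Q z) (adjoint (Phi z))).

End integral.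

End processes.

Arguments doleans {R d Omega} P F {U} T zeta C.

Notation predSpace F T U :=
  (g_sigma_algebraType (predictable_rect F (horizon T)) * borelType U)%type.

(* Main.v *)
Require Import Defs.
From HB Require Import structures.
From mathcomp Require Import all_boot all_order all_algebra.
From mathcomp Require Import all_classical all_reals all_analysis.
From mathcomp Require Import measurable_realfun.
From mathcomp Require Import ring lra.

(** The integral [N] is an integrator of the same kind as [M], and its brackets
    are the integrals of the quadratic form of [Phi Q Phi^*]. Its intensity at
    a unit vector [y] is therefore the measure with density
    [<Phi Q Phi^* y, y>] with respect to the quadratic variation of [M], and
    the least measure above all of them has the supremum of these densities as
    its density, which is the norm of the positive symmetric operator
    [Phi Q Phi^*]. The normalised operator then represents the covariations of
    [N]. Separability makes all suprema countable, so that exceptional events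
    can be collected.

    Three points need an argument.

    The isometry ([ito_block], [ito_isometry_ring]). The second moment of an
    increment of [N] over a past event is the integral of the quadratic form
    over the corresponding predictable box. For simple integrands this cannot
    be read off directly: disjoint marks make [M] orthogonal for one functional
    at a time, whereas a simple integrand applies different functionals on
    different marks. It does hold on the atoms of the marks of the integrand
    ([simple_isometry]), and [N] at a fixed [y] is orthogonal on disjoint
    marks. Summing over the atoms of an approximating simple integrand requires
    that the squared errors on the atoms have a small sum. Up to a factor four
    this sum is the squared error on one union of atoms
    ([exists_large_subsum]), and the approximation is uniform over subsets
    ([uniform_integral_convergence]), because mixtures of approximating
    sequences are again approximating sequences with the same limit.

    Predictability ([regular_quadratic_variation]). The quadratic variation of
    [M] is only minimal, not predictable by definition. Its products with the
    diagonal values of the operator [Q] at a dense sequence are brackets of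
    [M], hence have predictable versions; as [Q] has norm one, at almost every
    point one of these values is positive and can be divided out
    ([predictable_of_weights]). Reflexivity and separability of [X] provide the
    dense sequence in the dual ([dual_dense_seq]).

    Uniqueness of intensities ([intensity_measure_unique]). The expectations of
    an intensity measure of [N] on predictable boxes are second moments of
    increments, so any two of them have the same Doleans measure. Predictable
    random measures with the same Doleans measure coincide
    ([predictable_random_measure_unique]): for the masses [b] and [b'] of a
    bounded predictable set, integration by parts writes the expectations of
    [b b], [b b'], [b' b] and [b' b'] as expectations of integrals of
    predictable functions, so that the expectation of [(b - b')^2] is 0. This
    gives minimality of the candidate, its uniqueness, and also uniqueness of
    the operator, since any other operator defines intensity measures of [N]
    through its quadratic form. *)

Set Implicit Arguments.
Unset Strict Implicit.
Unset Printing Implicit Defensive.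

Import Order.TTheory GRing.Theory Num.Theory.
Import numFieldNormedType.Exports.

Local Open Scope classical_set_scope.
Local Open Scope ring_scope.
Local Open Scope ereal_scope.

(** * Bounded operators and bilinear forms *)

Section contlin_values.
Local Open Scope ring_scope.
Context (R : realType) (V W : normedModType R).
Implicit Types f g : contlin V W.

Lemma contlinD f g x : (f + g) x = f x + g x.
Proof. by rewrite -[(f + g) x]/(val (f + g) x) [val _]raddfD. Qed.

Lemma contlinN f x : (- f) x = - f x.
Proof. by rewrite -[(- f) x]/(val (- f) x) [val _]raddfN. Qed.

Lemma contlinB f g x : (f - g) x = f x - g x.
Proof. by rewrite contlinD contlinN. Qed.

Lemma contlinZ (c : R) f x : (c *: f) x = c *: f x.
Proof. by rewrite -[(c *: f) x]/(val (c *: f) x) [val _]linearZ. Qed.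

Lemma contlin0 x : (0 : contlin V W) x = 0.
Proof. by rewrite -[(0 : contlin V W) x]/(val (0 : contlin V W) x) [val _]raddf0. Qed.

Lemma contlin_argD f x y : f (x + y) = f x + f y.
Proof. exact: linearD. Qed.

Lemma contlin_argN f x : f (- x) = - f x.
Proof. exact: linearN. Qed.

Lemma contlin_argB f x y : f (x - y) = f x - f y.
Proof. exact: linearB. Qed.

Lemma contlin_argZ f (c : R) x : f (c *: x) = c *: f x.
Proof. exact: linearZ. Qed.
End contlin_values.

Section bilinear_values.
Local Open Scope ring_scope.
Context (R : realType) (E : normedModType R).
Implicit Types B C D : contlin E (dual E).

Lemma bilinearB B C a b : (B - C) a b = B a b - C a b.
Proof. by rewrite contlinB [LHS]contlinB. Qed.

Lemma bilinearN B a b : (- B) a b = - B a b.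
Proof. by rewrite contlinN [LHS]contlinN. Qed.

Lemma bilinear_argBl B a a' b : B (a - a') b = B a b - B a' b.
Proof. by rewrite contlin_argB [LHS]contlinB. Qed.

Lemma bilinear_argDl B a a' b : B (a + a') b = B a b + B a' b.
Proof. by rewrite contlin_argD [LHS]contlinD. Qed.

Lemma bilinear_argZl B c a b : B (c *: a) b = c * B a b.
Proof. by rewrite contlin_argZ [LHS]contlinZ. Qed.

Lemma bilinear_argNl B a b : B (- a) b = - B a b.
Proof. by rewrite contlin_argN [LHS]contlinN. Qed.

Lemma bilinear_argBr B a b b' : B a (b - b') = B a b - B a b'.
Proof. exact: (contlin_argB (B a)). Qed.

Lemma bilinear_argDr B a b b' : B a (b + b') = B a b + B a b'.
Proof. exact: (contlin_argD (B a)). Qed.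

Lemma bilinear_argNr B a b : B a (- b) = - B a b.
Proof. exact: (contlin_argN (B a)). Qed.

Lemma bilinear_argZr B c a b : B a (c *: b) = c * B a b.
Proof. exact: (contlin_argZ (B a)). Qed.

Definition bilinear_argE := (bilinear_argBl, bilinear_argDl, bilinear_argZl,
  bilinear_argNl, bilinear_argBr, bilinear_argDr, bilinear_argNr, bilinear_argZr).
End bilinear_values.

(** * The Hahn-Banach theorem and separability of the dual *)

Section hahn_banach.
Local Open Scope ring_scope.
Context (R : realType) (V : lmodType R).
Implicit Types (p q : V -> R) (x y v : V).

Definition sublinear p :=
  (forall x y, p (x + y) <= p x + p y)%R /\
  (forall (c : R) x, (0 <= c)%R -> p (c *: x) = c * p x)%R.

Lemma sublinear0 p : sublinear p -> p 0 = 0%R.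
Proof. by move=> [_ /(_ 0 0 (lexx _))]; rewrite scaler0 mul0r. Qed.

Lemma sublinear_ge p x : sublinear p -> (- p (- x) <= p x)%R.
Proof.
move=> sp; have := sp.1 x (- x)%R; rewrite subrr (sublinear0 sp).
by move=> ?; rewrite lerNl -subr_ge0 opprK addrC.
Qed.

(** The largest sublinear functional below [p] that is at most [- p v] at [-
    v]: along the ray of [v] the value of [p] is discounted linearly. *)
Definition slide p v x : R := inf [set (p (x + t *: v) - t * p v)%R | t in [set t : R | (0 <= t)%R]].

Lemma slide_has_inf p v x : sublinear p ->
  has_inf [set (p (x + t *: v) - t * p v)%R | t in [set t : R | (0 <= t)%R]].
Proof.
move=> sp; split; first by exists (p (x + 0 *: v) - 0 * p v)%R, 0%R => /=.
exists (- p (- x))%R => _ [t /= t0 <-].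
have := sp.1 (x + t *: v)%R (- x)%R; rewrite addrAC subrr add0r sp.2//.
by move=> ?; rewrite lerNl opprB lerBlDr addrC.
Qed.

Lemma slide_le p v x (t : R) : sublinear p -> (0 <= t)%R ->
  (slide p v x <= p (x + t *: v) - t * p v)%R.
Proof.
by move=> sp t0; apply: ge_inf; [exact: (slide_has_inf _ _ sp).2|exists t].
Qed.

Lemma slide_ge p v x (c : R) : sublinear p ->
  (forall t : R, (0 <= t)%R -> c <= p (x + t *: v) - t * p v)%R ->
  (c <= slide p v x)%R.
Proof.
move=> sp h; apply: lb_le_inf; first exact: (slide_has_inf _ _ sp).1.
by move=> _ [t /= t0 <-]; exact: h.
Qed.

Lemma slide_le_self p v x : sublinear p -> (slide p v x <= p x)%R.
Proof.
by move=> sp; have := slide_le v x sp (lexx 0%R); rewrite scale0r addr0 mul0r subr0.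
Qed.

Lemma slide_opp p v : sublinear p -> (slide p v (- v) <= - p v)%R.
Proof.
move=> sp; have := slide_le v (- v)%R sp ler01.
by rewrite scale1r addNr mul1r (sublinear0 sp) sub0r.
Qed.

Lemma slide_sublinear p v : sublinear p -> sublinear (slide p v).
Proof.
move=> sp; split=> [x y|c x].
  rewrite -lerBlDr; apply: slide_ge => // s s0.
  rewrite lerBlDr -lerBlDl; apply: slide_ge => // t t0.
  rewrite lerBlDl; apply: le_trans (slide_le v (x + y)%R sp (addr_ge0 s0 t0)) _.
  have := sp.1 (x + s *: v)%R (y + t *: v)%R.
  rewrite addrACA -scalerDl mulrDl; lra.
rewrite le_eqVlt => /predU1P[<-|c0].
  rewrite scale0r mul0r; apply/eqP; rewrite eq_le; apply/andP; split.
    by rewrite (le_trans (slide_le_self _ _ sp))// (sublinear0 sp).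
  by apply: slide_ge => // t t0; rewrite add0r sp.2// subrr.
have le (b : R) z : (0 < b)%R -> (slide p v (b *: z) <= b * slide p v z)%R.
  move=> b0; rewrite -ler_pdivrMl//; apply: slide_ge => // t t0.
  rewrite ler_pdivrMl// (le_trans (slide_le v _ sp (mulr_ge0 (ltW b0) t0)))//.
  by rewrite -scalerA -scalerDr (sp.2 _ _ (ltW b0)) mulrBr mulrA.
apply/eqP; rewrite eq_le le//= -ler_pdivlMl//.
by have := le c^-1%R (c *: x)%R; rewrite invr_gt0 scalerA mulVf ?gt_eqF// scale1r; exact.
Qed.

(** Sliding along a vector [v] produces a smaller functional, so minimality
    forces [q (- v) <= - q v]. *)
Lemma minimal_sublinear p : sublinear p ->
  exists f : V -> R, linear (f : V -> R^o) /\ forall x, (f x <= p x)%R.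
Proof.
move=> sp; pose S := {q : V -> R | sublinear q /\ forall x, (q x <= p x)%R}.
pose below (q r : S) := `[< forall x, sval r x <= sval q x >]%R.
have [|q r s /asboolP qr /asboolP rs|q r /asboolP qr /asboolP rq|C Ctot|q qmin] :=
    @Zorn S below.
- by move=> q; apply/asboolP.
- by apply/asboolP => x; rewrite (le_trans (rs x)).
- case: q r qr rq => [q Hq] [r Hr] /= qr rq.
  have e : q = r by apply/funext => x; apply/eqP; rewrite eq_le qr rq.
  by subst r; congr exist; exact: Prop_irrelevance.
- have [[q0 Cq0]|C0] := pselect (C !=set0); last first.
    by exists (exist _ p (conj sp (fun x => lexx _))) => s Cs; case: C0; exists s.
  pose r x : R := inf [set sval q x | q in C].
  have rinf x : has_inf [set sval q x | q in C].
    split; first by exists (sval q0 x), q0.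
    exists (- p (- x))%R => _ [[q [sq qp]] /= Cq <-].
    by rewrite (le_trans _ (sublinear_ge x sq))// lerN2.
  have rle (q : S) x : C q -> (r x <= sval q x)%R.
    by move=> Cq; apply: ge_inf; [exact: (rinf x).2|exists q].
  have rge x c : (forall q : S, C q -> c <= sval q x)%R -> (c <= r x)%R.
    move=> h; apply: lb_le_inf; first exact: (rinf x).1.
    by move=> _ [q Cq <-]; exact: h.
  have sr : sublinear r.
    split=> [x y|c x c0].
      rewrite -lerBlDr; apply: (rge _ _) => s Cs.
      rewrite lerBlDr -lerBlDl; apply: (rge _ _) => t Ct; rewrite lerBlDl.
      have [/asboolP st|/asboolP ts] := Ctot _ _ Cs Ct.
        rewrite (le_trans (rle t _ Ct))// (le_trans ((svalP t).1.1 x y))//.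
        by have := st x; lra.
      rewrite (le_trans (rle s _ Cs))// (le_trans ((svalP s).1.1 x y))//.
      by have := ts y; lra.
    move: c0; rewrite le_eqVlt => /predU1P[<-|c0].
      rewrite scale0r mul0r; apply/eqP; rewrite eq_le; apply/andP; split.
        by rewrite (le_trans (rle _ _ Cq0))// (sublinear0 (svalP q0).1).
      by apply: (rge _ _) => s _; rewrite (sublinear0 (svalP s).1).
    apply/eqP; rewrite eq_le; apply/andP; split.
      rewrite -ler_pdivrMl//; apply: (rge _ _) => s Cs; rewrite ler_pdivrMl//.
      by rewrite (le_trans (rle _ _ Cs))// (svalP s).1.2// ltW.
    apply: (rge _ _) => s Cs; rewrite (svalP s).1.2 ?(ltW c0)//.
    by rewrite ler_wpM2l ?(ltW c0)// rle.
  have rp x : (r x <= p x)%R by rewrite (le_trans (rle _ _ Cq0))// (svalP q0).2.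
  by exists (exist _ r (conj sr rp)) => s Cs; apply/asboolP => x /=; exact: rle.
case: q qmin => q [sq qp] qmin; exists q; split=> //.
have qN v : q (- v)%R = (- q v)%R.
  apply/eqP; rewrite eq_le; apply/andP; split; last first.
    by have := sublinear_ge (- v)%R sq; rewrite opprK.
  have sp' : forall x, (slide q v x <= p x)%R.
    by move=> x; rewrite (le_trans (slide_le_self _ _ sq)).
  have := qmin (exist _ (slide q v) (conj (slide_sublinear v sq) sp')).
  have -> : below (exist _ q (conj sq qp))
      (exist _ (slide q v) (conj (slide_sublinear v sq) sp')).
    by apply/asboolP => x /=; exact: slide_le_self.
  by move=> /(_ isT) [eqq]; rewrite -[X in (X _ <= _)%R]eqq slide_opp.
have qD x y : (q (x + y) = q x + q y)%R.
  apply/eqP; rewrite eq_le sq.1/=; have := sq.1 (- x)%R (- y)%R.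
  by rewrite -opprD !qN -opprD lerN2.
move=> a x y; rewrite qD; congr (_ + _)%R.
have [a0|/ltW a0] := leP 0%R a; first exact: sq.2.
by rewrite -[a]opprK scaleNr qN sq.2 ?oppr_ge0// scaleNr.
Qed.

(** A minimal sublinear functional below [slide p v] exists by Zorn's lemma
    and takes the value [p v] at [v], because the slide already bounds its
    value at [- v]. *)
Lemma hahn_banach p v : sublinear p ->
  exists f : V -> R, [/\ linear (f : V -> R^o), forall x, (f x <= p x)%R
    & f v = p v].
Proof.
move=> sp; have [f [lf fp]] := minimal_sublinear (slide_sublinear v sp).
exists f; split=> // [x|]; first by rewrite (le_trans (fp x))// slide_le_self.
pose flin := GRing.isLinear.Build R V R^o _ f lf.
pose g : {linear V -> R^o} := HB.pack f flin.
apply/eqP; rewrite eq_le (le_trans (fp v)) ?slide_le_self//=.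
have := le_trans (fp (- v)%R) (slide_opp v sp).
by rewrite -[f]/(g : V -> R) linearN lerN2.
Qed.

End hahn_banach.

Section duality.
Local Open Scope ring_scope.
Context (R : realType).

Lemma dominated_functional (V : normedModType R) (p : V -> R) v :
  sublinear p -> (forall x, p x <= `|x|) ->
  exists f : dual V, [/\ forall x, f x <= p x, `|f| <= 1 & f v = p v].
Proof.
move=> sp pn; have [f [lf fp fv]] := hahn_banach v sp.
have fn x : `|f x| <= 1 * `|x|.
  rewrite mul1r ler_norml (le_trans (fp x))// andbT lerNl.
  pose flin := GRing.isLinear.Build R V R^o _ f lf.
  pose g : {linear V -> R^o} := HB.pack f flin.
  by rewrite -[f x]/(g x : R) -linearN/= -normrN (le_trans (fp _)).
exists (Contlin (@bounded_contlin R V R^o f 1 lf fn)); split=> //.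
apply: op_norm_le => x x1 /=; rewrite (le_trans (fn x))//.
by rewrite mul1r.
Qed.

Lemma norm_functional (V : normedModType R) (v : V) :
  exists f : dual V, `|f| <= 1 /\ f v = `|v|.
Proof.
have [|//|f [_ f1 fv]] := @dominated_functional V (fun x => `|x|) v.
  by split=> [x y|c x c0]; [exact: ler_normD|rewrite normrZ ger0_norm].
by exists f.
Qed.

Lemma norm_le_functionals (V : normedModType R) (v : V) (s : R) :
  (forall f : dual V, `|f| <= 1 -> f v <= s) -> `|v| <= s.
Proof. by move=> fs; have [f [f1 <-]] := norm_functional v; exact: fs. Qed.

Lemma norm_to_bidual (V W : normedModType R) (A : contlin W V) :
  `|contlin_comp (to_bidual V) A| = `|A|.
Proof.
apply/eqP; rewrite eq_le; apply/andP; split; apply: op_norm_le => x x1 /=.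
  apply: op_norm_le => f f1 /=; rewrite (le_trans (dual_norm_le _ _))//.
  by rewrite -[leRHS]mul1r ler_pM// op_norm_ub.
apply: norm_le_functionals => f f1.
rewrite (le_trans (ler_norm _))// -[f (A x)]/(to_bidual V (A x) f).
rewrite (le_trans (op_norm_ub _ f1))//.
exact: (op_norm_ub (contlin_comp (to_bidual V) A) x1).
Qed.

Definition dense_seq (V : normedModType R) (v_ : nat -> V) :=
  forall v (e : R), 0 < e -> exists n, `|v - v_ n| < e.

Lemma separable_dense_seq (V : normedModType R) :
  separable V -> exists v_ : nat -> V, dense_seq v_.
Proof.
move=> [D cD dD].
have [f fi] : exists f : V -> nat, {in D &, injective f}.
  by have /countable_injP := cD.
have [v0 _ ]: (setT `&` D) !=set0 by apply: dD => //; [exists 0|exact: openT].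
pose v_ n := if pselect (exists v, D v /\ f v = n) is left h then sval (cid h) else v0.
exists v_ => v e e0.
have [w [/= vw Dw]] : (ball v e `&` D) !=set0.
  by apply: dD; [exists v; exact: ballxx|exact: ball_open].
exists (f w); rewrite /v_; case: pselect => [h|[]]; last by exists w.
case: cid => w' /= [Dw' /fi ->]; rewrite ?inE//.
by move: vw; rewrite -ball_normE.
Qed.

(** Norming functionals of a dense sequence separate points: a vector killed
    by all of them is close to some [u_ n] whose norm is then small. *)
Lemma separating_seq (V : normedModType R) : separable V ->
  exists x_ : nat -> dual V, forall u, (forall n, x_ n u = 0) -> u = 0.
Proof.
move=> /separable_dense_seq[u_ du].
have /choice[x_ xP] : forall n, exists f : dual V, `|f| <= 1 /\ f (u_ n) = `|u_ n|.
  by move=> n; exact: norm_functional.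
exists x_ => u xu; apply/eqP; rewrite -normr_le0; apply/ler_addgt0Pl => e e0.
rewrite addr0.
have [n un] := du u (e / 2) (divr_gt0 e0 (ltr0Sn _ 1)).
have : `|u_ n| <= `|u - u_ n|.
  rewrite -[leLHS](xP n).2 -[leLHS]subr0 -(xu n) -linearB/= (le_trans (ler_norm _))//.
  rewrite (le_trans (dual_norm_le _ _))// distrC -[leRHS]mul1r ler_wpM2r//.
  exact: (xP n).1.
have := ler_distD (u_ n) u 0; rewrite !subr0; lra.
Qed.
End duality.

Section dual_separability.
Local Open Scope ring_scope.
Context (R : realType).

(** Finite linear combinations of a sequence are coded by their list of
    coefficients, so that the rational ones are visibly countable. *)
Definition comb (V : lmodType R) (x_ : nat -> V) (c : seq R) : V :=
  \sum_(i < size c) c`_i *: x_ i.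

Lemma comb_pad (V : lmodType R) (x_ : nat -> V) (c : seq R) n :
  (size c <= n)%N -> comb x_ c = \sum_(i < n) c`_i *: x_ i.
Proof.
move=> cn; rewrite /comb (big_ord_widen n (fun i => c`_i *: x_ i) cn) big_mkcond/=.
by apply: eq_bigr => i _; case: ltnP => // ci; rewrite nth_default// scale0r.
Qed.

Lemma combD (V : lmodType R) (x_ : nat -> V) (c c' : seq R) :
  exists c'', comb x_ c'' = comb x_ c + comb x_ c'.
Proof.
exists (mkseq (fun i => c`_i + c'`_i) (maxn (size c) (size c'))).
rewrite (comb_pad _ (leq_maxl (size c) (size c'))).
rewrite (comb_pad _ (leq_maxr (size c) (size c'))) -big_split/=.
rewrite (@comb_pad _ _ _ (maxn (size c) (size c'))) ?size_mkseq//.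
by apply: eq_bigr => i _; rewrite nth_mkseq// scalerDl.
Qed.

Lemma combZ (V : lmodType R) (x_ : nat -> V) (a : R) (c : seq R) :
  comb x_ [seq a * x | x <- c] = a *: comb x_ c.
Proof.
rewrite /comb size_map scaler_sumr; apply: eq_bigr => i _.
by rewrite (nth_map 0)// scalerA.
Qed.

Lemma comb_delta (V : lmodType R) (x_ : nat -> V) n :
  comb x_ (rcons (nseq n 0) 1) = x_ n.
Proof.
rewrite /comb size_rcons size_nseq big_ord_recr/= nth_rcons size_nseq ltnn eqxx.
rewrite scale1r big1 ?add0r// => i _.
by rewrite nth_rcons size_nseq ltn_ord nth_nseq ltn_ord scale0r.
Qed.

(** A functional on the dual that vanishes on the span is, by reflexivity, the
    evaluation at a vector killed by every term of the sequence, hence zero. *)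
Lemma separating_span (V : normedModType R) (x_ : nat -> dual V) :
  reflexive_space V -> (forall u, (forall n, x_ n u = 0) -> u = 0) ->
  forall (y : dual V) (e : R), 0 < e -> exists c, `|y - comb x_ c| < e.
Proof.
move=> reflV sepx y e e0.
pose p (z : dual V) := inf [set `|z - comb x_ c| | c in [set: seq R]].
have pinf z : has_inf [set `|z - comb x_ c| | c in [set: seq R]].
  by split; [exists `|z - comb x_ [::]|, [::]|exists 0 => _ [c _ <-]].
have ple z c : p z <= `|z - comb x_ c|.
  by apply: ge_inf; [exact: (pinf z).2|exists c].
have pge z a : (forall c, a <= `|z - comb x_ c|) -> a <= p z.
  move=> h; apply: lb_le_inf; first exact: (pinf z).1.
  by move=> _ [c _ <-]; exact: h.
have p0 z : 0 <= p z by apply: pge.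
have pn z : p z <= `|z|.
  by rewrite (le_trans (ple z [::]))// /comb big_ord0 subr0.
have pZ a z : 0 < a -> p (a *: z) <= a * p z.
  move=> a0; rewrite -ler_pdivrMl//; apply: (pge) => c; rewrite ler_pdivrMl//.
  rewrite (le_trans (ple _ [seq a * x | x <- c]))// combZ -scalerBr normrZ.
  by rewrite gtr0_norm.
have sp : sublinear p.
  split=> [z w|a z].
    rewrite -lerBlDr; apply: (pge) => c.
    rewrite lerBlDr -lerBlDl; apply: (pge) => c'; rewrite lerBlDl.
    have [c'' cE] := combD x_ c c'.
    by rewrite (le_trans (ple _ c''))// cE opprD addrACA ler_normD.
  rewrite le_eqVlt => /predU1P[<-|a0].
    rewrite scale0r mul0r; apply/eqP; rewrite eq_le p0 andbT.
    by rewrite (le_trans (pn _))// normr0.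
  apply/eqP; rewrite eq_le pZ//= -ler_pdivlMl//.
  by have := pZ a^-1 (a *: z); rewrite invr_gt0 scalerA mulVf ?gt_eqF// scale1r; exact.
have [f [fp f1 fy]] := dominated_functional y sp pn.
have pcomb c : p (comb x_ c) = 0.
  apply/eqP; rewrite eq_le p0 andbT.
  by rewrite (le_trans (ple _ c))// subrr normr0.
have fx n : f (x_ n) = 0.
  have := fp (x_ n); have := fp (- x_ n); rewrite linearN/=.
  have -> : p (x_ n) = 0 by rewrite -(comb_delta x_ n) pcomb.
  have -> : p (- x_ n) = 0.
    by rewrite -(comb_delta x_ n) -scaleN1r -combZ pcomb.
  by rewrite lerNl oppr0 => *; apply/eqP; rewrite eq_le; apply/andP; split.
have [u fu] := reflV f.
have u0 : u = 0 by apply: sepx => n; rewrite -(fx n) fu.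
have py0 : p y = 0 by rewrite -fy fu u0 /= linear0.
have [_ [c _ <-] ce] := inf_adherent e0 (pinf y).
by exists c; rewrite (lt_le_trans ce)// -/(p y) py0 add0r.
Qed.

Lemma rat_comb (V : normedModType R) (x_ : nat -> V) (c : seq R) (e : R) :
  0 < e -> exists q : seq rat, `|comb x_ c - comb x_ [seq ratr t | t <- q]| < e.
Proof.
move=> e0; pose k := (size c).
have dk i : 0 < e / (k.+1%:R * (`|x_ i| + 1)).
  by rewrite divr_gt0// mulr_gt0// ltr_wpDl.
have /choice[q qP] i : exists t : rat,
    c`_i < ratr t < c`_i + e / (k.+1%:R * (`|x_ i| + 1)).
  have [|t] := @rat_in_itvoo R c`_i (c`_i + e / (k.+1%:R * (`|x_ i| + 1))).
    by rewrite ltrDl.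
  by rewrite in_itv/=; exists t.
exists (mkseq q k).
rewrite [X in _ - X](@comb_pad _ _ _ k) ?size_map ?size_mkseq ?size_iota//.
rewrite /comb -sumrB (le_lt_trans (ler_norm_sum _ _ _))//.
apply: (@le_lt_trans _ _ (\sum_(i < k) e / k.+1%:R)).
  apply: ler_sum => i _; rewrite (nth_map 0) ?size_mkseq// nth_mkseq//.
  rewrite -scalerBl normrZ distrC gtr0_norm ?subr_gt0; last by have /andP[] := qP i.
  have /andP[_ ql] := qP i.
  apply: (@le_trans _ _ (e / (k.+1%:R * (`|x_ i| + 1)) * `|x_ i|)).
    by rewrite ler_wpM2r// lerBlDl ltW.
  rewrite invfM -!mulrA ler_pM2l// ler_piMr ?invr_ge0//.
  by rewrite mulrC ler_pdivrMr ?ltr_wpDl// mul1r lerDl.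
rewrite [X in X < _](_ : _ = e * (k%:R / k.+1%:R)); last first.
  by rewrite big_const_ord iter_addr_0 mulrA mulrAC mulr_natr.
by rewrite gtr_pMr// ltr_pdivrMr// mul1r ltr_nat.
Qed.

(** Rational combinations of a separating sequence of functionals are dense,
    by density of their real span. *)
Lemma dual_dense_seq (V : normedModType R) : reflexive_space V -> separable V ->
  exists y_ : nat -> dual V, dense_seq y_.
Proof.
move=> reflV /separating_seq[x_ sepx].
exists (fun n => comb x_ [seq ratr t | t <- odflt [::] (unpickle n)]) => y e e0.
have e2 : 0 < e / 2 by rewrite divr_gt0.
have [c yc] := separating_span reflV sepx y e2.
have [q cq] := rat_comb x_ c e2.
exists (pickle q); rewrite pickleK/= (splitr e).
by rewrite (le_lt_trans (ler_distD (comb x_ c) _ _))// ltrD.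
Qed.

(** Points of the dense sequence that lie outside the ball are projected onto
    it by rescaling, which at most doubles their distance to a point of the
    ball. *)
Lemma ball_dense_seq (V : normedModType R) : (exists v_ : nat -> V, dense_seq v_) ->
  exists v_ : nat -> V, (forall n, `|v_ n| <= 1) /\
    forall v (e : R), `|v| <= 1 -> 0 < e -> exists n, `|v - v_ n| < e.
Proof.
move=> [v_ dv]; pose m n := Num.max 1 `|v_ n|.
have m0 n : 0 < m n by rewrite /m lt_max ltr01.
exists (fun n => (m n)^-1 *: v_ n); split=> [n|v e v1 e0].
  by rewrite normrZ gtr0_norm ?invr_gt0// ler_pdivrMl// mulr1 /m le_max lexx orbT.
have [n vn] := dv v (e / 2) (divr_gt0 e0 (ltr0Sn _ 1)); exists n.
rewrite (splitr e) (le_lt_trans (ler_distD (v_ n) _ _))// ltr_leD//.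
rewrite -[X in X - _]scale1r -scalerBl normrZ /m.
case: (ltP 1 `|v_ n|) => [v1n|_]; last first.
  by rewrite invr1 subrr normr0 mul0r ltW// divr_gt0.
have n0 : 0 < `|v_ n| := lt_trans ltr01 v1n.
rewrite ger0_norm ?subr_ge0 ?invf_le1 ?(ltW v1n)//.
rewrite mulrBl mul1r mulVf ?gt_eqF//.
by have := ler_distD v (v_ n) 0; rewrite !subr0 distrC; lra.
Qed.
End dual_separability.

Section bilinear_forms.
Local Open Scope ring_scope.
Context (R : realType) (E : normedModType R).
Implicit Types (B C D : contlin E (dual E)) (a b : E).

Lemma bilinear_lipschitz B a b a' b' :
  `|B a b - B a' b'| <= `|B| * (`|a - a'| * `|b| + `|a'| * `|b - b'|).
Proof.
have -> : B a b - B a' b' = B (a - a') b + B a' (b - b').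
  by rewrite !bilinear_argE addrA subrK.
rewrite (le_trans (ler_normD _ _))// mulrDr lerD// mulrA.
  by rewrite (le_trans (dual_norm_le _ _))// ler_wpM2r// op_normP.
by rewrite (le_trans (dual_norm_le _ _))// ler_wpM2r// op_normP.
Qed.

Lemma bilinear_continuous B a b (e : R) : 0 < e ->
  exists2 d, 0 < d & forall a' b', `|a - a'| < d -> `|b - b'| < d ->
    `|B a b - B a' b'| < e.
Proof.
move=> e0; pose K := `|B| * (`|a| + `|b| + 1) + 1.
have K0 : 0 < K by rewrite /K ltr_wpDl// mulr_ge0// !addr_ge0.
exists (Num.min 1 (e / K)); first by rewrite lt_min ltr01 divr_gt0.
move=> a' b'; rewrite !lt_min => /andP[a1 aK] /andP[b1 bK].
have a'1 : `|a'| <= `|a| + 1.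
  by have := ler_distD a a' 0; rewrite !subr0 distrC; lra.
rewrite (le_lt_trans (bilinear_lipschitz _ _ _ _ _))//.
apply: (@le_lt_trans _ _ (`|B| * (`|a| + `|b| + 1) * (e / K))).
  rewrite -mulrA ler_wpM2l//.
  have -> : (`|a| + `|b| + 1) * (e / K) = (e / K) * `|b| + (`|a| + 1) * (e / K).
    by ring.
  by rewrite lerD// ler_pM// ltW.
rewrite mulrC -mulrA gtr_pMr// ltr_pdivrMl// mulr1 /K.
by rewrite ltrDl.
Qed.

Lemma bilinear_le_approx B a b (s : R) :
  (forall d : R, 0 < d -> exists a' b', [/\ `|a - a'| < d, `|b - b'| < d & B a' b' <= s]) ->
  B a b <= s.
Proof.
move=> h; apply/ler_addgt0Pr => e e0.
have [d d0 dP] := bilinear_continuous B a b e0.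
have [a' [b' [aa bb Bs]]] := h d d0.
by have := dP _ _ aa bb; rewrite ltr_norml => /andP[]; lra.
Qed.

Lemma bilinear_eq_dense B C (v_ : nat -> E) : dense_seq v_ ->
  (forall n m, B (v_ n) (v_ m) = C (v_ n) (v_ m)) -> B = C.
Proof.
move=> dv h.
have le0 D a b : (forall n m, D (v_ n) (v_ m) = 0) -> D a b <= 0.
  move=> D0; apply: bilinear_le_approx => d d0.
  have [n an] := dv a d d0; have [m bm] := dv b d d0.
  by exists (v_ n), (v_ m); split=> //; rewrite D0.
apply: contlinP => a; apply: contlinP => b; apply/eqP.
rewrite eq_le -[in X in X && _]subr_le0 -[in X in _ && X]subr_le0.
apply/andP; split.
  rewrite -bilinearB; apply: le0 => n m; by rewrite bilinearB h subrr.
by rewrite -bilinearB; apply: le0 => n m; rewrite bilinearB h subrr.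
Qed.

Definition positive_symmetric B :=
  (forall a, 0 <= B a a) /\ (forall a b, B a b = B b a).

Lemma positive_symmetric_dense B (v_ : nat -> E) : dense_seq v_ ->
  (forall n, 0 <= B (v_ n) (v_ n)) ->
  (forall n m, B (v_ n) (v_ m) = B (v_ m) (v_ n)) -> positive_symmetric B.
Proof.
move=> dv B0 BC.
split=> [a|].
  rewrite -oppr_le0 -bilinearN; apply: bilinear_le_approx => d d0.
  have [n an] := dv a d d0; exists (v_ n), (v_ n); split=> //.
  by rewrite bilinearN oppr_le0.
suff le a b : B a b <= B b a by move=> a b; apply/eqP; rewrite eq_le !le.
apply/ler_addgt0Pr => e e0.
have [d1 d10 P1] := bilinear_continuous B a b (divr_gt0 e0 (ltr0Sn R 1)).
have [d2 d20 P2] := bilinear_continuous B b a (divr_gt0 e0 (ltr0Sn R 1)).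
have d0 : 0 < Num.min d1 d2 by rewrite lt_min d10.
have [n] := dv a _ d0; have [m] := dv b _ d0.
rewrite !lt_min => /andP[bm1 bm2] /andP[an1 an2].
have := P1 _ _ an1 bm1; have := P2 _ _ bm2 an2; rewrite BC !ltr_norml.
by move=> /andP[? ?] /andP[? ?]; lra.
Qed.

(** The form is nonnegative at [d *: b - (a - b)]. This is the triangle
    inequality for the square root of the form without square roots, the
    parameter being chosen in the applications. *)
Lemma positive_symmetric_young B a b (d : R) : positive_symmetric B -> 0 < d ->
  B a a <= (1 + d) * B b b + (1 + d^-1) * B (a - b) (a - b).
Proof.
move=> [B0 BC] d0; have di : 0 < d^-1 by rewrite invr_gt0.
have := B0 (d *: b - (a - b)); rewrite !bilinear_argE !(BC b a) => h.
rewrite -subr_ge0 -(pmulr_rge0 _ d0).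
have -> : d * ((1 + d) * B b b + (1 + d^-1) * (B a a - B a b - (B a b - B b b)) - B a a) =
  d * (1 + d) * B b b + (d + d * d^-1) * (B a a - B a b - (B a b - B b b)) - d * B a a.
  by ring.
rewrite mulfV ?gt_eqF//.
apply: le_trans h _; rewrite le_eqVlt; apply/orP; left; apply/eqP.
ring.
Qed.

Section unit_ball.
Context (v_ : nat -> E).
Hypothesis v1 : forall n, `|v_ n| <= 1.
Hypothesis dv : forall v (e : R), `|v| <= 1 -> 0 < e -> exists n, `|v - v_ n| < e.

Lemma norm_le_bilinear B (s : R) :
  (forall a b, `|a| <= 1 -> `|b| <= 1 -> B a b <= s) -> `|B| <= s.
Proof.
move=> Bs; apply: op_norm_le => a a1; apply: op_norm_le => b b1.
rewrite ler_norml Bs// andbT lerNl.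
by have := Bs a (- b); rewrite normrN bilinear_argNr; exact.
Qed.

Lemma bilinear_le_norm B a b : `|a| <= 1 -> `|b| <= 1 -> B a b <= `|B|.
Proof.
move=> a1 b1; rewrite (le_trans (ler_norm _))// (le_trans (dual_norm_le _ _))//.
by rewrite -[leRHS]mulr1 ler_pM// op_norm_ub.
Qed.

Lemma norm_le_dense B (s : R) : (forall n m, B (v_ n) (v_ m) <= s) -> `|B| <= s.
Proof.
move=> Bs; apply: norm_le_bilinear => a b a1 b1.
apply: bilinear_le_approx => d d0.
have [n an] := dv a1 d0; have [m bm] := dv b1 d0.
by exists (v_ n), (v_ m); split.
Qed.

(** By the Cauchy-Schwarz inequality the norm of a positive symmetric form is
    the supremum of its diagonal values on the unit ball, and by continuity a
    dense sequence of the ball is enough. *)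
Lemma norm_le_dense_diag B (s : R) : positive_symmetric B ->
  (forall n, B (v_ n) (v_ n) <= s) -> `|B| <= s.
Proof.
move=> [B0 BC] Bs; apply: norm_le_dense => n m.
have := B0 (v_ n - v_ m); rewrite !bilinear_argE (BC (v_ m) (v_ n)).
by have := Bs n; have := Bs m; lra.
Qed.
End unit_ball.

End bilinear_forms.

(** * Integrals and measures *)

Section nonneg_induction.
Import HBNNSimple.
Context d (T : measurableType d) (R : realType).

(** The monotone class argument for functions: every nonnegative measurable
    function is an increasing limit of sums of multiples of indicators. *)
Lemma nonneg_measurable_ind (Pr : (T -> \bar R) -> Prop) :
  (forall E, measurable E -> Pr (EFin \o \1_E)) ->
  (forall f g : T -> \bar R, measurable_fun setT f -> measurable_fun setT g ->
    (forall x, 0 <= f x) -> (forall x, 0 <= g x) -> Pr f -> Pr g ->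
    Pr (fun x => f x + g x)) ->
  (forall (c : R) (f : T -> \bar R), (0 <= c)%R -> measurable_fun setT f ->
    (forall x, 0 <= f x) -> Pr f -> Pr (fun x => c%:E * f x)) ->
  (forall (f_ : (T -> \bar R)^nat) (f : T -> \bar R), (forall n, measurable_fun setT (f_ n)) ->
    (forall n x, 0 <= f_ n x) -> measurable_fun setT f ->
    (forall x, {homo f_^~ x : n m / (n <= m)%N >-> n <= m}) ->
    (forall x, f_ n x @[n --> \oo] --> f x) -> (forall n, Pr (f_ n)) -> Pr f) ->
  forall f : T -> \bar R, measurable_fun setT f -> (forall x, 0 <= f x) -> Pr f.
Proof.
move=> Pind PD PZ Plim f mf f0.
pose g_ (n : nat) (x : T) : \bar R := (nnsfun_approx measurableT mf n x)%:E.
apply: (Plim g_) => //.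
- move=> n; exact/measurable_EFinP.
- by move=> n x; rewrite lee_fin.
- move=> x n m nm; rewrite lee_fin.
  by have /lefP := nd_nnsfun_approx measurableT mf nm; exact.
- by move=> x; exact: (@cvg_nnsfun_approx _ _ _ _ measurableT f mf (fun x _ => f0 x)).
move=> n; rewrite /g_; move: (nnsfun_approx measurableT mf n) => g {g_}.
have Pind0 : Pr (fun=> 0).
  rewrite (_ : (fun=> 0) = EFin \o (\1_set0 : T -> R)); first exact: Pind.
  by apply/funext => x /=; rewrite indic0.
pose s := finmap.enum_fset (fset_set (range g)).
rewrite (_ : (fun x => _) = fun x =>
    \sum_(y <- s) (y%:E * (\1_(g @^-1` [set y]) x)%:E)); last first.
  apply/funext => x; rewrite [in LHS](fimfunE g) fsbig_finite//=.
  by rewrite -sumEFin; apply: eq_bigr.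
have : forall y, y \in s -> (0 <= y)%R.
  by move=> y; rewrite in_fset_set// inE => -[x _ <-].
suff sP (r : seq R) : (forall y, y \in r -> (0 <= y)%R) ->
  [/\ measurable_fun setT (fun x =>
        \sum_(y <- r) (y%:E * (\1_(g @^-1` [set y]) x)%:E : \bar R)),
      forall x, 0 <= \sum_(y <- r) (y%:E * (\1_(g @^-1` [set y]) x)%:E) &
      Pr (fun x => \sum_(y <- r) (y%:E * (\1_(g @^-1` [set y]) x)%:E))].
  by move=> /sP[].
have mi y : measurable_fun setT (fun x => y%:E * (\1_(g @^-1` [set y]) x)%:E : \bar R).
  by apply: measurable_funeM; apply/measurable_EFinP; exact: measurable_indic.
elim: r => [_|y r ih ry].
  have -> : (fun x : T => \sum_(y <- [::]) (y%:E * (\1_(g @^-1` [set y]) x)%:E)) =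
      (fun=> 0) by apply/funext => x; rewrite big_nil.
  by split=> // x; rewrite big_nil.
have [|mF F0 PF] := ih; first by move=> z zr; apply: ry; rewrite inE zr orbT.
have y0 : (0 <= y)%R by apply: ry; rewrite inE eqxx.
rewrite (_ : (fun x => _) = fun x => y%:E * (\1_(g @^-1` [set y]) x)%:E +
    \sum_(z <- r) (z%:E * (\1_(g @^-1` [set z]) x)%:E)); last first.
  by apply/funext => x; rewrite big_cons.
split.
- exact: emeasurable_funD.
- by move=> x; rewrite big_cons adde_ge0// mule_ge0// lee_fin.
- apply: PD => //; first by move=> x; rewrite mule_ge0// lee_fin.
  apply: PZ => //; first by apply/measurable_EFinP; exact: measurable_indic.
  exact: Pind.
Qed.

End nonneg_induction.

Section mixtures.
Context d1 d2 (T1 : measurableType d1) (T2 : measurableType d2) (R : realType).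
Context (m : {measure set T1 -> \bar R}) (k : T1 -> {measure set T2 -> \bar R}).
Hypothesis mk : forall E, measurable E -> measurable_fun setT (fun x => k x E).

Lemma measurable_integral_family (f : T2 -> \bar R) :
  measurable_fun setT f -> (forall y, 0 <= f y) ->
  measurable_fun setT (fun x => \int[k x]_y f y).
Proof.
move=> mf f0; apply: (@nonneg_measurable_ind _ _ _ (fun f => measurable_fun setT
  (fun x => \int[k x]_y f y)) _ _ _ _ f mf f0).
- move=> E mE; under eq_fun do rewrite /= integral_indic// setIT; exact: mk.
- move=> f1 f2 mf1 mf2 f10 f20 P1 P2.
  by under eq_fun do rewrite ge0_integralD//; exact: emeasurable_funD.
- move=> c g c0 mg g0 Pg.
  by under eq_fun do rewrite ge0_integralZl_EFin//; exact: measurable_funeM.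
- move=> f_ g mf_ f_0 mg nd cvg Pf.
  apply: (emeasurable_fun_cvg (fun n x => \int[k x]_y f_ n y)) => // x _.
  rewrite (_ : \int[k x]_y g y = \int[k x]_y limn (f_^~ y)).
    by apply: cvg_monotone_convergence.
  by apply: eq_integral => y _; apply/esym/cvg_lim.
Qed.

(** Carried as a function of the measurability proof so that the structure of
    a measure can be attached to it. *)
Definition mixture of (forall E, measurable E -> measurable_fun setT (fun x => k x E)) :=
  fun E : set T2 => \int[m]_x k x E.
Local Notation mix := (mixture mk).

Let mixture0 : mix set0 = 0.
Proof. by rewrite /mixture integral0_eq// => x _; rewrite measure0. Qed.

Let mixture_ge0 E : 0 <= mix E.
Proof. exact: integral_ge0. Qed.

Let mixture_sigma_additive : semi_sigma_additive mix.
Proof.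
move=> F mF tF mUF; rewrite /mixture.
rewrite (_ : \int[m]_x k x (\bigcup_n F n) = \sum_(0 <= i <oo) \int[m]_x k x (F i)).
  by apply: is_cvg_nneseries_cond => n _ _; exact: integral_ge0.
rewrite -integral_nneseries//; last by move=> n; exact: mk.
by apply: eq_integral => x _; rewrite measure_semi_bigcup.
Qed.

HB.instance Definition _ := isMeasure.Build _ _ _ mix
  mixture0 mixture_ge0 mixture_sigma_additive.

Lemma integral_mixture (mu : {measure set T2 -> \bar R}) (f : T2 -> \bar R) :
  (forall E, measurable E -> mu E = \int[m]_x k x E) ->
  measurable_fun setT f -> (forall y, 0 <= f y) ->
  \int[mu]_y f y = \int[m]_x \int[k x]_y f y.
Proof.
move=> muE mf f0; apply: (@nonneg_measurable_ind _ _ _ (fun f =>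
  \int[mu]_y f y = \int[m]_x \int[k x]_y f y) _ _ _ _ f mf f0).
- move=> E mE; rewrite integral_indic// setIT muE//.
  by apply: eq_integral => x _; rewrite integral_indic// setIT.
- move=> f1 f2 mf1 mf2 f10 f20 P1 P2.
  rewrite (ge0_integralD mu measurableT (fun x _ => f10 x) mf1 (fun x _ => f20 x) mf2) P1 P2.
  have mI (h : T2 -> \bar R) : measurable_fun setT h -> (forall y, 0 <= h y) ->
      measurable_fun setT (fun x => \int[k x]_y h y).
    by move=> mh h0; exact: measurable_integral_family.
  have I0 (h : T2 -> \bar R) : (forall y, 0 <= h y) ->
      forall x, setT x -> 0 <= \int[k x]_y h y.
    by move=> h0 x _; apply: integral_ge0.
  rewrite -(ge0_integralD m measurableT (I0 _ f10) (mI _ mf1 f10) (I0 _ f20) (mI _ mf2 f20)).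
  by apply: eq_integral => x _;
    rewrite (ge0_integralD (k x) measurableT (fun x _ => f10 x) mf1 (fun x _ => f20 x) mf2).
- move=> c g c0 mg g0 Pg;
  rewrite (ge0_integralZl_EFin mu measurableT (fun x _ => g0 x) mg c0) Pg.
  rewrite -(ge0_integralZl_EFin m measurableT _ _ c0).
  + by apply: eq_integral => x _;
      rewrite (ge0_integralZl_EFin (k x) measurableT (fun x _ => g0 x) mg c0).
  + by move=> x _; apply: integral_ge0.
  + exact: measurable_integral_family.
- move=> f_ g mf_ f_0 mg nd cvg Pf.
  have lim (M : {measure set T2 -> \bar R}) :
      \int[M]_y f_ n y @[n --> \oo] --> \int[M]_y g y.
    rewrite (_ : \int[M]_y g y = \int[M]_y limn (f_^~ y)).
      by apply: cvg_monotone_convergence.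
    by apply: eq_integral => y _; apply/esym/cvg_lim.
  rewrite -(cvg_lim _ (lim mu))// (_ : (fun n => _) =
    (fun n => \int[m]_x \int[k x]_y f_ n y)); last exact/funext.
  apply/cvg_lim => //; rewrite (_ : \int[m]_x \int[k x]_y g y =
    \int[m]_x limn (fun n => \int[k x]_y f_ n y)); last first.
    by apply: eq_integral => x _; apply/esym/cvg_lim => //; exact: lim.
  apply: cvg_monotone_convergence => //.
  + by move=> n; exact: measurable_integral_family.
  + by move=> n x _; exact: integral_ge0.
  + by move=> x _ a b ab; apply: ge0_le_integral => // y _; exact: nd.
Qed.

End mixtures.

Section densities.
Context d (T : measurableType d) (R : realType) (m : {measure set T -> \bar R}).
Context (f : T -> R) (mf : measurable_fun setT f) (f0 : forall x, (0 <= f x)%R).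

Definition density of measurable_fun setT f & (forall x, (0 <= f x)%R) :=
  fun E : set T => \int[m]_(x in E) (f x)%:E.

Let meF : measurable_fun setT (EFin \o f).
Proof. exact/measurable_EFinP. Qed.

Local Notation nu := (density mf f0).

Let density0 : nu set0 = 0.
Proof. exact: integral_set0. Qed.

Let density_ge0 E : 0 <= nu E.
Proof. by apply: integral_ge0 => x _; rewrite lee_fin. Qed.

Let density_sigma_additive : semi_sigma_additive nu.
Proof.
move=> F mF tF mUF; rewrite /density ge0_integral_bigcup//; last 2 first.
  exact: measurable_funTS.
  by move=> x _; rewrite lee_fin.
by apply: is_cvg_nneseries_cond => n _ _; apply: integral_ge0 => x _; rewrite lee_fin.
Qed.

HB.instance Definition _ := isMeasure.Build _ _ _ nu
  density0 density_ge0 density_sigma_additive.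

Lemma integral_density (g : T -> \bar R) (D : set T) : measurable D ->
  measurable_fun D g -> (forall x, D x -> 0 <= g x) ->
  \int[nu]_(x in D) g x = \int[m]_(x in D) ((f x)%:E * g x).
Proof.
move=> mD mg g0; rewrite (integral_mkcond D g) (integral_mkcond D (fun x => (f x)%:E * g x)).
rewrite (_ : (fun x => (f x)%:E * g x) \_ D = fun x => (f x)%:E * (g \_ D) x); last first.
  by apply/funext => x; rewrite !patchE; case: ifPn => // _; rewrite mule0.
have {}mg : measurable_fun setT (g \_ D) by exact/(measurable_restrictT _ _).1.
have {}g0 x : 0 <= (g \_ D) x.
  by rewrite patchE; case: ifPn => // /set_mem; exact: g0.
move: (g \_ D) mg g0 => {}g mg g0.
apply: (@nonneg_measurable_ind _ _ _ (fun g =>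
  \int[nu]_x g x = \int[m]_x ((f x)%:E * g x)) _ _ _ _ g mg g0).
- move=> E mE; rewrite (integral_indic nu measurableT)// setIT.
  rewrite -[LHS]/(\int[m]_(x in E) (f x)%:E) (integral_mkcond E).
  apply: eq_integral => x _; rewrite patchE /= indicE.
  by case: ifPn => _; rewrite ?mule1 ?mule0.
- move=> f1 f2 mf1 mf2 f10 f20 P1 P2.
  rewrite (ge0_integralD nu measurableT (fun x _ => f10 x) mf1 (fun x _ => f20 x) mf2) P1 P2.
  have M0 (h : T -> \bar R) : (forall y, 0 <= h y) -> forall x, setT x -> 0 <= (f x)%:E * h x.
    by move=> h0 x _; apply: mule_ge0; rewrite ?lee_fin.
  rewrite -(ge0_integralD m measurableT (M0 _ f10) (emeasurable_funM meF mf1)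
    (M0 _ f20) (emeasurable_funM meF mf2)).
  by apply: eq_integral => x _; rewrite ge0_muleDr.
- move=> c h c0 mh h0 Ph;
  rewrite (ge0_integralZl_EFin nu measurableT (fun x _ => h0 x) mh c0) Ph.
  rewrite -(ge0_integralZl_EFin m measurableT _ _ c0).
  + by apply: eq_integral => x _; rewrite muleCA.
  + by move=> x _; apply: mule_ge0; rewrite ?lee_fin.
  + exact: emeasurable_funM.
- move=> f_ h mf_ f_0 mh nd cvg Pf.
  have lim (M : {measure set T -> \bar R}) (h_ : (T -> \bar R)^nat) hh :
      (forall n, measurable_fun setT (h_ n)) -> (forall n x, 0 <= h_ n x) ->
      (forall x, {homo h_^~ x : n m / (n <= m)%N >-> n <= m}) ->
      (forall x, h_ n x @[n --> \oo] --> hh x) ->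
      \int[M]_y h_ n y @[n --> \oo] --> \int[M]_y hh y.
    move=> mh_ h_0 ndh cvgh; rewrite (_ : \int[M]_y hh y = \int[M]_y limn (h_^~ y)).
      by apply: cvg_monotone_convergence.
    by apply: eq_integral => y _; apply/esym/cvg_lim.
  rewrite -(cvg_lim _ (lim nu f_ h mf_ f_0 nd cvg))// (_ : (fun n => _) =
    (fun n => \int[m]_x ((f x)%:E * f_ n x))); last exact/funext.
  apply/cvg_lim => //; apply: lim.
  + by move=> n; exact: emeasurable_funM.
  + by move=> n x; apply: mule_ge0; rewrite ?lee_fin.
  + by move=> x a b ab; rewrite lee_wpmul2l ?lee_fin//; exact: nd.
  + by move=> x; apply: cvgeZl.
Qed.

End densities.

Section integrals_of_arbitrary_functions.
Import HBNNSimple.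
Context d (T : measurableType d) (R : realType) (mu : {measure set T -> \bar R}).
Implicit Types (f g : T -> \bar R) (B D G : set T).

Lemma sintegral_proj_null (h : {nnsfun T >-> R}) B (mB : measurable (~` B)) :
  measurable B -> mu B = 0 -> sintegral mu (proj_nnsfun h mB) = sintegral mu h.
Proof.
move=> mB' B0; rewrite -!integralT_nnsfun.
apply: ge0_ae_eq_integral => //.
- exact/measurable_EFinP.
- exact/measurable_EFinP.
- by move=> x _; rewrite lee_fin.
- by move=> x _; rewrite lee_fin.
exists B; split=> // x /= /not_implyP[_]; apply: contra_notP => Bx.
by rewrite /= mindicE mem_set// mulr1.
Qed.

(** The integral of a nonnegative function is the supremum of the integrals of
    the simple functions below it, measurable or not; a simple function may be
    cut off on a null set without changing its integral. *)
Lemma le_integral_off_null f g B : measurable B -> mu B = 0 ->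
  (forall x, 0 <= f x) -> (forall x, 0 <= g x) -> (forall x, ~ B x -> f x <= g x) ->
  \int[mu]_x f x <= \int[mu]_x g x.
Proof.
move=> mB B0 f0 g0 fg; rewrite !ge0_integralTE//.
apply: ge_ereal_sup => _ [h /= hf <-].
rewrite -(sintegral_proj_null h (measurableC mB) mB B0).
apply: ereal_sup_ubound; exists (proj_nnsfun h (measurableC mB)) => // x /=.
rewrite mindicE; case: (pselect (B x)) => Bx.
  by rewrite memNset ?mulr0//= => /(_ Bx).
by rewrite mem_set// mulr1 (le_trans (hf x))// fg.
Qed.

Lemma integral_pos_off_null f D B : measurable B -> mu B = 0 ->
  (forall x, D x -> ~ B x -> 0 <= f x) ->
  \int[mu]_(x in D) f x = \int[mu]_x ((f \_ D)^\+ x).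
Proof.
move=> mB B0 f0; rewrite integral_mkcond integralE.
rewrite [X in _ - X](_ : _ = 0) ?sube0//.
apply/eqP; rewrite eq_le integral_ge0 ?andbT; last first.
  by move=> x _; exact: funeneg_ge0.
rewrite -(integral0 mu setT) -/(cst 0).
apply: (le_integral_off_null mB B0) => // x nB.
rewrite funenegE ge_max lexx andbT patchE leeNl oppe0.
by case: ifPn => // /set_mem Dx; exact: f0.
Qed.

Lemma le_integral_ge0_off_null f g D B : measurable B -> mu B = 0 ->
  (forall x, D x -> 0 <= g x) -> (forall x, D x -> ~ B x -> g x <= f x) ->
  \int[mu]_(x in D) g x <= \int[mu]_(x in D) f x.
Proof.
move=> mB B0 g0 gf.
rewrite (@integral_pos_off_null f D B mB B0); last first.
  by move=> x Dx Bx; rewrite (le_trans (g0 x Dx))// gf.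
rewrite integral_mkcond; apply: (le_integral_off_null mB B0).
- by move=> x; rewrite patchE; case: ifPn => // /set_mem; exact: g0.
- by move=> x; exact: funepos_ge0.
move=> x Bx; rewrite funeposE le_max !patchE.
by case: ifPn => [/set_mem Dx|_]; rewrite ?gf// lexx.
Qed.

Lemma integral_ge0_off_null f D B : measurable B -> mu B = 0 ->
  (forall x, D x -> ~ B x -> 0 <= f x) -> 0 <= \int[mu]_(x in D) f x.
Proof.
move=> mB B0 f0; rewrite (integral_pos_off_null mB B0 f0).
by apply: integral_ge0 => x _; exact: funepos_ge0.
Qed.

(** The quadratic forms of differences of integrands are not known to be
    measurable; for such functions additivity of the integral survives as an
    inequality. *)
Lemma le_integral_mix f f1 f2 D B G : measurable B -> mu B = 0 -> measurable G ->
  (forall x, D x -> ~ B x -> 0 <= f1 x) -> (forall x, D x -> ~ B x -> 0 <= f2 x) ->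
  (forall x, D x -> G x -> f x = f1 x) -> (forall x, D x -> ~ G x -> f x = f2 x) ->
  \int[mu]_(x in D) f x <= \int[mu]_(x in D) f1 x + \int[mu]_(x in D) f2 x.
Proof.
move=> mB B0 mG f10 f20 ff1 ff2.
have f0 x : D x -> ~ B x -> 0 <= f x.
  move=> Dx Bx; have [Gx|Gx] := pselect (G x); first by rewrite ff1// f10.
  by rewrite ff2// f20.
rewrite (integral_pos_off_null mB B0 f0) (integral_pos_off_null mB B0 f10).
rewrite (integral_pos_off_null mB B0 f20) !ge0_integralTE; last 3 first.
- by move=> x; exact: funepos_ge0.
- by move=> x; exact: funepos_ge0.
- by move=> x; exact: funepos_ge0.
apply: ge_ereal_sup => _ [h /= hf <-].
have -> : sintegral mu h =
    sintegral mu (proj_nnsfun h mG) + sintegral mu (proj_nnsfun h (measurableC mG)).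
  rewrite -!integralT_nnsfun -ge0_integralD//; last 4 first.
  - by move=> x _; rewrite lee_fin.
  - exact/measurable_EFinP.
  - by move=> x _; rewrite lee_fin.
  - exact/measurable_EFinP.
  apply: eq_integral => x _ /=; rewrite -EFinD -mulrDr.
  rewrite !mindicE; have [Gx|Gx] := pselect (G x).
    by rewrite (mem_set Gx) memNset//= ?addr0 ?mulr1.
  by rewrite (memNset Gx) mem_set//= add0r mulr1.
apply: leeD; apply: ereal_sup_ubound.
- exists (proj_nnsfun h mG) => // x /=; rewrite mindicE.
  have [Gx|Gx] := pselect (G x); last first.
    by rewrite memNset// mulr0 funepos_ge0.
  rewrite mem_set// mulr1 (le_trans (hf x))// !funeposE !patchE.
  by case: ifPn => // /set_mem Dx; rewrite ff1.
- exists (proj_nnsfun h (measurableC mG)) => // x /=; rewrite mindicE.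
  have [Gx|Gx] := pselect (G x).
    by rewrite memNset// ?mulr0 ?funepos_ge0//= => /(_ Gx).
  rewrite mem_set// mulr1 (le_trans (hf x))// !funeposE !patchE.
  by case: ifPn => // /set_mem Dx; rewrite ff2.
Qed.

End integrals_of_arbitrary_functions.

Section measures_on_time_and_marks.
Context (R : realType) (U : ptopologicalType).
Local Notation S := (R * borelType U)%type.

Lemma product_generator (f : U -> R) :
  continuous f ->
  (forall O : set U, open O -> exists2 V : set R, open V & O = f @^-1` V) ->
  @measurable _ S = <<s [set C | C = setT \/ exists q r : rat,
    C = [set p : S | (p.1 < ratr q)%R /\ (f p.2 < ratr r)%R] ] >>.
Proof.
move=> cf fo; set G := [set C | _].
have mf : measurable_fun setT (f : borelType U -> R).
  apply: (measurability _ (RGenOpens.measurableE R)) => _ [_ [a [b -> <-]]].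
  rewrite setTI; apply: sub_sigma_algebra.
  by move/continuousP : cf => /(_ `]a, b[%classic); apply; exact: interval_open.
rewrite eqEsubset; split; last first.
  apply: smallest_sub; first exact: sigma_algebra_measurable.
  move=> C [->|[q [r ->]]]; first exact: measurableT.
  rewrite (_ : [set p | _] = (fst @^-1` `]-oo, (ratr q : R)[) `&`
      ((f \o snd) @^-1` `]-oo, (ratr r : R)[)); last first.
    by apply/seteqP; split => p /=; rewrite !in_itv.
  apply: measurableI; rewrite -[X in measurable X]setTI.
    exact: measurable_fst.
  by apply: (measurableT_comp mf measurable_snd).
move=> C mC.
pose GT := g_sigma_algebraType G.
have lt1 (x : R) : (x < x + 1)%R by rewrite ltrDl.
have ratlt (x y : R) : (x < y)%R -> exists q : rat, (x < ratr q < y)%R.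
  by move=> /rat_in_itvoo[q]; rewrite in_itv/= => ?; exists q.
have genT (A : set GT) (h : rat -> rat -> Prop) :
    A = \bigcup_q \bigcup_r (if pselect (h q r) is left _ then
      [set p : S | (p.1 < ratr q)%R /\ (f p.2 < ratr r)%R] else set0) ->
    @measurable _ GT A.
  move=> ->; apply: bigcupT_measurable_rat => q; apply: bigcupT_measurable_rat => r.
  case: pselect => _; last exact: measurable0.
  by apply: sub_sigma_algebra; right; exists q, r.
have mfst : measurable_fun setT (fst : GT -> R).
  apply: (measurability _ (RGenInftyO.measurableE R)) => _ [_ [a ->] <-].
  rewrite setTI; apply: (genT _ (fun q r => (ratr q < a)%R)).
  apply/seteqP; split=> [p /=|p [q _ [r _]]]; last first.
    by case: pselect => // qa [pq _] /=; rewrite in_itv/=; exact: lt_trans qa.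
  rewrite in_itv/= => /ratlt[q /andP[pq qa]].
  have [r /andP[pr _]] := ratlt (f p.2) (f p.2 + 1)%R (lt1 _).
  by exists q => //; exists r => //; case: pselect.
have mfsnd : measurable_fun setT (f \o snd : GT -> R).
  apply: (measurability _ (RGenInftyO.measurableE R)) => _ [_ [a ->] <-].
  rewrite setTI; apply: (genT _ (fun q r => (ratr r < a)%R)).
  apply/seteqP; split=> [p /=|p [q _ [r _]]]; last first.
    by case: pselect => // qa [pq pr] /=; rewrite in_itv/=; exact: lt_trans qa.
  rewrite in_itv/= => /ratlt[r /andP[pr ra]].
  have [q /andP[pq _]] := ratlt p.1 (p.1 + 1)%R (lt1 _).
  by exists q => //; exists r => //; case: pselect.
have msnd : measurable_fun setT (snd : GT -> borelType U).
  have mUE : @measurable _ (borelType U) = <<s (@open U : set (set (borelType U))) >> by [].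
  apply: (measurability _ mUE).
  move=> _ [ O /fo[V oV ->] <-].
  by rewrite setTI -comp_preimage -[X in measurable X]setTI; apply: mfsnd => //; exact: open_measurable.
have mid : measurable_fun setT (idfun : GT -> S).
  by apply/measurable_fun_pairP; split.
by have := mid measurableT C mC; rewrite setTI.
Qed.

(** A homeomorphism onto a Borel subset of the line makes the Borel sets of
    time and marks countably generated, so two finite measures are compared on
    countably many rectangles; this is what turns equalities that hold almost
    surely set by set into an almost sure equality of measures. *)
Lemma countable_measure_determining : homeomorphic_to_borel R U ->
  exists C_ : nat -> set S, (forall n, measurable (C_ n)) /\
    forall m1 m2 : {measure set S -> \bar R}, m1 setT < +oo ->
      (forall n, m1 (C_ n) = m2 (C_ n)) ->
      forall C, measurable C -> m1 C = m2 C.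
Proof.
move=> [f [B [mB [Bf finj fsurj] cf fo]]].
have {}fo (O : set U) : open O -> exists2 V : set R, open V & O = f @^-1` V.
  move=> /fo[V oV fOV]; exists V => //; apply/seteqP; split=> u /=.
    by move=> Ou; have [] : (B `&` V) (f u) by rewrite -fOV; exists u.
  move=> Vu; have : (f @` O) (f u) by rewrite fOV; split=> //; exact: Bf.
  by move=> [v Ov vu]; rewrite -(finj v u) ?inE.
have gen := product_generator cf fo.
pose G_ (c : option (rat * rat)) : set S := if c is Some (q, r) then
  [set p : S | (p.1 < ratr q)%R /\ (f p.2 < ratr r)%R] else setT.
have GE C : (C = setT \/ exists q r : rat,
    C = [set p : S | (p.1 < ratr q)%R /\ (f p.2 < ratr r)%R]) -> exists c, C = G_ c.
  by move=> [->|[q [r ->]]]; [exists None|exists (Some (q, r))].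
pose C_ n := G_ (odflt None (unpickle n)).
exists C_; split=> [n|m1 m2 m1T m12].
  rewrite gen; apply: sub_sigma_algebra; rewrite /C_.
  by case: (odflt _ _) => [[q r]|]; [right; exists q, r|left].
apply: (measure_unique _ (fun=> setT) gen).
- move=> C D /= [->|[q [r ->]]] [->|[q' [r' ->]]]; rewrite ?setTI ?setIT.
  + by left.
  + by right; exists q', r'.
  + by right; exists q, r.
  right; exists (Num.min q q'), (Num.min r r'); apply/seteqP; split=> p /=.
    move=> [[pq pr] [pq' pr']].
    by rewrite /Num.min; case: ifP => _; case: ifP.
  have le (a b : rat) (x : R) : (x < ratr (Num.min a b))%R -> (x < ratr a)%R /\ (x < ratr b)%R.
    by move=> xab; split; apply: (lt_le_trans xab); rewrite ler_rat ge_min lexx ?orbT.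
  by move=> [/le[? ?] /le[? ?]].
- by left.
- by apply/seteqP; split=> // p _; exists 0%N.
- by move=> C /GE[c ->]; have := m12 (pickle c); rewrite /C_ pickleK.
- by [].
Qed.

(** A down-closed set of times is a half line, open or closed, and in the open
    case the bound passes to the increasing limit. *)
Lemma down_closed_le (m : {measure set S -> \bar R}) (C : set S) (I : set R) (K : \bar R) :
  measurable C -> (forall s t, I t -> (s <= t)%R -> I s) -> 0 <= K ->
  (forall t, I t -> m (C `&` [set p | (p.1 <= t)%R]) <= K) ->
  m (C `&` [set p | I p.1]) <= K.
Proof.
move=> mC dI K0 mK.
have [[t0 It0]|I0] := pselect (I !=set0); last first.
  rewrite (_ : _ `&` _ = set0) ?measure0//; apply/seteqP; split=> // p [_ Ip].
  by case: I0; exists p.1.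
have [[t [It tmax]]|nomax] := pselect (exists t, I t /\ forall s, I s -> (s <= t)%R).
  rewrite (_ : _ `&` _ = C `&` [set p | (p.1 <= t)%R]) ?mK//.
  by apply/seteqP; split=> p [Cp /= pt]; split=> //; [exact: tmax|exact: dI pt].
pose c n : R := if unpickle n is Some q then
  (if pselect (I (ratr (q : rat))) then ratr q else t0) else t0.
have Ic n : I (c n) by rewrite /c; case: unpickle => // q; case: pselect.
pose t_ := fix t_ n := if n is n'.+1 then Num.max (t_ n') (c n) else c 0%N.
have It_ n : I (t_ n).
  elim: n => [|n ih] /=; first exact: Ic.
  by rewrite /Num.max; case: ifP => _ //; exact: Ic.
have t_nd : {homo t_ : n k / (n <= k)%N >-> (n <= k)%R}.
  by apply: homo_leq => [//|? ? ?|n]; [exact: le_trans|rewrite /= le_max lexx].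
have ct n : (c n <= t_ n)%R by case: n => [//|n] /=; rewrite le_max lexx orbT.
pose F n := C `&` [set p : S | (p.1 <= t_ n)%R].
have mray (t : R) : measurable [set p : S | (p.1 <= t)%R].
  rewrite (_ : [set p | _] = fst @^-1` `]-oo, t]); last first.
    by apply/seteqP; split=> p /=; rewrite in_itv.
  by rewrite -[X in measurable X]setTI; apply: measurable_fst.
have mF n : measurable (F n) by apply: measurableI.
have FE : C `&` [set p | I p.1] = \bigcup_n F n.
  apply/seteqP; split=> [p [Cp /= Ip]|p [n _ [Cp /= pt]]]; last first.
    by split=> //; exact: dI pt.
  have [s [Is ps]] : exists s, I s /\ (p.1 < s)%R.
    apply: contrapT => ns; apply: nomax; exists p.1; split=> // s Is.
    by rewrite leNgt; apply/negP => ps; apply: ns; exists s.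
  have /rat_in_itvoo[q] := ps; rewrite in_itv/= => /andP[pq qs].
  exists (pickle q) => //; split=> //=; apply: (le_trans _ (ct _)).
  rewrite /c pickleK; case: (pselect (I (ratr q))) => [Iq|nIq] /=; first exact: ltW.
  by case: nIq; exact: dI Is (ltW qs).
have cvgF : m (F n) @[n --> \oo] --> m (\bigcup_n F n).
  apply: nondecreasing_cvg_mu => //; first by apply: bigcupT_measurable.
  move=> n k nk; apply/subsetPset => p [Cp /= pt]; split=> //=.
  by apply: le_trans pt _; exact: t_nd.
rewrite FE -(cvg_lim _ cvgF)//; apply: lime_le; first by apply/cvg_ex; eexists; exact: cvgF.
by near=> n; exact: mK.
Unshelve. all: by end_near. Qed.

(** Fubini's theorem on the two triangles of pairs of points ordered in time;
    the diagonal goes to the first of them. *)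
Lemma product_mass_split (m1 m2 : {measure set S -> \bar R}) :
  m1 setT < +oo -> m2 setT < +oo ->
  m1 setT * m2 setT = \int[m2]_p m1 [set q | (q.1 <= p.1)%R] +
                      \int[m1]_p m2 [set q | (q.1 < p.1)%R].
Proof.
move=> m1T m2T.
have fin (m : {measure set S -> \bar R}) : m setT < +oo ->
    exists m' : {finite_measure set S -> \bar R}, m = m' :> {measure set S -> \bar R}.
  move=> mT; exists (mfrestr measurableT mT); apply: eq_measure; apply/funext => C.
  by rewrite -[RHS]/(m (C `&` setT)) setIT.
have [m1' e1] := fin m1 m1T; have [m2' e2] := fin m2 m2T.
rewrite e1 e2 in m1T m2T *.
have mle : measurable [set q : S * S | (q.1.1 <= q.2.1)%R].
  rewrite -[X in measurable X]setTI.
  apply: (@measurable_fun_le _ _ _ _ (fun q : S * S => q.1.1) (fun q => q.2.1)) => //.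
    exact: (measurableT_comp measurable_fst measurable_fst).
  exact: (measurableT_comp measurable_fst measurable_snd).
have mind : measurable_fun setT (fun z : S * S => (\1_[set q : S * S | (q.1.1 <= q.2.1)%R] z)%:E : \bar R).
  by apply/measurable_EFinP; exact: measurable_indic.
have mray (a : R) : measurable [set q : S | (q.1 <= a)%R].
  rewrite (_ : [set p | _] = fst @^-1` `]-oo, a]); last first.
    by apply/seteqP; split=> p /=; rewrite in_itv.
  by rewrite -[X in measurable X]setTI; apply: measurable_fst.
have mray' (a : R) : measurable [set q : S | (a <= q.1)%R].
  rewrite (_ : [set p | _] = fst @^-1` `[a, +oo[); last first.
    by apply/seteqP; split=> p /=; rewrite in_itv/= andbT.
  by rewrite -[X in measurable X]setTI; apply: measurable_fst.
have mrayo (a : R) : measurable [set q : S | (q.1 < a)%R].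
  rewrite (_ : [set p | _] = fst @^-1` `]-oo, a[); last first.
    by apply/seteqP; split=> p /=; rewrite in_itv.
  by rewrite -[X in measurable X]setTI; apply: measurable_fst.
have := @fubini_tonelli _ _ S S R m1' m2' _ mind (fun z => ler0n _ _).
have -> : \int[m2']_y \int[m1']_x (\1_[set q : S * S | (q.1.1 <= q.2.1)%R] (x, y))%:E =
    \int[m2']_p m1' [set q | (q.1 <= p.1)%R].
  by apply: eq_integral => y _; rewrite -(setIT [set q : S | _]) -integral_indic.
move=> <-.
have inE2 x : \int[m2']_y (\1_[set q : S * S | (q.1.1 <= q.2.1)%R] (x, y))%:E =
    m2' [set q | (x.1 <= q.1)%R].
  by rewrite -(setIT [set q : S | _]) -integral_indic.
have mF : measurable_fun setT (fun x => \int[m2']_y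
    (\1_[set q : S * S | (q.1.1 <= q.2.1)%R] (x, y))%:E).
  exact: (@measurable_fun_fubini_tonelli_F _ _ S S R m2' _ mind (fun z => ler0n _ _)).
have cE (x : S) : m2' [set q : S | (q.1 < x.1)%R] = m2' setT - m2' [set q : S | (x.1 <= q.1)%R].
  have -> : [set q : S | (q.1 < x.1)%R] = setT `\` [set q : S | (x.1 <= q.1)%R].
    apply/seteqP; split=> q /=; rewrite ltNge; first by move=> /negP nxq; split.
    by move=> [_ /negP].
  by rewrite measureD// setTI.
rewrite -ge0_integralD//.
- rewrite (eq_integral (fun=> m2' setT)); first by rewrite integral_cst// muleC.
  move=> x _; rewrite /= inE2 [X in _ + X](cE x) addeC subeK//.
  by apply: lty_fin_num_fun.
- by move=> x _; apply: integral_ge0 => y _; rewrite lee_fin.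
- rewrite (_ : (fun x : S => _) = fun x => m2' setT - \int[m2']_y
    (\1_[set q : S * S | (q.1.1 <= q.2.1)%R] (x, y))%:E); last first.
    by apply/funext => x; rewrite inE2 [LHS](cE x).
  by apply: emeasurable_funB.
Qed.
End measures_on_time_and_marks.

(** * Predictable sets and processes *)

Section predictable_sets.
Context (R : realType) (d : measure_display) (Omega : measurableType d).
Context (P : probability Omega R) (F : R -> set (set Omega)) (T : R).
Context (U : ptopologicalType).
Hypothesis usual : usual_conditions P F.
Hypothesis T0 : (0 < T)%R.

Local Notation FT t := (g_sigma_algebraType (F t)).
Local Notation PT := (g_sigma_algebraType (predictable_rect F (horizon T))).
Local Notation PS := (PT * borelType U)%type.
Local Notation S := (R * borelType U)%type.

Lemma filtration_measurableE (t : R) (A : set (FT t)) : (0 <= t)%R ->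
  measurable A = F t A.
Proof.
by move=> t0; rewrite /measurable/= sigma_algebra_id//; case: usual => _ /(_ t t0)[].
Qed.

Lemma filtration_sub (t : R) A : (0 <= t)%R -> F t A -> measurable A.
Proof. by move=> t0; case: usual => _ /(_ t t0)[_ FM] _ _ _; exact: FM. Qed.

Lemma filtration_le (s t : R) A : (0 <= s <= t)%R -> F s A -> F t A.
Proof. by move=> st; case: usual => _ _ /(_ s t st) FF _ _; exact: FF. Qed.

Lemma filtration_negligible (t : R) A : (0 <= t)%R -> P.-negligible A -> F t A.
Proof.
move=> t0 NA; apply: (@filtration_le 0%R); first by rewrite lexx.
by case: usual => _ _ _ _; exact.
Qed.

Lemma filtrationT (t : R) : (0 <= t)%R -> F t setT.
Proof. by move=> t0; rewrite -(@filtration_measurableE t)//; exact: (@measurableT _ (FT t)). Qed.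

Lemma filtration0 (t : R) : (0 <= t)%R -> F t set0.
Proof. by move=> t0; rewrite -(@filtration_measurableE t)//; exact: (@measurable0 _ (FT t)). Qed.

Lemma filtrationI (t : R) A B : (0 <= t)%R -> F t A -> F t B -> F t (A `&` B).
Proof.
move=> t0; rewrite -!(@filtration_measurableE t)//; exact: measurableI.
Qed.

Lemma adapted_measurable d' (V : measurableType d') (t : R) (f : Omega -> V) : (0 <= t)%R ->
  measurable_fun setT (f : FT t -> V) -> measurable_fun setT f.
Proof.
move=> t0 mf _ B mB; rewrite setTI; apply: (filtration_sub t0).
by rewrite -filtration_measurableE// -[X in measurable X]setTI; exact: mf.
Qed.

Lemma adapted_le d' (V : measurableType d') (s t : R) (f : Omega -> V) : (0 <= s <= t)%R ->
  measurable_fun setT (f : FT s -> V) -> measurable_fun setT (f : FT t -> V).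
Proof.
move=> /andP[s0 st] mf _ B mB; rewrite filtration_measurableE ?(le_trans s0)//.
apply: (@filtration_le s); first by rewrite s0.
by rewrite -filtration_measurableE//; exact: mf.
Qed.

Lemma measurable_predE : @measurable _ PT =
  <<s (predictable_rect F (horizon T) : set (set PT)) >>.
Proof. by []. Qed.

Lemma measurable_id_predictable :
  measurable_fun setT (fun z : Omega * R => z : PT).
Proof.
apply: (measurability _ measurable_predE) => _ [C rC <-]; rewrite setTI.
case: rC => [[A FA ->]|[s [t [A [/andP[s0 st] _ FA ->]]]]].
  by apply: measurableX => //; exact: filtration_sub FA.
apply: measurableX; first exact: filtration_sub FA.
rewrite (_ : [set r | _] = `]s, t]%classic); first exact: measurable_itv.
by apply/seteqP; split=> r /=; rewrite in_itv.
Qed.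

Lemma measurable_to_predSpace :
  measurable_fun setT (fun z : Omega * S => (z.1, z.2.1, z.2.2) : PS).
Proof.
apply/measurable_fun_pairP; split; last first.
  exact: (measurableT_comp measurable_snd measurable_snd).
apply: (measurableT_comp measurable_id_predictable).
apply/measurable_fun_pairP; split; first exact: measurable_fst.
exact: (measurableT_comp measurable_fst measurable_snd).
Qed.

Lemma measurable_predSpace_section w :
  measurable_fun setT (fun p : S => (w, p.1, p.2) : PS).
Proof.
have := measurable_to_predSpace.
by move=> /(measurable_fun_pair2 w).
Qed.

Lemma measurable_time_section t : horizon T t ->
  measurable_fun setT (fun w : FT t => (w, t) : PT).
Proof.
move=> /andP[t0 tT].
apply: (measurability _ measurable_predE) => _ [C rC <-]; rewrite setTI.
rewrite filtration_measurableE//.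
case: rC => [[A FA ->]|[s [r [A [/andP[s0 sr] _ FA ->]]]]].
  have [t00|nt0] := eqVneq t 0%R.
    rewrite (_ : _ @^-1` _ = A) ?t00//.
    by apply/seteqP; split=> w //= [].
  rewrite (_ : _ @^-1` _ = set0); first exact: filtration0.
  by apply/seteqP; split=> w //= [_ /eqP]; rewrite (negbTE nt0).
have [/andP[st tr]|nt] := boolP (s < t <= r)%R.
  rewrite (_ : _ @^-1` _ = A); first by apply: (@filtration_le s) => //; rewrite s0 ltW.
  by apply/seteqP; split=> w /= => [[]//|Aw]; rewrite st tr.
rewrite (_ : _ @^-1` _ = set0); first exact: filtration0.
by apply/seteqP; split=> w //= [_]; rewrite (negbTE nt).
Qed.

Lemma measurable_pred_rect (s r : R) (A : set Omega) : (0 <= s)%R -> (r <= T)%R -> F s A ->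
  measurable (A `*` [set t | (s < t <= r)%R] : set PT).
Proof.
move=> s0 rT FA; have [sr|rs] := ltP s r.
  apply: sub_sigma_algebra; right; exists s, r, A; split=> //.
    by rewrite s0.
  by rewrite /horizon/= rT (le_trans s0 (ltW sr)).
rewrite (_ : _ `*` _ = set0) ?measurable0//; apply/seteqP; split=> // -[w t] [_ /= /andP[st tr]].
by have := lt_le_trans st tr; rewrite ltNge rs.
Qed.

Lemma measurable_pred_zero (A : set Omega) : F 0%R A ->
  measurable (A `*` [set 0%R] : set PT).
Proof. by move=> FA; apply: sub_sigma_algebra; left; exists A. Qed.

Lemma measurable_slabT : measurable ([set z | horizon T z.2] : set PT).
Proof.
rewrite (_ : [set z | _] = setT `*` [set 0%R] `|` setT `*` [set t | (0 < t <= T)%R]).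
  apply: measurableU; first by apply: measurable_pred_zero; exact: filtrationT.
  by apply: measurable_pred_rect => //; exact: filtrationT.
apply/seteqP; split=> -[w t] /=; rewrite /horizon/=.
  move=> /andP[]; rewrite le_eqVlt => /predU1P[<- _|t0 tT]; [by left|right].
  by rewrite t0.
by move=> [[_ ->]|[_ /andP[t0 ->]]]; rewrite ?lexx ?ltW.
Qed.

Lemma measurable_slab (A : set U) : measurable (A : set (borelType U)) ->
  measurable (slab T A : set PS).
Proof.
move=> mA; rewrite (_ : slab T A = [set z | horizon T z.2] `*` A).
  by apply: measurableX => //; exact: measurable_slabT.
by apply/seteqP; split=> -[[w t] u].
Qed.

(** A random variable known at time [s] and switched on just afterwards gives
    a block over a predictable rectangle; the predictable processes below are
    countable suprema or infima of such blocks. *)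
Lemma predictable_block d' (V : measurableType d') (s r : R) (g : Omega -> V) (c : V) :
  (0 <= s)%R -> (r <= T)%R -> measurable_fun setT (g : FT s -> V) ->
  measurable_fun setT (fun z : PT => if (s < z.2 <= r)%R then g z.1 else c).
Proof.
move=> s0 rT mg.
have mD : measurable (setT `*` [set t | (s < t <= r)%R] : set PT).
  by apply: measurable_pred_rect => //; exact: filtrationT.
move=> _ B mB; rewrite setTI.
rewrite (_ : _ @^-1` B = (g @^-1` B) `*` [set t | (s < t <= r)%R] `|`
   (if pselect (B c) then ~` (setT `*` [set t | (s < t <= r)%R]) else set0)).
  apply: measurableU; last first.
    by case: (pselect (B c)) => [Bc|nBc] /=; [exact: measurableC|exact: measurable0].
  apply: measurable_pred_rect => //; rewrite -filtration_measurableE//.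
  by rewrite -[X in measurable X]setTI; exact: mg.
apply/seteqP; split=> -[w t] /=; have [st|/negP st] := boolP (s < t <= r)%R.
- by left.
- by move=> Bc; right; case: (pselect (B c)) => [Bc'|nBc] //= [].
- by move=> [[]//|]; case: (pselect (B c)) => [Bc|nBc] //= [].
- by move=> [[]//|]; case: (pselect (B c)) => [Bc|nBc].
Qed.

Lemma predictable_initial d' (V : measurableType d') (g : Omega -> V) :
  measurable_fun setT (g : FT 0%R -> V) ->
  measurable_fun ([set z | horizon T z.2] : set PT) (fun z : PT => g z.1).
Proof.
move=> mg _ B mB.
have FB : F 0%R (g @^-1` B).
  by rewrite -filtration_measurableE// -[X in measurable X]setTI; exact: mg.
rewrite (_ : _ `&` _ = (g @^-1` B) `*` [set 0%R] `|`
    (g @^-1` B) `*` [set t | (0 < t <= T)%R]).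
  apply: measurableU; first exact: measurable_pred_zero.
  exact: measurable_pred_rect.
apply/seteqP; split=> -[w t] /=; rewrite /horizon/=.
  move=> [/andP[]]; rewrite le_eqVlt => /predU1P[<- _|t0 tT]; [by left|right].
  by rewrite t0.
by move=> [[? ->]|[? /andP[t0 ->]]]; rewrite ?lexx ?ltW// T0.
Qed.

(** Restricting a predictable set of the half line to the horizon truncates
    the generating intervals at [T]. *)
Lemma predictable_trace (C : set (Omega * R)) :
  @measurable _ (g_sigma_algebraType (predictable_rect F (@halfline R))) C ->
  measurable (C `&` [set z | horizon T z.2] : set PT).
Proof.
pose tr := [set C : set (Omega * R) | measurable (C `&` [set z | horizon T z.2] : set PT)].
suff trS : <<s predictable_rect F (@halfline R) >> `<=` tr by move=> mC; exact: trS mC.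
apply: smallest_sub.
  split=> [|A mA|A mA]; rewrite /tr/=.
  - by rewrite set0I; exact: measurable0.
  - rewrite setTD (_ : _ `&` _ = [set z | horizon T z.2] `\` (A `&` [set z | horizon T z.2])).
      by apply: measurableD => //; exact: measurable_slabT.
    by apply/seteqP; split=> z /=; tauto.
  - by rewrite setI_bigcupl; exact: bigcupT_measurable.
move=> _ [[A FA ->]|[s [t [A [/andP[s0 st] _ FA ->]]]]]; rewrite /tr/=.
  rewrite (_ : _ `&` _ = A `*` [set 0%R]); first exact: measurable_pred_zero.
  by apply/seteqP; split=> -[w r] /= => [[]|[Aw ->]] //; rewrite /horizon/= lexx ltW.
rewrite (_ : _ `&` _ = A `*` [set r | (s < r <= Num.min t T)%R]).
  by apply: measurable_pred_rect => //; rewrite ge_min lexx orbT.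
apply/seteqP; split=> -[w r] /=; rewrite /horizon/= le_min.
  by move=> [[Aw /andP[-> ->]] /andP[_ ->]].
by move=> [Aw /and3P[sr -> ->]]; rewrite sr (le_trans s0 (ltW sr)).
Qed.

Lemma predictable_process_horizon (V : R -> Omega -> \bar R) :
  predictable_process F (@halfline R) V -> predictable_process F (horizon T) V.
Proof.
move=> mV mD B mB.
have mH : @measurable _ (g_sigma_algebraType (predictable_rect F (@halfline R)))
    [set z | halfline z.2].
  rewrite (_ : [set z | _] = setT `*` [set 0%R] `|`
      \bigcup_n (setT `*` [set t | (0 < t <= n.+1%:R)%R])).
    apply: measurableU.
      by apply: sub_sigma_algebra; left; exists setT => //; exact: filtrationT.
    apply: bigcupT_measurable => n; apply: sub_sigma_algebra; right.
    exists 0%R, n.+1%:R, setT; split=> //; first by rewrite lexx ltr0n.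
      by rewrite /halfline/= ler0n.
    exact: filtrationT.
  apply/seteqP; split=> -[w t] /=; rewrite /halfline/=.
    rewrite le_eqVlt => /predU1P[<-|t0]; [by left|right].
    exists (Num.bound t) => //; split=> //=; rewrite t0/=.
    by rewrite (le_trans (ltW (archi_boundP (ltW t0))))// ler_nat.
  by move=> [[_ ->//]|[n _ [_ /= /andP[/ltW]]]].
have := predictable_trace (mV mH B mB).
rewrite (_ : _ `&` _ `&` _ = [set z | horizon T z.2] `&` (fun z => V z.2 z.1) @^-1` B)//.
by apply/seteqP; split=> -[w t] /= => [[[]]|[/andP[t0 tT] ?]] //; do 2?split=> //; apply/andP.
Qed.

End predictable_sets.

Section distribution_functions.
Context (R : realType) (U : ptopologicalType).
Local Notation S := (R * borelType U)%type.
Context (m : {measure set S -> \bar R}) (D : set S).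
Hypothesis mD : measurable D.
Hypothesis mfin : m setT < +oo.

Lemma measurable_time_le (t : R) : measurable ([set p | (p.1 <= t)%R] : set S).
Proof.
rewrite (_ : [set p | _] = fst @^-1` `]-oo, t]); last first.
  by apply/seteqP; split=> p /=; rewrite in_itv.
by rewrite -[X in measurable X]setTI; apply: measurable_fst.
Qed.

Lemma measurable_time_lt (t : R) : measurable ([set p | (p.1 < t)%R] : set S).
Proof.
rewrite (_ : [set p | _] = fst @^-1` `]-oo, t[); last first.
  by apply/seteqP; split=> p /=; rewrite in_itv.
by rewrite -[X in measurable X]setTI; apply: measurable_fst.
Qed.

Definition mass_upto (t : R) : \bar R := m (D `&` [set p | (p.1 <= t)%R]).

Lemma measurable_upto t : measurable (D `&` [set p | (p.1 <= t)%R]).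
Proof. by apply: measurableI => //; exact: measurable_time_le. Qed.

Lemma mass_upto_fin t : mass_upto t \is a fin_num.
Proof. by apply: lty_fin_num_fun => //; exact: measurable_upto. Qed.

Lemma mass_upto_nd (s t : R) : (s <= t)%R -> mass_upto s <= mass_upto t.
Proof.
move=> st; apply: le_measure; rewrite ?inE; [exact: measurable_upto..|].
by move=> p [Dp /= ps]; split=> //=; exact: le_trans ps st.
Qed.

Lemma fine_mass_upto_nd (s t : R) : (s <= t)%R -> (fine (mass_upto s) <= fine (mass_upto t))%R.
Proof. by move=> st; rewrite fine_le ?mass_upto_fin// mass_upto_nd. Qed.

Lemma mass_upto_right (t e : R) : (0 < e)%R ->
  exists2 dl, (0 < dl)%R & forall s, (t <= s < t + dl)%R ->
    (fine (mass_upto s) < fine (mass_upto t) + e)%R.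
Proof.
move=> e0; pose G n := D `&` [set p : S | (p.1 <= t + n.+1%:R^-1)%R].
have cvgG : m (G n) @[n --> \oo] --> m (\bigcap_n G n).
  apply: nonincreasing_cvg_mu.
  - rewrite (le_lt_trans _ mfin)// le_measure// inE; last exact: measurableT.
    exact: measurable_upto.
  - by move=> n; exact: measurable_upto.
  - by apply: bigcapT_measurable => n; exact: measurable_upto.
  move=> n k nk; apply/subsetPset => p [Dp /= pk]; split=> //=.
  by rewrite (le_trans pk)// lerD2l lef_pV2 ?posrE// ler_nat.
have capG : \bigcap_n G n = D `&` [set p | (p.1 <= t)%R].
  apply/seteqP; split=> [p Gp|p [Dp /= pt] n _]; last first.
    by split=> //=; rewrite (le_trans pt)// lerDl.
  split; first by have [] := Gp 0%N I.
  apply/ler_addgt0Pr => r r0.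
  have [n nr] : exists n, (n.+1%:R^-1 <= r)%R.
    exists (Num.bound r^-1); rewrite invf_ple ?posrE//.
    by rewrite (le_trans (ltW (archi_boundP _))) ?ler_nat// invr_ge0 ltW.
  by have [_ /= pn] := Gp n I; rewrite (le_trans pn)// lerD2l.
move: cvgG; rewrite capG -/(mass_upto t) => cvgG.
have : \forall n \near \oo, (fine (m (G n)) < fine (mass_upto t) + e)%R.
  have /cvgrPdist_lt/(_ e e0) : fine (m (G n)) @[n --> \oo] --> fine (mass_upto t).
    by apply: fine_cvg; rewrite fineK// mass_upto_fin.
  by apply: filterS => n /=; rewrite distrC ltr_norml => /andP[_]; rewrite ltrBlDl.
move=> [n _ /(_ n (leqnn n)) Gn]; exists (n.+1%:R^-1)%R; first by rewrite invr_gt0.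
move=> s /andP[_ sn]; apply: le_lt_trans Gn; apply: fine_mass_upto_nd.
exact: ltW.
Qed.

Lemma cadlag_mass_upto J : cadlag J (fun t => fine (mass_upto t)).
Proof.
move=> t Jt; split.
  apply/cvgrPdist_lt => e e0; have [dl dl0 dlP] := mass_upto_right t e0.
  rewrite /nbhs/= /within/=; near_simpl.
  apply/nbhs_ballP; exists dl => //= s; rewrite /ball/= ltr_norml => /andP[ts _] [Js lts].
  rewrite ler0_norm ?subr_le0 ?fine_mass_upto_nd ?(ltW lts)// opprB ltrBlDl dlP// (ltW lts)/=.
  by rewrite -ltrBlDl -opprB ltrNl.
pose X := [set fine (mass_upto s) | s in [set s | (s < t)%R]].
have supX : has_sup X.
  split; first by exists (fine (mass_upto (t - 1))), (t - 1)%R => //=; rewrite ltrBlDr ltrDl.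
  by exists (fine (mass_upto t)) => _ [s /= st <-]; rewrite fine_mass_upto_nd// ltW.
exists (sup X); apply/cvgrPdist_lt => e e0.
have [_ [s /= st <-] se] := sup_adherent e0 supX.
rewrite /nbhs/= /within/=; near_simpl.
apply/nbhs_ballP; exists (t - s)%R => /=; first by rewrite subr_gt0.
move=> r; rewrite /ball/= ltr_norml => /andP[_ tr] [Jr rt].
rewrite ger0_norm ?subr_ge0; last by apply: sup_upper_bound => //; exists r.
rewrite ltrBlDl -ltrBlDr (lt_le_trans se)// fine_mass_upto_nd//.
by move: tr; rewrite ltrD2l ltrN2 => /ltW.
Qed.

Lemma bounded_variation_mass_upto (a b : R) : bounded_variation a b (fun t => fine (mass_upto t)).
Proof.
by apply: nondecreasing_bounded_variation => s t _ _ st; exact: fine_mass_upto_nd.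
Qed.

End distribution_functions.

Section predictable_versions.
Context (R : realType) (d : measure_display) (Omega : measurableType d).
Context (P : probability Omega R) (F : R -> set (set Omega)) (T : R).
Context (U : ptopologicalType).
Hypothesis usual : usual_conditions P F.
Hypothesis T0 : (0 < T)%R.

Local Notation FT t := (g_sigma_algebraType (F t)).
Local Notation PT := (g_sigma_algebraType (predictable_rect F (horizon T))).
Local Notation PS := (PT * borelType U)%type.
Local Notation S := (R * borelType U)%type.
Local Notation slabT := ([set z | horizon T z.2] : set PT).

(** The terminal time is added to the rationals because a right-continuous
    path is not determined there by its values at earlier times. *)
Definition horizon_seq n : R := if (unpickle n : option rat) is Some q then
  (if (0 <= (ratr q : R) <= T)%R then ratr q else T) else T.

Lemma horizon_seq_in n : horizon T (horizon_seq n).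
Proof.
rewrite /horizon_seq /horizon/=; case: unpickle => [q|]; last by rewrite lexx ltW.
by case: ifP => // _; rewrite lexx ltW.
Qed.

Lemma horizon_seq_dense t (e : R) : (0 < e)%R -> horizon T t ->
  exists n, (t <= horizon_seq n < t + e)%R.
Proof.
move=> e0 /= /andP[t0 tT]; have [tT'|Tt] := ltP t T; last first.
  have -> : t = T by apply/eqP; rewrite eq_le tT.
  exists (pickle (-1 : rat)); rewrite /horizon_seq pickleK rmorphN1 ler0N1.
  by rewrite lexx ltrDl.
have : (t < Num.min T (t + e))%R by rewrite lt_min tT' ltrDl.
move=> /rat_in_itvoo[q]; rewrite in_itv/= lt_min => /and3P[tq qT qe].
exists (pickle q); rewrite /horizon_seq pickleK (le_trans t0 (ltW tq)) (ltW qT)/=.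
by rewrite ltW.
Qed.

Lemma horizon_seq_end : exists n, horizon_seq n = T.
Proof. by exists (pickle (-1 : rat)); rewrite /horizon_seq pickleK rmorphN1 ler0N1. Qed.

(** Both sides are right-continuous, so that rational times and the terminal
    time suffice. *)
Lemma cadlag_eq_mass_upto (m : {measure set S -> \bar R}) (D : set S) (v : R -> R) :
  measurable D -> m setT < +oo -> cadlag (@halfline R) v ->
  (forall n, (v (horizon_seq n))%:E = mass_upto m D (horizon_seq n)) ->
  forall t, horizon T t -> (v t)%:E = mass_upto m D t.
Proof.
move=> mD mfin cv vq t ht; have := ht => /= /andP[t0 tT].
have [[n tn]|nt] := pselect (exists n, horizon_seq n = t); first by rewrite -tn vq.
rewrite -(fineK (mass_upto_fin mD mfin t)); congr EFin.
have [/cvgrPdist_lt vr _] := cv t t0.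
apply/eqP; rewrite -subr_eq0 -normr_le0; apply/ler_addgt0Pl => e e0; rewrite addr0.
have e2 : (0 < e / 2)%R by rewrite divr_gt0.
have := vr (e / 2)%R e2; rewrite /nbhs/= /within/=; near_simpl.
move=> /nbhs_ballP[d1 /= d10 d1P].
have [d2 d20 d2P] := mass_upto_right mD mfin t e2.
have [n /andP[tn]] : exists n, (t <= horizon_seq n < t + Num.min d1 d2)%R.
  by apply: horizon_seq_dense => //; rewrite lt_min d10.
rewrite -ltrBlDl lt_min => /andP[nd1 nd2].
have {}tn : (t < horizon_seq n)%R.
  by rewrite lt_neqAle tn andbT; apply/eqP => tE; apply: nt; exists n.
have h1 : (`|v t - v (horizon_seq n)| < e / 2)%R.
  apply: d1P; last by split=> //; case/andP: (horizon_seq_in n).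
  by rewrite /ball/= distrC gtr0_norm ?subr_gt0.
have h2 : (fine (mass_upto m D (horizon_seq n)) < fine (mass_upto m D t) + e / 2)%R.
  by apply: d2P; rewrite (ltW tn)/= -ltrBlDl.
have h3 := fine_mass_upto_nd mD mfin (ltW tn).
move: h1; rewrite -[v (horizon_seq n)]/(fine (v (horizon_seq n))%:E) vq !ltr_norml => /andP[h11 h12].
by rewrite ler_norml; apply/andP; split; lra.
Qed.

(** Null events belong to the sigma-algebra at time zero, hence a process
    supported by one of them is predictable once it is a countable infimum of
    blocks. *)
Lemma predictable_mass_null (m : Omega -> {measure set S -> \bar R}) (D : set S) (N : set Omega) :
  measurable D -> (forall w, m w setT < +oo) -> P.-negligible N ->
  measurable_fun slabT (fun z : PT => if `[< N z.1 >] then mass_upto (m z.1) D z.2 else 0).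
Proof.
move=> mD mfin NN.
have NF (A : set Omega) : A `<=` N -> F 0%R A.
  by move=> AN; apply: (filtration_negligible usual) => //; exact: negligibleS NN.
pose g n (w : Omega) : \bar R := if `[< N w >] then mass_upto (m w) D (horizon_seq n) else 0.
have mg n : measurable_fun setT (g n : FT 0%R -> \bar R).
  move=> _ B mB; rewrite setTI (filtration_measurableE usual)//.
  have [B0|B0] := pselect (B 0).
    rewrite -(setCK (g n @^-1` B)) -(filtration_measurableE usual)//.
    apply: measurableC; rewrite (filtration_measurableE usual)//; apply: NF => w /=.
    by rewrite /g; case: asboolP.
  by apply: NF => w /=; rewrite /g; case: asboolP.
pose b n (z : PT) : \bar R := if (horizon_seq n < z.2 <= T)%R then +oo else g n z.1.
have mb n : measurable_fun slabT (b n).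
  have hn := horizon_seq_in n.
  apply: measurable_fun_if.
  - exact: (measurable_slabT usual T0).
  - apply: (@measurable_fun_bool _ _ _ _ true); rewrite setIC.
    rewrite (_ : _ `&` _ = setT `*` [set t | (horizon_seq n < t <= T)%R]).
      by apply: measurable_pred_rect => //; [case/andP: hn|
        apply: (filtrationT usual); case/andP: hn].
    apply/seteqP; split=> -[w t] /=; first by move=> [].
    move=> [_ nt]; split=> //; rewrite /horizon/=; case/andP: nt => nt ->.
    by case/andP: hn => ? _; rewrite (le_trans _ (ltW nt)).
  - exact: measurable_cst.
  - by apply: measurable_funS (predictable_initial usual T0 (mg n));
      [exact: (measurable_slabT usual T0)|move=> z []].
apply: (eq_measurable_fun (fun z => einfs (b^~ z) 0%N)); last exact: measurable_fun_einfs.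
move=> [w t]; rewrite inE/= => ht; apply/eqP; rewrite eq_le; apply/andP; split.
  have [Nw|Nw] := asboolP (N w); last first.
    apply: ereal_inf_lbound; have [n nT] := horizon_seq_end; exists n => //=.
    by rewrite /b/= nT; case: ltP => [//|_] /=; [case: leP|]; rewrite /g asboolF//.
  rewrite -(fineK (mass_upto_fin mD (mfin w) t)); apply/lee_addgt0Pr => e e0.
  have [dl dl0 dlP] := mass_upto_right mD (mfin w) t e0.
  have [n tn] := horizon_seq_dense dl0 ht.
  apply: (@le_trans _ _ (b n (w, t))); first by apply: ereal_inf_lbound; exists n.
  have /andP[tn' _] := tn; rewrite /b/= ltNge tn'/= /g asboolT//.
  rewrite -(fineK (mass_upto_fin mD (mfin w) (horizon_seq n))) -EFinD lee_fin.
  by rewrite ltW// dlP.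
apply: le_ereal_inf_tmp => _ [n _ <-]; rewrite /b/=.
case: (boolP (horizon_seq n < t <= T)%R) => [_|]; first exact: leey.
have /andP[t0 tT] := ht; rewrite tT andbT -leNgt => tn; rewrite /g.
by case: asboolP => // _; exact: mass_upto_nd.
Qed.

(** The process and its version differ on the paths of a null set of
    scenarios, all subsets of which are known at time zero. *)
Lemma predictable_of_version (m : Omega -> {measure set S -> \bar R}) (D : set S)
    (V : R -> Omega -> R) :
  measurable D -> (forall w, m w setT < +oo) ->
  predictable_process F (horizon T) (fun t w => (V t w)%:E) ->
  {ae P, forall w, cadlag (@halfline R) (V ^~ w)} ->
  (forall t, horizon T t -> {ae P, forall w, (V t w)%:E = mass_upto (m w) D t}) ->
  predictable_process F (horizon T) (fun t w => mass_upto (m w) D t).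
Proof.
move=> mD mfin pV cV Vm.
pose N := [set w | ~ forall t, horizon T t -> (V t w)%:E = mass_upto (m w) D t].
have NN : P.-negligible N.
  have : {ae P, forall w, forall n, (V (horizon_seq n) w)%:E = mass_upto (m w) D (horizon_seq n)}.
    by apply/ae_foralln => n; apply: Vm; exact: horizon_seq_in.
  move=> hq; have : {ae P, forall w, forall t, horizon T t -> (V t w)%:E = mass_upto (m w) D t}.
    by apply: filterS2 cV hq => w cw qw; exact: cadlag_eq_mass_upto.
  by [].
have mS := measurable_slabT usual T0.
have mN : measurable (slabT `&` [set z | N z.1]).
  have mN' : measurable_fun setT ((fun w => `[< N w >]) : FT 0%R -> bool).
    apply: (@measurable_fun_bool _ _ _ _ true); rewrite setTI (filtration_measurableE usual)//.
    rewrite (_ : _ @^-1` _ = N); first exact: (filtration_negligible usual).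
    by apply/seteqP; split=> w /asboolP.
  have h : measurable_fun slabT (fun z : PT => `[< N z.1 >]) := predictable_initial usual T0 mN'.
  have := h mS [set true] I.
  rewrite (_ : _ `&` _ = slabT `&` [set z | N z.1])//.
  by apply/seteqP; split=> z /= [? /asboolP].
apply: (eq_measurable_fun (fun z : PT => if `[< N z.1 >] then
  (if `[< N z.1 >] then mass_upto (m z.1) D z.2 else 0) else (V z.2 z.1)%:E)).
  move=> [w t]; rewrite inE/= => ht; case: asboolP => // Nw.
  by move/contrapT : Nw; exact.
apply: measurable_fun_if => //.
- apply: (@measurable_fun_bool _ _ _ _ true).
  rewrite (_ : _ `&` _ = slabT `&` [set z | N z.1])//.
  by apply/seteqP; split=> z /= [? /asboolP].
- by apply: measurable_funS (predictable_mass_null mD mfin NN) => // z [].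
- by apply: measurable_funS pV => // z [].
Qed.

End predictable_versions.

Lemma measure_diff d (T : measurableType d) (R : realType)
    (m : {measure set T -> \bar R}) (A B : set T) :
  measurable A -> measurable B -> B `<=` A -> m A < +oo -> m A - m B = m (A `\` B).
Proof. by move=> mA mB BA Aoo; rewrite measureD// setIidr. Qed.

Lemma measurable_fun_inv d (T : measurableType d) (R : realType) (D : set T)
    (f : T -> R) : measurable_fun D f -> (forall x, (0 <= f x)%R) ->
  measurable_fun D (fun x => (f x)^-1)%R.
Proof.
move=> mf f0; apply: (eq_measurable_fun (fun x => f x `^ (-1))%R).
  by move=> x _; rewrite powR_inv1.
exact: (measurableT_comp (measurable_powR (-1)%R) mf).
Qed.

Section predictable_integrals.
Context (R : realType) (d : measure_display) (Omega : measurableType d).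
Context (P : probability Omega R) (F : R -> set (set Omega)) (T : R).
Context (U : ptopologicalType).
Hypothesis usual : usual_conditions P F.
Hypothesis T0 : (0 < T)%R.

Local Notation FT t := (g_sigma_algebraType (F t)).
Local Notation PT := (g_sigma_algebraType (predictable_rect F (horizon T))).
Local Notation PS := (PT * borelType U)%type.
Local Notation S := (R * borelType U)%type.
Local Notation slabT := ([set z | horizon T z.2] : set PT).

(** The whole of the product of time and scenarios is included as a first
    factor to cover the part outside the horizon, which the predictable
    rectangles do not reach. *)
Definition pred_boxes : set (set PS) :=
  [set C | exists E B, [/\ E = setT \/ predictable_rect F (horizon T) E,
    measurable (B : set (borelType U)) & C = E `*` B]].

Lemma pred_boxesE : @measurable _ PS = <<s pred_boxes >>.
Proof.
rewrite eqEsubset; split; last first.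
  apply: smallest_sub; first exact: sigma_algebra_measurable.
  move=> _ [E [B [rE mB ->]]]; apply: measurableX => //.
  by case: rE => [->|rE]; [exact: measurableT|exact: sub_sigma_algebra].
rewrite measurable_prod_measurableType; apply: smallest_sub.
  exact: smallest_sigma_algebra.
move=> _ [A mA [B mB <-]].
pose GB := [set A : set PT | <<s pred_boxes >> (A `*` B)].
suff GBS : <<s predictable_rect F (horizon T) >> `<=` GB by exact: GBS mA.
apply: smallest_sub => [|E rE]; last first.
  by apply: sub_sigma_algebra; exists E, B; split=> //; right.
have GBT : GB setT by apply: sub_sigma_algebra; exists setT, B; split=> //; left.
split=> [|C GC|C GC]; rewrite /GB/=.
- by rewrite set0X; exact: sigma_algebra0.
- rewrite (_ : _ `*` _ = (setT `*` B) `\` (C `*` B)).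
    by apply: (@measurableD _ (g_sigma_algebraType pred_boxes)).
  by apply/seteqP; split=> -[z u] /=; tauto.
- by rewrite setX_bigcupl; exact: (@bigcupT_measurable _ (g_sigma_algebraType pred_boxes)).
Qed.

Lemma predictable_rectI C D : predictable_rect F (horizon T) C ->
  predictable_rect F (horizon T) D -> predictable_rect F (horizon T) (C `&` D).
Proof.
have F0 : F 0%R set0 by exact: (filtration0 usual).
have rect0 : predictable_rect F (horizon T) set0.
  by left; exists set0 => //; rewrite set0X.
have Z A s t B : F s A -> F 0%R B -> (0 <= s)%R ->
   (A `*` [set r | (s < r <= t)%R]) `&` (B `*` [set 0%R]) = set0.
  move=> _ _ s0; apply/seteqP; split=> // -[w r] [[_ /= /andP[sr _]] [_ /= r0]].
  by move: sr; rewrite r0 ltNge s0.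
move=> [[A FA ->]|[s [t [A [/andP[s0 st] ht FA ->]]]]] [[B FB ->]|[s' [t' [B [/andP[s'0 s't'] ht' FB ->]]]]].
- left; exists (A `&` B); first exact: (filtrationI usual).
  by apply/seteqP; split=> -[w r] /=; tauto.
- by rewrite setIC Z.
- by rewrite Z.
- have [st'|] := ltP (Num.max s s') (Num.min t t'); last first.
    move=> ts; rewrite (_ : _ `&` _ = set0)//; apply/seteqP; split=> // -[w r] /=.
    move=> [[_ /andP[sr rt]] [_ /andP[sr' rt']]].
    have : (Num.max s s' < Num.min t t')%R.
      by rewrite gt_max !lt_min (lt_le_trans sr rt) (lt_le_trans sr rt')
        (lt_le_trans sr' rt) (lt_le_trans sr' rt').
    by rewrite ltNge ts.
  right; exists (Num.max s s'), (Num.min t t'), (A `&` B); split.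
  + by rewrite st' le_max s0.
  + case/andP: ht ht' => t0 tT /andP[t'0 t'T].
    by rewrite /horizon/= le_min t0 t'0 ge_min tT.
  + have m0 : (0 <= Num.max s s')%R by rewrite le_max s0.
    apply: (filtrationI usual) => //.
      by apply: (filtration_le usual) FA; rewrite s0 le_max lexx.
    by apply: (filtration_le usual) FB; rewrite s'0 le_max lexx orbT.
  + apply/seteqP; split=> -[w r] /=; rewrite gt_max le_min.
      by move=> [[Aw /andP[-> ->]] [Bw /andP[-> ->]]].
    by move=> [[Aw Bw] /andP[/andP[-> ->] /andP[-> ->]]].
Qed.

Lemma pred_boxesI : setI_closed pred_boxes.
Proof.
move=> _ _ [E [B [rE mB ->]]] [E' [B' [rE' mB' ->]]].
exists (E `&` E'), (B `&` B'); split.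
- case: rE => [->|rE]; first by rewrite setTI.
  by case: rE' => [->|rE']; [rewrite setIT; right|right; exact: predictable_rectI].
- exact: measurableI.
- by rewrite setXI.
Qed.

Section dynkin_step.
Context (m : Omega -> {measure set S -> \bar R}) (A0 : set U).
Hypothesis mA0 : measurable (A0 : set (borelType U)).
Hypothesis mfin : forall w, m w setT < +oo.
Hypothesis mcar : forall w, m w (~` (horizon T `*` setT)) = 0.
Hypothesis mpred : forall B, measurable (B : set (borelType U)) -> B `<=` A0 ->
  predictable_process F (horizon T) (fun t w => mass_upto (m w) [set p | B p.2] t).

Let marked (B : set (borelType U)) : measurable B -> measurable ([set p | B p.2] : set S).
Proof. by move=> mB; rewrite -[X in measurable X]setTI; exact: measurable_snd. Qed.

Lemma measurable_sectionS (E : set PS) w : measurable E ->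
  measurable ([set p | E (w, p.1, p.2)] : set S).
Proof.
by move=> mE; rewrite -[X in measurable X]setTI; exact: (measurable_predSpace_section usual w).
Qed.

Lemma mass_neg w (D : set S) : measurable D -> m w (D `&` [set p | (p.1 < 0)%R]) = 0.
Proof.
move=> mD; apply: (@subset_measure0 _ _ _ _ _ (~` (horizon T `*` setT))) => //.
- by apply: measurableI => //; exact: measurable_time_lt.
- apply: measurableC; apply: measurableX => //.
  rewrite (_ : horizon T = `[0%R, T]%classic); first exact: measurable_itv.
  by apply/seteqP; split=> r /=; rewrite in_itv.
- by move=> p [_ /= p0] [/andP[]]; rewrite leNgt p0.
- exact: mcar.
Qed.

Let evt (E : set PS) w : set S := [set p | A0 p.2 /\ E (w, p.1, p.2)].

Let mevt E w : measurable E -> measurable (evt E w).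
Proof.
by move=> mE; apply: measurableI; [exact: marked|exact: measurable_sectionS].
Qed.

(** On a box the cumulated mass is the increment of a predictable process
    multiplied by an event known at its start; a Dynkin class argument does
    the rest. *)
Lemma predictable_mass_section (E : set PS) : measurable E ->
  predictable_process F (horizon T)
    (fun t w => mass_upto (m w) [set p | A0 p.2 /\ E (w, p.1, p.2)] t).
Proof.
have mS := measurable_slabT usual T0.
rewrite pred_boxesE; move: E; apply: (dynkin_induction pred_boxesE pred_boxesI) => /=.
- have -> : (fun t w => mass_upto (m w) [set p | A0 p.2 /\ [set: PS] (w, p.1, p.2)] t)
      = (fun t w => mass_upto (m w) [set p | A0 p.2] t).
    apply/funext => t; apply/funext => w; congr (mass_upto _ _ _).
    by apply/seteqP; split=> p //= [].
  exact: mpred.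
- move=> _ [E [B [rE mB ->]]].
  have mAB : measurable (A0 `&` B : set (borelType U)) by apply: measurableI.
  have AB0 : A0 `&` B `<=` A0 by move=> u [].
  pose a (t : R) w := mass_upto (m w) [set p | (A0 `&` B) p.2] t.
  have pa : predictable_process F (horizon T) a by exact: mpred.
  have aF t w : a t w \is a fin_num by apply: mass_upto_fin => //; exact: marked.
  have ma t : horizon T t -> measurable_fun setT (a t : FT t -> \bar R).
    move=> ht; have := measurable_time_section usual ht.
    move=> h; apply: (measurable_comp (F := slabT) _ _ pa h) => //.
    by move=> _ [w _ <-].
  case: rE => [->|[[A FA ->]|[s [r [A [/andP[s0 sr] /andP[r0 rT] FA ->]]]]]].
  + have -> : (fun t w => mass_upto (m w) [set p | A0 p.2 /\
        ([set: PT] `*` B) (w, p.1, p.2)] t) = a.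
      apply/funext => t; apply/funext => w; congr (mass_upto _ _ _).
      by apply/seteqP; split=> p /= => [[? []]|[]].
    exact: pa.
  + apply: (eq_measurable_fun (fun z : PT => (\1_A z.1)%:E * a 0%R z.1)).
      move=> [w t]; rewrite inE/= => /andP[t0 tT].
      have [Aw|Aw] := pselect (A w); last first.
        rewrite indicE memNset// mul0e /mass_upto (_ : _ `&` _ = set0) ?measure0//.
        by apply/seteqP; split=> // p [[_ [[/Aw]]]].
      rewrite indicE mem_set// mul1e /a /mass_upto.
      have -> : [set p : S | (A0 `&` B) p.2] `&` [set p | (p.1 <= 0)%R] =
          ([set p | A0 p.2 /\ (A `*` [set 0%R] `*` B) (w, p.1, p.2)] `&` [set p | (p.1 <= t)%R])
          `|` ([set p | (A0 `&` B) p.2] `&` [set p | (p.1 < 0)%R]).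
        apply/seteqP; split=> [[x u] [/= [A0u Bu]]|[x u] /=].
          by rewrite le_eqVlt => /predU1P[->|x0]; [left; do !split|right; do !split].
        by move=> [[[? [[_ ->] ?]] _]|[[? ?] /ltW]]; rewrite ?lexx.
      rewrite measureU0//; last by apply: mass_neg; exact: marked.
        apply: measurableI; last exact: measurable_time_le.
        apply: mevt; apply: measurableX => //; exact: measurable_pred_zero.
      by apply: measurableI; [exact: marked|exact: measurable_time_lt].
    apply: (predictable_initial usual T0 (g := fun w => (\1_A w)%:E * a 0%R w)).
    apply: emeasurable_funM; last by apply: ma; rewrite /horizon/= lexx ltW.
    apply/measurable_EFinP/measurable_indic.
    by rewrite (filtration_measurableE usual).
  + have hr : horizon T r by rewrite /horizon/= r0 rT.
    have hs : horizon T s by rewrite /horizon/= s0 (le_trans (ltW sr)).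
    have mblock q : horizon T q -> F q A -> measurable_fun slabT (fun z : PT =>
        if (q < z.2 <= T)%R then (\1_A z.1)%:E * a q z.1 else 0).
      move=> hq FqA; apply: measurable_funTS; have /andP[q0 _] := hq.
      apply: (predictable_block usual (s := q) (r := T) (g := fun w => (\1_A w)%:E * a q w)) => //.
      apply: emeasurable_funM; last exact: ma.
      apply/measurable_EFinP/measurable_indic.
      by rewrite (filtration_measurableE usual).
    have mFr : F r A by apply: (filtration_le usual) FA; rewrite s0 ltW.
    apply: (eq_measurable_fun (fun z : PT =>
      (\1_(A `*` [set t | (s < t <= r)%R]) z)%:E * a z.2 z.1 +
      (if (r < z.2 <= T)%R then (\1_A z.1)%:E * a r z.1 else 0) -
      (if (s < z.2 <= T)%R then (\1_A z.1)%:E * a s z.1 else 0))); last first.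
      apply: emeasurable_funB; last exact: mblock.
      apply: emeasurable_funD; last exact: mblock.
      apply: emeasurable_funM => //; apply/measurable_EFinP/measurable_indic.
      exact: measurable_pred_rect.
    move=> [w t]; rewrite inE/= => /andP[t0 tT]; rewrite tT !andbT.
    have [Aw|Aw] := pselect (A w); last first.
      have iA : \1_A w = 0%R :> R by rewrite indicE memNset.
      have iAX : \1_(A `*` [set t | (s < t <= r)%R]) (w, t) = 0%R :> R.
        by rewrite indicE memNset// => -[].
      rewrite iA iAX !mul0e !if_same adde0 sube0.
      rewrite /mass_upto (_ : _ `&` _ = set0) ?measure0//.
      by apply/seteqP; split=> // p [[_ [[/Aw]]]].
    have iA : \1_A w = 1%R :> R by rewrite indicE mem_set.
    rewrite iA !mul1e.
    have incr (q : R) : (s <= q)%R -> a q w - a s w =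
        m w ([set p | (A0 `&` B) p.2] `&` [set p : S | (s < p.1 <= q)%R]).
      move=> sq; rewrite /a /mass_upto measure_diff; last 4 first.
      - by apply: measurable_upto; exact: marked.
      - by apply: measurable_upto; exact: marked.
      - by move=> p [? /= ps]; split=> //=; exact: le_trans ps sq.
      - by rewrite ltey_eq; apply/orP; left; exact: aF.
      congr (m w _); apply/seteqP; split=> p /=.
        by move=> [[? pq] np]; split=> //; rewrite pq andbT ltNge; apply/negP => ps; apply: np.
      by move=> [? /andP[sp pq]]; split=> // -[_]; rewrite leNgt sp.
    have lhs (q : R) : m w ([set p | (A0 `&` B) p.2] `&` [set p : S | (s < p.1 <= Num.min r t)%R]) =
       mass_upto (m w) [set p | A0 p.2 /\ (A `*` [set t | (s < t <= r)%R] `*` B) (w, p.1, p.2)] t.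
      rewrite /mass_upto; congr (m w _); apply/seteqP; split=> p /=; rewrite le_min.
        by move=> [[? ?] /and3P[-> -> ->]].
      by move=> [[? [[_ /andP[-> ->]] ?]] ->].
    rewrite -(lhs 0%R); have [ts|st] := leP t s.
      have rt : (r < t)%R = false by apply/negbTE; rewrite -leNgt (le_trans ts)// ltW.
      rewrite rt indicE memNset; last by move=> [_ /=]; rewrite ltNge ts.
      rewrite mul0e adde0 sube0 (_ : _ `&` _ = set0) ?measure0//.
      apply/seteqP; split=> // p [_ /= /andP[sp]]; rewrite le_min => /andP[_ pt].
      by move: (lt_le_trans sp pt); rewrite ltNge ts.
    have [tr|rt] := leP t r.
      rewrite indicE mem_set; last by split=> //=; rewrite st.
      by rewrite mul1e adde0 incr 1?ltW// min_r.
    rewrite indicE memNset; last by move=> [_ /= /andP[_]]; rewrite leNgt rt.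
    by rewrite mul0e add0e incr 1?ltW// min_l// ltW.
- move=> E mE pE.
  apply: (eq_measurable_fun (fun z : PT => mass_upto (m z.1) [set p | A0 p.2] z.2 -
     mass_upto (m z.1) [set p | A0 p.2 /\ E (z.1, p.1, p.2)] z.2)).
    move=> [w t] _ /=; rewrite /mass_upto measure_diff; last 4 first.
    - by apply: measurable_upto; exact: marked.
    - by apply: measurable_upto; exact: mevt.
    - by move=> p [[]].
    - by rewrite ltey_eq; apply/orP; left; apply: mass_upto_fin => //; exact: marked.
    by congr (m w _); apply/seteqP; split=> p /=; tauto.
  by apply: emeasurable_funB => //; exact: mpred.
- move=> E mE tE pE.
  apply: (eq_measurable_fun (fun z : PT => \sum_(0 <= k <oo)
     mass_upto (m z.1) [set p | A0 p.2 /\ E k (z.1, p.1, p.2)] z.2)).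
    move=> [w t] _ /=; rewrite /mass_upto.
    have -> : [set p : S | A0 p.2 /\ (\bigcup_k E k) (w, p.1, p.2)] `&` [set p | (p.1 <= t)%R] =
       \bigcup_k ([set p : S | A0 p.2 /\ E k (w, p.1, p.2)] `&` [set p | (p.1 <= t)%R]).
      apply/seteqP; split=> p /=; first by move=> [[? [k _ ?]] ?]; exists k.
      by move=> [k _ [[? ?] ?]]; split=> //; split=> //; exists k.
    rewrite measure_semi_bigcup//.
    + by move=> k; apply: measurable_upto; exact: mevt.
    + apply/trivIsetP => i j _ _ ij; apply/seteqP; split=> // p [[[_ Ei] _] [[_ Ej] _]].
      by have /trivIsetP/(_ i j I I ij) := tE; rewrite -subset0 => /(_ (w, p.1, p.2)); exact.
    + by apply: bigcupT_measurable => k; apply: measurable_upto; exact: mevt.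
  apply: ge0_emeasurable_sum => [k z _ _|k _]; [exact: measure_ge0|exact: pE].
Qed.

Lemma predictable_integral_section (W : PS -> \bar R) :
  measurable_fun setT W -> (forall z, 0 <= W z) ->
  predictable_process F (horizon T) (fun t w =>
    \int[m w]_(p in [set p | A0 p.2] `&` [set p | (p.1 <= t)%R]) W (w, p.1, p.2)).
Proof.
move=> mW W0.
have mD t : measurable ([set p | A0 p.2] `&` [set p | (p.1 <= t)%R] : set S).
  by apply: measurable_upto; exact: marked.
have msec w (f : PS -> \bar R) (t : R) : measurable_fun setT f ->
    measurable_fun ([set p | A0 p.2] `&` [set p | (p.1 <= t)%R] : set S)
      (fun p => f (w, p.1, p.2)).
  move=> mf; apply: measurable_funTS.
  exact: (measurableT_comp mf (measurable_predSpace_section usual w)).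
apply: (@nonneg_measurable_ind _ PS R (fun W => predictable_process F (horizon T) (fun t w =>
    \int[m w]_(p in [set p | A0 p.2] `&` [set p | (p.1 <= t)%R]) W (w, p.1, p.2)))
    _ _ _ _ W mW W0).
- move=> E mE; apply: (eq_measurable_fun (fun z : PT =>
    mass_upto (m z.1) [set p | A0 p.2 /\ E (z.1, p.1, p.2)] z.2)).
    move=> [w t] _ /=.
    transitivity (\int[m w]_(p in [set p | A0 p.2] `&` [set p | (p.1 <= t)%R])
      (\1_[set p : S | E (w, p.1, p.2)] p)%:E); last by [].
    rewrite integral_indic//; last exact: measurable_sectionS.
    by congr (m w _); apply/seteqP; split=> p /=; tauto.
  exact: predictable_mass_section.
- move=> f g mf mg f0 g0 pf pg.
  apply: (eq_measurable_fun (fun z : PT =>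
    \int[m z.1]_(p in [set p | A0 p.2] `&` [set p | (p.1 <= z.2)%R]) f (z.1, p.1, p.2) +
    \int[m z.1]_(p in [set p | A0 p.2] `&` [set p | (p.1 <= z.2)%R]) g (z.1, p.1, p.2))).
    by move=> [w t] _ /=; rewrite -ge0_integralD//; exact: msec.
  exact: emeasurable_funD.
- move=> c f c0 mf f0 pf.
  apply: (eq_measurable_fun (fun z : PT => c%:E *
    \int[m z.1]_(p in [set p | A0 p.2] `&` [set p | (p.1 <= z.2)%R]) f (z.1, p.1, p.2))).
    by move=> [w t] _ /=; rewrite -ge0_integralZl_EFin//; exact: msec.
  exact: measurable_funeM.
- move=> f_ f mf_ f_0 mf nd cvg pf.
  apply: (emeasurable_fun_cvg (fun n (z : PT) =>
    \int[m z.1]_(p in [set p | A0 p.2] `&` [set p | (p.1 <= z.2)%R]) f_ n (z.1, p.1, p.2))).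
    exact: pf.
  move=> [w t] _ /=.
  rewrite (_ : \int[m w]_(p in _) f (w, p.1, p.2) =
    \int[m w]_(p in [set p | A0 p.2] `&` [set p | (p.1 <= t)%R]) limn (fun n => f_ n (w, p.1, p.2))).
    by apply: cvg_monotone_convergence => // n; exact: msec.
  by apply: eq_integral => p _; apply/esym/cvg_lim.
Qed.

End dynkin_step.

(** The weighted measures are handled through their distribution functions,
    and dividing out the first positive weight recovers the measure itself. *)
Lemma predictable_of_weights (zeta : Omega -> {measure set S -> \bar R})
    (U_ : (set U)^nat) (f_ : nat -> PS -> R) :
  (forall w, zeta w setT < +oo) ->
  (forall w, zeta w (~` (horizon T `*` setT)) = 0) ->
  {homo U_ : n k / (n <= k)%N >-> n `<=` k} -> \bigcup_n U_ n = setT ->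
  (forall n, measurable (U_ n : set (borelType U))) ->
  (forall n, measurable_fun setT (f_ n)) ->
  (forall n z, (0 <= f_ n z)%R) ->
  (forall n w, \int[zeta w]_p (f_ n (w, p.1, p.2))%:E < +oo) ->
  (forall w, {ae zeta w, forall p, exists n, (0 < f_ n (w, p.1, p.2))%R}) ->
  (forall n k (B : set (borelType U)), measurable B -> B `<=` U_ k ->
    predictable_process F (horizon T) (fun t w =>
      \int[zeta w]_(p in [set p | B p.2] `&` [set p | (p.1 <= t)%R]) (f_ n (w, p.1, p.2))%:E)) ->
  forall W : PS -> \bar R, measurable_fun ([set z | horizon T z.1.2] : set PS) W ->
    (forall z, 0 <= W z) ->
    predictable_process F (horizon T) (fun t w =>
      \int[zeta w]_(p in `[0%R, t]%classic `*` setT) W (w, p.1, p.2)).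
Proof.
move=> zfin zcar ndU UT mU mf f0 ffin fpos fpred W mW W0.
have mS := measurable_slabT usual T0.
have mD1 : measurable ([set z | horizon T z.1.2] : set PS).
  rewrite (_ : [set z | _] = [set z | horizon T z.2] `*` setT); last first.
    by apply/seteqP; split=> z //= [].
  exact: measurableX.
pose W' : PS -> \bar R := W \_ [set z : PS | horizon T z.1.2].
have mW' : measurable_fun setT W' by apply/(measurable_restrictT _ _).1.
have W'0 z : 0 <= W' z by rewrite /W' patchE; case: ifP.
have msecR w n : measurable_fun setT (fun p : S => f_ n (w, p.1, p.2)).
  exact: (measurableT_comp (mf n) (measurable_predSpace_section usual w)).
pose m n w : {measure set S -> \bar R} :=
  density (zeta w) (msecR w n) (fun p => f0 n (w, p.1, p.2)).
pose E n : set PS := [set z | (0 < f_ n z)%R] `\` \bigcup_(k < n) [set z | (0 < f_ k z)%R].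
have mpos n : measurable ([set z | (0 < f_ n z)%R] : set PS).
  rewrite (_ : [set z | _] = f_ n @^-1` `]0%R, +oo[).
    by rewrite -[X in measurable X]setTI; apply: mf.
  by apply/seteqP; split=> z /=; rewrite in_itv/= andbT.
have mE n : measurable (E n).
  by apply: measurableD => //; apply: bigcup_measurable => k _; exact: mpos.
have tE : trivIset setT E.
  apply/trivIsetP => i j _ _; wlog ij : i j / (i < j)%N.
    move=> h; rewrite neq_ltn => /orP[ij|ji]; first by apply: h; rewrite // ltn_eqF.
    by rewrite setIC; apply: h; rewrite // ltn_eqF.
  by move=> _; apply/seteqP; split=> // z [[fi _] [_ nj]]; apply: nj; exists i.
pose G n z := (\1_(E n) z * (f_ n z)^-1)%:E * W' z.
have mG n : measurable_fun setT (G n).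
  apply: emeasurable_funM => //; apply/measurable_EFinP; apply: measurable_funM.
    exact: measurable_indic.
  exact: measurable_fun_inv.
have G0 n z : 0 <= G n z by rewrite mule_ge0// lee_fin mulr_ge0// invr_ge0.
have mUk k : measurable ([set p | U_ k p.2] : set S).
  by rewrite -[X in measurable X]setTI; apply: measurable_snd.
pose D k t : set S := [set p | U_ k p.2] `&` [set p | (p.1 <= t)%R].
have mD k t : measurable (D k t) by exact: measurable_upto.
have pG n k : predictable_process F (horizon T) (fun t w =>
    \int[m n w]_(p in D k t) G n (w, p.1, p.2)).
  apply: predictable_integral_section => //.
  - by move=> w; rewrite /m/= /density; exact: ffin.
  - move=> w; rewrite /m/= /density; apply/eqP; rewrite eq_le; apply/andP; split; last first.
      by apply: integral_ge0 => p _; rewrite lee_fin.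
    rewrite null_set_integral//; last by apply: measurable_funTS; apply/measurable_EFinP.
    apply: measurableC; apply: measurableX => //.
    rewrite (_ : horizon T = `[0%R, T]%classic); first exact: measurable_itv.
    by apply/seteqP; split=> r /=; rewrite in_itv.
  - move=> B mB BU; apply: (eq_measurable_fun (fun z : PT => \int[zeta z.1]_(p in
      [set p | B p.2] `&` [set p | (p.1 <= z.2)%R]) (f_ n (z.1, p.1, p.2))%:E)) => //.
    exact: fpred BU.
have msecW w D0 : measurable_fun D0 (fun p : S => W' (w, p.1, p.2)).
  by apply: measurable_funTS; exact: (measurableT_comp mW' (measurable_predSpace_section usual w)).
have msecE w n : measurable ([set p | E n (w, p.1, p.2)] : set S).
  exact: measurable_sectionS.
have WE w t k : \int[zeta w]_(p in D k t) W' (w, p.1, p.2) =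
    \sum_(0 <= n <oo) \int[m n w]_(p in D k t) G n (w, p.1, p.2).
  have [N [mN N0 subN]] := fpos w.
  rewrite (ge0_negligible_integral mN)//.
  have DE : D k t `\` N = \bigcup_n ((D k t `\` N) `&` [set p | E n (w, p.1, p.2)]).
    apply/seteqP; split=> [p [Dp Np]|p [n _ [] //]].
    have /notP[n fn] : ~ ~ exists n, (0 < f_ n (w, p.1, p.2))%R.
      by move=> nf; apply: Np; exact: subN.
    have exn : exists n, (0 < f_ n (w, p.1, p.2))%R by exists n.
    have [m0 fm mmin] := ex_minnP exn.
    exists m0 => //; split=> //; split=> //= -[j jm fj].
    by have := mmin j fj; rewrite leqNgt jm.
  rewrite DE ge0_integral_bigcup//; last 2 first.
  - by move=> n; apply: measurableI => //; exact: measurableD.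
  - apply/trivIsetP => i j _ _ ij; apply/seteqP; split=> // p [[_ Ei] [_ Ej]].
    by have /trivIsetP/(_ i j I I ij) := tE; rewrite -subset0 => /(_ (w, p.1, p.2)); exact.
  apply: eq_eseriesr => n _.
  rewrite integral_density//; last first.
    by apply: measurable_funTS; exact: (measurableT_comp (mG n) (measurable_predSpace_section usual w)).
  rewrite [RHS](ge0_negligible_integral mN)//; last 2 first.
  - apply: emeasurable_funM; first by apply: measurable_funTS; apply/measurable_EFinP.
    by apply: measurable_funTS; exact: (measurableT_comp (mG n) (measurable_predSpace_section usual w)).
  - by move=> p _; rewrite mule_ge0// lee_fin.
  rewrite integral_mkcondr; apply: eq_integral => p _; rewrite patchE /G indicE.
  have [Ep|Ep] := pselect (E n (w, p.1, p.2)); last first.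
    by rewrite memNset// memNset// mul0r mul0e mule0.
  rewrite mem_set// mem_set// mul1r muleA -EFinM mulfV ?mul1e//.
  by rewrite gt_eqF//; case: Ep.
apply: (emeasurable_fun_cvg (fun k (z : PT) => \sum_(0 <= n <oo)
    \int[m n z.1]_(p in D k z.2) G n (z.1, p.1, p.2))).
  move=> k; apply: ge0_emeasurable_sum => [n z _ _|n _]; last exact: pG.
  exact: integral_ge0.
move=> [w t] /= /andP[t0 tT]; under eq_fun do rewrite -WE.
rewrite (_ : \int[zeta w]_(p in _) W (w, p.1, p.2) =
    \int[zeta w]_(p in \bigcup_k D k t) W' (w, p.1, p.2)).
  apply: ge0_nondecreasing_set_cvg_integral => //.
  by move=> i j ij; apply/subsetPset => p [Up /= pt]; split=> //; exact: ndU ij _ Up.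
rewrite integral_mkcond [RHS]integral_mkcond; apply: eq_integral => p _.
have -> : \bigcup_k D k t = [set p | (p.1 <= t)%R].
  apply/seteqP; split=> [q [k _ []]//|q /= qt].
  by have [k _ Uk] : (\bigcup_n U_ n) q.2 by [rewrite UT]; exists k.
rewrite !patchE; have [pt|pt] := leP p.1 t; last first.
  rewrite memNset; last by move=> [/=]; rewrite in_itv/= (leNgt _ t) pt andbF.
  by rewrite memNset//= leNgt pt.
rewrite [in RHS]mem_set// /W' patchE; have [p0|p0] := leP 0%R p.1.
  rewrite mem_set; last by split=> //=; rewrite in_itv/= p0.
  by rewrite mem_set//= /horizon/= p0 (le_trans pt).
rewrite memNset; last by move=> [/=]; rewrite in_itv/= (leNgt 0%R) p0.
by rewrite memNset//= /horizon/= leNgt p0.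
Qed.

End predictable_integrals.

(** * Doleans measures and uniqueness of predictable random measures *)

Section time_boxes.
Context (R : realType) (U : ptopologicalType).
Local Notation S := (R * borelType U)%type.

Lemma measurable_cylinder (t : R) (A : set U) : measurable (A : set (borelType U)) ->
  measurable (`[0%R, t]%classic `*` A : set S).
Proof. by move=> mA; apply: measurableX => //; exact: measurable_itv. Qed.

Lemma measurable_strip (s t : R) (A : set U) : measurable (A : set (borelType U)) ->
  measurable ([set r | (s < r <= t)%R] `*` A : set S).
Proof.
move=> mA; apply: measurableX => //; rewrite (_ : [set r | _] = `]s, t]%classic); first exact: measurable_itv.
by apply/seteqP; split=> r /=; rewrite in_itv.
Qed.

Lemma cylinder_marks (T t : R) (A : set U) : horizon T t ->
  `[0%R, t]%classic `*` A `<=` (horizon T `*` A : set S).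
Proof.
move=> /andP[_ tT] [r u] /=; rewrite in_itv/= /horizon/= => -[/andP[-> rt] Au]; split=> //.
by rewrite (le_trans rt).
Qed.

Lemma cylinder_horizon (T t : R) (A : set U) : horizon T t ->
  `[0%R, t]%classic `*` A `<=` (horizon T `*` setT : set S).
Proof. by move=> ht p /(cylinder_marks ht)[]. Qed.

Lemma cylinder_split (s t : R) (A : set U) : (0 <= s)%R -> (s <= t)%R ->
  `[0%R, t]%classic `*` A = (`[0%R, s]%classic `*` A) `|` ([set r | (s < r <= t)%R] `*` A) :> set S.
Proof.
move=> s0 st; apply/seteqP; split=> -[r u] /=; rewrite !in_itv/=.
  by move=> [/andP[r0 rt] Au]; have [rs|sr] := leP r s; [left|right]; rewrite ?r0 ?rt.
by move=> [[/andP[r0 rs] Au]|[/andP[sr rt] Au]]; split=> //;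
  rewrite ?r0 ?rt ?(le_trans rs) ?(le_trans s0 (ltW sr)).
Qed.

Lemma cylinder_strip_disjoint (s t : R) (A : set U) :
  (`[0%R, s]%classic `*` A) `&` ([set r | (s < r <= t)%R] `*` A) = set0 :> set S.
Proof.
rewrite -subset0 => -[r u] /= [[rs _] [/andP[sr _] _]]; move: rs; rewrite in_itv/= => /andP[_].
by rewrite leNgt sr.
Qed.

Lemma measure_cylinder_split (m : {measure set S -> \bar R}) (s t : R) (A : set U) :
  measurable (A : set (borelType U)) -> (0 <= s)%R -> (s <= t)%R ->
  m (`[0%R, t]%classic `*` A) = m (`[0%R, s]%classic `*` A) + m ([set r | (s < r <= t)%R] `*` A).
Proof.
move=> mA s0 st; rewrite (cylinder_split _ s0 st) measureU//.
- exact: measurable_cylinder.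
- exact: measurable_strip.
- exact: cylinder_strip_disjoint.
Qed.

End time_boxes.

Section doleans_measures.
Context (R : realType) (d : measure_display) (Omega : measurableType d).
Context (P : probability Omega R) (F : R -> set (set Omega)) (T : R).
Context (U : ptopologicalType).
Hypothesis usual : usual_conditions P F.
Hypothesis T0 : (0 < T)%R.

Local Notation FT t := (g_sigma_algebraType (F t)).
Local Notation PT := (g_sigma_algebraType (predictable_rect F (horizon T))).
Local Notation PS := (PT * borelType U)%type.
Local Notation S := (R * borelType U)%type.
Local Notation slabT := ([set z | horizon T z.2] : set PT).

Lemma measurable_horizon : measurable (horizon T).
Proof.
rewrite (_ : horizon T = `[0%R, T]%classic); first exact: measurable_itv.
by apply/seteqP; split=> r /=; rewrite in_itv.
Qed.

Lemma measurable_marks (B : set U) : measurable (B : set (borelType U)) ->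
  measurable (horizon T `*` B : set S).
Proof. by move=> mB; apply: measurableX => //; exact: measurable_horizon. Qed.

(** The section of a random measure at one scenario, carried to the
    predictable product space; averaging these over the scenarios gives the
    Doleans measure. *)
Definition trace_at of usual_conditions P F := fun (D : set S) of measurable D =>
  fun (nu : {measure set S -> \bar R}) (w : Omega) (E : set PS) =>
  nu (D `&` [set p | E (w, p.1, p.2)]).

Section trace_measure.
Context (D : set S) (mD : measurable D) (nu : {measure set S -> \bar R}) (w : Omega).
Local Notation tr := (trace_at usual mD nu w).

Lemma measurable_trace (E : set PS) : measurable E ->
  measurable (D `&` [set p | E (w, p.1, p.2)]).
Proof. by move=> mE; apply: measurableI => //; exact: (measurable_sectionS usual). Qed.

Let trace0 : tr set0 = 0.
Proof.
by rewrite /trace_at (_ : _ `&` _ = set0) ?measure0//; apply/seteqP; split=> // p [].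
Qed.

Let trace_ge0 E : 0 <= tr E.
Proof. exact: measure_ge0. Qed.

Let trace_sigma_additive : semi_sigma_additive tr.
Proof.
move=> E mE tE mUE; rewrite /trace_at.
have -> : D `&` [set p | (\bigcup_n E n) (w, p.1, p.2)] =
    \bigcup_n (D `&` [set p | E n (w, p.1, p.2)]).
  by apply/seteqP; split=> [p [Dp [n _ En]]|p [n _ [Dp En]]]; [exists n|split=> //; exists n].
apply: measure_semi_sigma_additive.
- by move=> n; exact: measurable_trace.
- apply/trivIsetP => i j _ _ ij; apply/seteqP; split=> // p [[_ Ei] [_ Ej]].
  by have /trivIsetP/(_ i j I I ij) := tE; rewrite -subset0 => /(_ (w, p.1, p.2)); exact.
- by apply: bigcupT_measurable => n; exact: measurable_trace.
Qed.

HB.instance Definition _ := isMeasure.Build _ _ _ tr trace0 trace_ge0 trace_sigma_additive.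

Lemma integral_trace (f : PS -> \bar R) : measurable_fun setT f -> (forall z, 0 <= f z) ->
  \int[tr]_z f z = \int[nu]_(p in D) f (w, p.1, p.2).
Proof.
move=> mf f0.
have msec (g : PS -> \bar R) : measurable_fun setT g -> measurable_fun D (fun p => g (w, p.1, p.2)).
  move=> mg; apply: measurable_funTS.
  exact: (measurableT_comp mg (measurable_predSpace_section usual w)).
apply: (@nonneg_measurable_ind _ PS R (fun f => \int[tr]_z f z =
  \int[nu]_(p in D) f (w, p.1, p.2)) _ _ _ _ f mf f0).
- move=> E mE; rewrite (integral_indic tr measurableT)// setIT.
  transitivity (\int[nu]_(p in D) (\1_[set p : S | E (w, p.1, p.2)] p)%:E); last by [].
  rewrite integral_indic//; last exact: (measurable_sectionS usual).
  by rewrite setIC.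
- move=> f1 f2 mf1 mf2 f10 f20 P1 P2.
  rewrite (ge0_integralD tr measurableT (fun x _ => f10 x) mf1 (fun x _ => f20 x) mf2) P1 P2.
  by rewrite -(ge0_integralD nu mD (fun p _ => f10 _) (msec _ mf1) (fun p _ => f20 _) (msec _ mf2)).
- move=> c g c0 mg g0 Pg.
  rewrite (ge0_integralZl_EFin tr measurableT (fun x _ => g0 x) mg c0) Pg.
  by rewrite -(ge0_integralZl_EFin nu mD (fun p _ => g0 _) (msec _ mg) c0).
- move=> f_ g mf_ f_0 mg nd cvg Pf.
  have lim : \int[tr]_z f_ n z @[n --> \oo] --> \int[tr]_z g z.
    rewrite (_ : \int[tr]_y g y = \int[tr]_y limn (f_^~ y)).
      by apply: cvg_monotone_convergence.
    by apply: eq_integral => y _; apply/esym/cvg_lim.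
  rewrite -(cvg_lim _ lim)// (_ : (fun n => _) = (fun n => \int[nu]_(p in D) f_ n (w, p.1, p.2))).
    apply/cvg_lim => //; rewrite (_ : \int[nu]_(p in D) g (w, p.1, p.2) =
      \int[nu]_(p in D) limn (fun n => f_ n (w, p.1, p.2))).
      by apply: cvg_monotone_convergence => // n; exact: msec.
    by apply: eq_integral => p _; apply/esym/cvg_lim.
  exact/funext.
Qed.

End trace_measure.

(** The process of the masses up to time [t] is predictable, hence adapted,
    and is read off at the horizon. *)
Lemma measurable_trace_at (nu : R.-ker Omega ~> S) (B : set U)
    (mB : measurable (horizon T `*` B : set S)) (E : set PS) :
  predictable_random_measure F (horizon T) nu ->
  measurable (B : set (borelType U)) ->
  measurable E ->
  measurable_fun setT (fun w => trace_at usual mB (nu w) w E).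
Proof.
move=> pnu mB' mE.
pose W (z : PS) : \bar R := (\1_(E `&` slab T B) z)%:E.
have mEB : measurable (E `&` slab T B) by apply: measurableI => //; exact: (measurable_slab usual).
have mW : measurable_fun ([set z | horizon T z.1.2] : set PS) W.
  by apply: measurable_funTS; apply/measurable_EFinP; exact: measurable_indic.
have W0 z : 0 <= W z by rewrite lee_fin.
have hT : horizon T T by rewrite /horizon/= lexx ltW.
have := pnu W mW W0 => pW.
have mT : measurable_fun setT (fun w : FT T =>
    \int[nu w]_(p in `[0%R, T]%classic `*` setT) W (w, p.1, p.2)).
  apply: (measurable_comp (F := slabT) _ _ pW (measurable_time_section usual hT)).
    exact: (measurable_slabT usual).
  by move=> _ [w _ <-].
have T0' : (0 <= T)%R by exact: ltW.
have := adapted_measurable usual T0' mT; apply: eq_measurable_fun => w _.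
transitivity (\int[nu w]_(p in `[0%R, T]%classic `*` setT)
    (\1_[set p : S | (E `&` slab T B) (w, p.1, p.2)] p)%:E); first by [].
rewrite integral_indic//; last 2 first.
- by apply: measurableX => //; exact: measurable_itv.
- exact: (measurable_sectionS usual).
rewrite /trace_at; congr (nu w _); apply/seteqP; split=> p /=; rewrite in_itv/=.
  by move=> [[Ep [hp Bp]] _].
by move=> [[hp Bp] Ep]; do !split.
Qed.

Section equal_doleans.
Context (nu nu' : R.-ker Omega ~> S).
Hypothesis car : carried_by (horizon T) nu.
Hypothesis car' : carried_by (horizon T) nu'.
Hypothesis pnu : predictable_random_measure F (horizon T) nu.
Hypothesis pnu' : predictable_random_measure F (horizon T) nu'.
Context (B : set U).
Hypothesis mB : measurable (B : set (borelType U)).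
Hypothesis fin : \int[P]_w nu w (horizon T `*` B) < +oo.
Hypothesis eq0 : forall A (C : set (borelType U)), F 0%R A -> measurable C -> C `<=` B ->
  \int[P]_(w in A) nu w ([set 0%R] `*` C) = \int[P]_(w in A) nu' w ([set 0%R] `*` C).
Hypothesis eqI : forall s t A (C : set (borelType U)), (0 <= s < t)%R -> (t <= T)%R ->
  F s A -> measurable C -> C `<=` B ->
  \int[P]_(w in A) nu w ([set r | (s < r <= t)%R] `*` C) =
  \int[P]_(w in A) nu' w ([set r | (s < r <= t)%R] `*` C).

Let mH := measurable_marks mB.

Let fam (k : R.-ker Omega ~> S) (pk : predictable_random_measure F (horizon T) k) E (mE : measurable E) :
  measurable_fun setT (fun w => trace_at usual mH (k w) w E) := measurable_trace_at mH pk mB mE.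

Let horizonE : horizon T = [set 0%R] `|` [set r | (0 < r <= T)%R].
Proof.
apply/seteqP; split=> r /=; rewrite /horizon/=.
  by move=> /andP[]; rewrite le_eqVlt => /predU1P[<-|r0 rT]; [left|right; rewrite r0].
by move=> [->|/andP[/ltW -> ->]]; rewrite ?lexx ?ltW.
Qed.

Let trace_box (k : R.-ker Omega ~> S) (I : set R) (A : set Omega) (C : set U) :
  I `<=` horizon T -> measurable I -> measurable (C : set (borelType U)) -> measurable A ->
  \int[P]_w trace_at usual mH (k w) w ((A `*` I) `*` C) =
  \int[P]_(w in A) k w (I `*` (C `&` B)).
Proof.
move=> Ih mI mC mA; rewrite [RHS]integral_mkcond; apply: eq_integral => w _.
rewrite patchE /trace_at; case: ifPn => Aw.
  congr (k w _); apply/seteqP; split=> -[r u] /=; first by move=> [[? ?] [[? ?] ?]].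
  by move=> [? [? ?]]; do !split => //; [exact: Ih|exact/set_mem].
rewrite (_ : _ `&` _ = set0) ?measure0//.
by apply/seteqP; split=> // p [_ [[/mem_set]]]; rewrite (negbTE Aw).
Qed.

Let mker (k : R.-ker Omega ~> S) A (C : set S) : measurable C -> measurable_fun A (k ^~ C).
Proof. by move=> mC; apply: measurable_funTS; exact: measurable_kernel. Qed.

Let mI0 : measurable ([set 0%R] : set R). Proof. exact: measurable_set1. Qed.

Let mIoc (s t : R) : measurable ([set r | (s < r <= t)%R] : set R).
Proof.
rewrite (_ : [set r | _] = `]s, t]%classic); first exact: measurable_itv.
by apply/seteqP; split=> r /=; rewrite in_itv.
Qed.

Let trace_setT (k : R.-ker Omega ~> S) (C : set U) : measurable (C : set (borelType U)) ->
  \int[P]_w trace_at usual mH (k w) w (setT `*` C) =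
  \int[P]_w k w ([set 0%R] `*` (C `&` B)) +
  \int[P]_w k w ([set r | (0 < r <= T)%R] `*` (C `&` B)).
Proof.
move=> mC; rewrite -ge0_integralD//.
- apply: eq_integral => w _; rewrite /trace_at -measureU.
  + congr (k w _); rewrite horizonE; apply/seteqP; split=> -[r u] /=.
      by move=> [[[->|?] ?] [_ ?]]; [left|right].
    by move=> [[-> [? ?]]|[? [? ?]]]; do !split=> //; [left|right].
  + by apply: measurableX => //; exact: measurableI.
  + by apply: measurableX => //; exact: measurableI.
  + by apply/seteqP; split=> // -[r u] /= [[-> _] [/andP[]]]; rewrite ltxx.
- by apply: mker; apply: measurableX => //; exact: measurableI.
- by apply: mker; apply: measurableX => //; exact: measurableI.
Qed.

(** The Doleans measures are finite on the marks of [B] and agree on the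
    rectangles, which are stable under intersection and generate the
    predictable sets. *)
Lemma equal_doleans (G : PS -> \bar R) : measurable_fun setT G -> (forall z, 0 <= G z) ->
  \int[P]_w \int[nu w]_(p in horizon T `*` B) G (w, p.1, p.2) =
  \int[P]_w \int[nu' w]_(p in horizon T `*` B) G (w, p.1, p.2).
Proof.
pose m1 : {measure set PS -> \bar R} := mixture P (fam pnu).
pose m2 : {measure set PS -> \bar R} := mixture P (fam pnu').
have m12 E : measurable E -> m1 E = m2 E.
  have PI := @pred_boxesI R d Omega P F T U usual.
  apply: (@measure_unique _ R PS (@pred_boxes R d Omega F T U) (fun=> setT) (pred_boxesE F T U) PI).
  - move=> _; exists setT, setT; split=> //; first by left.
    by apply/seteqP; split=> -[].
  - by apply/seteqP; split=> // z _; exists 0%N.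
  - move=> _ [E1 [C [rE mC ->]]]; rewrite /m1 /m2/= /mixture.
    have mCB : measurable (C `&` B : set (borelType U)) by exact: measurableI.
    have CB : C `&` B `<=` B by move=> u [].
    case: rE => [->|[[A FA ->]|[s [t [A [/andP[s0 st] /andP[t0 tT] FA ->]]]]]].
    + have FT0 := filtrationT usual (lexx 0%R).
      by rewrite !trace_setT// eq0// eqI ?lexx.
    + rewrite !trace_box//; last 4 first.
      * by move=> _ ->; rewrite /horizon/= lexx ltW.
      * exact: (filtration_sub usual (lexx 0%R)).
      * by move=> _ ->; rewrite /horizon/= lexx ltW.
      * exact: (filtration_sub usual (lexx 0%R)).
      exact: eq0.
    + have Ih : [set r | (s < r <= t)%R] `<=` horizon T.
        by move=> r /= /andP[sr rt]; rewrite /horizon/= (le_trans s0 (ltW sr)) (le_trans rt).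
      rewrite !trace_box//; [|exact: (filtration_sub usual s0)..].
      by apply: eqI => //; rewrite s0.
  - move=> _; rewrite /m1/= /mixture (le_lt_trans _ fin)// ge0_le_integral//.
    + exact: fam.
    + exact: mker.
    + move=> w _; rewrite /trace_at; apply: le_measure; rewrite ?inE//.
      by apply: measurable_trace.
move=> mG G0.
have E1 := @integral_mixture _ _ Omega PS R P (fun w => trace_at usual mH (nu w) w) (fam pnu) m1 G (fun _ _ => erefl) mG G0.
have E2 := @integral_mixture _ _ Omega PS R P (fun w => trace_at usual mH (nu' w) w) (fam pnu') m2 G (fun _ _ => erefl) mG G0.
have E3 : \int[m1]_z G z = \int[m2]_z G z by apply: eq_measure_integral => E mE _; exact: m12.
transitivity (\int[P]_w \int[trace_at usual mH (nu w) w]_z G z).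
  by apply: eq_integral => w _; rewrite integral_trace.
rewrite -E1 E3 E2.
by apply: eq_integral => w _; rewrite integral_trace.
Qed.
End equal_doleans.
End doleans_measures.

Section uniqueness.
Context (R : realType) (d : measure_display) (Omega : measurableType d).
Context (P : probability Omega R) (F : R -> set (set Omega)) (T : R).
Context (U : ptopologicalType).
Hypothesis usual : usual_conditions P F.
Hypothesis T0 : (0 < T)%R.

Local Notation FT t := (g_sigma_algebraType (F t)).
Local Notation PT := (g_sigma_algebraType (predictable_rect F (horizon T))).
Local Notation PS := (PT * borelType U)%type.
Local Notation S := (R * borelType U)%type.
Local Notation slabT := ([set z | horizon T z.2] : set PT).

Local Notation cut H w := ([set p : S | H (w, p.1, p.2)]).

Lemma measurable_predictable_time : measurable_fun slabT (snd : PT -> R).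
Proof.
have mS := measurable_slabT usual T0.
apply: (measurability _ (RGenCInfty.measurableE R)) => _ [_ [r ->] <-].
have -> : slabT `&` snd @^-1` `[r, +oo[%classic =
    slabT `\` [set z | horizon T z.2 /\ (z.2 < r)%R].
  apply/seteqP; split=> z /=; rewrite in_itv/= andbT.
    by move=> [hz rz]; split=> // -[_]; rewrite ltNge rz.
  by move=> [hz nz]; split=> //; rewrite leNgt; apply/negP => zr; exact: nz.
apply: measurableD => //.
have -> : [set z | horizon T z.2 /\ (z.2 < r)%R] = \bigcup_n
    [set z : PT | horizon T z.2 /\ (z.2 <= r - n.+1%:R^-1)%R].
  apply/seteqP; split=> [z /= [hz zr]|z [n _ /= [hz zr]]].
    have rz : (0 < r - z.2)%R by rewrite subr_gt0.
    have [n _ /(_ _ (leqnn n)) /= nr] := near_infty_natSinv_lt (PosNum rz).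
    by exists n => //=; split=> //; rewrite lerBrDr addrC -lerBrDr ltW.
  by split=> //; rewrite (le_lt_trans zr)// gtrBl.
apply: bigcupT_measurable => n; set s := (r - _)%R.
have [s0|s0] := ltP s 0%R.
  rewrite (_ : [set z | _] = set0)//; apply/seteqP; split=> // z /= [/andP[z0 _] zs].
  by have := le_lt_trans z0 (le_lt_trans zs s0); rewrite ltxx.
have -> : [set z : PT | horizon T z.2 /\ (z.2 <= s)%R] =
    (setT `*` [set 0%R]) `|` (setT `*` [set r | (0 < r <= Num.min s T)%R]).
  apply/seteqP; split=> z /=.
    move=> [/andP[]]; rewrite le_eqVlt => /predU1P[<-|z0] zT zs; [by left|right].
    by rewrite z0 le_min zs zT.
  move=> [[_ ->]|[_ /andP[z0]]]; first by rewrite /horizon/= lexx ltW.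
  by rewrite le_min => /andP[zs zT]; rewrite /horizon/= (ltW z0) zT.
apply: measurableU.
  by apply: measurable_pred_zero; exact: (filtrationT usual (lexx _)).
apply: measurable_pred_rect => //; first by rewrite ge_min lexx orbT.
exact: (filtrationT usual (lexx _)).
Qed.

Lemma measurable_deterministic (C : set S) : measurable C ->
  measurable ([set z | horizon T z.1.2 /\ C (z.1.2, z.2)] : set PS).
Proof.
move=> mC.
have mslab := measurable_slab usual T0 (@measurableT _ (borelType U)).
have mS := measurable_slabT usual T0.
pose tm : PT -> R := (snd : PT -> R) \_ slabT.
have mtm : measurable_fun setT tm by apply/(measurable_restrictT _ mS); exact: measurable_predictable_time.
have mf : measurable_fun setT (fun z : PS => (tm z.1, z.2) : S).
  apply: measurable_fun_pair; last exact: measurable_snd.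
  exact: (measurableT_comp mtm measurable_fst).
have := measurableI _ _ mslab (mf measurableT C mC).
rewrite (_ : _ `&` _ = [set z | horizon T z.1.2 /\ C (z.1.2, z.2)])//.
apply/seteqP; split=> -[z u] /=; rewrite /slab/= /tm patchE.
  by move=> [[hz _]]; rewrite mem_set// => -[].
by move=> [hz Cz]; rewrite mem_set.
Qed.

Lemma measurable_mass_le (m : {measure set S -> \bar R}) : m setT < +oo ->
  measurable_fun setT (fun p : S => m [set q | (q.1 <= p.1)%R]) /\
  measurable_fun setT (fun p : S => m [set q | (q.1 < p.1)%R]).
Proof.
move=> mT.
have fin A : measurable A -> m A \is a fin_num.
  move=> mA; rewrite ge0_fin_numE ?measure_ge0// (le_lt_trans _ mT)//.
  by apply: le_measure; rewrite ?inE.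
have aux (A : R -> set S) : (forall t, measurable (A t)) -> (forall s t, (s <= t)%R -> A s `<=` A t) ->
    measurable_fun setT (fun p : S => m (A p.1)).
  move=> mA Ale.
  rewrite (_ : (fun p => _) = EFin \o ((fun t => fine (m (A t))) \o (fst : S -> R))); last first.
    by apply/funext => p; rewrite /= fineK// fin.
  apply/measurable_EFinP; apply: measurableT_comp; last exact: measurable_fst.
  apply: nondecreasing_measurable => // s t st; apply: fine_le; rewrite ?fin//.
  by apply: le_measure; rewrite ?inE//; exact: Ale.
split.
  apply: (aux (fun t => [set q | (q.1 <= t)%R])).
- by move=> t; exact: measurable_time_le.
- by move=> s t st p /= ps; exact: le_trans st.
apply: (aux (fun t => [set q | (q.1 < t)%R])).
- by move=> t; exact: measurable_time_lt.
- by move=> s t st p /= ps; exact: lt_le_trans st.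
Qed.

Lemma integral_mrestr (m : {measure set S -> \bar R}) (C : set S) (mC : measurable C)
    (g : S -> \bar R) : measurable_fun setT g -> (forall p, 0 <= g p) ->
  \int[mrestr m mC]_p g p = \int[m]_(p in C) g p.
Proof.
move=> mg g0.
have mf : measurable_fun setT (\1_C : S -> R) by exact: measurable_indic.
have f0 p : (0 <= (\1_C : S -> R) p)%R by rewrite indicE ler0n.
rewrite (eq_measure_integral (density m mf f0)).
  rewrite integral_density// [RHS]integral_mkcond; apply: eq_integral => p _.
  by rewrite patchE indicE; case: ifP => _; rewrite ?mul1e ?mul0e.
move=> A mA _; rewrite /= /density integral_indic// /mrestr setIC//.
Qed.

(** The cumulated mass of a predictable set, up to and including the current
    time; on the diagonal one factor of a product of masses must include the
    current time and the other must not. *)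
Definition cum of usual_conditions P F := fun (k : R.-ker Omega ~> S) (H : set PS) =>
  ((fun z : PT => \int[k z.1]_(p in `[0%R, z.2]%classic `*` setT)
    (\1_H (z.1, p.1, p.2))%:E) \_ slabT).

(** A supremum over countably many earlier times, which makes it predictable
    without a left limit. *)
Definition cum_before (k : R.-ker Omega ~> S) (H : set PS) (z : PT) : \bar R :=
  ereal_sup [set (if (horizon_seq T n < z.2 <= T)%R
    then cum usual k H (z.1, horizon_seq T n) else 0) | n in setT].

Section one_kernel.
Context (k : R.-ker Omega ~> S).
Hypothesis pk : predictable_random_measure F (horizon T) k.
Context (B : set U).
Hypothesis mB : measurable (B : set (borelType U)).
Context (H : set PS) (mH : measurable H) (HB : H `<=` slab T B).

Lemma measurable_cut w : measurable ((cut H w)).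
Proof. exact: (measurable_sectionS usual). Qed.

Lemma cumE w t : horizon T t -> cum usual k H (w, t) = k w ((cut H w) `&` [set p | (p.1 <= t)%R]).
Proof.
move=> ht; rewrite /cum patchE mem_set//=.
transitivity (\int[k w]_(p in `[0%R, t]%classic `*` setT) (\1_((cut H w)) p)%:E); first by [].
rewrite integral_indic//; last 2 first.
- by apply: measurableX => //; exact: measurable_itv.
- exact: measurable_cut.
congr (k w _); apply/seteqP; split=> p /=; rewrite in_itv/=.
  by move=> [Hp [/andP[_ ->] _]].
by move=> [Hp pt]; split=> //; rewrite pt; have [/andP[-> _] _] := HB Hp.
Qed.

Lemma cum_ge0 z : 0 <= cum usual k H z.
Proof.
rewrite /cum patchE; case: ifP => // _.
by apply: integral_ge0 => p _; rewrite lee_fin.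
Qed.

Lemma measurable_cum : measurable_fun setT (cum usual k H).
Proof.
have mS := measurable_slabT usual T0.
apply/(measurable_restrictT _ mS).
apply: (pk (W := fun z => (\1_H z)%:E)).
- by apply: measurable_funTS; apply/measurable_EFinP; exact: measurable_indic.
- by move=> z; rewrite lee_fin.
Qed.

Lemma cum_before_ge0 z : 0 <= cum_before k H z.
Proof.
apply: le_trans (ereal_sup_ubound _); last by exists 0%N.
by case: (horizon_seq T 0 < z.2 <= T)%R => //; exact: cum_ge0.
Qed.

Lemma cum_beforeE w t : horizon T t ->
  cum_before k H (w, t) = k w ((cut H w) `&` [set p | (p.1 < t)%R]).
Proof.
move=> /andP[t0 tT]; apply/eqP; rewrite eq_le; apply/andP; split.
  apply: ge_ereal_sup => _ [n _ <-] /=; case: ifP => // /andP[nt _].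
  rewrite cumE; last exact: horizon_seq_in.
  apply: le_measure; rewrite ?inE.
  - by apply: measurableI; [exact: measurable_cut|exact: measurable_time_le].
  - by apply: measurableI; [exact: measurable_cut|exact: measurable_time_lt].
  - by move=> p [Hp /= pn]; split=> //=; exact: le_lt_trans nt.
set K := cum_before _ _ _.
have K0 : 0 <= K by exact: cum_before_ge0.
apply: (@down_closed_le _ _ _ _ [set s | (s < t)%R]) => //.
- exact: measurable_cut.
- by move=> s r /= rt sr; exact: le_lt_trans rt.
move=> s /= st; have [s0|s0] := ltP s 0%R.
  rewrite (_ : _ `&` _ = set0) ?measure0//; apply/seteqP; split=> // p [Hp /= ps].
  have [/andP[p0 _] _] := HB Hp.
  by have := le_lt_trans p0 (le_lt_trans ps s0); rewrite ltxx.
have hm : horizon T ((s + t) / 2)%R by apply/andP; split; lra.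
have e0 : (0 < (t - s) / 2)%R by lra.
have [n hn] := horizon_seq_dense e0 hm.
apply: le_trans (ereal_sup_ubound _); last by exists n.
have /andP[sn nt] : (s < horizon_seq T n < t)%R.
  by case/andP: hn => h1 h2; apply/andP; split; lra.
rewrite /= nt tT/= cumE; last exact: horizon_seq_in.
apply: le_measure; rewrite ?inE.
- by apply: measurableI; [exact: measurable_cut|exact: measurable_time_le].
- by apply: measurableI; [exact: measurable_cut|exact: measurable_time_le].
- by move=> p [Hp /= ps]; split=> //=; rewrite (le_trans ps)// ltW.
Qed.

Lemma measurable_cum_before : measurable_fun setT (cum_before k H).
Proof.
have mS := measurable_slabT usual T0.
pose f n (z : PT) := if (horizon_seq T n < z.2 <= T)%R
    then cum usual k H (z.1, horizon_seq T n) else 0.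
have mf n : measurable_fun setT (f n).
  have /andP[n0 _] := @horizon_seq_in R T T0 n.
  apply: (@predictable_block _ _ _ P F T usual _ _ (horizon_seq T n) T
    (fun w => cum usual k H (w, horizon_seq T n)) 0) => //.
  apply: (measurableT_comp (f := cum usual k H)
    (g := (fun w => (w, horizon_seq T n)) : FT (horizon_seq T n) -> PT)).
    exact: measurable_cum.
  by apply: (measurable_time_section usual); exact: horizon_seq_in.
have := measurable_fun_esups mf 0%N; apply: eq_measurable_fun => z _.
rewrite /esups/cum_before; congr ereal_sup; apply/seteqP; split=> x /=.
  by move=> [n _ <-]; exists n.
by move=> [n _ <-]; exists n.
Qed.

End one_kernel.

Section bounded.
Context (nu nu' : R.-ker Omega ~> S).
Context (B : set U).
Hypothesis mB : measurable (B : set (borelType U)).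
Context (H : set PS) (mH : measurable H) (HB : H `<=` slab T B).
Context (K : R).

Local Notation mD := (measurable_marks T mB).

(** Integration by parts for two cumulated masses, written as an identity
    between integrals of predictable functions. *)
Lemma product_split (k1 k2 : R.-ker Omega ~> S) :
  (forall w, k1 w (cut H w) <= K%:E) -> (forall w, k2 w (cut H w) <= K%:E) ->
  predictable_random_measure F (horizon T) k1 ->
  predictable_random_measure F (horizon T) k2 ->
  \int[P]_w (k1 w (cut H w) * k2 w (cut H w)) =
  \int[P]_w \int[k2 w]_(p in horizon T `*` B)
    ((\1_H (w, p.1, p.2))%:E * cum usual k1 H (w, p.1)) +
  \int[P]_w \int[k1 w]_(p in horizon T `*` B)
    ((\1_H (w, p.1, p.2))%:E * cum_before k2 H (w, p.1)).
Proof.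
move=> b1 b2 pk1 pk2.
have mW (k : R.-ker Omega ~> S) (g : PT -> \bar R) : predictable_random_measure F (horizon T) k ->
    measurable_fun setT g -> (forall z, 0 <= g z) ->
    measurable_fun setT (fun w => \int[k w]_(p in horizon T `*` B)
      ((\1_H (w, p.1, p.2))%:E * g (w, p.1))).
  move=> pk mg g0.
  pose W (z : PS) := (\1_H z)%:E * g z.1.
  have mWW : measurable_fun setT W.
    apply: emeasurable_funM; last exact: (measurableT_comp mg measurable_fst).
    by apply/measurable_EFinP; exact: measurable_indic.
  have W0 z : 0 <= W z by rewrite mule_ge0// lee_fin.
  have hT : horizon T T by rewrite /horizon/= lexx ltW.
  have mT : measurable_fun setT (fun w : FT T =>
      \int[k w]_(p in `[0%R, T]%classic `*` setT) W (w, p.1, p.2)).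
    apply: (measurable_comp (F := slabT) _ _ (pk W (measurable_funTS mWW) W0)
      (measurable_time_section usual hT)).
      exact: (measurable_slabT usual).
    by move=> _ [w _ <-].
  have := adapted_measurable usual (ltW T0) mT; apply: eq_measurable_fun => w _.
  rewrite integral_mkcond [RHS]integral_mkcond; apply: eq_integral => p _.
  rewrite !patchE /W indicE; case: (boolP ((w, p.1, p.2) \in H)) => Hp; last first.
    by rewrite mul0e !if_same.
  have [/= hp Bp] := HB (set_mem Hp).
  rewrite !mem_set// /= in_itv/=; split=> //.
rewrite -ge0_integralD//; last 4 first.
- move=> w _; apply: integral_ge0 => p _; rewrite mule_ge0//.
  exact: cum_ge0.
- by apply: mW => //; [exact: measurable_cum|exact: cum_ge0].
- move=> w _; apply: integral_ge0 => p _; rewrite mule_ge0//.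
  exact: cum_before_ge0.
- by apply: mW => //; [exact: measurable_cum_before|exact: cum_before_ge0].
apply: eq_integral => w _.
have mC := measurable_cut mH w.
pose m1 : {measure set S -> \bar R} := mrestr (k1 w) mC.
pose m2 : {measure set S -> \bar R} := mrestr (k2 w) mC.
have m1E : m1 setT = k1 w (cut H w) by rewrite /m1/= /mrestr setTI.
have m2E : m2 setT = k2 w (cut H w) by rewrite /m2/= /mrestr setTI.
have h1 : m1 setT < +oo by rewrite m1E (le_lt_trans (b1 w))// ltry.
have h2 : m2 setT < +oo by rewrite m2E (le_lt_trans (b2 w))// ltry.
rewrite -m1E -m2E (product_mass_split h1 h2).
have restr (k : R.-ker Omega ~> S) (g : S -> \bar R) (f : R -> \bar R) :
    (forall p, 0 <= g p) -> measurable_fun setT g ->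
    (forall t, horizon T t -> forall u, g (t, u) = f t) ->
    \int[mrestr (k w) mC]_p g p = \int[k w]_(p in horizon T `*` B)
      ((\1_H (w, p.1, p.2))%:E * f p.1).
  move=> g0 mg gf.
  rewrite integral_mrestr//; rewrite (integral_mkcond (cut H w : set S)) (integral_mkcond (horizon T `*` B : set S)).
  apply: eq_integral => -[t u] _.
  rewrite !patchE indicE/=; case: (boolP ((t, u) \in (cut H w))) => Hp; last first.
    have /negbTE -> : (w, t, u) \notin H by apply: contra Hp => /set_mem ?; exact/mem_set.
    by rewrite mul0e if_same.
  have Hp' := set_mem Hp; have [/= hp Bp] := HB Hp'.
  by rewrite !mem_set// mul1e gf.
congr (_ + _).
- apply: (restr k2 (fun p => m1 [set q | (q.1 <= p.1)%R]) (fun t => cum usual k1 H (w, t))).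
  + by move=> p; exact: measure_ge0.
  + exact: (measurable_mass_le h1).1.
  + move=> t ht u; rewrite (cumE k1 mH HB)// /m1/= /mrestr setIC//.
- apply: (restr k1 (fun p => m2 [set q | (q.1 < p.1)%R]) (fun t => cum_before k2 H (w, t))).
  + by move=> p; exact: measure_ge0.
  + exact: (measurable_mass_le h2).2.
  + move=> t ht u; rewrite (cum_beforeE k2 mH HB)// /m2/= /mrestr setIC//.
Qed.

Hypothesis pnu : predictable_random_measure F (horizon T) nu.
Hypothesis pnu' : predictable_random_measure F (horizon T) nu'.
Hypothesis doleansE : forall G : PS -> \bar R, measurable_fun setT G -> (forall z, 0 <= G z) ->
  \int[P]_w \int[nu w]_(p in horizon T `*` B) G (w, p.1, p.2) =
  \int[P]_w \int[nu' w]_(p in horizon T `*` B) G (w, p.1, p.2).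
Hypothesis nuK : forall w, nu w (cut H w) <= K%:E.
Hypothesis nuK' : forall w, nu' w (cut H w) <= K%:E.

(** Splitting the products of the two total masses [b] and [b'] along the
    diagonal expresses the expectations of [b b], [b' b'], [b b'] and [b' b]
    through integrals of predictable functions, which do not see the
    difference between the two random measures; hence the expectation of
    [(b - b')^2] vanishes. *)
Lemma bounded_masses_eq : {ae P, forall w, nu w (cut H w) = nu' w (cut H w)}.
Proof.
have mk (k : R.-ker Omega ~> S) : predictable_random_measure F (horizon T) k ->
    measurable_fun setT (fun w => k w (cut H w)).
  move=> pk; have := measurable_trace_at usual T0 mD pk mB mH; apply: eq_measurable_fun => w _.
  rewrite /trace_at; congr (k w _); apply/seteqP; split=> p /=; first by move=> [].
  by move=> Hp; split=> //; have [] := HB Hp.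
have G_eq (g : PT -> \bar R) : measurable_fun setT g -> (forall z, 0 <= g z) ->
    \int[P]_w \int[nu w]_(p in horizon T `*` B) ((\1_H (w, p.1, p.2))%:E * g (w, p.1)) =
    \int[P]_w \int[nu' w]_(p in horizon T `*` B) ((\1_H (w, p.1, p.2))%:E * g (w, p.1)).
  move=> mg g0; apply: (doleansE (G := fun z => (\1_H z)%:E * g z.1)).
    apply: emeasurable_funM; last exact: (measurableT_comp mg measurable_fst).
    by apply/measurable_EFinP; exact: measurable_indic.
  by move=> z; rewrite mule_ge0// lee_fin.
have e11 := product_split nuK nuK pnu pnu.
have e12 := product_split nuK nuK' pnu pnu'.
have e21 := product_split nuK' nuK pnu' pnu.
have e22 := product_split nuK' nuK' pnu' pnu'.
rewrite -(G_eq (cum usual nu H)) in e12; [|exact: measurable_cum|exact: cum_ge0].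
rewrite (G_eq (cum_before nu' H)) in e12; [|exact: measurable_cum_before|exact: cum_before_ge0].
rewrite (G_eq (cum usual nu' H)) in e21; [|exact: measurable_cum|exact: cum_ge0].
rewrite -(G_eq (cum_before nu H)) in e21; [|exact: measurable_cum_before|exact: cum_before_ge0].
have fin w (k : R.-ker Omega ~> S) : k w (cut H w) <= K%:E -> k w (cut H w) = (fine (k w (cut H w)))%:E.
  by move=> kK; rewrite fineK// ge0_fin_numE ?measure_ge0// (le_lt_trans kK) ?ltry.
pose b w := fine (nu w (cut H w)); pose b' w := fine (nu' w (cut H w)).
have bE w : nu w (cut H w) = (b w)%:E by exact: fin.
have bE' w : nu' w (cut H w) = (b' w)%:E by exact: fin.
have b0 w : (0 <= b w)%R by rewrite fine_ge0.
have b0' w : (0 <= b' w)%R by rewrite fine_ge0.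
have bK w : (b w <= K)%R by rewrite -lee_fin -bE.
have bK' w : (b' w <= K)%R by rewrite -lee_fin -bE'.
have mb : measurable_fun setT b by apply: measurableT_comp => //; exact: mk.
have mb' : measurable_fun setT b' by apply: measurableT_comp => //; exact: mk.
have sum : \int[P]_w ((b w - b' w) ^+ 2)%:E + (\int[P]_w (b w * b' w)%:E + \int[P]_w (b' w * b w)%:E) =
    \int[P]_w (b w * b w)%:E + \int[P]_w (b' w * b' w)%:E.
  rewrite -!ge0_integralD//; try (by move=> w _; rewrite lee_fin ?sqr_ge0 ?addr_ge0 ?mulr_ge0); try
    (by apply/measurable_EFinP; rewrite ?(measurable_funX, measurable_funM, measurable_funB)//;
     do ?[apply: measurable_funX|apply: measurable_funM|apply: measurable_funB|apply: measurable_funD]).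
  by apply: eq_integral => w _; rewrite -!EFinD; congr EFin; ring.
have eqs : \int[P]_w (b w * b' w)%:E + \int[P]_w (b' w * b w)%:E =
    \int[P]_w (b w * b w)%:E + \int[P]_w (b' w * b' w)%:E.
  have rw (k1 k2 : R.-ker Omega ~> S) (f g : Omega -> R) : (forall w, k1 w (cut H w) = (f w)%:E) ->
      (forall w, k2 w (cut H w) = (g w)%:E) ->
      \int[P]_w (f w * g w)%:E = \int[P]_w (k1 w (cut H w) * k2 w (cut H w)).
    by move=> k1f k2g; apply: eq_integral => w _; rewrite k1f k2g EFinM.
  rewrite (rw _ _ _ _ bE bE') (rw _ _ _ _ bE' bE) (rw _ _ _ _ bE bE) (rw _ _ _ _ bE' bE').
  have ac (x y z t : \bar R) : (x + t) + (z + y) = (x + y) + (z + t).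
    by rewrite addeACA [t + y]addeC addeACA.
  by rewrite e11 e12 e21 e22; exact: ac.
have fine_int : \int[P]_w (b w * b' w)%:E + \int[P]_w (b' w * b w)%:E \is a fin_num.
  have aux (f g : Omega -> R) : (forall w, 0 <= f w <= K)%R -> (forall w, 0 <= g w <= K)%R ->
      measurable_fun setT f -> measurable_fun setT g -> \int[P]_w (f w * g w)%:E \is a fin_num.
    move=> fK gK mf mg.
    have fg0 w : (0 <= f w * g w)%R.
      by have /andP[f0 _] := fK w; have /andP[g0 _] := gK w; exact: mulr_ge0.
    rewrite ge0_fin_numE; last by apply: integral_ge0 => w _; rewrite lee_fin.
    rewrite (@le_lt_trans _ _ (\int[P]_w (K * K)%:E))//; last first.
      by rewrite integral_cst//= probability_setT mule1 ltry.
    apply: ge0_le_integral => //.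
    - by move=> w _; rewrite lee_fin.
    - by apply/measurable_EFinP; exact: measurable_funM.
    - move=> w _; rewrite lee_fin; have /andP[f0 f1] := fK w; have /andP[g0 g1] := gK w.
      exact: ler_pM.
  by rewrite fin_numD !aux// => w; rewrite ?b0 ?b0' ?bK ?bK'.
have z0 : \int[P]_w ((b w - b' w) ^+ 2)%:E = 0.
  have := congr1 (fun x => x - (\int[P]_w (b w * b' w)%:E + \int[P]_w (b' w * b w)%:E)) sum.
  by rewrite addeK// -eqs subee.
have msq : measurable_fun setT (fun w => ((b w - b' w) ^+ 2)%:E).
  by apply/measurable_EFinP; apply: measurable_funX; exact: measurable_funB.
have := (ae_eq_integral_abs P measurableT msq).1.
have -> : \int[P]_w `|((b w - b' w) ^+ 2)%:E| = 0.
  by rewrite -[RHS]z0; apply: eq_integral => w _; rewrite gee0_abs// lee_fin sqr_ge0.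
move=> /(_ erefl); apply: filterS => w /(_ I) [] /eqP.
by rewrite sqrf_eq0 subr_eq0 bE bE' => /eqP ->.
Qed.
End bounded.

Section unique.
Context (nu nu' : R.-ker Omega ~> S).
Hypothesis car : carried_by (horizon T) nu.
Hypothesis car' : carried_by (horizon T) nu'.
Hypothesis pnu : predictable_random_measure F (horizon T) nu.
Hypothesis pnu' : predictable_random_measure F (horizon T) nu'.
Context (U_ : (set U)^nat).
Hypothesis ndU : {homo U_ : n m / (n <= m)%N >-> n `<=` m}.
Hypothesis bigU : \bigcup_n U_ n = setT.
Hypothesis mU : forall n, measurable (U_ n : set (borelType U)).
Hypothesis homeoU : homeomorphic_to_borel R U.
Hypothesis fin : forall n, \int[P]_w nu w (horizon T `*` U_ n) < +oo.
Hypothesis doleansE : forall n (G : PS -> \bar R), measurable_fun setT G -> (forall z, 0 <= G z) ->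
  \int[P]_w \int[nu w]_(p in horizon T `*` U_ n) G (w, p.1, p.2) =
  \int[P]_w \int[nu' w]_(p in horizon T `*` U_ n) G (w, p.1, p.2).

Let fin_ae (k : R.-ker Omega ~> S) n : \int[P]_w k w (horizon T `*` U_ n) < +oo ->
  {ae P, forall w, k w (horizon T `*` U_ n) < +oo}.
Proof.
move=> kfin.
have mk : measurable_fun setT (k ^~ (horizon T `*` U_ n)).
  by apply: measurable_kernel; exact: measurable_marks.
have : P.-integrable setT (k ^~ (horizon T `*` U_ n)).
  apply/integrableP; split=> //; rewrite (le_lt_trans _ kfin)//.
  by rewrite (eq_integral (k ^~ (horizon T `*` U_ n)))// => w _; rewrite gee0_abs.
move=> /(integrable_ae measurableT); apply: filterS => w /(_ I).
by rewrite ge0_fin_numE.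
Qed.

(** Truncation reduces to bounded masses: the set is restricted to the times
    at which both cumulated masses are still below a level [K], and this
    restricted set is again predictable. *)
Lemma predictable_set_masses_eq n (E : set PS) : measurable E -> E `<=` slab T (U_ n) ->
  {ae P, forall w, nu w (cut E w) = nu' w (cut E w)}.
Proof.
move=> mE EU.
have mB := mU n; have mD := measurable_marks T mB.
pose H (K : nat) : set PS := E `&` [set z | cum usual nu E z.1 <= K%:R%:E] `&`
  [set z | cum usual nu' E z.1 <= K%:R%:E].
have mcumK (k : R.-ker Omega ~> S) (K : nat) : predictable_random_measure F (horizon T) k ->
    measurable ([set z | cum usual k E z.1 <= K%:R%:E] : set PS).
  move=> pk; rewrite -[X in measurable X]setTI.
  have mc : measurable_fun setT (fun z : PS => cum usual k E z.1).
    apply: measurableT_comp; last exact: measurable_fst.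
    exact: measurable_cum.
  by apply: emeasurable_fun_le.
have mH K : measurable (H K) by apply: measurableI; [apply: measurableI|] => //; exact: mcumK.
have HU K : H K `<=` slab T (U_ n) by move=> z [[/EU]].
have down (k : R.-ker Omega ~> S) (K : nat) (L : set PS) w :
    L `<=` E `&` [set z | cum usual k E z.1 <= K%:R%:E] -> measurable L ->
    k w (cut L w) <= K%:R%:E.
  move=> LE mL.
  pose I := [set t | exists2 r, horizon T r /\ (t <= r)%R & cum usual k E (w, r) <= K%:R%:E].
  apply: (@le_trans _ _ (k w (cut E w `&` [set p | I p.1]))).
    have mI : measurable I.
      apply: is_interval_measurable => x y [rx [hx xr] cx] [ry [hy yr] cy] z /andP[xz zy].
      by exists ry => //; split=> //; exact: le_trans yr.
    apply: le_measure; rewrite ?inE.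
    - exact: measurable_cut.
    - apply: measurableI; first exact: measurable_cut.
      by rewrite -[X in measurable X]setTI; apply: measurable_fst.
    - move=> p /= Lp; have [Ep cp] := LE _ Lp; split=> //.
      by exists p.1; first by have [] := EU _ Ep.
  apply: down_closed_le => //.
  - exact: measurable_cut.
  - by move=> s t [r [hr tr] cr] st; exists r => //; split=> //; exact: le_trans tr.
  move=> t [r [hr tr]]; rewrite (cumE k mE EU)//; apply: le_trans.
  apply: le_measure; rewrite ?inE.
  - by apply: measurableI; [exact: measurable_cut|exact: measurable_time_le].
  - by apply: measurableI; [exact: measurable_cut|exact: measurable_time_le].
  - by move=> p [Ep /= pt]; split=> //=; exact: le_trans tr.
have bounded K := bounded_masses_eq mB (mH K) (HU K) pnu pnu' (@doleansE n)
  (fun w => down nu K (H K) w (fun z h => h.1) (mH K))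
  (fun w => down nu' K (H K) w (fun z h => conj h.1.1 h.2) (mH K)).
have fin' : \int[P]_w nu' w (horizon T `*` U_ n) < +oo.
  have := @doleansE n (fun=> 1) (measurable_cst _) (fun=> lee01).
  have one (k : R.-ker Omega ~> S) : \int[P]_w \int[k w]_(p in horizon T `*` U_ n) 1 =
      \int[P]_w k w (horizon T `*` U_ n).
    by apply: eq_integral => w _; rewrite integral_cst// mul1e.
  rewrite !one.
  by move=> <-.
have allb : {ae P, forall w, forall K, nu w (cut (H K) w) = nu' w (cut (H K) w)}.
  exact: ae_foralln.
have fa := fin_ae (fin n); have fa' := fin_ae fin'.
move: allb fa fa'; apply: filterS3 => w bw fw fw'.
have [K [HK1 HK2]] : exists K : nat, nu w (horizon T `*` U_ n) <= K%:R%:E /\ nu' w (horizon T `*` U_ n) <= K%:R%:E.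
  have aux (x : \bar R) : 0 <= x -> x < +oo -> exists K : nat, x <= K%:R%:E.
    case: x => [r r0 _|//|//]; exists (Num.truncn r).+1.
    by rewrite lee_fin ltW// truncnS_gt.
  have [K1 h1] := aux _ (measure_ge0 _ _) fw; have [K2 h2] := aux _ (measure_ge0 _ _) fw'.
  exists (maxn K1 K2); split.
    by rewrite (le_trans h1)// lee_fin ler_nat leq_maxl.
  by rewrite (le_trans h2)// lee_fin ler_nat leq_maxr.
have cutE : cut E w = cut (H K) w.
  apply/seteqP; split=> p /=; last by move=> [[]].
  move=> Ep; have [hp Up] := EU _ Ep; split; first split=> //=.
    rewrite (cumE nu mE EU)//; apply: le_trans HK1; apply: le_measure; rewrite ?inE//.
      by apply: measurableI; [exact: measurable_cut|exact: measurable_time_le].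
    by move=> q [/EU].
  rewrite /= (cumE nu' mE EU)//; apply: le_trans HK2; apply: le_measure; rewrite ?inE//.
    by apply: measurableI; [exact: measurable_cut|exact: measurable_time_le].
  by move=> q [/EU].
by rewrite cutE.
Qed.

(** The masses of each predictable set agree almost surely; applied to the
    countably many deterministic rectangles of a determining class this
    identifies the two measures simultaneously on all Borel sets. *)
Lemma predictable_random_measure_unique :
  {ae P, forall w, forall C, measurable C -> nu w C = nu' w C}.
Proof.
have [C_ [mC_ C_eq]] := countable_measure_determining homeoU.
pose E k n : set PS := [set z | horizon T z.1.2 /\ C_ k (z.1.2, z.2)] `&` slab T (U_ n).
have mE k n : measurable (E k n).
  apply: measurableI; first exact: measurable_deterministic.
  by apply: (measurable_slab usual T0); exact: mU.
have EU k n : E k n `<=` slab T (U_ n) by move=> z [].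
have masses : {ae P, forall w, forall k n, nu w (cut (E k n) w) = nu' w (cut (E k n) w)}.
  by apply: ae_foralln => k; apply: ae_foralln => n; exact: predictable_set_masses_eq.
have finn : {ae P, forall w, forall n, nu w (horizon T `*` U_ n) < +oo}.
  by apply: ae_foralln => n; exact: fin_ae.
move: masses finn; apply: filterS2 => w mw fw.
have mD n := measurable_marks T (mU n).
have eqn n (C : set S) : measurable C -> nu w (C `&` (horizon T `*` U_ n)) = nu' w (C `&` (horizon T `*` U_ n)).
  move=> mC; apply: (C_eq (mrestr (nu w) (mD n)) (mrestr (nu' w) (mD n))) => //.
    by rewrite /= /mrestr setTI.
  move=> k; have := mw k n; rewrite (_ : cut (E k n) w = C_ k `&` (horizon T `*` U_ n))//.
  apply/seteqP; split=> -[r u] /=; first by move=> [[? ?] [? ?]].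
  by move=> [? [? ?]].
move=> C mC.
have lim (k : R.-ker Omega ~> S) : carried_by (horizon T) k ->
    k w (C `&` (horizon T `*` U_ n)) @[n --> \oo] --> k w C.
  move=> ck.
  have -> : k w C = k w (\bigcup_n (C `&` (horizon T `*` U_ n))).
    rewrite -setI_bigcupr.
    have -> : \bigcup_n (horizon T `*` U_ n) = horizon T `*` setT.
      apply/seteqP; split=> -[r u] /=; first by move=> [n _ [? ?]].
      by move=> [hr _]; have : (\bigcup_n U_ n) u by [rewrite bigU]; move=> [n _ Un]; exists n.
    have mh : measurable (horizon T `*` setT : set S) by exact: (measurable_marks T measurableT).
    apply/eqP; rewrite eq_le; apply/andP; split; last first.
      by apply: le_measure; rewrite ?inE//; exact: measurableI.
    have -> : k w C = k w (C `&` (horizon T `*` setT)) + k w (C `\` (horizon T `*` setT)).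
      by rewrite addeC -measureDI.
    rewrite [X in _ + X](_ : _ = 0) ?adde0//; apply/eqP; rewrite eq_le measure_ge0 andbT.
    rewrite -(ck w); apply: le_measure; rewrite ?inE.
    - exact: measurableD.
    - exact: measurableC.
    - by move=> p [].
  apply: nondecreasing_cvg_mu.
  - by move=> n; exact: measurableI.
  - by apply: bigcupT_measurable => n; exact: measurableI.
  - move=> n m nm; apply/subsetPset => -[r u] [Cp [hr /= Un]]; split=> //; split=> //=.
    exact: ndU nm _ Un.
rewrite -(cvg_lim _ (lim nu car))// -(cvg_lim _ (lim nu' car'))//.
by congr (limn _); apply/funext => n; exact: eqn.
Qed.
End unique.
End uniqueness.

(** * Predictability of the quadratic variation of the integrator *)

Lemma ae_null_set d (Omega : measurableType d) (R : realType)
    (P : {measure set Omega -> \bar R}) (prop : set Omega) : {ae P, forall w, prop w} ->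
  exists N, [/\ measurable N, P N = 0 & forall w, ~ N w -> prop w].
Proof.
move=> [N [mN N0 sN]]; exists N; split=> // w nN.
by apply: contrapT => np; exact/nN/sN.
Qed.

Section regularised_kernel.
Context (R : realType) d d' (Omega : measurableType d) (S : measurableType d').
Context (k : R.-ker Omega ~> S) (D : set S) (mD : measurable D).
Context (N : set Omega) (mN : measurable N).

(** Set to zero on an exceptional event and restricted to [D] elsewhere:
    almost sure properties of the kernel become properties at every scenario. *)
Definition regularised of measurable N := fun w : Omega =>
  (if w \in N then (mzero : {measure set S -> \bar R})
  else (mrestr (k w) mD : {measure set S -> \bar R})).

Lemma regularised_out w C : ~ N w -> regularised mN w C = k w (C `&` D).
Proof. by move=> nN; rewrite /regularised memNset. Qed.

Lemma regularised_in w C : N w -> regularised mN w C = 0.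
Proof. by move=> wN; rewrite /regularised mem_set. Qed.

Let measurable_regularised C : measurable C -> measurable_fun setT (regularised mN ^~ C).
Proof.
move=> mC; rewrite (_ : regularised mN ^~ C = (fun w => k w (C `&` D)) \_ (~` N)).
  apply/(measurable_restrictT _ (measurableC mN)); apply: measurable_funTS.
  by apply: measurable_kernel; exact: measurableI.
apply/funext => w; rewrite patchE; case: ifPn => [/set_mem nN|].
  exact: regularised_out.
by move/negP => h; apply: regularised_in; apply: contrapT => nN; apply: h; exact/mem_set.
Qed.

HB.instance Definition _ := isKernel.Build _ _ Omega S R (regularised mN) measurable_regularised.
End regularised_kernel.

(** Otherwise the diagonal of the form would vanish on a dense sequence, hence
    everywhere, and with it the norm. *)
Lemma diagonal_positive (R : realType) (X : normedModType R) (x_ : nat -> dual X) (L : contlin (dual X) X) :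
  dense_seq x_ -> (forall x : dual X, (0 <= x (L x))%R) ->
  (forall x1 x2 : dual X, x2 (L x1) = x1 (L x2)) -> `|L|%R = 1%R ->
  exists n, (0 < x_ n (L (x_ n)))%R.
Proof.
move=> dx Lpos Lsym L1; apply: contrapT => /forallNP np.
have PS0 : positive_symmetric (contlin_comp (to_bidual X) L).
  by split=> [a|a b]; [exact: Lpos|exact: Lsym].
have diag a : (contlin_comp (to_bidual X) L a a <= 0)%R.
  apply: bilinear_le_approx => e e0; have [n an] := dx a e e0.
  by exists (x_ n), (x_ n); split=> //; have /negP := np n; rewrite -leNgt.
have [v_ [v1 dv]] : exists v_ : nat -> dual X, (forall n, `|v_ n| <= 1)%R /\
    forall v (e : R), (`|v| <= 1)%R -> (0 < e)%R -> exists n, (`|v - v_ n| < e)%R.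
  by apply: ball_dense_seq; exists x_.
have := norm_le_dense_diag dv PS0 (fun n => diag (v_ n)).
by rewrite norm_to_bidual L1 ler10.
Qed.

Section predictability.
Context (R : realType) (d : measure_display) (Omega : measurableType d).
Context (P : probability Omega R) (F : R -> set (set Omega)) (T : R).
Context (U : ptopologicalType).
Hypothesis usual : usual_conditions P F.
Hypothesis T0 : (0 < T)%R.
Local Notation PT := (g_sigma_algebraType (predictable_rect F (horizon T))).
Local Notation PS := (PT * borelType U)%type.
Local Notation S := (R * borelType U)%type.

Context (X : normedModType R) (x_ : nat -> dual X).
Hypothesis dx : dense_seq x_.
Context (Q : Omega * R * U -> contlin (dual X) X).
Hypothesis mQ : forall x1 x2 : dual X, measurable_fun (slab T setT : set PS) (fun z => x2 (Q z x1) : R).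
Context (zeta : Omega -> {measure set S -> \bar R}).
Hypothesis fin : forall w, zeta w setT < +oo.
Hypothesis car : forall w, zeta w (~` (horizon T `*` setT)) = 0.
Hypothesis good : forall w, {ae zeta w, forall p,
  [/\ forall x : dual X, (0 <= x (Q (w, p.1, p.2) x))%R,
      forall x1 x2 : dual X, x2 (Q (w, p.1, p.2) x1) = x1 (Q (w, p.1, p.2) x2) &
      `|Q (w, p.1, p.2)|%R = 1%R]}.
Context (U_ : (set U)^nat).
Hypothesis ndU : {homo U_ : n m / (n <= m)%N >-> n `<=` m}.
Hypothesis bigU : \bigcup_n U_ n = setT.
Hypothesis mU : forall n, measurable (U_ n : set (borelType U)).
Hypothesis version : forall (x : dual X) n (B : set U), measurable (B : set (borelType U)) ->
  B `<=` U_ n -> exists V : R -> Omega -> R,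
  [/\ predictable_process F (horizon T) (fun t w => (V t w)%:E),
      {ae P, forall w, cadlag (@halfline R) (V ^~ w)} &
      forall t, horizon T t -> {ae P, forall w, (V t w)%:E =
        \int[zeta w]_(p in `[0%R, t]%classic `*` B) (x (Q (w, p.1, p.2) x))%:E}].

Let weight n (z : PS) : R :=
  (if (0 <= z.1.2 <= T)%R then Num.min (`|x_ n| ^+ 2) (Num.max 0 (x_ n (Q z (x_ n)))) else 0)%R.

Let weight_ge0 n z : (0 <= weight n z)%R.
Proof. by rewrite /weight; case: ifP => // _; rewrite le_min exprn_ge0//= le_max lexx. Qed.

Let weight_le n z : (weight n z <= `|x_ n| ^+ 2)%R.
Proof. by rewrite /weight; case: ifP => [_|_]; rewrite ?ge_min ?lexx// exprn_ge0. Qed.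

Let measurable_weight n : measurable_fun setT (weight n).
Proof.
have mslab := measurable_slab usual T0 (@measurableT _ (borelType U)).
rewrite (_ : weight n = (fun z : PS => Num.min (`|x_ n| ^+ 2) (Num.max 0 (x_ n (Q z (x_ n)))))%R
  \_ (slab T setT)).
  apply/(measurable_restrictT _ mslab).
  apply: measurable_minr; first exact: measurable_cst.
  by apply: measurable_maxr; [exact: measurable_cst|exact: mQ].
apply/funext => z; rewrite patchE /weight.
case: ifPn => hz; first by rewrite mem_set.
by rewrite memNset// => -[/= h]; rewrite h in hz.
Qed.

Let weight_good n w p : horizon T p.1 -> [/\ forall x : dual X, (0 <= x (Q (w, p.1, p.2) x))%R,
      forall x1 x2 : dual X, x2 (Q (w, p.1, p.2) x1) = x1 (Q (w, p.1, p.2) x2) &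
      `|Q (w, p.1, p.2)|%R = 1%R] ->
  weight n (w, p.1, p.2) = x_ n (Q (w, p.1, p.2) (x_ n)).
Proof.
move=> hp [Q0 _ Q1]; rewrite /weight /= ifT//; rewrite (max_idPr _) ?Q0//.
apply/min_idPr; rewrite (le_trans (ler_norm _))//.
rewrite (le_trans (dual_norm_le _ _))// expr2 ler_wpM2l//.
by rewrite (le_trans (op_normP _ _))// -[op_norm _]/(`|Q (w, p.1, p.2)|%R) Q1 mul1r.
Qed.

Let msec n w : measurable_fun setT (fun p : S => weight n (w, p.1, p.2)).
Proof.
by apply: (measurableT_comp (measurable_weight n)); exact: (measurable_predSpace_section usual).
Qed.

Let ae_horizon w : {ae zeta w, forall p, horizon T p.1}.
Proof.
exists (~` (horizon T `*` setT)); split; last by move=> p /= hp [].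
- apply: measurableC; exact: (measurable_marks T measurableT).
- exact: car.
Qed.

(** The operator norm being one, the diagonal form of [Q] is positive at some
    point of a dense sequence; the weights built from these diagonal values are
    densities of the brackets of [M], which are predictable. *)
Lemma predictable_quadratic_variation (W : PS -> \bar R) :
  measurable_fun ([set z | horizon T z.1.2] : set PS) W -> (forall z, 0 <= W z) ->
  predictable_process F (horizon T)
   (fun t w => \int[zeta w]_(p in `[0%R, t]%classic `*` setT) W (w, p.1, p.2)).
Proof.
apply: (@predictable_of_weights _ _ _ P F T U usual T0 zeta U_ weight) => //.
- move=> n w; apply: (@le_lt_trans _ _ (\int[zeta w]_p (`|x_ n| ^+ 2)%:E)).
    apply: ge0_le_integral => //.
    + by move=> p _; rewrite lee_fin.
    + by apply/measurable_EFinP; exact: msec.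
    + by move=> p _; rewrite lee_fin.
  rewrite integral_cst//= -ge0_fin_numE; last by rewrite mule_ge0// lee_fin exprn_ge0.
  by rewrite fin_numM// ge0_fin_numE.
- move=> w; move: (good w) (ae_horizon w); apply: (@filterS2 _ _ (ae_filter_ringOfSetsType (zeta w))) => p Qp hp.
  have [Qpos Qsym Q1] := Qp.
  have [n xn] := diagonal_positive dx Qpos Qsym Q1.
  by exists n; rewrite weight_good.
- move=> n k B mB BU.
  have [V [pV cV VE]] := version (x_ n) mB BU.
  have mD : measurable [set p : S | B p.2].
    by rewrite -[X in measurable X]setTI; exact: measurable_snd.
  pose m w : {measure set S -> \bar R} := density (zeta w) (msec n w) (fun p => weight_ge0 n (w, p.1, p.2)).
  have mfin w : m w setT < +oo.
    rewrite /m/= /density; apply: (@le_lt_trans _ _ (\int[zeta w]_p (`|x_ n| ^+ 2)%:E)).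
      apply: ge0_le_integral => //.
      + by move=> p _; rewrite lee_fin.
      + by apply/measurable_EFinP; exact: msec.
      + by move=> p _; rewrite lee_fin.
    rewrite integral_cst//= -ge0_fin_numE; last by rewrite mule_ge0// lee_fin exprn_ge0.
    by rewrite fin_numM// ge0_fin_numE.
  have Vm t : horizon T t -> {ae P, forall w, (V t w)%:E = mass_upto (m w) [set p | B p.2] t}; last first.
    exact: (@predictable_of_version _ _ _ P F T U usual T0 m [set p | B p.2] V mD mfin pV cV Vm).
  move=> ht; have := VE t ht; apply: filterS => w ->.
  rewrite /mass_upto /m/= /density.
  rewrite (integral_mkcond (`[0%R, t]%classic `*` B : set S)) (integral_mkcond (_ `&` _)).
  have mI : measurable (`[0%R, t]%classic `*` B : set S).
    by apply: measurableX => //; exact: measurable_itv.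
  apply: ae_eq_integral => //.
  - apply/(measurable_restrictT _ mI); apply/measurable_EFinP.
    apply: (measurable_comp (F := slab T setT : set PS) _ _ (mQ (x_ n) (x_ n))).
    + exact: (measurable_slab usual T0).
    + move=> _ [p [/= pt _] <-]; split=> //=; move: pt; rewrite in_itv/= => /andP[p0 pt].
      by rewrite /horizon/= p0 (le_trans pt)//; case/andP: ht.
    + by apply: measurable_funTS; exact: (measurable_predSpace_section usual).
  - have mBt : measurable ([set p | B p.2] `&` [set p : S | (p.1 <= t)%R]).
      by apply: measurableI => //; exact: measurable_time_le.
    apply/(measurable_restrictT _ mBt).
    by apply: measurable_funTS; apply/measurable_EFinP; exact: msec.
  move: (good w) (ae_horizon w); apply: (@filterS2 _ _ (ae_filter_ringOfSetsType (zeta w))) => p Qp hp _.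
  rewrite !patchE; have := hp => /andP[p0 _].
  have [[Bp pt]|np] := pselect (B p.2 /\ (p.1 <= t)%R).
    by rewrite !mem_set//= ?in_itv/= ?p0 ?pt// (weight_good _ hp).
  rewrite (@memNset _ (`[0%R, t] `*` B)) ?(@memNset _ (_ `&` _))//.
  by case; rewrite /= in_itv/= => /andP[_ pt] Bp; exact: np.
Qed.
End predictability.

(** * Second moments of martingale increments *)

Section square_integrable.
Context (R : realType) d (Omega : measurableType d) (P : probability Omega R).
Implicit Types f g : Omega -> R.
Local Open Scope ring_scope.

(** Square integrable random variables and their inner product are handled as
    functions, without passing to classes, because the integrators are only
    linear almost surely for each pair of arguments. *)
Definition sqint f := measurable_fun setT f /\ (\int[P]_w ((f w) ^+ 2)%:E < +oo)%E.

Lemma measurable_sqr f : measurable_fun setT f ->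
  measurable_fun setT (fun w => ((f w) ^+ 2)%:E : \bar R).
Proof. by move=> mf; apply/measurable_EFinP; exact: measurable_funX. Qed.

Lemma sqint_dominated f g h : measurable_fun setT f -> sqint g -> sqint h ->
  (forall w, `|f w| <= 2 * g w ^+ 2 + 2 * h w ^+ 2) -> P.-integrable setT (EFin \o f).
Proof.
move=> mf [mg g2] [mh h2] fgh; apply/integrableP; split; first exact/measurable_EFinP.
apply: (@le_lt_trans _ _ (2%:E * \int[P]_w ((g w) ^+ 2)%:E + 2%:E * \int[P]_w ((h w) ^+ 2)%:E)%E).
  rewrite -!ge0_integralZl_EFin//; try exact: measurable_sqr; try by move=> w _; rewrite lee_fin sqr_ge0.
  rewrite -ge0_integralD//; last 4 first.
  - by move=> w _; rewrite -EFinM lee_fin mulr_ge0// sqr_ge0.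
  - by apply/measurable_EFinP; apply: measurable_funM => //; exact: measurable_funX.
  - by move=> w _; rewrite -EFinM lee_fin mulr_ge0// sqr_ge0.
  - by apply/measurable_EFinP; apply: measurable_funM => //; exact: measurable_funX.
  apply: ge0_le_integral => //.
  - by apply/measurable_EFinP; apply: measurableT_comp.
  - apply/measurable_EFinP; apply: measurable_funD; apply: measurable_funM => //; exact: measurable_funX.
  - by move=> w _; rewrite /= -!EFinM -EFinD lee_fin.
by rewrite lte_add_pinfty//; apply: lte_mul_pinfty => //; rewrite lee_fin.
Qed.

Lemma sqintP f : measurable_fun setT f -> P.-integrable setT (EFin \o (fun w => f w ^+ 2)) -> sqint f.
Proof.
move=> mf /integrableP[_]; rewrite (eq_integral (fun w => ((f w) ^+ 2)%:E)) => [|w _]; last first.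
  by rewrite /= ger0_norm// sqr_ge0.
by move=> f2; split.
Qed.

Lemma sqint_mul f g : sqint f -> sqint g ->
  P.-integrable setT (EFin \o (fun w => f w * g w)).
Proof.
move=> sf sg; apply: (sqint_dominated _ sf sg); first by apply: measurable_funM; [exact: sf.1|exact: sg.1].
move=> w; rewrite normrM -(real_normK (num_real (f w))) -(real_normK (num_real (g w))).
have := sqr_ge0 (`|f w| - `|g w|); have := sqr_ge0 (`|f w| + `|g w|); lra.
Qed.

Lemma sqintD f g : sqint f -> sqint g -> sqint (fun w => f w + g w).
Proof.
move=> sf sg; have mfg : measurable_fun setT (fun w => f w + g w).
  by apply: measurable_funD; [exact: sf.1|exact: sg.1].
apply: sqintP => //; apply: (sqint_dominated _ sf sg); first exact: measurable_funX.
by move=> w; rewrite ger0_norm ?sqr_ge0//; have := sqr_ge0 (f w - g w); lra.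
Qed.

Lemma sqintZ a f : sqint f -> sqint (fun w => a * f w).
Proof.
move=> [mf f2]; split; first exact: measurable_funM.
rewrite (eq_integral (fun w => ((a ^+ 2)%:E * ((f w) ^+ 2)%:E)%E)) => [|w _]; last by rewrite -EFinM exprMn.
rewrite ge0_integralZl_EFin//; [|by move=> w _; rewrite lee_fin sqr_ge0|exact: measurable_sqr|exact: sqr_ge0].
by apply: lte_mul_pinfty => //; rewrite lee_fin sqr_ge0.
Qed.

Lemma sqintB f g : sqint f -> sqint g -> sqint (fun w => f w - g w).
Proof.
move=> sf sg; have := sqintD sf (sqintZ (-1) sg); congr (sqint _).
by apply/funext => w; rewrite mulN1r.
Qed.

Lemma sqint0 : sqint (fun=> 0).
Proof. by split=> //; rewrite integral0_eq// => w _; rewrite expr0n. Qed.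

Lemma sqint_indic f (H : set Omega) : measurable H -> sqint f -> sqint (fun w => \1_H w * f w).
Proof.
move=> mH sf; have mHf : measurable_fun setT (fun w => \1_H w * f w : R).
  by apply: measurable_funM; [exact: measurable_indic|exact: sf.1].
apply: sqintP => //; apply: (sqint_dominated _ sf sf); first exact: measurable_funX.
move=> w; rewrite ger0_norm ?sqr_ge0// indicE; have := sqr_ge0 (f w).
by case: (w \in H) => /=; rewrite ?mul1r ?mul0r ?expr0n/=; lra.
Qed.

Lemma sqint_sum (I : Type) (r : seq I) (Q : pred I) (f : I -> Omega -> R) :
  (forall i, sqint (f i)) -> sqint (fun w => \sum_(i <- r | Q i) f i w).
Proof.
move=> sf; elim: r => [|i r IH].
  by have := sqint0; congr sqint; apply/funext => w; rewrite big_nil.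
rewrite (_ : (fun w => _) = fun w => if Q i then f i w + \sum_(j <- r | Q j) f j w
  else \sum_(j <- r | Q j) f j w); last by apply/funext => w; rewrite big_cons.
by case: (Q i) => //; exact: sqintD.
Qed.

Definition ip f g : R := \int[P]_w (f w * g w).

Lemma ipC f g : ip f g = ip g f.
Proof. by apply: eq_Rintegral => w _; rewrite mulrC. Qed.

Lemma ip_ge0 f : 0 <= ip f f.
Proof. by apply: Rintegral_ge0 => w _; rewrite -expr2 sqr_ge0. Qed.

Lemma ipDl f1 f2 g : sqint f1 -> sqint f2 -> sqint g ->
  ip (fun w => f1 w + f2 w) g = ip f1 g + ip f2 g.
Proof.
move=> s1 s2 sg; rewrite /ip -RintegralD//; try exact: sqint_mul.
by apply: eq_Rintegral => w _; rewrite mulrDl.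
Qed.

Lemma ipBl f1 f2 g : sqint f1 -> sqint f2 -> sqint g ->
  ip (fun w => f1 w - f2 w) g = ip f1 g - ip f2 g.
Proof.
move=> s1 s2 sg; rewrite /ip -RintegralB//; try exact: sqint_mul.
by apply: eq_Rintegral => w _; rewrite mulrBl.
Qed.

Lemma ipZl a f g : sqint f -> sqint g -> ip (fun w => a * f w) g = a * ip f g.
Proof.
move=> sf sg; rewrite /ip -RintegralZl//; last exact: sqint_mul.
by apply: eq_Rintegral => w _; rewrite mulrA.
Qed.

Lemma ip0l g : ip (fun=> 0) g = 0.
Proof.
rewrite /ip (_ : (fun w => _) = cst 0); last by apply/funext => w; rewrite mul0r.
by rewrite Rintegral_cst// mul0r.
Qed.

Lemma ip_suml (I : Type) (r : seq I) (Q : pred I) (f : I -> Omega -> R) g :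
  (forall i, sqint (f i)) -> sqint g ->
  ip (fun w => \sum_(i <- r | Q i) f i w) g = \sum_(i <- r | Q i) ip (f i) g.
Proof.
move=> sf sg; elim: r => [|i r IH].
  rewrite big_nil -[RHS](ip0l g); congr (ip _ g); apply/funext => w; rewrite big_nil//.
rewrite (_ : (fun w => _) = fun w => if Q i then f i w + \sum_(j <- r | Q j) f j w
  else \sum_(j <- r | Q j) f j w); last by apply/funext => w; rewrite big_cons.
rewrite big_cons; case: (Q i) => //; rewrite ipDl ?IH//; exact: sqint_sum.
Qed.

Lemma ip_ae f f' g g' : {ae P, forall w, f w = f' w} -> {ae P, forall w, g w = g' w} ->
  measurable_fun setT f -> measurable_fun setT f' -> measurable_fun setT g -> measurable_fun setT g' ->
  ip f g = ip f' g'.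
Proof.
move=> ff' gg' mf mf' mg mg'; rewrite /ip /Rintegral; congr fine.
apply: ae_eq_integral => //; try by apply/measurable_EFinP; exact: measurable_funM.
by move: ff' gg'; apply: filterS2 => w -> ->.
Qed.

Lemma EFin_ip f g : sqint f -> sqint g -> (ip f g)%:E = (\int[P]_w (f w * g w)%:E)%E.
Proof.
move=> sf sg; rewrite /ip /Rintegral fineK//; apply: integrable_fin_num => //.
exact: sqint_mul.
Qed.

Lemma L2norm_sqint f : measurable_fun setT f -> (L2norm P f < +oo)%E -> sqint f.
Proof.
move=> mf fL; split=> //; have := poweR_Lnorm P (EFin \o f) (r := 2).
move=> /(_ ltac:(by rewrite pnatr_eq0)).
rewrite (eq_integral (fun w => ((f w) ^+ 2)%:E)) => [<-|w _]; first exact: poweR_lty.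
by rewrite (_ : `|(EFin \o f) w|%E = `|f w|%:E)// poweR_EFin powR_mulrn// real_normK// num_real.
Qed.

Lemma ip_le_L2norm f (e : R) : sqint f -> (L2norm P f <= e%:E)%E -> ip f f <= e ^+ 2.
Proof.
move=> sf fe; have := poweR_Lnorm P (EFin \o f) (r := 2).
move=> /(_ ltac:(by rewrite pnatr_eq0)).
rewrite (eq_integral (fun w => (f w * f w)%:E)) => [|w _]; last first.
  by rewrite (_ : `|(EFin \o f) w|%E = `|f w|%:E)// poweR_EFin powR_mulrn// real_normK ?num_real// expr2.
rewrite -EFin_ip//; move: fe (Lnorm_ge0 P 2%:E (EFin \o f)); rewrite /L2norm.
case: ('N[P]_2%:E [EFin \o f])%E => [r||]; rewrite ?lee_fin//= => re r0.
rewrite powR_mulrn// => -[<-].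
by rewrite lerXn2r// ?nnegrE// (le_trans r0).
Qed.

(** A greedy choice of signs makes the square of the signed sum at least the
    sum of the squares; splitting the signed sum into its two halves loses at
    most a factor four. *)
Lemma exists_large_subsum (I : finType) (e : I -> Omega -> R) : (forall i, sqint (e i)) ->
  exists S : {set I}, \sum_i ip (e i) (e i) <=
    4 * ip (fun w => \sum_(i in S) e i w) (fun w => \sum_(i in S) e i w).
Proof.
move=> se.
have nrmD f g : sqint f -> sqint g -> ip (fun w => f w + g w) (fun w => f w + g w) =
    ip f f + 2 * ip f g + ip g g.
  move=> sf sg; have sfg := sqintD sf sg.
  by rewrite ipDl// (ipC f) (ipC g) !ipDl// (ipC g f); lra.
have nrmB f g : sqint f -> sqint g -> ip (fun w => f w - g w) (fun w => f w - g w) =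
    ip f f - 2 * ip f g + ip g g.
  move=> sf sg; have sfg := sqintB sf sg.
  by rewrite ipBl// (ipC f) (ipC g) !ipBl// (ipC g f); lra.
have [S1 [S2 S12]] : exists S1 S2 : {set I}, \sum_i ip (e i) (e i) <=
    ip (fun w => \sum_(i in S1) e i w - \sum_(i in S2) e i w)
       (fun w => \sum_(i in S1) e i w - \sum_(i in S2) e i w).
  suff H r : uniq r -> exists S1 S2 : {set I}, [/\ {subset S1 <= r}, {subset S2 <= r} &
      \sum_(i <- r) ip (e i) (e i) <=
      ip (fun w => \sum_(i in S1) e i w - \sum_(i in S2) e i w)
         (fun w => \sum_(i in S1) e i w - \sum_(i in S2) e i w)].
    by have [S1 [S2 [_ _ h]]] := H _ (index_enum_uniq I); exists S1, S2.
  elim: r => [_|i r IH /= /andP[ir /IH[S1 [S2 [s1 s2 h]]]]].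
    exists finset.set0, finset.set0; split; try by move=> x; rewrite inE.
    by rewrite big_nil ip_ge0.
  pose D w := \sum_(i in S1) e i w - \sum_(i in S2) e i w.
  have sD : sqint D by apply: sqintB; exact: sqint_sum.
  have iS1 : i \notin S1 by apply: contra ir; exact: s1.
  have iS2 : i \notin S2 by apply: contra ir; exact: s2.
  rewrite big_cons; have [c0|c0] := leP 0 (ip D (e i)).
    exists (i |: S1)%SET, S2; split.
    - by move=> x; rewrite !inE => /predU1P[->|/s1 ->]; rewrite ?eqxx ?orbT.
    - by move=> x /s2; rewrite inE orbC => ->.
    rewrite (_ : (fun w => _ - _) = fun w => D w + e i w); last first.
      by apply/funext => w; rewrite big_setU1//= /D; lra.
    by rewrite nrmD//; move: h; rewrite -/D; lra.
  exists S1, (i |: S2)%SET; split.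
  - by move=> x /s1; rewrite inE orbC => ->.
  - by move=> x; rewrite !inE => /predU1P[->|/s2 ->]; rewrite ?eqxx ?orbT.
  rewrite (_ : (fun w => _ - _) = fun w => D w - e i w); last first.
    by apply/funext => w; rewrite big_setU1//= /D; lra.
  by rewrite nrmB//; move: h; rewrite -/D; lra.
set f := fun w => \sum_(i in S1) e i w in S12; set g := fun w => \sum_(i in S2) e i w in S12.
have sf : sqint f by exact: sqint_sum.
have sg : sqint g by exact: sqint_sum.
have h1 := ip_ge0 (fun w => f w + g w); rewrite nrmD// in h1.
rewrite nrmB// in S12.
have [fg|fg] := leP (ip f f) (ip g g); [exists S2|exists S1]; rewrite -/f -/g; lra.
Qed.

Lemma ip_young f g (a : R) : 0 < a -> sqint f -> sqint g ->
  ip f f <= (1 + a) * ip g g + (1 + a^-1) * ip (fun w => f w - g w) (fun w => f w - g w).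
Proof.
move=> a0 sf sg; set h := fun w => f w - g w; have sh : sqint h by exact: sqintB.
have fE : f = (fun w => g w + h w) by apply/funext => w; rewrite /h addrC subrK.
clearbody h.
have E1 : ip f f = ip g g + 2 * ip g h + ip h h.
  rewrite {1 2}fE ipDl; [|by []|by []|exact: sqintD].
  by rewrite (ipC g) (ipC h) !ipDl// (ipC h g); lra.
have := ip_ge0 (fun w => a * g w - h w).
rewrite ipBl; [|exact: sqintZ|by []|by apply: sqintB => //; exact: sqintZ].
rewrite ![ip _ (fun w => a * g w - h w)]ipC !ipBl//; try exact: sqintZ.
rewrite [ip (fun w => a * g w) (fun w => a * g w)]ipZl//; last exact: sqintZ.
rewrite (ipC g (fun w => a * g w)) (ipC h (fun w => a * g w)) !ipZl// => h0.
rewrite E1 -subr_ge0 (_ : _ - _ = a^-1 * (a * (a * ip g g) - a * ip g h - (a * ip g h - ip h h))).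
  by rewrite mulr_ge0// invr_ge0 ltW.
by field; rewrite gt_eqF.
Qed.

End square_integrable.

Section martingale_increments.
Context (R : realType) (d : measure_display) (Omega : measurableType d).
Context (P : probability Omega R) (F : R -> set (set Omega)).
Hypothesis usual : usual_conditions P F.
Context (J : set R).
Local Open Scope ring_scope.
Hypothesis J0 : forall t, J t -> 0 <= t.
Local Notation FT t := (g_sigma_algebraType (F t)).

Lemma filtration_measurable t A : J t -> F t A -> measurable (A : set (FT t)).
Proof. by move=> Jt FA; rewrite (filtration_measurableE usual)//; exact: J0. Qed.

Lemma measurable_filtration t A : J t -> measurable (A : set (FT t)) -> F t A.
Proof. by move=> Jt; rewrite (filtration_measurableE usual)//; exact: J0. Qed.

Lemma martingale_measurable m t : martingale P F J m -> J t ->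
  measurable_fun setT (m t : FT t -> R).
Proof.
move=> [am _ _] Jt _ B mB; rewrite setTI.
by apply: filtration_measurable => //; exact: am.
Qed.

Lemma martingale_measurable_fun m t : martingale P F J m -> J t -> measurable_fun setT (m t).
Proof. by move=> mm Jt; apply: (adapted_measurable usual (J0 Jt)); exact: martingale_measurable. Qed.

Lemma L2_martingale_sqint m t : L2_martingale P F J m -> J t -> sqint P (m t).
Proof.
move=> [mm _ mL _] Jt; apply: L2norm_sqint; last exact: mL.
exact: martingale_measurable_fun.
Qed.

(** The martingale property is tested against events of the past; simple
    functions extend it to square integrable variables of the past. *)
Lemma martingale_orthogonal m s t (Z : Omega -> R) : martingale P F J m ->
  J s -> J t -> s <= t -> sqint P (m s) -> sqint P (m t) ->
  measurable_fun setT (Z : FT s -> R) -> sqint P Z ->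
  ip P Z (fun w => m t w - m s w) = 0.
Proof.
move=> mm Js Jt st ss sti mZ sZ.
have [_ im mart] := mm.
pose f w := m t w - m s w.
have sf : sqint P f by exact: sqintB.
have f_int : P.-integrable setT (EFin \o f).
  have := integrableB measurableT (im t Jt) (im s Js); apply: eq_integrable => // w _.
have fH H : F s H -> (\int[P]_(w in H) (f w)%:E = 0)%E.
  move=> FH; have mH := filtration_sub usual (J0 Js) FH.
  have iH r : J r -> P.-integrable H (EFin \o m r).
    by move=> Jr; apply: integrableS (im r Jr).
  rewrite (eq_integral (fun w => ((m t w)%:E - (m s w)%:E)%E)) => [|w _]; last by [].
  rewrite integralB_EFin//; [|exact: iH..].
  rewrite (mart s t Js Jt st H FH) subee//.
  by apply: integrable_fin_num => //; exact: iH.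
have mfp : measurable_fun setT ((EFin \o f)^\+)%E by apply: measurable_funepos; apply/measurable_EFinP; exact: sf.1.
have mfn : measurable_fun setT ((EFin \o f)^\-)%E by apply: measurable_funeneg; apply/measurable_EFinP; exact: sf.1.
have sub (g : FT s -> \bar R) : measurable_fun setT g -> measurable_fun setT (g : Omega -> \bar R).
  exact: (adapted_measurable usual (J0 Js)).
have pn (g : FT s -> \bar R) : measurable_fun setT g -> (forall w, 0 <= g w)%E ->
    (\int[P]_w (g w * (EFin \o f)^\+ w) = \int[P]_w (g w * (EFin \o f)^\- w))%E.
  move=> mg g0; apply: (@nonneg_measurable_ind _ (FT s) R (fun g => \int[P]_w (g w * (EFin \o f)^\+ w) =
    \int[P]_w (g w * (EFin \o f)^\- w))%E _ _ _ _ g mg g0).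
  - move=> H mH; have FH : F s H by exact: measurable_filtration.
    have mH' := filtration_sub usual (J0 Js) FH.
    have rw (h : Omega -> \bar R) : (\int[P]_w ((\1_H w)%:E * h w) = \int[P]_(w in H) h w)%E.
      rewrite [RHS]integral_mkcond; apply: eq_integral => w _.
      by rewrite patchE indicE; case: ifP => _; rewrite ?mul1e ?mul0e.
    rewrite !rw; have := fH H FH; rewrite integralE.
    have fin1 : (\int[P]_(x in H) (EFin \o f)^\+ x \is a fin_num)%E.
      have := integrable_pos_fin_num mH' (integrableS measurableT mH' (@subsetT _ _) f_int); exact.
    have fin2 : (\int[P]_(x in H) (EFin \o f)^\- x \is a fin_num)%E.
      have := integrable_neg_fin_num mH' (integrableS measurableT mH' (@subsetT _ _) f_int); exact.
    move=> E0; have {E0} : (\int[P]_(x in H) (EFin \o f)^\+ x - \int[P]_(x in H) (EFin \o f)^\- x = 0)%E := E0.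
    rewrite -(fineK fin1) -(fineK fin2) -EFinB => -[] /eqP.
    by rewrite subr_eq0 => /eqP ->.
  - move=> g1 g2 mg1 mg2 g10 g20 P1 P2.
    have aux (h : Omega -> \bar R) : (forall w, 0 <= h w)%E -> measurable_fun setT h ->
        (\int[P]_w ((g1 w + g2 w) * h w) = \int[P]_w (g1 w * h w) + \int[P]_w (g2 w * h w))%E.
      move=> h0 mh; rewrite -(ge0_integralD P measurableT (fun w _ => mule_ge0 (g10 w) (h0 w))
        (emeasurable_funM (sub _ mg1) mh) (fun w _ => mule_ge0 (g20 w) (h0 w))
        (emeasurable_funM (sub _ mg2) mh)).
      by apply: eq_integral => w _; rewrite ge0_muleDl.
    by rewrite !aux// P1 P2.
  - move=> c g1 c0 mg1 g10 P1.
    have aux (h : Omega -> \bar R) : (forall w, 0 <= h w)%E -> measurable_fun setT h ->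
        (\int[P]_w (c%:E * g1 w * h w) = c%:E * \int[P]_w (g1 w * h w))%E.
      move=> h0 mh; rewrite -(ge0_integralZl_EFin P measurableT (fun w _ => mule_ge0 (g10 w) (h0 w))
        (emeasurable_funM (sub _ mg1) mh) c0).
      by apply: eq_integral => w _; rewrite muleA.
    by rewrite !aux// P1.
  - move=> g_ g1 mg_ g_0 mg1 nd cvg Pg.
    have aux (h : Omega -> \bar R) : (forall w, 0 <= h w)%E -> (forall w, h w \is a fin_num) ->
        measurable_fun setT h -> (\int[P]_w (g_ n w * h w) @[n --> \oo] --> \int[P]_w (g1 w * h w))%E.
      move=> h0 hfin mh; rewrite (_ : (\int[P]_w (g1 w * h w))%E = (\int[P]_w limn (fun n => g_ n w * h w))%E).
        apply: cvg_monotone_convergence => //.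
        + by move=> n; apply: emeasurable_funM => //; exact: sub.
        + by move=> n w _; exact: mule_ge0.
        + by move=> w _ n k nk; apply: lee_wpmul2r => //; exact: nd.
      apply: eq_integral => w _; apply/esym/cvg_lim => //.
      by apply: cvgeZr => //; exact: cvg.
    have finp w : ((EFin \o f)^\+ w \is a fin_num)%E by rewrite funeposE -EFin_max.
    have finn w : ((EFin \o f)^\- w \is a fin_num)%E by rewrite funenegE -EFinN -EFin_max.
    rewrite -(cvg_lim _ (aux _ (fun w => funepos_ge0 _ w) finp mfp))//.
    rewrite -(cvg_lim _ (aux _ (fun w => funeneg_ge0 _ w) finn mfn))//.
    by congr (limn _); apply/funext => n; exact: Pg.
have pos (g : FT s -> R) : measurable_fun setT g -> (forall w, 0 <= g w) -> sqint P g -> ip P g f = 0.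
  move=> mg g0 sg; apply: EFin_inj; rewrite EFin_ip//.
  rewrite integralE.
  have mg' : measurable_fun setT (fun w : FT s => (g w)%:E) by exact/measurable_EFinP.
  have := pn (fun w => (g w)%:E) mg' (fun w => g0 w).
  have -> : (fun w => (g w * f w)%:E)^\+%E = (fun w => (g w)%:E * (EFin \o f)^\+ w)%E.
    apply/funext => w; rewrite !funeposE/= -!EFin_max -EFinM; congr EFin.
    by rewrite -[in LHS](mulr0 (g w)) -maxr_pMr.
  have -> : (fun w => (g w * f w)%:E)^\-%E = (fun w => (g w)%:E * (EFin \o f)^\- w)%E.
    apply/funext => w; rewrite !funenegE/= -!EFin_max -EFinM; congr EFin.
    by rewrite -mulrN -[in LHS](mulr0 (g w)) -maxr_pMr.
  move=> ->; rewrite subee//.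
  rewrite (_ : (fun w => (g w)%:E * (EFin \o f)^\- w)%E = (EFin \o (fun w => (g w * f w)%R))^\-%E).
    exact: (integrable_neg_fin_num measurableT (sqint_mul sg sf)).
  apply/funext => w; rewrite !funenegE/= -!EFin_max -EFinM; congr EFin.
  by rewrite -mulrN -[in RHS](mulr0 (g w)) -maxr_pMr.
have part (g : FT s -> R) : measurable_fun setT g -> sqint P g -> sqint P (fun w => Num.max (g w) 0).
  move=> mg sg; have mx : measurable_fun setT (fun w : Omega => Num.max (g w) 0).
    by apply: measurable_maxr => //; exact: sg.1.
  apply: sqintP => //; apply: (sqint_dominated _ sg sg); first exact: measurable_funX.
  move=> w; rewrite ger0_norm ?sqr_ge0//; have := sqr_ge0 (g w).
  by rewrite /Num.max; case: ifP => _; rewrite ?expr0n/=; lra.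
have mN : measurable_fun setT (fun w : FT s => - Z w) by exact: measurableT_comp.
have sN : sqint P (fun w => - Z w).
  by have := sqintZ (-1) sZ; congr sqint; apply/funext => w; rewrite mulN1r.
have -> : ip P Z f = ip P (fun w => Num.max (Z w) 0 - Num.max (- Z w) 0) f.
  apply: eq_Rintegral => w _; congr (_ * _).
  by rewrite /Num.max; case: ltP => h1; case: ltP => h2; lra.
rewrite ipBl//; [|exact: part|exact: part].
rewrite !pos ?subr0//.
- by apply: measurable_maxr.
- by move=> w; rewrite le_max lexx orbT.
- exact: part.
- by apply: measurable_maxr.
- by move=> w; rewrite le_max lexx orbT.
- exact: part.
Qed.

Definition incr (m : R -> Omega -> R) (H : set Omega) (s t : R) : Omega -> R :=
  fun w => \1_H w * (m t w - m s w).

Lemma sqint_incr m H s t : measurable H -> sqint P (m s) -> sqint P (m t) ->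
  sqint P (incr m H s t).
Proof. by move=> mH ss st; apply: sqint_indic => //; exact: sqintB. Qed.

Lemma ip_incr m1 m2 H s t : L2_martingale P F J m1 -> L2_martingale P F J m2 ->
  J s -> J t -> s <= t -> F s H ->
  ip P (incr m1 H s t) (incr m2 H s t) =
  \int[P]_(w in H) (m1 t w * m2 t w) - \int[P]_(w in H) (m1 s w * m2 s w).
Proof.
move=> L1 L2 Js Jt st FH.
have mH := filtration_sub usual (J0 Js) FH.
have [mm1 _ _ _] := L1; have [mm2 _ _ _] := L2.
have s1 r : J r -> sqint P (m1 r) by exact: L2_martingale_sqint.
have s2 r : J r -> sqint P (m2 r) by exact: L2_martingale_sqint.
have si f : sqint P f -> sqint P (fun w => \1_H w * f w) by exact: sqint_indic.
have mI : measurable_fun setT (\1_H : FT s -> R).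
  by apply: measurable_indic; exact: filtration_measurable.
have o1 : ip P (fun w => \1_H w * m1 s w) (fun w => m2 t w - m2 s w) = 0.
  apply: martingale_orthogonal => //; [exact: s2|exact: s2| |exact/si/s1].
  by apply: measurable_funM => //; exact: martingale_measurable.
have o2 : ip P (fun w => \1_H w * m2 s w) (fun w => m1 t w - m1 s w) = 0.
  apply: martingale_orthogonal => //; [exact: s1|exact: s1| |exact/si/s2].
  by apply: measurable_funM => //; exact: martingale_measurable.
have setH f g : sqint P f -> sqint P g ->
    \int[P]_(w in H) (f w * g w) = ip P (fun w => \1_H w * f w) g.
  move=> sf sg; rewrite Rintegral_mkcond; apply: eq_Rintegral => w _.
  by rewrite patchE indicE; case: ifP => _; rewrite ?mul1r ?mul0r.
have E : ip P (incr m1 H s t) (incr m2 H s t) = ip P (fun w => \1_H w * m1 t w - \1_H w * m1 s w)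
    (fun w => m2 t w - m2 s w).
  apply: eq_Rintegral => w _; rewrite /incr indicE.
  by case: (w \in H) => /=; ring.
rewrite E ipBl; [|exact/si/s1|exact/si/s1|by apply: sqintB; exact: s2].
rewrite o1 subr0 ipC ipBl; [|exact: s2|exact: s2|exact/si/s1].
rewrite !setH; [|exact: s1|exact: s2|exact: s1|exact: s2].
rewrite [ip P (m2 t) _]ipC; congr (_ - _).
have : ip P (m2 s) (fun w => \1_H w * (m1 t w - m1 s w)) = 0.
  by rewrite -[RHS]o2; apply: eq_Rintegral => w _; rewrite mulrCA mulrA.
rewrite (_ : (fun w => \1_H w * (m1 t w - m1 s w)) = fun w => \1_H w * m1 t w - \1_H w * m1 s w); last first.
  by apply/funext => w; rewrite mulrBr.
rewrite ipC ipBl; [|exact/si/s1|exact/si/s1|exact: s2].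
by move=> /eqP; rewrite subr_eq0 ipC => /eqP.
Qed.

(** The martingale defining the covariation turns products of increments over
    a past event into increments of the covariation; this is the form in which
    all brackets are used below. *)
Lemma covariation_incr m1 m2 V H s t : L2_martingale P F J m1 -> L2_martingale P F J m2 ->
  covariation P F J m1 m2 V -> J s -> J t -> s <= t -> F s H ->
  [/\ P.-integrable setT (EFin \o V s), P.-integrable setT (EFin \o V t) &
  ip P (incr m1 H s t) (incr m2 H s t) = \int[P]_(w in H) V t w - \int[P]_(w in H) V s w].
Proof.
move=> L1 L2 [_ _ _ [aV iV mart]] Js Jt st FH.
have mH := filtration_sub usual (J0 Js) FH.
have i12 r : J r -> P.-integrable setT (EFin \o (fun w => m1 r w * m2 r w)).
  by move=> Jr; apply: sqint_mul; exact: L2_martingale_sqint.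
have iVV r : J r -> P.-integrable setT (EFin \o V r).
  move=> Jr; have := integrableB measurableT (i12 r Jr) (iV r Jr); apply: eq_integrable => // w _.
  by rewrite /= -EFinB; congr EFin; ring.
split; [exact: iVV|exact: iVV|].
rewrite (ip_incr L1 L2 Js Jt st FH).
have := congr1 fine (mart s t Js Jt st H FH); rewrite -/(Rintegral _ _ _) -[X in _ = X]/(Rintegral _ _ _).
have iH (g : Omega -> R) : P.-integrable setT (EFin \o g) -> P.-integrable H (EFin \o g).
  exact: integrableS.
rewrite !RintegralB//; [lra|apply: iH..].
- exact: i12.
- exact: iVV.
- exact: i12.
- exact: iVV.
Qed.

Lemma covariation_of_incr m1 m2 V : L2_martingale P F J m1 -> L2_martingale P F J m2 ->
  (forall t, J t -> forall B, measurable B -> F t (V t @^-1` B)) ->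
  (forall t, J t -> P.-integrable setT (EFin \o V t)) ->
  (forall s t H, J s -> J t -> s <= t -> F s H ->
    ip P (incr m1 H s t) (incr m2 H s t) = \int[P]_(w in H) V t w - \int[P]_(w in H) V s w) ->
  martingale P F J (fun t w => m1 t w * m2 t w - V t w).
Proof.
move=> L1 L2 aV iV eqV; have [mm1 _ _ _] := L1; have [mm2 _ _ _] := L2.
have i12 r : J r -> P.-integrable setT (EFin \o (fun w => m1 r w * m2 r w)).
  by move=> Jr; apply: sqint_mul; exact: L2_martingale_sqint.
have i12V r : J r -> P.-integrable setT (EFin \o (fun w => m1 r w * m2 r w - V r w)).
  move=> Jr; have := integrableB measurableT (i12 r Jr) (iV r Jr); apply: eq_integrable => // w _.
split=> //.
- move=> t Jt B mB; apply: measurable_filtration => //.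
  have mV : measurable_fun setT (V t : FT t -> R).
    by move=> _ C mC; rewrite setTI; apply: filtration_measurable => //; exact: aV.
  have mm : measurable_fun setT (fun w : FT t => m1 t w * m2 t w - V t w).
    apply: measurable_funB => //; apply: measurable_funM; exact: martingale_measurable.
  by rewrite -[X in measurable X]setTI; exact: mm.
- move=> s t Js Jt st H FH; have mH := filtration_sub usual (J0 Js) FH.
  have iH (g : Omega -> R) : P.-integrable setT (EFin \o g) -> P.-integrable H (EFin \o g).
    exact: integrableS.
  have fin r : J r -> (\int[P]_(w in H) (m1 r w * m2 r w - V r w)%:E \is a fin_num)%E.
    by move=> Jr; apply: integrable_fin_num => //; exact/iH/i12V.
  rewrite -(fineK (fin t Jt)) -(fineK (fin s Js)); congr EFin.
  rewrite -/(Rintegral P H (fun w => m1 t w * m2 t w - V t w)) -/(Rintegral P H (fun w => m1 s w * m2 s w - V s w)).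
  rewrite !RintegralB//; [|apply: iH..]; [|exact: i12|exact: iV|exact: i12|exact: iV].
  have := eqV s t H Js Jt st FH; rewrite (ip_incr L1 L2 Js Jt st FH); lra.
Qed.

End martingale_increments.

(** * Simple integrands and the distance of integrands *)

Section simple_families.
Context (R : realType) (d : measure_display) (Omega : measurableType d).
Context (P : probability Omega R) (F : R -> set (set Omega)) (T : R).
Context (U : ptopologicalType) (rA : set (set (borelType U))).
Context (X Y : normedModType R) (M : R -> set U -> dual X -> Omega -> R).
Hypothesis usual : usual_conditions P F.
Hypothesis ringA : setring rA.
Local Open Scope ring_scope.

Lemma telescope_cells (V : zmodType) (phi : R -> V) (pts : seq R) (s t : R) :
  sorted <%R pts -> s \in pts -> t \in pts -> s < t ->
  \sum_(c < (size pts).-1 | (index s pts <= c < index t pts)%N)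
    (phi pts`_c.+1 - phi pts`_c) = phi t - phi s.
Proof.
move=> sp sin tin st.
have ile : (index s pts <= index t pts)%N.
  rewrite leqNgt; apply/negP => ti.
  have := sorted_ltn_nth lt_trans 0 sp (index t pts) (index s pts).
  by rewrite !inE !index_mem => /(_ tin sin ti); rewrite !nth_index// ltNge (ltW st).
have tn : (index t pts <= (size pts).-1)%N by move: tin; rewrite -index_mem; case: (size pts).
rewrite -(big_mkord (fun c => (index s pts <= c < index t pts)%N)
  (fun c => phi pts`_c.+1 - phi pts`_c)).
rewrite -[in RHS](nth_index 0 sin) -[in RHS](nth_index 0 tin).
rewrite -(telescope_sumr (fun c => phi pts`_c) ile).
rewrite (big_nat_widen _ _ _ _ _ tn) [RHS](big_nat_widenl _ 0)//.
by apply: eq_bigl => c; rewrite /= andbC.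
Qed.

Lemma indic_box (A : set Omega) (B : set R) (C : set U) w r u :
  \1_(A `*` B `*` C) (w, r, u) = \1_A w * \1_B r * \1_C u :> R.
Proof.
have [/=Aw|nAw] := pselect (A w); last first.
  by rewrite (@indicE _ _ A) memNset// !mul0r indicE memNset// => -[[]].
have [/=Br|nBr] := pselect (B r); last first.
  by rewrite (@indicE _ _ B) memNset// mulr0 mul0r indicE memNset// => -[[]].
have [/=Cu|nCu] := pselect (C u); last first.
  by rewrite (@indicE _ _ C) memNset// mulr0 indicE memNset// => -[[]].
by rewrite !indicE !mem_set//= !mulr1.
Qed.

Lemma indic_Ioc (s t r : R) : s <= t -> \1_[set x | (s < x <= t)] r = (r <= t)%R%:R - (r <= s)%R%:R :> R.
Proof.
move=> st; rewrite indicE; have [rs|sr] := leP r s.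
  by rewrite (le_trans rs st) subrr memNset// => /= /andP[]; rewrite ltNge rs.
rewrite subr0; have [rt|tr] := leP r t; first by rewrite mem_set//= sr rt.
by rewrite memNset// => /= /andP[_]; rewrite leNgt tr.
Qed.

(** Cutting the time axis at all end points leaves on each cell the elementary
    integrands that are alive there, and these have disjoint marks. *)
Lemma simple_refinement (K : finType) (st en : K -> R) (ev : K -> set Omega)
    (mk : K -> set U) (op : K -> contlin X Y) :
  (forall x, [/\ 0 <= st x < en x, en x <= T, F (st x) (ev x) & rA (mk x)]) ->
  (forall x y, x != y ->
    [set r | st x < r <= en x] `&` [set r | st y < r <= en y] = set0 \/
    mk x `&` mk y = set0) ->
  exists m : simple_family Omega U X Y, [/\ simple F rA T m,
    forall z, sf_fun m z =
      \sum_x \1_(ev x `*` [set r | st x < r <= en x] `*` mk x) z *: op x &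
    forall t A y w, simple_integral M m t A y w =
      \sum_x \1_(ev x) w * (M (Num.min t (en x)) (A `&` mk x) (adjoint (op x) y) w -
                            M (Num.min t (st x)) (A `&` mk x) (adjoint (op x) y) w)].
Proof.
move=> proper disj; have [rA0 rAU rAD] := ringA.
pose pts := sort <=%R (undup ([seq st x | x : K] ++ [seq en x | x : K])).
have spts : sorted <%R pts by rewrite sort_lt_sorted undup_uniq.
have stin x : st x \in pts by rewrite mem_sort mem_undup mem_cat fintype.image_f.
have enin x : en x \in pts by rewrite mem_sort mem_undup mem_cat orbC fintype.image_f.
pose n := (size pts).-1.
pose I : finType := (K * 'I_n)%type.
pose cov (i : I) := (index (st i.1) pts <= i.2 < index (en i.1) pts)%N.
have stE x : pts`_(index (st x) pts) = st x by rewrite nth_index.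
have enE x : pts`_(index (en x) pts) = en x by rewrite nth_index.
have ltn_size (c : 'I_n) : (c.+1 < size pts)%N.
  suff aux k l : (k < l.-1)%N -> (k.+1 < l)%N by exact: aux (ltn_ord c).
  by case: l.
have nth_lt (c : 'I_n) : pts`_c < pts`_c.+1.
  apply: (sorted_ltn_nth lt_trans 0 spts) => //; rewrite inE; last exact: ltn_size.
  exact: ltn_trans (ltn_size c).
have nth_le a b : (a <= b < size pts)%N -> pts`_a <= pts`_b.
  move=> /andP[]; rewrite leq_eqVlt => /predU1P[->//|ab bs]; apply: ltW.
  by apply: (sorted_ltn_nth lt_trans 0 spts) => //; rewrite inE// (ltn_trans ab).
have pts_ge0 a : (a < size pts)%N -> 0 <= pts`_a <= T.
  move=> sa; have : pts`_a \in pts by exact: mem_nth.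
  rewrite mem_sort mem_undup mem_cat => /orP[] /fintype.imageP[x _ ->].
    by have [/andP[h1 h2] h3 _ _] := proper x; rewrite h1 (le_trans (ltW h2)).
  by have [/andP[h1 h2] h3 _ _] := proper x; rewrite h3 (le_trans h1)// ltW.
have cov_st (i : I) : cov i -> st i.1 <= pts`_i.2.
  move=> /andP[h _]; rewrite -stE; apply: nth_le; rewrite h/=.
  exact: ltn_trans (ltn_size i.2).
have cov_en (i : I) : cov i -> pts`_i.2.+1 <= en i.1.
  by move=> /andP[_ h]; rewrite -enE; apply: nth_le; rewrite h/= index_mem.
pose m : simple_family Omega U X Y := @SimpleFamily R d Omega U X Y #|{: I}|
  (fun k => if cov (enum_val k) then ev (enum_val k).1 else set0)
  (fun k => pts`_(enum_val k).2) (fun k => pts`_(enum_val k).2.+1)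
  (fun k => if cov (enum_val k) then mk (enum_val k).1 else set0)
  (fun k => op (enum_val k).1).
exists m; split.
- split=> [k|k l kl] /=.
    set i := enum_val k; have /andP[a0 aT] := pts_ge0 _ (ltn_trans (ltnSn _) (ltn_size i.2)).
    have /andP[_ bT] := pts_ge0 _ (ltn_size i.2).
    split=> //; first by rewrite a0 nth_lt.
      case: ifP => [ci|_]; last exact: (filtration0 usual).
      have [/andP[s0 _] _ Fev _] := proper i.1.
      by apply: (filtration_le usual _ Fev); rewrite s0 cov_st.
    by case: ifP => // _; have [] := proper i.1.
  have ij : enum_val k != enum_val l by apply: contra kl => /eqP /enum_val_inj ->.
  rewrite /sf_interval/=; set i := enum_val k in ij *; set j := enum_val l in ij *.
  have [cij|cij] := eqVneq i.2 j.2; last first.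
    left; rewrite -subset0 => r /= [/andP[r1 r2] /andP[r3 r4]].
    move: cij; rewrite neq_ltn => /orP[ab|ab].
      have := nth_le i.2.+1 j.2; rewrite ab (ltn_trans (ltnSn _) (ltn_size j.2)) => /(_ isT) h.
      by have := lt_le_trans r3 (le_trans r2 h); rewrite ltxx.
    have := nth_le j.2.+1 i.2; rewrite ab (ltn_trans (ltnSn _) (ltn_size i.2)) => /(_ isT) h.
    by have := lt_le_trans r1 (le_trans r4 h); rewrite ltxx.
  right; split; first by rewrite cij.
  have xy : i.1 != j.1.
    by apply: contra ij => /eqP h; rewrite (surjective_pairing i) (surjective_pairing j) h cij.
  case: ifP => ci; last by rewrite set0I.
  case: ifP => cj; last by rewrite setI0.
  have [h|//] := disj _ _ xy; exfalso.
  have : ([set r | st i.1 < r <= en i.1] `&` [set r | st j.1 < r <= en j.1]) pts`_i.2.+1.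
    split=> /=.
      by rewrite (le_lt_trans (cov_st i ci) (nth_lt i.2)) cov_en.
    by rewrite cij (le_lt_trans (cov_st j cj) (nth_lt j.2)) cov_en.
  by rewrite h.
- move=> [[w r] u]; rewrite /sf_fun/=.
  rewrite -(@big_enum_val _ _ _ I {: I} (fun i : I => \1_((if cov i then ev i.1 else set0) `*`
    [set x | pts`_i.2 < x <= pts`_i.2.+1] `*` (if cov i then mk i.1 else set0)) (w, r, u) *: op i.1))/=.
  rewrite -(pair_bigA _ (fun x c => \1_((if cov (x, c) then ev x else set0) `*`
    [set x | pts`_c < x <= pts`_c.+1] `*` (if cov (x, c) then mk x else set0)) (w, r, u) *: op x))/=.
  apply: eq_bigr => x _.
  have [/andP[_ se] _ _ _] := proper x.
  have tc := telescope_cells (fun s => (r <= s)%R%:R : R) spts (stin x) (enin x) se; rewrite /= in tc.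
  have tc' : \1_[set r' | st x < r' <= en x] r = \sum_(c < n | cov (x, c))
      ((r <= pts`_c.+1)%R%:R - (r <= pts`_c)%R%:R) :> R.
    by rewrite (indic_Ioc _ (ltW se)); exact/esym/tc.
  rewrite [in RHS]indic_box tc'.
  rewrite mulr_sumr mulr_suml scaler_suml [RHS]big_mkcond; apply: eq_bigr => c _.
  rewrite indic_box indic_Ioc; last exact: ltW (nth_lt c).
  rewrite -/(cov (x, c)); case: (cov (x, c)) => //.
  by rewrite indic0 mul0r mul0r scale0r.
- move=> t A y w; rewrite /simple_integral/=.
  rewrite -(@big_enum_val _ _ _ I {: I} (fun i : I => \1_(if cov i then ev i.1 else set0) w *
    (M (Num.min t pts`_i.2.+1) (A `&` (if cov i then mk i.1 else set0)) (adjoint (op i.1) y) w -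
     M (Num.min t pts`_i.2) (A `&` (if cov i then mk i.1 else set0)) (adjoint (op i.1) y) w)))/=.
  rewrite -(pair_bigA _ (fun x c => \1_(if cov (x, c) then ev x else set0) w *
    (M (Num.min t pts`_c.+1) (A `&` (if cov (x, c) then mk x else set0)) (adjoint (op x) y) w -
     M (Num.min t pts`_c) (A `&` (if cov (x, c) then mk x else set0)) (adjoint (op x) y) w)))/=.
  apply: eq_bigr => x _.
  have [/andP[_ se] _ _ _] := proper x.
  have tc := telescope_cells (fun s => M (Num.min t s) (A `&` mk x) (adjoint (op x) y) w) spts (stin x) (enin x) se.
  rewrite /= in tc; rewrite -tc.
  rewrite mulr_sumr [RHS]big_mkcond; apply: eq_bigr => c _.
  rewrite -/(cov (x, c)); case: (cov (x, c)) => //.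
  by rewrite indic0 mul0r.
Qed.

(** The intervals of the two families may overlap, but then their marks are
    separated by [G]; hence they can be refined to a common simple family. *)
Lemma simple_mixture (f g : simple_family Omega U X Y) (G : set U) :
  simple F rA T f -> simple F rA T g -> rA G ->
  exists m : simple_family Omega U X Y, [/\ simple F rA T m,
    forall w r u, G u -> sf_fun m (w, r, u) = sf_fun f (w, r, u),
    forall w r u, ~ G u -> sf_fun m (w, r, u) = sf_fun g (w, r, u) &
    forall t A y w, simple_integral M m t A y w =
      simple_integral M f t (A `&` G) y w + simple_integral M g t (A `\` G) y w].
Proof.
move=> [f1 f2] [g1 g2] rG; have [rA0 rAU rAD] := ringA.
have rAI B : rA B -> rA (B `&` G).
  move=> rB; rewrite (_ : B `&` G = B `\` (B `\` G)); first exact/rAD/rAD.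
  by rewrite setDD.
pose K : finType := ('I_(sf_size f) + 'I_(sf_size g))%type.
pose st (x : K) := match x with inl i => sf_start i | inr j => sf_start j end.
pose en (x : K) := match x with inl i => sf_end i | inr j => sf_end j end.
pose ev (x : K) := match x with inl i => sf_event i | inr j => sf_event j end.
pose mk (x : K) := match x with inl i => sf_mark i `&` G | inr j => sf_mark j `\` G end.
pose op (x : K) := match x with inl i => sf_op i | inr j => sf_op j end.
have [m [sm mE mI]] : exists m : simple_family Omega U X Y, [/\ simple F rA T m,
    forall z, sf_fun m z =
      \sum_x \1_(ev x `*` [set r | st x < r <= en x] `*` mk x) z *: op x &
    forall t A y w, simple_integral M m t A y w =
      \sum_x \1_(ev x) w * (M (Num.min t (en x)) (A `&` mk x) (adjoint (op x) y) w -
                            M (Num.min t (st x)) (A `&` mk x) (adjoint (op x) y) w)].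
  apply: simple_refinement.
  - move=> [i|j] /=; first by have [? ? ? ?] := f1 i; split=> //; exact: rAI.
    by have [? ? ? ?] := g1 j; split=> //; exact: rAD.
  - have dj (A B : set U) : (A `&` G) `&` (B `\` G) = set0.
      by rewrite -subset0 => u [[_ Gu] [_]].
    move=> [i|j] [i'|j'] xy /=.
    + have ii : i != i' by apply: contra xy => /eqP ->.
      have [h|[_ h]] := f2 i i' ii; [by left|right].
      by rewrite -subset0 => u [[h1 _] [h2 _]]; rewrite -h.
    + by right; exact: dj.
    + by right; rewrite setIC; exact: dj.
    + have jj : j != j' by apply: contra xy => /eqP ->.
      have [h|[_ h]] := g2 j j' jj; [by left|right].
      by rewrite -subset0 => u [[h1 _] [h2 _]]; rewrite -h.
exists m; split=> //.
- move=> w r u Gu; rewrite mE big_sumType/= [X in _ + X]big1 ?addr0 => [|j _]; last first.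
    by rewrite indic_box (@indicE _ _ (_ `\` _)) memNset ?mulr0 ?scale0r// => -[].
  apply: eq_bigr => i _; rewrite !indic_box; congr (_ * _ *: _).
  rewrite !indicE; congr (nat_of_bool _)%:R; apply/idP/idP => /set_mem h; apply/mem_set.
    by case: h.
  by split.
- move=> w r u Gu; rewrite mE big_sumType/= [X in X + _]big1 ?add0r => [|j _]; last first.
    by rewrite indic_box (@indicE _ _ (_ `&` _)) memNset ?mulr0 ?scale0r// => -[].
  apply: eq_bigr => i _; rewrite !indic_box; congr (_ * _ *: _).
  rewrite !indicE; congr (nat_of_bool _)%:R; apply/idP/idP => /set_mem h; apply/mem_set.
    by case: h.
  by split.
- move=> t A y w; rewrite mI big_sumType/=; congr (_ + _); apply: eq_bigr => i _.
    by rewrite (setIC (sf_mark i)) setIA.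
  by rewrite (_ : A `&` (sf_mark i `\` G) = (A `\` G) `&` sf_mark i)// setDE setIA setIAC.
Qed.

End simple_families.

Section contraction.
Context (R : realType).

Lemma contract_subadditive (x y : \bar R) : 0 <= x -> 0 <= y ->
  (contract (x + y) <= contract x + contract y)%R.
Proof.
move=> x0 y0; case: x x0 => [r| |//]; rewrite ?lee_fin; last first.
  have ny : y != -oo by rewrite -ltNye (lt_le_trans _ y0).
  move=> _; rewrite addye// lerDl.
  by rewrite -(contract0 R) le_contract.
case: y y0 => [s| |//]; rewrite ?lee_fin; last first.
  by move=> _ r0; rewrite addey// lerDr -(contract0 R) le_contract.
move=> s0 r0; rewrite /contract/= !ger0_norm ?addr_ge0// mulrDl.
have aux (a b : R) : (0 <= a -> 0 <= b -> a / (1 + (a + b)) <= a / (1 + a))%R.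
  move=> a0 b0; apply: ler_wpM2l => //; rewrite lef_pV2 ?posrE; lra.
by apply: lerD; [exact: aux|rewrite [(r + s)%R]addrC; exact: aux].
Qed.

Lemma poweR12_subadditive (x y : \bar R) : 0 <= x -> 0 <= y ->
  (x + y) `^ 2^-1 <= x `^ 2^-1 + y `^ 2^-1.
Proof.
move=> x0 y0; case: x x0 => [r| |//]; rewrite ?lee_fin; last first.
  have ny : y `^ 2^-1 != -oo by rewrite -ltNye (lt_le_trans _ (poweR_ge0 _ _)).
  by move=> _; rewrite [X in _ <= X + _]poweRyr ?invr_neq0// [X in _ <= X]addye// leey.
case: y y0 => [s| |//]; rewrite ?lee_fin; last first.
  by move=> _ r0; rewrite poweRyr ?invr_neq0// addey ?leey// poweR_EFin.
move=> s0 r0.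
rewrite !powR12_sqrt ?addr_ge0// -(ler_pXn2r (n := 2)) ?nnegrE ?addr_ge0 ?sqrtr_ge0//.
rewrite sqrrD !sqr_sqrtr ?addr_ge0//.
by have := mulr_ge0 (sqrtr_ge0 r) (sqrtr_ge0 s); lra.
Qed.
End contraction.

Section integrand_distance.
Context (R : realType) (d : measure_display) (Omega : measurableType d).
Context (P : probability Omega R) (F : R -> set (set Omega)) (T : R).
Context (U : ptopologicalType) (U_ : (set U)^nat).
Context (X Y : normedModType R).
Local Notation PS := (predSpace F T U).
Context (mu : {measure set PS -> \bar R}) (Q : Omega * R * U -> contlin (dual X) X).
Context (N0 : set PS).
Hypothesis mN0 : measurable N0.
Hypothesis muN0 : mu N0 = 0.
Hypothesis posQ : forall z, horizon T z.1.2 -> ~ N0 z -> forall x : dual X, (0 <= x (Q z x))%R.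
Implicit Types Phi Psi : Omega * R * U -> contlin X Y.

Lemma rho_ge0 (A : set U) Phi : 0 <= rho mu Q A Phi.
Proof.
apply: le_trans (poweR_ge0 (\int[mu]_(z in slab T A) (qform Q Phi 0 0 z)%:E) 2^-1) _.
by apply: ereal_sup_ubound; exists 0%R => //=; rewrite normr0.
Qed.

Lemma le_integral_rho (A : set U) Phi (y : dual Y) (e : R) : (`|y| <= 1)%R -> (0 <= e)%R ->
  rho mu Q A Phi <= e%:E -> \int[mu]_(z in slab T A) (qform Q Phi y y z)%:E <= (e ^+ 2)%:E.
Proof.
move=> y1 e0 re; set I := integral _ _ _.
have I0 : 0 <= I.
  apply: (integral_ge0_off_null mN0 muN0) => z [hz _] Nz.
  by rewrite lee_fin; exact: posQ.
have : I `^ 2^-1 <= e%:E by apply: le_trans re; apply: ereal_sup_ubound; exists y.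
case: I I0 => [r| |//]; rewrite ?lee_fin; last first.
  by rewrite poweRyr ?invr_neq0// leye_eq.
move=> r0; rewrite powR12_sqrt// => se.
by rewrite -(sqr_sqrtr r0) lerXn2r ?nnegrE ?sqrtr_ge0.
Qed.

Let term0 Phi Psi n : 0 <= ((2 ^- n)%R * contract (rho mu Q (U_ n) (fun z => Phi z - Psi z)%R))%:E :> \bar R.
Proof.
rewrite lee_fin mulr_ge0// ?invr_ge0 ?exprn_ge0//.
by rewrite -(contract0 R) le_contract rho_ge0.
Qed.

(** Each term of the series is small when its sum is, and [contract] is
    invertible near 0. *)
Lemma dist_small (k : nat) (e : R) : (0 < e)%R -> exists2 c : R, (0 < c)%R &
  forall Phi Psi (y : dual Y), dist U_ mu Q Phi Psi <= c%:E -> (`|y| <= 1)%R ->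
    \int[mu]_(z in slab T (U_ k)) (qform Q (fun z => Phi z - Psi z)%R y y z)%:E <= e%:E.
Proof.
move=> e0; pose s := Num.sqrt e; have s0 : (0 < s)%R by rewrite sqrtr_gt0.
exists (2 ^- k * contract s%:E)%R.
  rewrite mulr_gt0// ?invr_gt0 ?exprn_gt0//.
  by rewrite -(contract0 R) lt_contract lte_fin.
move=> Phi Psi y dc y1; rewrite -(sqr_sqrtr (ltW e0)) -/s; apply: le_integral_rho => //; first exact: ltW.
have : ((2 ^- k)%R * contract (rho mu Q (U_ k) (fun z => Phi z - Psi z)%R))%:E <= (2 ^- k * contract s%:E)%:E.
  apply: le_trans dc; rewrite /dist.
  apply: le_trans (nneseries_lim_ge k.+1 (fun n _ _ => term0 Phi Psi n)).
  rewrite big_nat_recr//= leeDr// sume_ge0// => n _; exact: term0.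
by rewrite lee_fin ler_pM2l ?invr_gt0 ?exprn_gt0// le_contract.
Qed.

(** The quadratic form of the mixture is that of one of the two families on
    each part; the square root and the contraction are subadditive. *)
Lemma dist_mixture Phi Psi1 Psi2 Psi (G : set U) : measurable (G : set (borelType U)) ->
  (forall w r u, G u -> Psi (w, r, u) = Psi1 (w, r, u)) ->
  (forall w r u, ~ G u -> Psi (w, r, u) = Psi2 (w, r, u)) ->
  dist U_ mu Q Psi Phi <= dist U_ mu Q Psi1 Phi + dist U_ mu Q Psi2 Phi.
Proof.
move=> mG e1 e2; rewrite /dist -nneseriesD//.
apply: lee_nneseries => [n _ _|n _]; first exact: term0.
rewrite -EFinD -mulrDr lee_fin ler_wpM2l// ?invr_ge0 ?exprn_ge0//.
apply: le_trans (contract_subadditive (rho_ge0 _ _) (rho_ge0 _ _)).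
rewrite le_contract; apply: ge_ereal_sup => _ [y /= y1 <-].
apply: (@le_trans _ _ (
  (\int[mu]_(z in slab T (U_ n)) (qform Q (fun z => Psi1 z - Phi z)%R y y z)%:E) `^ 2^-1 +
  (\int[mu]_(z in slab T (U_ n)) (qform Q (fun z => Psi2 z - Phi z)%R y y z)%:E) `^ 2^-1)); last first.
  by apply: leeD; apply: ereal_sup_ubound; exists y.
have pos (L : Omega * R * U -> contlin X Y) :
    0 <= \int[mu]_(z in slab T (U_ n)) (qform Q L y y z)%:E.
  by apply: (integral_ge0_off_null mN0 muN0) => z [hz _] Nz; rewrite lee_fin; exact: posQ.
apply: le_trans (poweR12_subadditive (pos _) (pos _)).
apply: gt0_ler_poweR => //.
- by rewrite in_itv/= pos leey.
- by rewrite in_itv/= adde_ge0 ?leey.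
have mGS : measurable ([set z | G z.2] : set PS).
  by rewrite -[X in measurable X]setTI; apply: measurable_snd.
apply: (le_integral_mix mN0 muN0 mGS).
- by move=> z [hz _] Nz; rewrite lee_fin; exact: posQ.
- by move=> z [hz _] Nz; rewrite lee_fin; exact: posQ.
- by move=> [[w r] u] _ Gu; rewrite /qform e1.
- by move=> [[w r] u] _ Gu; rewrite /qform e2.
Qed.
End integrand_distance.

(** * The isometry for simple and general integrands *)

Section simple_isometry.
Context (R : realType) (d : measure_display) (Omega : measurableType d).
Context (P : probability Omega R) (F : R -> set (set Omega)) (T : R).
Context (U : ptopologicalType) (rA : set (set (borelType U))).
Context (X Y : normedModType R) (M : R -> set U -> dual X -> Omega -> R).
Hypothesis usual : usual_conditions P F.
Hypothesis ringA : setring rA.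
Hypothesis rA_measurable : rA `<=` measurable.
Local Notation PS := (predSpace F T U).
Local Notation FT t := (g_sigma_algebraType (F t)).
Context (mu : {measure set PS -> \bar R}) (Q : Omega * R * U -> contlin (dual X) X).
Hypothesis mQ : forall x1 x2 : dual X, measurable_fun setT (fun z : PS => x2 (Q z x1) : R).
Hypothesis psQ : forall z, positive_symmetric (contlin_comp (to_bidual X) (Q z)).
Hypothesis mM : forall A x, rA A -> L2_martingale P F (@halfline R) (fun t => M t A x).

Definition box (H : set Omega) (s t : R) (B : set U) : set PS :=
  (H `*` [set r | (s < r <= t)%R]) `*` B.

Hypothesis isoM : forall A (x : dual X) s t H, rA A -> (0 <= s)%R -> (s <= t)%R -> (t <= T)%R -> F s H ->
  (ip P (incr (fun t => M t A x) H s t) (incr (fun t => M t A x) H s t))%:E =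
  \int[mu]_(z in box H s t A) (x (Q z x))%:E.

Local Open Scope ring_scope.

(** Cauchy-Schwarz for a vanishing factor: otherwise a large multiple of [f]
    would make the square of [c f + g] negative. *)
Lemma ip_null f g : sqint P f -> sqint P g -> ip P f f = 0 -> ip P f g = 0.
Proof.
move=> sf sg f0; apply/eqP; apply: contraT => fg0.
pose c := - (ip P g g + 1) / (2 * ip P f g).
have := ip_ge0 P (fun w => c * f w + g w).
rewrite ipDl//; [|exact: sqintZ|by apply: sqintD => //; exact: sqintZ].
rewrite ipZl//; last by apply: sqintD => //; exact: sqintZ.
rewrite (ipC P f) (ipC P g) !ipDl//; try exact: sqintZ.
rewrite !ipZl// f0 (ipC P g f) => h.
have : c * (2 * ip P f g) = - (ip P g g + 1) by rewrite /c divfK// mulf_neq0.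
by move: h; lra.
Qed.

Lemma indic_setI (A B : set Omega) w : \1_(A `&` B) w = \1_A w * \1_B w :> R.
Proof.
rewrite !indicE; have [Aw|nA] := pselect (A w); last first.
  by rewrite (@memNset _ A)// mul0r memNset// => -[].
rewrite (@mem_set _ A)// mul1r; congr (nat_of_bool _)%:R.
by apply/idP/idP => /set_mem h; apply/mem_set; [case: h|split].
Qed.

Let clip (s t r : R) := Num.max s (Num.min t r).

Let clipE (phi : R -> R) s t r : s <= t ->
  phi (Num.min t r) - phi (Num.min s r) = phi (clip s t r) - phi s.
Proof.
move=> st; rewrite /clip; case: (leP r s) => [rs|sr].
  by rewrite (min_idPr (le_trans rs st)) (max_idPl rs) !subrr.
rewrite (max_idPr _)//.
by rewrite le_min st ltW.
Qed.

Let clip_le s t a b : a <= b -> clip s t a <= clip s t b.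
Proof.
move=> ab; rewrite /clip ge_max; apply/andP; split; first by rewrite le_max lexx.
by rewrite le_max; apply/orP; right; rewrite le_min ge_min lexx/= ge_min ab orbT.
Qed.

Let clip_ge s t a : s <= clip s t a. Proof. by rewrite /clip le_max lexx. Qed.
Let clip_leT s t a : s <= t -> clip s t a <= t.
Proof. by move=> st; rewrite /clip ge_max st ge_min lexx. Qed.

Let clip_start s t a b : clip s t a < clip s t b -> s <= t -> a <= clip s t a.
Proof.
move=> ab st; have [ta|at_] := leP t a.
  have : clip s t a = t by rewrite /clip (min_idPl ta) (max_idPr st).
  by move=> h; move: ab; rewrite h => /lt_le_trans /(_ (clip_leT b st)); rewrite ltxx.
by rewrite /clip (min_idPr (ltW at_)) le_max lexx orbT.
Qed.

Let clip_Ioc s t a b r : s <= t -> (clip s t a < r <= clip s t b) = (s < r <= t) && (a < r <= b).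
Proof.
move=> st; rewrite /clip gt_max le_max gt_min le_min.
case: (ltP s r) => sr /=; last by [].
by case: (ltP t r) => tr /=; rewrite ?andbF ?andbT.
Qed.

Section one_family.
Context (f : simple_family Omega U X Y).
Hypothesis sf : simple F rA T f.
Context (y : dual Y) (B : set U) (H : set Omega) (s t : R).
Hypothesis rB : rA B.
Hypothesis s0 : 0 <= s.
Hypothesis st : s <= t.
Hypothesis tT : t <= T.
Hypothesis FH : F s H.

Let x_ (i : 'I_(sf_size f)) : dual X := adjoint (sf_op i) y.
Let c_ (i : 'I_(sf_size f)) := clip s t (sf_start i).
Let e_ (i : 'I_(sf_size f)) := clip s t (sf_end i).
Let D (i : 'I_(sf_size f)) := incr (fun t => M t (B `&` sf_mark i) (x_ i)) (H `&` sf_event i) (c_ i) (e_ i).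

Let rAI i : rA (B `&` @sf_mark _ _ _ _ _ _ f i).
Proof.
have [rA0 rAU rAD] := ringA; have [/(_ i)[_ _ _ rm] _] := sf.
rewrite (_ : B `&` _ = B `\` (B `\` sf_mark i)); first exact/rAD/rAD.
by rewrite setDD.
Qed.

Let ce i : c_ i <= e_ i.
Proof. by apply: clip_le; have [/(_ i)[/andP[_ /ltW]]] := sf. Qed.

Let c0 i : 0 <= c_ i. Proof. exact: le_trans (clip_ge _ _ _). Qed.
Let e0 i : 0 <= e_ i. Proof. exact: le_trans (clip_ge _ _ _). Qed.

Let J0 (r : R) : halfline r -> 0 <= r. Proof. by []. Qed.

Let FHi i : c_ i < e_ i -> F (c_ i) (H `&` sf_event i).
Proof.
move=> cei; have [/(_ i)[/andP[st0 _] _ Fi _] _] := sf.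
apply: (filtrationI usual (c0 i)).
  by apply: (filtration_le usual _ FH); rewrite s0 clip_ge.
by apply: (filtration_le usual _ Fi); rewrite st0 (clip_start cei st).
Qed.

Let mHi i : measurable (H `&` @sf_event _ _ _ _ _ _ f i).
Proof.
have [/(_ i)[/andP[st0 _] _ Fi _] _] := sf.
by apply: measurableI; [exact: (filtration_sub usual s0)|exact: (filtration_sub usual st0)].
Qed.

Let sM i r : 0 <= r -> sqint P (M r (B `&` sf_mark i) (x_ i)).
Proof. by move=> r0; apply: (L2_martingale_sqint usual J0 (mM (x_ i) (rAI i))). Qed.

Let sD i : sqint P (D i).
Proof. by apply: sqint_incr => //; exact: sM. Qed.

Let D_deg i : e_ i <= c_ i -> D i = (fun=> 0).
Proof.
move=> ec; have -> : D i = incr (fun t => M t (B `&` sf_mark i) (x_ i)) (H `&` sf_event i) (c_ i) (c_ i).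
  by rewrite /D (_ : e_ i = c_ i)//; apply/eqP; rewrite eq_le ec ce.
by apply/funext => w; rewrite /incr subrr mulr0.
Qed.

Let isoD i : (ip P (D i) (D i))%:E =
  (\int[mu]_(z in box (H `&` sf_event i) (c_ i) (e_ i) (B `&` sf_mark i)) (x_ i (Q z (x_ i)))%:E)%E.
Proof.
have [cei|eci] := ltP (c_ i) (e_ i).
  by apply: isoM => //; [exact: (le_trans (clip_leT _ st))|exact: FHi].
rewrite D_deg// ip0l (_ : box _ _ _ _ = set0) ?integral_set0//.
rewrite -subset0 => -[[w r] u] [[_ /= /andP[h1 h2]] _].
by have := lt_le_trans h1 (le_trans h2 eci); rewrite ltxx.
Qed.

Let incrE : incr (fun t => simple_integral M f t B y) H s t = (fun w => \sum_i D i w).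
Proof.
apply/funext => w; rewrite /incr /simple_integral -sumrB mulr_sumr; apply: eq_bigr => i _.
rewrite /D /incr indic_setI -mulrBr mulrA; congr (_ * _).
have h1 := clipE (fun r => M r (B `&` sf_mark i) (x_ i) w) (sf_end i) st.
have h2 := clipE (fun r => M r (B `&` sf_mark i) (x_ i) w) (sf_start i) st.
by rewrite /c_ /e_; rewrite /x_ in h1 h2 *; lra.
Qed.

Let orthoD_before i j : c_ i < e_ i -> c_ j < e_ j -> e_ i <= c_ j -> ip P (D i) (D j) = 0.
Proof.
move=> cei cej ij.
pose Z w := \1_(H `&` sf_event j) w * D i w.
have -> : ip P (D i) (D j) = ip P Z (fun w => M (e_ j) (B `&` sf_mark j) (x_ j) w - M (c_ j) (B `&` sf_mark j) (x_ j) w).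
  by apply: eq_Rintegral => w _; rewrite /Z [D j w]/(incr _ _ _ _ w) /incr; ring.
have [mj _ _ _] := mM (x_ j) (rAI j); have [mi _ _ _] := mM (x_ i) (rAI i).
have mind k r : c_ k < e_ k -> c_ k <= r -> measurable_fun setT (\1_(H `&` sf_event k) : FT r -> R).
  move=> cek kr; apply: measurable_indic; apply: (filtration_measurable usual J0).
    exact: le_trans kr.
  by apply: (filtration_le usual _ (FHi cek)); rewrite c0.
apply: (martingale_orthogonal usual J0 mj) => //; try exact: sM; try exact: c0; try exact: e0.
- apply: measurable_funM; first exact: mind.
  apply: measurable_funM; first by apply: mind => //; exact: le_trans ij.
  apply: measurable_funB.
    apply: (adapted_le usual (s := e_ i)); first by rewrite e0.
    by apply: (martingale_measurable usual J0 mi); exact: e0.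
  apply: (adapted_le usual (s := c_ i)); first by rewrite c0 (le_trans (ce i)).
  by apply: (martingale_measurable usual J0 mi); exact: c0.
- exact: sqint_indic.
Qed.

Hypothesis atomic : forall i : 'I_(sf_size f), B `<=` sf_mark i \/ B `&` sf_mark i = set0.

Let orthoD i j : i != j -> ip P (D i) (D j) = 0.
Proof.
move=> ij; have [f1 f2] := sf.
have [cei|eci] := ltP (c_ i) (e_ i); last by rewrite (D_deg eci) ip0l.
have [cej|ecj] := ltP (c_ j) (e_ j); last by rewrite (D_deg ecj) ipC ip0l.
have [disj|[_ disj]] := f2 i j ij.
  have [/andP[_ sei] _ _ _] := f1 i; have [/andP[_ sej] _ _ _] := f1 j.
  have [h|h] := leP (sf_end i) (sf_start j).
    by apply: orthoD_before => //; exact: clip_le.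
  have [h'|h'] := leP (sf_end j) (sf_start i).
    by rewrite ipC; apply: orthoD_before => //; exact: clip_le.
  have : (sf_interval i `&` sf_interval j) (Num.min (sf_end i) (sf_end j)).
    by split; rewrite /sf_interval/= lt_min ge_min lexx ?orbT ?sei ?sej ?h ?h'.
  by rewrite disj.
have empty k : B `&` sf_mark k = set0 -> ip P (D k) (D k) = 0.
  move=> Bk; apply: EFin_inj; rewrite isoD (_ : box _ _ _ _ = set0) ?integral_set0//.
  by rewrite /box Bk -subset0 => -[[w r] u] [_].
have [Bi|Bi] := atomic i; last by apply: ip_null => //; exact: empty.
have [Bj|Bj] := atomic j; last by rewrite ipC; apply: ip_null => //; exact: empty.
apply: ip_null => //; apply: empty; rewrite -subset0 => u [Bu _]; rewrite -disj.
by split; [exact: Bi|exact: Bj].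
Qed.

Let disjoint_boxes i j z : i != j ->
  (sf_event i `*` sf_interval i `*` sf_mark i) z ->
  (sf_event j `*` sf_interval j `*` @sf_mark _ _ _ _ _ _ f j) z -> False.
Proof.
move=> ij; have [f1 f2] := sf; case: z => -[w r] u [[_ /= ri] ui] [[_ /= rj] uj].
have [disj|[_ disj]] := f2 i j ij.
  by have : (sf_interval i `&` sf_interval j) r by []; rewrite disj.
by have : (sf_mark i `&` sf_mark j) u by []; rewrite disj.
Qed.

Lemma sf_fun_in (i : 'I_(sf_size f)) z : (sf_event i `*` sf_interval i `*` sf_mark i) z -> sf_fun f z = sf_op i.
Proof.
move=> zi; rewrite /sf_fun (bigD1 i)//= big1 => [|j ji].
  by rewrite indicE mem_set// scale1r addr0.
by rewrite indicE memNset ?scale0r// => /(disjoint_boxes ji); exact.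
Qed.

Lemma sf_fun_out z : (forall i : 'I_(sf_size f), ~ (sf_event i `*` sf_interval i `*` sf_mark i) z) -> sf_fun f z = 0.
Proof. by move=> zi; rewrite /sf_fun big1// => i _; rewrite indicE memNset// scale0r. Qed.

Lemma adjoint0 : adjoint (0 : contlin X Y) y = 0.
Proof. by apply: contlinP => x; rewrite /= linear0. Qed.

Let mark_measurable A : rA A -> measurable (A : set (borelType U)).
Proof. exact: rA_measurable. Qed.

Lemma measurable_box H' a b (A : set U) : 0 <= a -> b <= T -> F a H' -> rA A -> measurable (box H' a b A).
Proof.
move=> a0 bT FH' rA'; apply: measurableX; last exact: mark_measurable.
exact: measurable_pred_rect.
Qed.

Lemma simple_isometry :
  sqint P (incr (fun t => simple_integral M f t B y) H s t) /\
  (ip P (incr (fun t => simple_integral M f t B y) H s t)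
        (incr (fun t => simple_integral M f t B y) H s t))%:E =
  (\int[mu]_(z in box H s t B) (qform Q (sf_fun f) y y z)%:E)%E.
Proof.
rewrite incrE; have sS : sqint P (fun w => \sum_i D i w) by exact: sqint_sum.
split=> //; rewrite ip_suml//.
rewrite (eq_bigr (fun i => ip P (D i) (D i))) => [|i _]; last first.
  rewrite ipC ip_suml// (bigD1 i)//= big1 ?addr0// => j ji; exact: orthoD.
pose bi i := box (H `&` sf_event i) (c_ i) (e_ i) (B `&` sf_mark i).
have mbi i : measurable (bi i).
  have [cei|eci] := ltP (c_ i) (e_ i).
    by apply: measurable_box => //; [exact: (le_trans (clip_leT _ st))|exact: FHi].
  rewrite (_ : bi i = set0)// -subset0 => -[[w r] u] [[_ /= /andP[h1 h2]] _].
  by have := lt_le_trans h1 (le_trans h2 eci); rewrite ltxx.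
have xQ0 i (z : Omega * R * U) : 0 <= x_ i (Q z (x_ i)) by have [p _] := psQ z; exact: (p (x_ i)).
transitivity (\sum_i \int[mu]_z ((EFin \o (fun z => x_ i (Q z (x_ i)))) \_ (bi i)) z)%E.
  rewrite -sumEFin; apply: eq_bigr => i _; rewrite isoD; exact: integral_mkcond.
rewrite -ge0_integral_sum//; last 2 first.
- by move=> i; apply/(measurable_restrictT _ (mbi i)); apply/measurable_EFinP; apply: measurable_funTS; exact: mQ.
- by move=> i z _; rewrite patchE; case: ifP => // _; rewrite lee_fin.
rewrite [RHS]integral_mkcond; apply: eq_integral => z _.
have biE i : bi i z <-> box H s t B z /\ (sf_event i `*` sf_interval i `*` sf_mark i) z.
  case: z => -[w r] u; rewrite /bi /box /sf_interval/= /c_ /e_ clip_Ioc//.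
  split; first by move=> [[[? ?] /andP[? ?]] [? ?]].
  by move=> [[[? ->] ?] [[? ->] ?]].
rewrite patchE; case: ifPn => [/set_mem zb|zb]; last first.
  rewrite big1// => i _; rewrite patchE memNset// => /biE[h _].
  by move/negP: zb; apply; exact/mem_set.
have [[i zi]|ni] := pselect (exists i, (sf_event i `*` sf_interval i `*` @sf_mark _ _ _ _ _ _ f i) z).
  rewrite (bigD1 i)//= big1 => [|j ji].
    by rewrite adde0 patchE mem_set ?/qform ?(sf_fun_in zi)//; exact/biE.
  by rewrite patchE memNset// => /biE[_ zj]; exact: disjoint_boxes ji zj zi.
rewrite big1 => [|i _]; last by rewrite patchE memNset// => /biE[_ zi]; apply: ni; exists i.
rewrite /qform sf_fun_out; last by move=> i zi; apply: ni; exists i.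
by rewrite adjoint0.
Qed.
End one_family.
End simple_isometry.

Section limit_lemmas.
Local Open Scope ring_scope.
Context (R : realType).

(** Young inequalities with parameters [x] and [h] play the role of the
    continuity of the norm: let [h] and then [x] tend to 0. *)
Lemma young_squeeze (a b : R) : 0 <= b ->
  (forall h, 0 < h -> exists c, forall x, 0 < x ->
    a <= (1 + x) * c + (1 + x^-1) * h /\ c <= (1 + x) * b + (1 + x^-1) * h) -> a <= b.
Proof.
move=> b0 acb; apply/ler_addgt0Pl => x x0.
pose k := Num.min 1 (x / (6 * (b + 1))).
have b1 : 0 < 6 * (b + 1) by lra.
have k0 : 0 < k by rewrite lt_min ltr01 divr_gt0.
have k1 : k <= 1 by rewrite ge_min lexx.
have kb : k * (6 * (b + 1)) <= x by rewrite -ler_pdivlMr// ge_min lexx orbT.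
have ki : 0 < k^-1 by rewrite invr_gt0.
pose h := x / (6 * (1 + k^-1)).
have h0 : 0 < h by rewrite divr_gt0// mulr_gt0//; lra.
have hE : h * (6 * (1 + k^-1)) = x by rewrite /h divfK// gt_eqF// mulr_gt0//; lra.
have [c /(_ k k0)[ac cb]] := acb h h0; move: ac cb.
set K := k^-1 in ki hE *; move: hE; clearbody h K => hE h3 h4.
have h5 : (1 + k) * c <= (1 + k) * ((1 + k) * b + (1 + K) * h) by rewrite ler_pM2l//; lra.
have h7 : k * ((1 + K) * h) <= (1 + K) * h by rewrite ler_piMl// mulr_ge0// ?ltW//; lra.
have h8 : k * (k * b) <= k * b by rewrite ler_piMl// mulr_ge0// ltW.
have kb0 : 0 <= k * b by rewrite mulr_ge0// ltW.
lra.
Qed.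
End limit_lemmas.

Section ito_isometry.
Context (R : realType) (d : measure_display) (Omega : measurableType d).
Context (P : probability Omega R) (F : R -> set (set Omega)) (T : R).
Context (U : ptopologicalType) (rA : set (set (borelType U))) (U_ : (set U)^nat).
Context (X Y : normedModType R) (M : R -> set U -> dual X -> Omega -> R).
Context (N : R -> set U -> dual Y -> Omega -> R).
Hypothesis usual : usual_conditions P F.
Hypothesis T0 : (0 < T)%R.
Hypothesis ringA : setring rA.
Hypothesis rA_measurable : rA `<=` measurable.
Hypothesis exh : exhausting rA U_.
Local Notation PS := (predSpace F T U).
Context (mu : {measure set PS -> \bar R}).
Context (Q0 Q : Omega * R * U -> contlin (dual X) X) (N0 : set PS).
Hypothesis mQ : forall x1 x2 : dual X, measurable_fun setT (fun z : PS => x2 (Q z x1) : R).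
Hypothesis psQ : forall z, positive_symmetric (contlin_comp (to_bidual X) (Q z)).
Hypothesis mN0 : measurable N0.
Hypothesis muN0 : mu N0 = 0.
Hypothesis QE : forall z : Omega * R * U, horizon T z.1.2 -> ~ N0 z -> Q z = Q0 z.
Hypothesis hM : orthogonal_mvm P F rA U_ (@halfline R) M.
Hypothesis hN : orthogonal_mvm P F rA U_ (horizon T) N.
Hypothesis isoM : forall A (x : dual X) s t H, rA A -> (0 <= s)%R -> (s <= t)%R -> (t <= T)%R -> F s H ->
  (ip P (incr (fun t => M t A x) H s t) (incr (fun t => M t A x) H s t))%:E =
  \int[mu]_(z in (box H s t A : set PS)) (x (Q z x))%:E.
Context (Phi : Omega * R * U -> contlin X Y).
Hypothesis intPhi : integrand rA mu Q0 Phi.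
Hypothesis mPhi : forall y1 y2 : dual Y, measurable_fun setT (qform Q Phi y1 y2 : PS -> R).
Context (Phi_ : nat -> simple_family Omega U X Y).
Hypothesis apprPhi : approximates rA U_ mu Q0 Phi Phi_.
Hypothesis intN : stochastic_integral P rA U_ M mu Q0 Phi N.

Local Open Scope ring_scope.

Let posQ0 (z : Omega * R * U) : horizon T z.1.2 -> ~ N0 z -> forall x : dual X, 0 <= x (Q0 z x).
Proof. by move=> hz nz x; rewrite -QE//; have [p _] := psQ z; exact: (p x). Qed.

Let rA0 : rA set0. Proof. by case: ringA. Qed.
Let rAU A B : rA A -> rA B -> rA (A `|` B). Proof. by case: ringA => _ + _; apply. Qed.
Let rAD A B : rA A -> rA B -> rA (A `\` B). Proof. by case: ringA => _ _; apply. Qed.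
Let rAI A B : rA A -> rA B -> rA (A `&` B).
Proof. by move=> a b; rewrite -setDD; exact/rAD/rAD. Qed.

Let mM A x : rA A -> L2_martingale P F (@halfline R) (fun t => M t A x).
Proof. by case: hM => _ _ + _ _; apply. Qed.

Let mN A y : rA A -> L2_martingale P F (horizon T) (fun t => N t A y).
Proof. by case: hN => _ _ + _ _; apply. Qed.

Let J0 (r : R) : halfline r -> 0 <= r. Proof. by []. Qed.
Let J1 (r : R) : horizon T r -> 0 <= r. Proof. by case/andP. Qed.

Let sM t A x : rA A -> 0 <= t -> sqint P (M t A x).
Proof. by move=> rA' t0; exact: (L2_martingale_sqint usual J0 (mM x rA')). Qed.

Let sN t A y : rA A -> horizon T t -> sqint P (N t A y).
Proof. by move=> rA' ht; exact: (L2_martingale_sqint usual J1 (mN y rA')). Qed.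

Lemma mvm_additive (E : normedModType R) (J : set R) (L : R -> set U -> E -> Omega -> R) t A B (x : E) :
  (forall r, J r -> 0 <= r) -> orthogonal_mvm P F rA U_ J L -> J t -> rA A -> rA B -> A `&` B = set0 ->
  {ae P, forall w, L t (A `|` B) x w = L t A x w + L t B x w}.
Proof.
move=> J_ge0 hL Jt a b ab; have [_ L0 _ Lm _] := hL.
have := J_ge0 t Jt; rewrite le_eqVlt => /predU1P[t0|t0].
  have h1 := L0 _ x (rAU a b); have h2 := L0 _ x a; have h3 := L0 _ x b.
  by move: h1 h2 h3; rewrite -t0; apply: filterS3 => w -> -> ->; rewrite addr0.
by have [_ add _ _ _] := Lm t x Jt t0; exact: add.
Qed.

Lemma mvm_additive_sum (E : normedModType R) (J : set R) (L : R -> set U -> E -> Omega -> R) t (x : E)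
    (I : finType) (B : I -> set U) (S : {set I}) :
  (forall r, J r -> 0 <= r) -> orthogonal_mvm P F rA U_ J L -> J t -> (forall i, rA (B i)) ->
  (forall i j, i != j -> B i `&` B j = set0) ->
  rA (\big[setU/set0]_(i in S) B i) /\
  {ae P, forall w, L t (\big[setU/set0]_(i in S) B i) x w = \sum_(i in S) L t (B i) x w}.
Proof.
move=> J_ge0 hL Jt rB dB.
suff aux r : uniq r -> rA (\big[setU/set0]_(i <- r) B i) /\
    {ae P, forall w, L t (\big[setU/set0]_(i <- r) B i) x w = \sum_(i <- r) L t (B i) x w}.
  have [h1 h2] := aux _ (enum_uniq S); rewrite -big_enum; split=> //.
  by move: h2; apply: filterS => w ->; rewrite big_enum.
elim: r => [_|i r IH /= /andP[ir /IH[rAr aer]]].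
  rewrite big_nil; split=> //.
  have := mvm_additive x J_ge0 hL Jt rA0 rA0 (set0I _).
  apply: filterS => w; rewrite setU0 big_nil => h.
  by apply: (addrI (L t set0 x w)); rewrite addr0.
rewrite big_cons; split; first exact: rAU.
have dis : B i `&` \big[setU/set0]_(j <- r) B j = set0.
  rewrite -subset0 => u [Bi]; rewrite -bigcup_seq => -[j /= jr Bj].
  have ij : i != j by apply: contra ir => /eqP ->.
  by have : (B i `&` B j) u by []; rewrite (dB _ _ ij).
have := mvm_additive x J_ge0 hL Jt (rB i) rAr dis.
by move: aer; apply: filterS2 => w e1; rewrite big_cons e1.
Qed.

Lemma sqint_simple_integral (f : simple_family Omega U X Y) t (B : set U) y : simple F rA T f -> rA B -> 0 <= t ->
  sqint P (simple_integral M f t B y).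
Proof.
move=> [f1 _] rB t0; apply: sqint_sum => i; have [/andP[a b] c Fi rm] := f1 i.
have b0 : 0 <= sf_end i by rewrite (le_trans a)// ltW.
apply: sqint_indic; first exact: (filtration_sub usual a).
by apply: sqintB; apply: sM; rewrite ?le_min ?t0//; exact: rAI.
Qed.

Lemma ip_sub_le f g : sqint P f -> sqint P g ->
  ip P (fun w => f w - g w) (fun w => f w - g w) <= 2 * ip P f f + 2 * ip P g g.
Proof.
move=> sf sg; have sfg := sqintB sf sg; have sfg' := sqintD sf sg.
have := ip_ge0 P (fun w => f w + g w).
have -> : ip P (fun w => f w + g w) (fun w => f w + g w) = ip P f f + 2 * ip P f g + ip P g g.
  by rewrite ipDl// (ipC P f) (ipC P g) !ipDl// (ipC P g f); lra.
have -> : ip P (fun w => f w - g w) (fun w => f w - g w) = ip P f f - 2 * ip P f g + ip P g g.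
  by rewrite ipBl// (ipC P f) (ipC P g) !ipBl// (ipC P g f); lra.
lra.
Qed.

Lemma ip_indic_le H f : measurable H -> sqint P f ->
  ip P (fun w => \1_H w * f w) (fun w => \1_H w * f w) <= ip P f f.
Proof.
move=> mH sf; rewrite /ip; apply: le_Rintegral => //.
- by apply: sqint_mul; exact: sqint_indic.
- exact: sqint_mul.
- move=> w _; rewrite indicE; have := sqr_ge0 (f w).
  by case: (w \in H); rewrite ?mul1r ?mul0r// -expr2.
Qed.

Lemma M2norm_ip t (m : R -> Omega -> R) (e : R) : horizon T t -> sqint P (m t) ->
  (M2norm P T m <= e%:E)%E -> ip P (m t) (m t) <= e ^+ 2.
Proof.
move=> ht sm me; apply: ip_le_L2norm => //; apply: le_trans me.
by apply: ereal_sup_ubound; exists t.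
Qed.

(** If the convergence were not uniform over the subsets [G], the families
    equal to a bad [Phi_ n] on a bad [G] and to a good [Phi_ m] elsewhere
    would still converge to [Phi] but their integrals would not converge to
    [N]. *)
Lemma uniform_integral_convergence k A y t (e : R) : measurable (A : set (borelType U)) -> A `<=` U_ k ->
  horizon T t -> 0 < e -> exists n0, forall n (G : set U), (n0 <= n)%N -> rA G -> G `<=` A ->
    ip P (fun w => simple_integral M (Phi_ n) t G y w - N t G y w)
         (fun w => simple_integral M (Phi_ n) t G y w - N t G y w) <= e.
Proof.
move=> mA AU ht e0; have [sPhi dPhi] := apprPhi.
have t0 : 0 <= t by exact: J1.
have rAA : rA A by case: exh => _ _ _; apply; eauto.
apply: contrapT => /forallNP bad.
have {bad} bad j : exists nG : nat * set U, [/\ (j <= nG.1)%N, rA nG.2, nG.2 `<=` A &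
    e < ip P (fun w => simple_integral M (Phi_ nG.1) t nG.2 y w - N t nG.2 y w)
             (fun w => simple_integral M (Phi_ nG.1) t nG.2 y w - N t nG.2 y w)].
  apply: contrapT => nbad; apply: (bad j) => n G jn rG GA; rewrite leNgt; apply/negP => h.
  by apply: nbad; exists (n, G).
have [nG nGP] := choice bad.
(* Two errors of norm [c] add up to an error whose square is [e]. *)
pose c := Num.sqrt e / 2.
have se : 0 < Num.sqrt e by rewrite sqrtr_gt0.
have c0 : 0 < c by rewrite /c; lra.
have cE : 4 * c ^+ 2 = e by rewrite /c expr_div_n sqr_sqrtr ?ltW//; lra.
have ev (f : nat -> \bar R) : f n @[n --> \oo] --> 0%E -> exists n0, forall n, (n0 <= n)%N -> (f n <= c%:E)%E.
  move=> /fine_cvgP[ffin /cvgrPdist_le/(_ c c0)]; move: ffin; rewrite !nearE => -[n1 _ h1] [n2 _ h2].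
  exists (maxn n1 n2) => n; rewrite geq_max => /andP[/h1 /= fn /h2 /=].
  rewrite sub0r normrN => h; rewrite -(fineK fn) lee_fin; exact: le_trans (ler_norm _) h.
have good j : exists m, (j <= m)%N /\ (M2norm P T (fun r w => simple_integral M (Phi_ m) r (A `\` (nG j).2) y w -
    N r (A `\` (nG j).2) y w)%R <= c%:E)%E.
  have [_ rG _ _] := nGP j.
  have [_ /(_ Phi_ apprPhi) /ev[n0 h]] := intN y (rAD rAA rG).
  by exists (maxn j n0); rewrite leq_maxl; split=> //; apply: h; rewrite leq_maxr.
have [m mP] := choice good.
have mix j : exists Psi : simple_family Omega U X Y, [/\ simple F rA T Psi,
    (dist U_ mu Q0 (sf_fun Psi) Phi <= dist U_ mu Q0 (sf_fun (Phi_ (nG j).1)) Phi +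
      dist U_ mu Q0 (sf_fun (Phi_ (m j))) Phi)%E &
    forall r w, simple_integral M Psi r A y w =
      simple_integral M (Phi_ (nG j).1) r (nG j).2 y w +
      simple_integral M (Phi_ (m j)) r (A `\` (nG j).2) y w].
  have [_ rG GA _] := nGP j.
  have [Psi [sPsi e1 e2 e3]] := simple_mixture M usual ringA (sPhi (nG j).1) (sPhi (m j)) rG.
  exists Psi; split=> //.
    have mG : measurable ((nG j).2 : set (borelType U)) by exact: rA_measurable.
    exact: (@dist_mixture R d Omega F T U U_ X Y mu Q0 N0 mN0 muN0 posQ0 Phi _ _ _ (nG j).2 mG e1 e2).
  by move=> r w; rewrite e3 (setIidr GA).
have [Psi PsiP] := choice mix.
have apprPsi : approximates rA U_ mu Q0 Phi Psi.
  split; first by move=> j; have [] := PsiP j.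
  have shift (l : nat -> nat) : (forall j, (j <= l j)%N) ->
      dist U_ mu Q0 (sf_fun (Phi_ (l j))) Phi @[j --> \oo] --> 0%E.
    move=> lj; apply: (cvg_comp _ _ _ dPhi).
    move=> S [n _ hn]; exists n => // j /= nj; apply: hn => /=; exact: leq_trans nj _.
  apply: (@squeeze_cvge _ _ _ _ (fun=> 0%E) _ (fun j => dist U_ mu Q0 (sf_fun (Phi_ (nG j).1)) Phi +
      dist U_ mu Q0 (sf_fun (Phi_ (m j))) Phi)%E).
  - apply: nearW => j; have [_ -> _] := PsiP j; rewrite andbT.
    apply: nneseries_ge0 => n _ _; rewrite lee_fin mulr_ge0// ?invr_ge0 ?exprn_ge0//.
    by rewrite -(contract0 R) le_contract rho_ge0.
  - exact: cvg_cst.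
  - have cc (f g : nat -> \bar R) : f n @[n --> \oo] --> 0%E -> g n @[n --> \oo] --> 0%E ->
        (f n + g n)%E @[n --> \oo] --> 0%E.
      by move=> cf cg; rewrite -[X in _ --> X](adde0 0%E); apply: cvgeD.
    apply: cc.
      by apply: (shift (fun j => (nG j).1)) => j; have [] := nGP j.
    by apply: (shift m) => j; have [] := mP j.
have [_ /(_ Psi apprPsi) /ev[j /(_ j (leqnn j)) h1]] := intN y rAA.
have [_ h2] := mP j; have [_ rG GA] := nGP j; have [sPsi _ PsiE] := PsiP j.
apply/negP; rewrite -leNgt.
pose g w := simple_integral M (Psi j) t A y w - N t A y w.
pose h w := simple_integral M (Phi_ (m j)) t (A `\` (nG j).2) y w - N t (A `\` (nG j).2) y w.
have sg : sqint P g by apply: sqintB; [exact: sqint_simple_integral|exact: sN].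
have sh : sqint P h.
  by apply: sqintB; [apply: sqint_simple_integral => //; exact: rAD|apply: sN => //; exact: rAD].
have sf : sqint P (fun w => simple_integral M (Phi_ (nG j).1) t (nG j).2 y w - N t (nG j).2 y w).
  by apply: sqintB; [exact: sqint_simple_integral|exact: sN].
have addN : {ae P, forall w, N t A y w = N t (nG j).2 y w + N t (A `\` (nG j).2) y w}.
  have := @mvm_additive _ _ _ t (nG j).2 (A `\` (nG j).2) y J1 hN ht rG (rAD rAA rG) (setDIK _ _).
  by rewrite setDUK.
have ae : {ae P, forall w, simple_integral M (Phi_ (nG j).1) t (nG j).2 y w - N t (nG j).2 y w = g w - h w}.
  by move: addN; apply: filterS => w e1; rewrite /g /h PsiE e1; ring.
have sgh := sqintB sg sh.
rewrite (ip_ae ae ae sf.1 sgh.1 sf.1 sgh.1) -cE.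
apply: le_trans (ip_sub_le sg sh) _.
have := @M2norm_ip t (fun r w => simple_integral M (Psi j) r A y w - N r A y w) c ht sg h1.
have := @M2norm_ip t (fun r w => simple_integral M (Phi_ (m j)) r (A `\` (nG j).2) y w -
  N r (A `\` (nG j).2) y w) c ht sh h2.
rewrite -/g -/h; lra.
Qed.

Lemma young_integral (D : set PS) (f g : PS -> R) (r : PS -> R) (a b : R) : measurable D ->
  measurable_fun setT f -> measurable_fun setT g -> (forall z, 0 <= f z) -> (forall z, 0 <= g z) ->
  (forall z, D z -> 0 <= r z) -> 0 <= a -> 0 < b -> (forall z, D z -> f z <= a * g z + b * r z) ->
  (\int[mu]_(z in D) (f z)%:E <= a%:E * \int[mu]_(z in D) (g z)%:E + b%:E * \int[mu]_(z in D) (r z)%:E)%E.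
Proof.
move=> mD mf mg f0 g0 r0 a0 b0 fgr.
pose m z := Num.max 0 (b^-1 * (f z - a * g z)).
have m0 z : 0 <= m z by rewrite le_max lexx.
have mm : measurable_fun setT m.
  apply: measurable_maxr => //; apply: measurable_funM => //.
  by apply: measurable_funB => //; exact: measurable_funM.
have fm z : f z <= a * g z + b * m z.
  have : b * (b^-1 * (f z - a * g z)) <= b * m z by rewrite ler_pM2l// /m le_max lexx orbT.
  by rewrite mulVKf ?gt_eqF//; lra.
apply: (@le_trans _ _ (a%:E * \int[mu]_(z in D) (g z)%:E + b%:E * \int[mu]_(z in D) (m z)%:E)%E).
  rewrite -!ge0_integralZl_EFin//; try (by move=> z _; rewrite lee_fin); try (by apply/measurable_EFinP; apply: measurable_funTS); try exact: ltW.
  rewrite -ge0_integralD//; try (by move=> z _; rewrite -EFinM lee_fin mulr_ge0// ltW); try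
    (by apply/measurable_EFinP; apply: measurable_funM => //; apply: measurable_funTS).
  apply: ge0_le_integral => //.
  - by move=> z _; rewrite lee_fin.
  - by apply/measurable_EFinP; exact: measurable_funTS.
  - apply/measurable_EFinP; apply: measurable_funD; apply: measurable_funM => //; exact: measurable_funTS.
  - by move=> z _; rewrite -!EFinM -EFinD lee_fin.
rewrite leeD2l//; apply: lee_wpmul2l; first by rewrite lee_fin ltW.
apply: (le_integral_ge0_off_null (@measurable0 _ _) (measure0 mu)).
- by move=> z _; rewrite lee_fin.
- move=> z Dz _; rewrite lee_fin /m ge_max r0//= ler_pdivrMl// lerBlDl; exact: fgr.
Qed.

Lemma adjointB (S1 S2 : contlin X Y) (y : dual Y) : adjoint (S1 - S2) y = adjoint S1 y - adjoint S2 y.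
Proof.
apply: contlinP => x; rewrite -[LHS]/(y ((S1 - S2) x)) contlinB contlin_argB.
by symmetry; exact: (contlinB (adjoint S1 y) (adjoint S2 y) x).
Qed.

Lemma qform_young (Psi1 Psi2 : Omega * R * U -> contlin X Y) y z (x : R) : 0 < x ->
  qform Q Psi1 y y z <= (1 + x) * qform Q Psi2 y y z +
    (1 + x^-1) * qform Q (fun z => Psi1 z - Psi2 z) y y z.
Proof.
move=> x0; have := positive_symmetric_young (adjoint (Psi1 z) y) (adjoint (Psi2 z) y) (psQ z) x0.
by rewrite -adjointB.
Qed.

Lemma qform_ge0 (Psi : Omega * R * U -> contlin X Y) y z : 0 <= qform Q Psi y y z.
Proof. by have [p _] := psQ z; exact: (p (adjoint (Psi z) y)). Qed.

Lemma measurable_qform_simple (f : simple_family Omega U X Y) (y : dual Y) : simple F rA T f ->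
  measurable_fun setT (qform Q (sf_fun f) y y : PS -> R).
Proof.
move=> sf; have [f1 _] := sf.
rewrite (_ : qform _ _ _ _ = fun z : PS => \sum_i (\1_(sf_event i `*` sf_interval i `*` sf_mark i : set PS) z *
    adjoint (@sf_op _ _ _ _ _ _ f i) y (Q z (adjoint (@sf_op _ _ _ _ _ _ f i) y)))).
  apply: measurable_sum => i; apply: measurable_funM; last exact: mQ.
  apply: measurable_indic; have [/andP[a b] c Fi rm] := f1 i.
  by apply: (measurable_box rA_measurable).
apply/funext => z.
have [[i zi]|ni] := pselect (exists i, (sf_event i `*` sf_interval i `*` @sf_mark _ _ _ _ _ _ f i) z).
  rewrite (bigD1 i)//= big1 => [|j ji].
    by rewrite addr0 indicE mem_set// mul1r /qform (sf_fun_in sf zi).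
  rewrite indicE memNset ?mul0r// => zj.
  have [_ f2] := sf; case: z zi zj => -[w r] u [[_ /= ri] ui] [[_ /= rj] uj].
  have [disj|[_ disj]] := f2 j i ji.
    by have : (sf_interval j `&` sf_interval i) r by []; rewrite disj.
  by have : (sf_mark j `&` sf_mark i) u by []; rewrite disj.
rewrite big1 => [|i _]; last by rewrite indicE memNset ?mul0r// => zi; apply: ni; exists i.
have sf0 : sf_fun f z = 0 by apply: sf_fun_out => i zi; apply: ni; exists i.
by rewrite /qform sf0 adjoint0; exact: (@contlin0 R X R^o _).
Qed.

Section fixed_block.
Context (k : nat) (A : set U) (y : dual Y) (H : set Omega) (s t : R).
Hypothesis mA : measurable (A : set (borelType U)).
Hypothesis AU : A `<=` U_ k.
Hypothesis y1 : `|y| <= 1.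
Hypothesis s0 : 0 <= s.
Hypothesis st : s <= t.
Hypothesis tT : t <= T.
Hypothesis FH : F s H.

Let rAA : rA A. Proof. by case: exh => _ _ _; apply; eauto. Qed.
Let mH : measurable H. Proof. exact: (filtration_sub usual s0). Qed.
Let hs : horizon T s. Proof. by rewrite /horizon/= s0 (le_trans st). Qed.
Let ht : horizon T t. Proof. by rewrite /horizon/= tT (le_trans s0). Qed.
Let E : set PS := box H s t A.
Let mE : measurable E. Proof. exact: (measurable_box rA_measurable). Qed.

(** The atoms of the algebra generated by the marks of [Phi_ n]: on each of
    them the simple family has one operator at each time. *)
Let atom n (S : {set 'I_(sf_size (Phi_ n))}) : set U :=
  A `&` \bigcap_(i in [set: 'I_(sf_size (Phi_ n))]) (if i \in S then sf_mark i else ~` sf_mark i).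

Let atom_rA n S : rA (@atom n S).
Proof.
have [_ _ _ ex] := exh; apply: (ex k); last by move=> u [/AU].
apply: measurableI => //; apply: fin_bigcap_measurable; first exact: finite_finset.
move=> i _; have [/(_ n)[/(_ i)[_ _ _ /rA_measurable mm] _] _] := apprPhi.
by case: ifP => _ //; exact: measurableC.
Qed.

Let atom_disj n (S S' : {set 'I_(sf_size (Phi_ n))}) : S != S' -> atom S `&` atom S' = set0.
Proof.
move=> SS; rewrite -subset0 => u [[_ h] [_ h']]; case/negP: SS; apply/eqP/setP => i.
have := h i I; have := h' i I; case: ifP => iS'; case: ifP => iS //.
Qed.

Let all_atoms n := [set S : {set 'I_(sf_size (Phi_ n))} | true]%SET.

Let atom_cover n : \big[setU/set0]_(S in all_atoms n) atom S = A.
Proof.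
rewrite -big_enum -bigcup_seq; apply/seteqP; split=> [u [S _ []//]|u Au].
exists [set i | `[< sf_mark i u >]]%SET; first by rewrite /= mem_enum inE.
by split=> // i _; case: ifPn; rewrite inE => /asboolP.
Qed.

Let inN n S := incr (fun t => N t (@atom n S) y) H s t.
Let inI n S := incr (fun t => simple_integral M (Phi_ n) t (@atom n S) y) H s t.

Let sinN n S : sqint P (@inN n S).
Proof. by apply: sqint_incr => //; apply: sN => //; exact: atom_rA. Qed.

Let sinI n S : sqint P (@inI n S).
Proof.
have [sPhi _] := apprPhi.
apply: sqint_incr => //; apply: sqint_simple_integral => //; try exact: atom_rA.
exact: le_trans st.
Qed.

Let normN n : ip P (incr (fun t => N t A y) H s t) (incr (fun t => N t A y) H s t) =
  \sum_S ip P (@inN n S) (inN S).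
Proof.
have add r (hr : horizon T r) := (@mvm_additive_sum _ _ N r y _ (@atom n) (all_atoms n) J1 hN hr
  (@atom_rA n) (@atom_disj n)).2.
have sums (f : {set 'I_(sf_size (Phi_ n))} -> R) : \sum_(S in all_atoms n) f S = \sum_S f S.
  by apply: eq_bigl => S'; rewrite inE.
have ae : {ae P, forall w, incr (fun t => N t A y) H s t w = \sum_S @inN n S w}.
  move: (add s hs) (add t ht); apply: filterS2 => w; rewrite atom_cover !sums => e1 e2.
  by rewrite /incr e1 e2 -sumrB mulr_sumr.
have s1 : sqint P (incr (fun t => N t A y) H s t) by apply: sqint_incr => //; exact: sN.
have s2 : sqint P (fun w => \sum_S @inN n S w) by exact: sqint_sum.
rewrite (ip_ae ae ae s1.1 s2.1 s1.1 s2.1) ip_suml//; apply: eq_bigr => S _.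
rewrite ipC ip_suml// (bigD1 S)//= big1 ?addr0// => S' SS.
have [_ _ _ _ orth] := hN.
have cov := orth _ _ y (atom_rA S') (atom_rA S) (atom_disj SS).
have [_ _ ->] := covariation_incr usual J1 (mN y (atom_rA S')) (mN y (atom_rA S)) cov hs ht st FH.
by rewrite subrr.
Qed.

Let normI n : (\sum_S ip P (@inI n S) (inI S))%:E = (\int[mu]_(z in E) (qform Q (sf_fun (Phi_ n)) y y z)%:E)%E.
Proof.
have [sPhi _] := apprPhi.
pose bx (S : {set 'I_(sf_size (Phi_ n))}) : set PS := box H s t (atom S).
have -> : E = \big[setU/set0]_(S <- enum (all_atoms n)) bx S.
  rewrite -bigcup_seq /E -[in LHS](atom_cover n) -big_enum -bigcup_seq.
  apply/seteqP; split=> [[[w r] u] [hr [S iS Su]]|[[w r] u] [S iS [hr Su]]]; first by exists S.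
  by split=> //; exists S.
rewrite ge0_integral_bigsetU.
- rewrite big_enum/= -sumEFin [RHS](eq_bigl xpredT) => [|S]; last by rewrite inE.
  apply: eq_bigr => S _.
  have at1 (i : 'I_(sf_size (Phi_ n))) : @atom n S `<=` sf_mark i \/ @atom n S `&` sf_mark i = set0.
    case: (boolP (i \in S)) => iS; [left=> u [_ /(_ i I)]|right].
      by rewrite iS.
    by rewrite -subset0 => u [[_ /(_ i I)]]; rewrite (negbTE iS).
  have [_ h] := simple_isometry usual ringA rA_measurable mQ psQ mM isoM (sPhi n) y (atom_rA S) s0 st tT FH at1.
  exact: h.
- by move=> S; apply: (measurable_box rA_measurable) => //; exact: atom_rA.
- exact: enum_uniq.
- apply/trivIsetP => S S' _ _ SS; rewrite -subset0 => -[[w r] u] [[_ u1] [_ u2]].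
  by have : (atom S `&` atom S') u by []; rewrite (atom_disj SS).
- by apply/measurable_EFinP; apply: measurable_funTS; exact: measurable_qform_simple.
- by move=> z _; rewrite lee_fin qform_ge0.
Qed.

Let block_le (Psi : Omega * R * U -> contlin X Y) :
  (\int[mu]_(z in E) (qform Q Psi y y z)%:E <= \int[mu]_(z in slab T (U_ k)) (qform Q0 Psi y y z)%:E)%E.
Proof.
apply: (@le_trans _ _ (\int[mu]_(z in slab T (U_ k)) (qform Q Psi y y z)%:E)%E).
  rewrite integral_mkcond [leRHS]integral_mkcond.
  apply: (le_integral_off_null (@measurable0 _ _) (measure0 mu)).
  - by move=> z; rewrite patchE; case: ifP => _; rewrite ?lee_fin ?qform_ge0.
  - by move=> z; rewrite patchE; case: ifP => _; rewrite ?lee_fin ?qform_ge0.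
  move=> z _; rewrite !patchE; case: ifPn => [/set_mem Ez|_]; last first.
    by case: ifP => _; rewrite ?lee_fin ?qform_ge0.
  rewrite mem_set//; case: z Ez => -[w r] u [[_ /= /andP[sr rt]] Au]; split; last exact: AU.
  by rewrite /horizon/= (le_trans s0 (ltW sr)) (le_trans rt).
apply: (le_integral_ge0_off_null mN0 muN0) => [z _|z [hz _] nz]; first by rewrite lee_fin qform_ge0.
by rewrite lee_fin /qform QE.
Qed.

Let err n S := fun w => @inI n S w - @inN n S w.

(** The sum of the squared errors over the atoms is controlled by the squared
    error on one union of atoms, where the convergence is uniform. *)
Let err_small (h : R) : 0 < h -> exists n0, forall n, (n0 <= n)%N -> \sum_S ip P (@err n S) (err S) <= h.
Proof.
(* A factor 4 comes from the choice of a large partial sum, a factor 2 from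
   the difference of two times and a factor 2 from their number. *)
move=> h0; have h16 : 0 < h / 16 by lra.
have [n1 c1] := uniform_integral_convergence y mA AU hs h16.
have [n2 c2] := uniform_integral_convergence y mA AU ht h16.
exists (maxn n1 n2) => n; rewrite geq_max => /andP[n1n n2n].
have serr S : sqint P (@err n S) by apply: sqintB.
have [S0 S0P] := exists_large_subsum serr.
pose G := \big[setU/set0]_(S in S0) @atom n S.
have [sPhi _] := apprPhi.
have addN r (hr : horizon T r) := (@mvm_additive_sum _ _ N r y _ (@atom n) S0 J1 hN hr
  (@atom_rA n) (@atom_disj n)).2.
have [rG _] := @mvm_additive_sum _ _ N s y _ (@atom n) S0 J1 hN hs (@atom_rA n) (@atom_disj n).
have GA : G `<=` A by rewrite /G -big_enum -bigcup_seq => u [S _ []].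
have addI r : 0 <= r -> {ae P, forall w, simple_integral M (Phi_ n) r G y w =
    \sum_(S in S0) simple_integral M (Phi_ n) r (@atom n S) y w}.
  move=> r0.
  have one (q : R) (i : 'I_(sf_size (Phi_ n))) : 0 <= q -> {ae P, forall w,
      M q (G `&` sf_mark i) (adjoint (sf_op i) y) w =
      \sum_(S in S0) M q (atom S `&` sf_mark i) (adjoint (sf_op i) y) w}.
    move=> q0; have [/(_ i)[_ _ _ rm] _] := sPhi n.
    have := (@mvm_additive_sum _ _ M q (adjoint (sf_op i) y) _ (fun S => @atom n S `&` sf_mark i) S0 J0 hM q0
      (fun S => rAI (atom_rA S) rm) _).2.
    rewrite /G big_distrl/=; apply => S S' SS.
    by rewrite setIACA (atom_disj SS) set0I.
  have all i : {ae P, forall w, \1_(sf_event i) w *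
      (M (Num.min r (sf_end i)) (G `&` @sf_mark _ _ _ _ _ _ (Phi_ n) i) (adjoint (sf_op i) y) w -
       M (Num.min r (sf_start i)) (G `&` sf_mark i) (adjoint (sf_op i) y) w) =
      \sum_(S in S0) \1_(sf_event i) w *
      (M (Num.min r (sf_end i)) (atom S `&` sf_mark i) (adjoint (sf_op i) y) w -
       M (Num.min r (sf_start i)) (atom S `&` sf_mark i) (adjoint (sf_op i) y) w)}.
    have [/(_ i)[/andP[a b] _ _ _] _] := sPhi n.
    have p1 : 0 <= Num.min r (sf_end i) by rewrite le_min r0 (le_trans a)// ltW.
    have p2 : 0 <= Num.min r (sf_start i) by rewrite le_min r0.
    move: (one _ i p1) (one _ i p2); apply: filterS2 => w -> ->.
    by rewrite -sumrB mulr_sumr.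
  have := filter_forall (ae_filter_ringOfSetsType P) all.
  apply: filterS => w hw; rewrite /simple_integral exchange_big/=; apply: eq_bigr => i _; exact: hw.
pose V r w := simple_integral M (Phi_ n) r G y w - N r G y w.
have sV r : horizon T r -> sqint P (V r).
  by move=> hr; apply: sqintB; [apply: sqint_simple_integral => //; exact: J1|exact: sN].
have ae : {ae P, forall w, \sum_(S in S0) @err n S w = \1_H w * V t w - \1_H w * V s w}.
  have e1 := addN s hs; have e2 := addN t ht; have e3 := addI s s0; have e4 := addI t (le_trans s0 st).
  have e12 : {ae P, forall w, N s G y w = \sum_(S in S0) N s (@atom n S) y w /\
      N t G y w = \sum_(S in S0) N t (@atom n S) y w}.
    by move: e1 e2; apply: filterS2 => w.
  move: e12 e3 e4.
  apply: filterS3 => w [q1 q2] q3 q4; rewrite /V q1 q2 q3 q4 /err /inI /inN /incr.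
  rewrite -mulrBr -!sumrB mulr_sumr; apply: eq_bigr => S _; ring.
have s1 : sqint P (fun w => \sum_(S in S0) @err n S w) by exact: sqint_sum.
have sHV r : horizon T r -> sqint P (fun w => \1_H w * V r w) by move=> hr; apply: sqint_indic => //; exact: sV.
have s2 := sqintB (sHV t ht) (sHV s hs).
apply: le_trans S0P _; rewrite (ip_ae ae ae s1.1 s2.1 s1.1 s2.1).
have h1 := ip_sub_le (sHV t ht) (sHV s hs).
have h2 := ip_indic_le mH (sV t ht); have h3 := ip_indic_le mH (sV s hs).
have h4 := c1 n G n1n rG GA; have h5 := c2 n G n2n rG GA.
rewrite -/(V s) in h4; rewrite -/(V t) in h5; lra.
Qed.

Let oppr2 (c : dual X) (v : X) : (- c) (- v) = c v.
Proof. by rewrite [LHS](contlinN (c : contlin X R^o)) contlin_argN opprK. Qed.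

Let qform_opp (Psi1 Psi2 : Omega * R * U -> contlin X Y) z :
  qform Q (fun z => Psi1 z - Psi2 z) y y z = qform Q (fun z => Psi2 z - Psi1 z) y y z.
Proof.
rewrite /qform !adjointB; move: (adjoint (Psi1 z) y) (adjoint (Psi2 z) y) => a b.
by rewrite -(opprB b a) contlin_argN; exact: oppr2.
Qed.

Let finite_Phi : (\int[mu]_(z in E) (qform Q Phi y y z)%:E \is a fin_num)%E.
Proof.
have rU : rA (U_ k) by have [_ _ mU ex] := exh; apply: (ex k).
have [_ /(_ _ rU)] := intPhi.
have := rho_ge0 mu Q0 (U_ k) Phi.
case rE : (rho mu Q0 (U_ k) Phi) => [r||]//; rewrite lee_fin => r0 _.
rewrite ge0_fin_numE; last by apply: integral_ge0 => z _; rewrite lee_fin qform_ge0.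
apply: le_lt_trans (block_le Phi) _.
apply: (@le_lt_trans _ _ (r ^+ 2)%:E); last exact: ltry.
by apply: (le_integral_rho mN0 muN0 posQ0 y1 r0); rewrite rE.
Qed.

(** Orthogonality in the marks is available for [M] at one functional at a
    time and for [N] at one functional, so the identity is obtained atom by
    atom: both sides are sums over the atoms, and the errors on the atoms have
    a small total. *)
Lemma ito_block : (ip P (incr (fun t => N t A y) H s t) (incr (fun t => N t A y) H s t))%:E =
  (\int[mu]_(z in E) (qform Q Phi y y z)%:E)%E.
Proof.
rewrite -(fineK finite_Phi); congr EFin.
set a := ip P _ _; set b := fine _.
have bE : b%:E = (\int[mu]_(z in E) (qform Q Phi y y z)%:E)%E by rewrite fineK.
have a0 : 0 <= a by exact: ip_ge0.
have b0 : 0 <= b by apply: fine_ge0; apply: integral_ge0 => z _; rewrite lee_fin qform_ge0.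
have [sPhi dPhi] := apprPhi.
have key h : 0 < h -> exists c, forall x, 0 < x ->
    [/\ a <= (1 + x) * c + (1 + x^-1) * h, c <= (1 + x) * a + (1 + x^-1) * h,
        c <= (1 + x) * b + (1 + x^-1) * h & b <= (1 + x) * c + (1 + x^-1) * h].
  move=> h0; have [n1 e1] := err_small h0.
  have [c c0 dc] := dist_small U_ Y mN0 muN0 posQ0 k h0.
  have [n2 e2] : exists n2, forall n, (n2 <= n)%N -> (dist U_ mu Q0 (sf_fun (Phi_ n)) Phi <= c%:E)%E.
    move: dPhi => /fine_cvgP[ffin /cvgrPdist_le/(_ c c0)]; move: ffin; rewrite !nearE => -[m1 _ h1] [m2 _ h2].
    exists (maxn m1 m2) => n; rewrite geq_max => /andP[/h1 /= fn /h2 /=].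
    rewrite sub0r normrN => h'; rewrite -(fineK fn) lee_fin; exact: le_trans (ler_norm _) h'.
  pose n := maxn n1 n2.
  have {}e1 := e1 n (leq_maxl _ _); have {}e2 := e2 n (leq_maxr _ _).
  have rn : (\int[mu]_(z in E) (qform Q (fun z => sf_fun (Phi_ n) z - Phi z) y y z)%:E <= h%:E)%E.
    by apply: le_trans (block_le _) _; exact: dc.
  have rn' : (\int[mu]_(z in E) (qform Q (fun z => Phi z - sf_fun (Phi_ n) z) y y z)%:E <= h%:E)%E.
    by apply: le_trans rn; rewrite le_eqVlt; apply/orP; left; apply/eqP;
      apply: eq_integral => z _; rewrite qform_opp.
  exists (\sum_S ip P (@inI n S) (inI S)) => x x0.
  have x1 : 0 < 1 + x^-1 by rewrite addr_gt0// invr_gt0.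
  have x2 : 0 <= 1 + x by lra.
  have eE S : ip P (fun w => @inN n S w - inI S w) (fun w => inN S w - inI S w) = ip P (@err n S) (err S).
    by apply: eq_Rintegral => w _; rewrite /err; ring.
  have e3 : (1 + x^-1) * \sum_S ip P (@err n S) (err S) <= (1 + x^-1) * h by rewrite ler_pM2l.
  have mq := measurable_qform_simple y (sPhi n).
  split.
  - rewrite /a (normN n); apply: le_trans (lerD (lexx _) e3).
    rewrite !mulr_sumr -big_split/=; apply: ler_sum => S _; rewrite -eE.
    exact: ip_young.
  - rewrite /a (normN n); apply: le_trans (lerD (lexx _) e3).
    rewrite !mulr_sumr -big_split/=; apply: ler_sum => S _.
    exact: ip_young.
  - rewrite -lee_fin normI EFinD !EFinM bE.
    apply: le_trans (young_integral mE mq (mPhi y y) (fun z => qform_ge0 _ _ _) (fun z => qform_ge0 _ _ _)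
      (fun z _ => qform_ge0 _ _ _) x2 x1 (fun z _ => @qform_young _ Phi y z x x0)) _.
    by rewrite leeD2l// lee_wpmul2l// lee_fin ltW.
  - rewrite -lee_fin EFinD !EFinM normI bE.
    apply: le_trans (young_integral mE (mPhi y y) mq (fun z => qform_ge0 _ _ _) (fun z => qform_ge0 _ _ _)
      (fun z _ => qform_ge0 _ _ _) x2 x1 (fun z _ => @qform_young _ (sf_fun (Phi_ n)) y z x x0)) _.
    by rewrite leeD2l// lee_wpmul2l// lee_fin ltW.
apply/eqP; rewrite eq_le; apply/andP; split; apply: young_squeeze => // h h0; have [c cP] := key h h0;
  by exists c => x x0; have [? ? ? ?] := cP x x0.
Qed.

End fixed_block.

End ito_isometry.

(** * Random measures with a predictable density *)

Lemma eq_integral_off_null d (T : measurableType d) (R : realType) (mu : {measure set T -> \bar R})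
    (f g : T -> \bar R) : (forall x, 0 <= f x) -> (forall x, 0 <= g x) ->
  {ae mu, forall x, f x = g x} -> \int[mu]_x f x = \int[mu]_x g x.
Proof.
move=> f0 g0 /ae_null_set[B [mB B0 fg]]; apply/eqP; rewrite eq_le.
by apply/andP; split; apply: (le_integral_off_null mB B0) => // x /fg ->.
Qed.

Section kernel_densities.
Context (R : realType) (d : measure_display) (Omega : measurableType d).
Context (P : probability Omega R) (F : R -> set (set Omega)) (T : R).
Context (U : ptopologicalType).
Hypothesis usual : usual_conditions P F.
Hypothesis T0 : (0 < T)%R.
Local Notation FT t := (g_sigma_algebraType (F t)).
Local Notation PT := (g_sigma_algebraType (predictable_rect F (horizon T))).
Local Notation PS := (PT * borelType U)%type.
Local Notation S := (R * borelType U)%type.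
Local Notation slabT := ([set z | horizon T z.2] : set PT).
Local Notation hor := (horizon T `*` setT : set S).
Local Notation cut E w := ([set p : S | E (w, p.1, p.2)]).

Let hT : horizon T T. Proof. by rewrite /horizon/= lexx ltW. Qed.
Let mhor : measurable hor. Proof. exact: (measurable_marks T measurableT). Qed.

Lemma measurable_section (f : PS -> R) w : measurable_fun setT f ->
  measurable_fun setT (fun p : S => f (w, p.1, p.2)).
Proof. by move=> mf; apply: (measurableT_comp mf); exact: (measurable_predSpace_section usual). Qed.

Context (zeta : R.-ker Omega ~> S).
Hypothesis pz : predictable_random_measure F (horizon T) zeta.
Hypothesis car : carried_by (horizon T) zeta.

Lemma integral_carried w (D : set S) (f : S -> \bar R) : measurable D -> measurable_fun D f ->
  (forall p, D p -> 0 <= f p) -> \int[zeta w]_(p in D) f p = \int[zeta w]_(p in D `&` hor) f p.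
Proof.
move=> mD mf f0.
rewrite (@ge0_negligible_integral _ _ _ (zeta w) D (~` hor))//.
  by rewrite setDE setCK.
exact: measurableC.
Qed.

Lemma measurable_kernel_integral (W : PS -> \bar R) : measurable_fun setT W -> (forall z, 0 <= W z) ->
  measurable_fun setT (fun w => \int[zeta w]_(p in hor) W (w, p.1, p.2)).
Proof.
move=> mW W0.
have mT : measurable_fun setT (fun w : FT T => \int[zeta w]_(p in `[0%R, T]%classic `*` setT) W (w, p.1, p.2)).
  apply: (measurable_comp (F := slabT) _ _ (pz (measurable_funTS mW) W0) (measurable_time_section usual hT)).
    exact: (measurable_slabT usual).
  by move=> _ [w _ <-].
have := adapted_measurable usual (ltW T0) mT; apply: eq_measurable_fun => w _.
by rewrite (_ : `[0%R, T]%classic `*` setT = hor).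
Qed.

Section one_density.
Context (g : PS -> R) (mg : measurable_fun setT g) (g0 : forall z, (0 <= g z)%R).

(** A random measure with a predictable density is again carried by the
    horizon and predictable; all intensity measures below arise in this way. *)
Definition weighted of usual_conditions P F & (0 < T)%R & predictable_random_measure F (horizon T) zeta &
    carried_by (horizon T) zeta :=
  fun w : Omega => (density (zeta w) (measurable_section w mg) (fun p : S => g0 (w, p.1, p.2)) :
    {measure set S -> \bar R}).

Local Notation kd := (weighted usual T0 pz car).

Lemma weightedE w C : kd w C = \int[zeta w]_(p in C) (g (w, p.1, p.2))%:E.
Proof. by []. Qed.

Lemma integral_weighted w (D : set S) (f : S -> \bar R) : measurable D -> measurable_fun D f ->
  (forall p, D p -> 0 <= f p) ->
  \int[kd w]_(p in D) f p = \int[zeta w]_(p in D) ((g (w, p.1, p.2))%:E * f p).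
Proof. by move=> mD mf f0; exact: integral_density. Qed.

Let measurable_weighted C : measurable C -> measurable_fun setT (kd ^~ C).
Proof.
move=> mC; pose E : set PS := [set z | horizon T z.1.2 /\ C (z.1.2, z.2)].
have mE : measurable E by exact: (measurable_deterministic usual).
have := @measurable_kernel_integral (fun z => (\1_E z * g z)%:E) _ _.
move=> /(_ _ _)/wrap[||h].
- by apply/measurable_EFinP; apply: measurable_funM => //; exact: measurable_indic.
- by move=> z; rewrite lee_fin mulr_ge0// indicE.
move: h; apply: eq_measurable_fun => w _; rewrite weightedE [RHS]integral_carried//; last 2 first.
- by apply: measurable_funTS; apply/measurable_EFinP; exact: measurable_section.
- by move=> p _; rewrite lee_fin.
rewrite (integral_mkcond hor) (integral_mkcond (C `&` hor)); apply: eq_integral => -[r u] _.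
rewrite !patchE indicE/=; have [[hr Cp]|n] := pselect (horizon T r /\ C (r, u)).
  by rewrite !mem_set ?mul1r.
rewrite (@memNset _ (C `&` hor)); last by case=> Cp [hr _]; apply: n.
rewrite (@memNset _ E); last by case=> hr Cp; apply: n.
by rewrite mul0r if_same.
Qed.

HB.instance Definition _ := isKernel.Build _ _ Omega S R kd measurable_weighted.

Lemma carried_weighted : carried_by (horizon T) (kd : R.-ker Omega ~> S).
Proof.
move=> w; rewrite weightedE integral_carried//; last 3 first.
- exact: measurableC.
- by apply: measurable_funTS; apply/measurable_EFinP; exact: measurable_section.
- by move=> p _; rewrite lee_fin.
by rewrite setICl integral_set0.
Qed.

Lemma predictable_weighted : predictable_random_measure F (horizon T) (kd : R.-ker Omega ~> S).
Proof.
move=> W mW W0.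
have mS := measurable_slab usual T0 (@measurableT _ (borelType U)).
have e0 : [set z : PS | horizon T z.1.2] = slab T setT by apply/seteqP; split=> z; rewrite /slab/=; [|case].
have mgW : measurable_fun ([set z | horizon T z.1.2] : set PS) (fun z : PS => (g z)%:E * W z).
  by apply: emeasurable_funM => //; apply: measurable_funTS; exact/measurable_EFinP.
have := pz mgW (fun z => mule_ge0 (g0 z : (0 <= (g z)%:E)) (W0 z)).
apply: eq_measurable_fun => -[w t] /set_mem /= ht.
have sub := @cylinder_horizon R U T t setT ht.
rewrite integral_weighted//.
- exact: measurable_cylinder.
- apply: (measurable_comp (F := slab T setT : set PS) mS _ _ _).
  + by move=> _ [p /sub[hp _] <-].
  + by rewrite -e0.
  + by apply: measurable_funTS; exact: (measurable_predSpace_section usual).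
Qed.

End one_density.

(** The kernel [k] that defines the Doleans measure need coincide with the
    predictable one only almost surely and on the horizon. *)
Section doleans_measure.
Context (k : R.-ker Omega ~> S).
Hypothesis kz : {ae P, forall w, forall C, measurable C -> C `<=` hor -> k w C = zeta w C}.

Lemma integral_kernel_horizon (f : Omega -> S -> \bar R) (D : set S) : D `<=` hor ->
  {ae P, forall w, \int[k w]_(p in D) f w p = \int[zeta w]_(p in D) f w p}.
Proof.
move=> Dh; move: kz; apply: filterS => w kw; apply: eq_measure_integral => C mC CD.
by apply: kw => //; exact: subset_trans Dh.
Qed.

Let fam E (mE : measurable E) : measurable_fun setT (fun w => trace_at usual mhor (zeta w) w E) :=
  @measurable_trace_at _ _ _ _ _ _ _ usual T0 zeta setT mhor E pz measurableT mE.

Lemma doleansE E : measurable E -> doleans P F T k E = mixture P fam E.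
Proof.
move=> mE; rewrite /doleans /mixture.
transitivity (\int[P]_w \int[zeta w]_(p in hor) (\1_E (w, p.1, p.2))%:E).
  apply: eq_integral_off_null.
  - by move=> w; apply: integral_ge0 => p _; rewrite lee_fin.
  - by move=> w; apply: integral_ge0 => p _; rewrite lee_fin.
  - exact: integral_kernel_horizon.
apply: eq_integral => w _.
transitivity (\int[zeta w]_(p in hor) (\1_(cut E w) p)%:E); first by [].
rewrite integral_indic; [|exact: mhor|exact: (measurable_sectionS usual)].
by rewrite setIC.
Qed.

Let doleans0 : doleans P F T k set0 = 0.
Proof. by rewrite doleansE// measure0. Qed.

Let doleans_ge0 E : 0 <= doleans P F T k E.
Proof. by apply: integral_ge0 => w _; apply: integral_ge0 => p _; rewrite lee_fin. Qed.

Let doleans_additive : semi_sigma_additive (doleans P F T k).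
Proof.
move=> E mE tE mUE; rewrite doleansE//.
rewrite (_ : (fun n => _) = fun n => \sum_(0 <= i < n) mixture P fam (E i)).
  exact: (@measure_semi_sigma_additive _ _ _ (mixture P fam) E mE tE mUE).
by apply/funext => n; apply: eq_bigr => i _; rewrite doleansE.
Qed.

Definition doleans_measure : {measure set PS -> \bar R} :=
  HB.pack (doleans P F T k) (isMeasure.Build _ _ _ (doleans P F T k) doleans0 doleans_ge0 doleans_additive).

Lemma integral_doleans (W : PS -> \bar R) : measurable_fun setT W -> (forall z, 0 <= W z) ->
  \int[doleans P F T k]_z W z = \int[P]_w \int[zeta w]_(p in hor) W (w, p.1, p.2).
Proof.
move=> mW W0; rewrite -[LHS]/(\int[doleans_measure]_z W z).
rewrite (eq_measure_integral (mixture P fam)) => [|E mE _]; last exact: doleansE.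
rewrite (@integral_mixture _ _ Omega PS R P (fun w => trace_at usual mhor (zeta w) w) fam (mixture P fam) W
  (fun _ _ => erefl) mW W0).
by apply: eq_integral => w _; rewrite integral_trace.
Qed.

Lemma integral_doleans_in (D : set PS) (f : PS -> R) : measurable D -> measurable_fun setT f -> (forall z, (0 <= f z)%R) ->
  \int[doleans P F T k]_(z in D) (f z)%:E =
  \int[P]_w \int[zeta w]_(p in hor `&` cut D w) (f (w, p.1, p.2))%:E.
Proof.
move=> mD mf f0.
have -> : \int[doleans P F T k]_(z in D) (f z)%:E = \int[doleans P F T k]_z ((EFin \o f) \_ D) z.
  exact: (integral_mkcond (mu := doleans_measure)).
rewrite integral_doleans; last 2 first.
- by apply/(measurable_restrictT _ mD); apply: measurable_funTS; exact/measurable_EFinP.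
- by move=> z; rewrite patchE; case: ifP => _; rewrite ?lee_fin.
apply: eq_integral => w _; rewrite (integral_mkcond hor) (integral_mkcond (hor `&` _)).
apply: eq_integral => -[r u] _; rewrite !patchE.
have [hr|nr] := pselect (horizon T r); last first.
  by rewrite (@memNset _ hor) ?(@memNset _ (hor `&` _))//; [case; case|case].
rewrite (@mem_set _ hor)//.
have [Dr|nD] := pselect (D (w, r, u)); first by rewrite !mem_set.
by rewrite !memNset// => -[].
Qed.

Lemma doleans_null (Z : set PS) : measurable Z -> (forall w, zeta w (hor `&` cut Z w) = 0) ->
  doleans_measure Z = 0.
Proof.
move=> mZ Z0; have : \int[doleans_measure]_(z in Z) 1%:E = 0.
  have m1 : measurable_fun setT (fun _ : PS => 1%R : R) by exact: measurable_cst.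
  rewrite (integral_doleans_in mZ m1 (fun=> ler01)).
  rewrite integral0_eq// => w _; rewrite integral_cst ?Z0 ?mule0//.
  apply: measurableI; first exact: (measurable_marks T measurableT).
  exact: (measurable_sectionS usual w mZ).
by rewrite integral_cst// mul1e.
Qed.

Lemma integral_doleans_box (H : set Omega) (s t : R) (A : set U) (f : PS -> R) :
  (0 <= s)%R -> (s <= t)%R -> (t <= T)%R -> F s H -> measurable (A : set (borelType U)) ->
  measurable_fun setT f -> (forall z, (0 <= f z)%R) ->
  \int[doleans P F T k]_(z in box H s t A) (f z)%:E =
  \int[P]_(w in H) \int[zeta w]_(p in [set r | (s < r <= t)%R] `*` A) (f (w, p.1, p.2))%:E.
Proof.
move=> s0 st tT FH mA mf f0.
have mbox : measurable (box H s t A : set PS) by apply: (measurable_box (rA := measurable)).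
rewrite (integral_doleans_in mbox mf f0).
rewrite [RHS]integral_mkcond; apply: eq_integral => w _; rewrite patchE; case: ifPn => [/set_mem Hw|nH].
  congr (integral _ _ _); apply/seteqP; split=> -[r u] /=; first by move=> [_ [[_ ?] ?]].
  move=> [/andP[sr rt] Au]; split; last by split=> //; split=> //; apply/andP.
  by split=> //; rewrite /horizon/= (le_trans s0 (ltW sr)) (le_trans rt).
rewrite (_ : _ `&` _ = set0) ?integral_set0// -subset0 => -[r u] [_ [[/mem_set]]].
by rewrite (negbTE nH).
Qed.

End doleans_measure.
End kernel_densities.

(** * Regular versions on the horizon *)

Section regular_version.
Context (R : realType) (d : measure_display) (Omega : measurableType d).
Context (P : probability Omega R) (F : R -> set (set Omega)) (T : R).
Context (U : ptopologicalType) (rA : set (set (borelType U))) (U_ : (set U)^nat).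
Context (X : normedModType R) (M : R -> set U -> dual X -> Omega -> R).
Hypothesis usual : usual_conditions P F.
Hypothesis T0 : (0 < T)%R.
Hypothesis rA_measurable : rA `<=` measurable.
Hypothesis exh : exhausting rA U_.
Local Notation PT := (g_sigma_algebraType (predictable_rect F (horizon T))).
Local Notation PS := (PT * borelType U)%type.
Local Notation S := (R * borelType U)%type.
Local Notation hor := (horizon T `*` setT : set S).
Local Notation cut E w := ([set p : S | E (w, p.1, p.2)]).
Context (zetaM : R.-ker Omega ~> S) (Q : Omega * R * U -> contlin (dual X) X).
Context (x_ : nat -> dual X).
Hypothesis dx : dense_seq x_.
Hypothesis mM : forall A x, rA A -> L2_martingale P F (@halfline R) (fun t => M t A x).
Hypothesis bounded_mass : {ae P, forall w, ereal_sup [set zetaM w (horizon T `*` A) | A in rA] < +oo}.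
Hypothesis varQ : variation_operator P F rA T (fun (x : X) (x' : dual X) => x' x : R)
  (ae_random P zetaM) (@halfline R) M zetaM Q.

Let mhor : measurable hor. Proof. exact: (measurable_marks T measurableT). Qed.
Let mQ0 (x1 x2 : dual X) : measurable_fun (slab T setT : set PS) (fun z => x2 (Q z x1) : R).
Proof. by have [h _ _] := varQ; exact: h. Qed.
Let mslab : measurable (slab T setT : set PS). Proof. exact: (measurable_slab usual T0). Qed.

Definition good_at (z : Omega * R * U) := [/\ forall x : dual X, (0 <= x (Q z x))%R,
  forall x1 x2 : dual X, x2 (Q z x1) = x1 (Q z x2) & `|Q z|%R = 1%R].

Let goodN : exists N, [/\ measurable N, P N = 0 & forall w, ~ N w ->
  zetaM w hor < +oo /\ {ae zetaM w, forall p, horizon T p.1 -> good_at (w, p.1, p.2)}].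
Proof.
have [_ mU bigU ex] := exh.
have [_ /ae_null_set[N1 [mN1 N10 g1]] _] := varQ.
have /ae_null_set[N2 [mN2 N20 g2]] := bounded_mass.
exists (N1 `|` N2); split; first exact: measurableU.
  by rewrite measureU0.
move=> w nN; have n1 : ~ N1 w by move=> h; apply: nN; left.
have n2 : ~ N2 w by move=> h; apply: nN; right.
split; last first.
  have := g1 w n1; apply: (@filterS _ _ (ae_filter_ringOfSetsType (zetaM w))) => p h hp; exact: h.
apply: le_lt_trans (g2 w n2).
have cvgm : zetaM w (horizon T `*` U_ n) @[n --> \oo] --> zetaM w hor.
  have -> : hor = \bigcup_n (horizon T `*` U_ n : set S).
    apply/seteqP; split=> -[r u] /=; last by move=> [n _ [hr _]].
    by move=> [hr _]; have : (\bigcup_n U_ n) u by [rewrite mU]; move=> [n _ Un]; exists n.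
  have [ndU _ _ _] := exh.
  apply: nondecreasing_cvg_mu.
  - by move=> n; exact: measurable_marks.
  - by apply: bigcupT_measurable => n; exact: measurable_marks.
  - by move=> n m nm; apply/subsetPset => -[r u] [hr /= Un]; split=> //=; exact: ndU nm _ Un.
rewrite -(cvg_lim _ cvgm)//; apply: lime_le; first by apply/cvg_ex; eexists; exact: cvgm.
apply: nearW => n; apply: ereal_sup_ubound; exists (U_ n) => //.
by apply: (ex n) => //; exact: bigU.
Qed.

Let N := projT1 (cid goodN).
Let mN : measurable N. Proof. by have [] := projT2 (cid goodN). Qed.
Let N0' : P N = 0. Proof. by have [] := projT2 (cid goodN). Qed.
Let goodP w : ~ N w -> zetaM w hor < +oo /\ {ae zetaM w, forall p, horizon T p.1 -> good_at (w, p.1, p.2)}.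
Proof. by have [_ _ h] := projT2 (cid goodN); exact: h. Qed.

Let zeta : R.-ker Omega ~> S := regularised zetaM mhor mN.

Let zeta_out w C : ~ N w -> zeta w C = zetaM w (C `&` hor). Proof. exact: (regularised_out zetaM mhor mN). Qed.
Let zeta_in w C : N w -> zeta w C = 0. Proof. exact: (regularised_in zetaM mhor mN). Qed.

Let zeta_fin w : zeta w setT < +oo.
Proof.
have [Nw|nN] := pselect (N w); first by rewrite zeta_in// ltry.
by rewrite zeta_out// setTI; exact: (goodP nN).1.
Qed.

Let car : carried_by (horizon T) zeta.
Proof.
move=> w; have [Nw|nN] := pselect (N w); first by rewrite zeta_in.
by rewrite zeta_out// setICl measure0.
Qed.

Let kz : {ae P, forall w, forall C, measurable C -> C `<=` hor -> zetaM w C = zeta w C}.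
Proof.
exists N; split=> // w /= /existsNP[C /not_implyP[mC /not_implyP[Ch nE]]].
by apply: contrapT => nN; apply: nE; rewrite zeta_out// setIidl.
Qed.

Let zeta_good w : {ae zeta w, forall p, good_at (w, p.1, p.2)}.
Proof.
have [Nw|nN] := pselect (N w); first by exists setT; split=> //; exact: zeta_in.
have [_ [B [mB B0 gB]]] := goodP nN.
exists ((B `&` hor) `|` ~` hor); split.
- by apply: measurableU; [exact: measurableI|exact: measurableC].
- rewrite zeta_out// setIUl setICl setU0; apply/eqP; rewrite eq_le measure_ge0 andbT -B0.
  have mI : measurable (B `&` hor `&` hor) by apply: measurableI => //; exact: measurableI.
  by apply: le_measure; rewrite ?inE// => p [[]].
- move=> p np; have [hp|nh] := pselect (horizon T p.1); [left; split=> //|by right => -[]].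
  by apply: gB => h; apply: np; exact: h.
Qed.

Let version (x : dual X) n (B : set U) : measurable (B : set (borelType U)) -> B `<=` U_ n ->
  exists V : R -> Omega -> R,
  [/\ predictable_process F (horizon T) (fun t w => (V t w)%:E),
      {ae P, forall w, cadlag (@halfline R) (V ^~ w)} &
      forall t, horizon T t -> {ae P, forall w, (V t w)%:E =
        \int[zeta w]_(p in `[0%R, t]%classic `*` B) (x (Q (w, p.1, p.2) x))%:E}].
Proof.
move=> mB BU; have [_ _ mU ex] := exh.
have rB : rA B by apply: (ex n).
have [_ _ /(_ B x x rB)[V [pV _ cV _] VE]] := varQ.
exists V; split.
- by first [exact: (predictable_process_horizon usual T0 pV)|exact: (predictable_process_horizon usual pV)].
- by apply: filterS cV => w [].
- move=> t ht; have Ih := @cylinder_horizon R U T t B ht.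
  move: (VE t ht) (@integral_kernel_horizon _ _ _ _ _ _ zeta zetaM kz
    (fun w p => (x (Q (w, p.1, p.2) x))%:E) _ Ih).
  by apply: filterS2 => w -> ->.
Qed.

Let pz : predictable_random_measure F (horizon T) zeta.
Proof.
have [ndU bigU mU ex] := exh.
move=> W mW W0.
exact: (@predictable_quadratic_variation _ _ _ P F T U usual T0 X x_ dx Q mQ0 zeta zeta_fin car zeta_good
  U_ ndU bigU mU version W mW W0).
Qed.

(** Failure of positivity or symmetry is tested on a dense sequence; unlike
    the condition for all functionals, this gives a predictable set. *)
Definition exceptional : set PS := slab T setT `&`
  ((\bigcup_n [set z | (x_ n (Q z (x_ n)) < 0)%R]) `|`
   \bigcup_n \bigcup_m [set z | x_ m (Q z (x_ n)) != x_ n (Q z (x_ m))]).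

Let measurable_exceptional : measurable exceptional.
Proof.
rewrite /exceptional setIUr; apply: measurableU.
  rewrite setI_bigcupr; apply: bigcupT_measurable => n.
  rewrite (_ : _ `&` _ = slab T setT `&` (fun z : PS => x_ n (Q z (x_ n)) : R) @^-1` `]-oo, 0%R[).
    by apply: mQ0 => //; exact: measurable_itv.
  by apply/seteqP; split=> z /=; rewrite in_itv.
rewrite setI_bigcupr; apply: bigcupT_measurable => n; rewrite setI_bigcupr.
apply: bigcupT_measurable => m.
rewrite (_ : _ `&` _ = slab T setT `&` (fun z : PS => x_ m (Q z (x_ n)) - x_ n (Q z (x_ m)) : R)%R @^-1` (~` [set 0%R])).
  apply: (measurable_funB (mQ0 (x_ n) (x_ m)) (mQ0 (x_ m) (x_ n))) => //.
  by apply: measurableC; exact: measurable_set1.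
apply/seteqP; split=> z /= [hz h]; split=> //; first by apply/eqP; rewrite subr_eq0.
by rewrite -subr_eq0; apply/eqP.
Qed.

Let null_exceptional w : zeta w (cut exceptional w) = 0.
Proof.
have mc : measurable (cut exceptional w) by exact: (measurable_sectionS usual w measurable_exceptional).
apply: (@negligibleP _ _ _ (zeta w) _ mc).1; have [B [mB B0 gB]] := zeta_good w; exists B; split=> // p [_ Ep].
apply: gB => -[pos sym _]; case: Ep => [[n _ /=]|[n _ [m _ /=]]].
  by rewrite ltNge pos.
by rewrite sym eqxx.
Qed.

Definition regular_operator (z : Omega * R * U) : contlin (dual X) X :=
  if `[< horizon T z.1.2 /\ ~ exceptional z >] then Q z else 0%R.
Local Notation Qr := regular_operator.

Lemma regular_operatorE z : horizon T z.1.2 -> ~ exceptional z -> Qr z = Q z.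
Proof. by move=> hz nz; rewrite /Qr asboolT. Qed.

Lemma regular_operator0 z : ~ (horizon T z.1.2 /\ ~ exceptional z) -> Qr z = 0%R.
Proof. by move=> nz; rewrite /Qr asboolF. Qed.

Lemma regular_operator_psd z : positive_symmetric (contlin_comp (to_bidual X) (Qr z)).
Proof.
have [[hz nz]|nz] := pselect (horizon T z.1.2 /\ ~ exceptional z); last first.
  rewrite regular_operator0//; split=> [a|a b].
    by rewrite -[leRHS]/(a ((0%R : contlin (dual X) X) a)) contlin0 linear0.
  rewrite -[LHS]/(b ((0%R : contlin (dual X) X) a)) -[RHS]/(a ((0%R : contlin (dual X) X) b)).
  by rewrite !contlin0 !linear0.
rewrite regular_operatorE//; apply: (positive_symmetric_dense dx) => [n|n m].
  rewrite leNgt; apply/negP => h; apply: nz; split; first by split.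
  by left; exists n.
apply/eqP; rewrite -[_ == _]negbK; apply/negP => h; apply: nz; split; first by split.
by right; exists n => //; exists m.
Qed.

Lemma measurable_regular_operator (x1 x2 : dual X) : measurable_fun setT (fun z : PS => x2 (Qr z x1) : R).
Proof.
have mD : measurable (slab T setT `\` exceptional : set PS) by exact: measurableD.
rewrite (_ : (fun z : PS => _) = (fun z => x2 (Q z x1) : R) \_ (slab T setT `\` exceptional)).
  apply/(measurable_restrictT _ mD); apply: (measurable_funS mslab _ (mQ0 x1 x2)); exact: subDsetl.
apply/funext => z; rewrite patchE; have [[hz nz]|nz] := pselect (horizon T z.1.2 /\ ~ exceptional z).
  by rewrite mem_set// regular_operatorE.
rewrite memNset ?regular_operator0 ?contlin0 ?linear0//.
by case=> -[h1 _] h2; exact: nz.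
Qed.

Let brackets A (x : dual X) : rA A -> exists V : R -> Omega -> R,
  covariation P F (@halfline R) (fun t => M t A x) (fun t => M t A x) V /\
  forall t, horizon T t -> {ae P, forall w, (V t w)%:E =
    \int[zeta w]_(p in `[0%R, t]%classic `*` A) (x (Qr (w, p.1, p.2) x))%:E}.
Proof.
move=> rA'; have [_ _ /(_ A x x rA')[V covV VE]] := varQ; exists V; split=> // t ht.
have mA : measurable (A : set (borelType U)) by exact: rA_measurable.
have Ih := @cylinder_horizon R U T t A ht.
have mI : measurable (`[0%R, t]%classic `*` A : set S) by exact: measurable_cylinder.
have := @integral_kernel_horizon _ _ _ _ _ _ zeta zetaM kz (fun w p => (x (Q (w, p.1, p.2) x))%:E) _ Ih.
move: (VE t ht); apply: filterS2 => w -> ->.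
have sec : measurable_fun (`[0%R, t]%classic `*` A : set S) (fun p => (w, p.1, p.2) : PS).
  by apply: measurable_funTS; exact: (measurable_predSpace_section usual).
apply: ae_eq_integral => //.
- apply/measurable_EFinP; apply: (measurable_comp (F := slab T setT : set PS) mslab _ (mQ0 x x) sec).
  by move=> _ [p /Ih[hp _] <-].
- apply/measurable_EFinP; apply: (measurableT_comp (measurable_regular_operator x x)); exact: sec.
exists (cut exceptional w); split.
- exact: (measurable_sectionS usual w measurable_exceptional).
- exact: null_exceptional.
- move=> p /= np; apply: contrapT => nE; apply: np => Ip; rewrite regular_operatorE//.
  by have [] := Ih _ Ip.
Qed.

Let Qr_ge0 (x : dual X) z : (0 <= x (Qr z x))%R.
Proof. by have [p _] := regular_operator_psd z; exact: (p x). Qed.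

Let mQrs (x : dual X) w : measurable_fun setT (fun p : S => (x (Qr (w, p.1, p.2) x))%:E).
Proof.
apply/measurable_EFinP; apply: (measurableT_comp (measurable_regular_operator x x)).
exact: (measurable_predSpace_section usual).
Qed.

Let measurable_block (x : dual X) (D : set S) : measurable D ->
  measurable_fun setT (fun w => \int[zeta w]_(p in D) (x (Qr (w, p.1, p.2) x))%:E).
Proof.
move=> mD; pose k : R.-ker Omega ~> S := weighted usual (measurable_regular_operator x x) (Qr_ge0 x) usual T0 pz car.
exact: (measurable_kernel k D mD).
Qed.

Let isoM A (x : dual X) s t H : rA A -> (0 <= s)%R -> (s <= t)%R -> (t <= T)%R -> F s H ->
  (ip P (incr (fun t => M t A x) H s t) (incr (fun t => M t A x) H s t))%:E =
  \int[doleans P F T zetaM]_(z in (box H s t A : set PS)) (x (Qr z x))%:E.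
Proof.
move=> rA' s0 st tT FH.
have mA : measurable (A : set (borelType U)) by exact: rA_measurable.
have mH := filtration_sub usual s0 FH.
have [V [covV VE]] := brackets x rA'.
have J0 (r : R) : halfline r -> (0 <= r)%R by [].
have [iVs iVt ->] := covariation_incr usual J0 (mM x rA') (mM x rA') covV s0 (le_trans s0 st) st FH.
have ht : horizon T t by rewrite /horizon/= tT (le_trans s0).
have hs : horizon T s by rewrite /horizon/= s0 (le_trans st).
have mI r : measurable (`[0%R, r]%classic `*` A : set S) by exact: measurable_cylinder.
have mB := @measurable_strip R U s t A mA.
pose a r w := \int[zeta w]_(p in `[0%R, r]%classic `*` A) (x (Qr (w, p.1, p.2) x))%:E.
pose b w := \int[zeta w]_(p in [set r | (s < r <= t)%R] `*` A) (x (Qr (w, p.1, p.2) x))%:E.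
have ab w : a t w = a s w + b w.
  rewrite /a (cylinder_split A s0 st) ge0_integral_setU//.
  - by apply: measurable_funTS; exact: mQrs.
  - by move=> p _; rewrite lee_fin.
  - by apply/eqP; exact: cylinder_strip_disjoint.
have EV r : horizon T r -> P.-integrable setT (EFin \o V r) ->
    ((\int[P]_(w in H) V r w)%R)%:E = \int[P]_(w in H) a r w.
  move=> hr iV; rewrite /Rintegral fineK; last first.
    by apply: integrable_fin_num => //; exact: integrableS iV.
  apply: ae_eq_integral => //.
  - by apply/measurable_EFinP; apply: measurable_funTS; have /integrableP[/measurable_EFinP] := iV.
  - by apply: measurable_funTS; exact: measurable_block.
  - by apply: filterS (VE r hr) => w ->.
rewrite EFinB EV// EV// (eq_integral (fun w => a s w + b w)) => [|w _]; last exact: ab.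
rewrite ge0_integralD//; last 4 first.
- by move=> w _; apply: integral_ge0 => p _; rewrite lee_fin.
- by apply: measurable_funTS; exact: measurable_block.
- by move=> w _; apply: integral_ge0 => p _; rewrite lee_fin.
- by apply: measurable_funTS; exact: measurable_block.
rewrite addeAC subee ?add0e; last first.
  by rewrite -EV.
by rewrite (integral_doleans_box usual T0 pz kz s0 st tT FH mA (measurable_regular_operator x x) (Qr_ge0 x)).
Qed.

Let time_zero : {ae P, forall w, zeta w ([set 0%R] `*` setT) = 0}.
Proof.
have [ndU bigU mU ex] := exh.
have rU k : rA (U_ k) by apply: (ex k).
have h0 : horizon T 0%R by rewrite /horizon/= lexx ltW.
have ae1 n k : {ae P, forall w, \int[zeta w]_(p in [set 0%R] `*` U_ k) (x_ n (Qr (w, p.1, p.2) (x_ n)))%:E = 0}.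
  have [V [[_ V0 _ _] VE]] := brackets (x_ n) (rU k).
  move: V0 (VE _ h0); apply: filterS2 => w -> /esym.
  by rewrite set_itv1.
have : {ae P, forall w, forall n k, \int[zeta w]_(p in [set 0%R] `*` U_ k) (x_ n (Qr (w, p.1, p.2) (x_ n)))%:E = 0}.
  by apply: ae_foralln => n; apply: ae_foralln => k; exact: ae1.
apply: filterS => w int0.
have mD k : measurable ([set 0%R] `*` U_ k : set S) by apply: measurableX => //; exact: measurable_set1.
have z0 k : zeta w ([set 0%R] `*` U_ k) = 0.
  apply: (@negligibleP _ _ _ (zeta w) _ (mD k)).1.
  have aen n : {ae zeta w, forall p, ([set 0%R] `*` U_ k : set S) p -> (x_ n (Qr (w, p.1, p.2) (x_ n)))%:E = 0}.
    apply: (ae_eq_integral_abs (zeta w) (mD k) _).1; first by apply: measurable_funTS; exact: mQrs.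
    by rewrite -[RHS](int0 n k); apply: eq_integral => p _; rewrite gee0_abs// lee_fin.
  have [B1 [mB1 B10 g1]] := zeta_good w.
  have [B2 [mB2 B20 g2]] := @ae_foralln _ _ _ (zeta w) _ aen.
  have mE := measurable_sectionS usual w measurable_exceptional.
  have neg : (zeta w).-negligible ((B1 `|` B2) `|` cut exceptional w).
    apply: negligibleU; first by apply: negligibleU; [exists B1; split|exists B2; split].
    by exists (cut exceptional w); split=> //; exact: null_exceptional.
  apply: negligibleS neg.
  move=> p Dp; apply: contrapT => nB.
  have gp : good_at (w, p.1, p.2) by apply: contrapT => h; apply: nB; left; left; apply: g1.
  have zp : forall n, (x_ n (Qr (w, p.1, p.2) (x_ n)))%:E = 0.
    by move=> n; apply: contrapT => h; apply: nB; left; right; apply: g2 => /(_ n Dp).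
  have [n] := let: And3 a b c := gp in diagonal_positive dx a b c.
  have := zp n; rewrite regular_operatorE => [[->]||]; rewrite ?ltxx//.
    by case: Dp => /= ->.
  by move=> Ep; apply: nB; right.
have -> : [set 0%R] `*` setT = \bigcup_k ([set 0%R] `*` U_ k : set S).
  apply/seteqP; split=> -[r u] /=; last by move=> [k _ []].
  by move=> [-> _]; have : (\bigcup_n U_ n) u by [rewrite bigU]; move=> [k _ Uk]; exists k.
have mB : measurable (\bigcup_k ([set 0%R] `*` U_ k : set S)) by exact: bigcupT_measurable.
apply: (@negligibleP _ _ _ (zeta w) _ mB).1; apply: negligible_bigcup => k.
by apply: (@negligibleP _ _ _ (zeta w) _ (mD k)).2; exact: z0.
Qed.

(** The random measure is given on the half line and is not predictable by
    assumption; on the horizon it has a finite version, zero on an exceptional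
    event, that is predictable because its products with the diagonal values
    of the operator are brackets of [M]. *)
Lemma regular_quadratic_variation : exists zeta : R.-ker Omega ~> S,
  [/\ carried_by (horizon T) zeta, predictable_random_measure F (horizon T) zeta,
    {ae P, forall w, forall C, measurable C -> C `<=` hor -> zetaM w C = zeta w C},
    (forall w, zeta w (cut exceptional w) = 0) &
    {ae P, forall w, zeta w ([set 0%R] `*` setT) = 0}] /\
  [/\ measurable exceptional &
    forall A (x : dual X) s t H, rA A -> (0 <= s)%R -> (s <= t)%R -> (t <= T)%R -> F s H ->
      (ip P (incr (fun t => M t A x) H s t) (incr (fun t => M t A x) H s t))%:E =
      \int[doleans P F T zetaM]_(z in (box H s t A : set PS)) (x (Qr z x))%:E].
Proof.
exists zeta; split; first by split=> //; exact: time_zero.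
by split.
Qed.

End regular_version.

(** * The isometry on the whole ring *)

Section cylindrical.
Context (R : realType) (d : measure_display) (Omega : measurableType d).
Context (P : probability Omega R) (E : normedModType R) (Z : E -> Omega -> R).
Hypothesis cZ : cylindrical_rv P Z.
Local Open Scope ring_scope.

Let cylindrical0 : {ae P, forall w, Z 0 w = 0}.
Proof.
have [_ /(_ 1 0 0) h _] := cZ; move: h; apply: filterS => w.
by rewrite scaler0 addr0 mul1r => h; apply: (addrI (Z 0 w)); rewrite addr0 -h.
Qed.

Lemma cylindrical_scale (c : R) x : {ae P, forall w, Z (c *: x) w = c * Z x w}.
Proof.
have [_ /(_ c x 0) h _] := cZ; move: cylindrical0 h; apply: filterS2 => w z0.
by rewrite addr0 z0 addr0.
Qed.

Lemma cylindrical_add x y : {ae P, forall w, Z (x + y) w = Z x w + Z y w}.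
Proof.
by have [_ /(_ 1 x y) h _] := cZ; move: h; apply: filterS => w; rewrite scale1r mul1r.
Qed.

Lemma cylindrical_sub x y : {ae P, forall w, Z (x - y) w = Z x w - Z y w}.
Proof.
move: (cylindrical_add x (- y)) (cylindrical_scale (-1) y); apply: filterS2 => w -> .
by rewrite scaleN1r => ->; rewrite mulN1r.
Qed.

End cylindrical.

Lemma ip_sqD (R : realType) d (Omega : measurableType d) (P : probability Omega R) (f g : Omega -> R) :
  sqint P f -> sqint P g ->
  (ip P (fun w => f w + g w) (fun w => f w + g w) = ip P f f + 2 * ip P f g + ip P g g)%R.
Proof.
move=> sf sg; have sp := sqintD sf sg.
by rewrite ipDl// (ipC P f) (ipC P g) !ipDl// (ipC P g f); lra.
Qed.

Lemma ip_polar (R : realType) d (Omega : measurableType d) (P : probability Omega R) (f g : Omega -> R) :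
  sqint P f -> sqint P g -> (4 * ip P f g = ip P (fun w => f w + g w) (fun w => f w + g w) -
    ip P (fun w => f w - g w) (fun w => f w - g w))%R.
Proof.
move=> sf sg; have sm := sqintB sf sg; rewrite ip_sqD//.
have -> : (ip P (fun w => f w - g w) (fun w => f w - g w) = ip P f f - 2 * ip P f g + ip P g g)%R.
  by rewrite ipBl// (ipC P f) (ipC P g) !ipBl// (ipC P g f); lra.
lra.
Qed.

Section ito_extension.
Context (R : realType) (d : measure_display) (Omega : measurableType d).
Context (P : probability Omega R) (F : R -> set (set Omega)) (T : R).
Context (U : ptopologicalType) (rA : set (set (borelType U))) (U_ : (set U)^nat).
Context (E : normedModType R) (N : R -> set U -> E -> Omega -> R).
Hypothesis usual : usual_conditions P F.
Hypothesis ringA : setring rA.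
Hypothesis rA_measurable : rA `<=` measurable.
Hypothesis exh : exhausting rA U_.
Hypothesis hN : orthogonal_mvm P F rA U_ (horizon T) N.
Local Notation PS := (predSpace F T U).
Context (mu : {measure set PS -> \bar R}) (B : Omega * R * U -> contlin E (dual E)).
Hypothesis mB : forall x y, measurable_fun setT (fun z : PS => B z x y : R).
Hypothesis psB : forall z, positive_symmetric (B z).
Hypothesis block : forall k A (y : E) s t H, measurable (A : set (borelType U)) -> A `<=` U_ k -> (`|y| <= 1)%R ->
  (0 <= s)%R -> (s <= t)%R -> (t <= T)%R -> F s H ->
  (ip P (incr (fun t => N t A y) H s t) (incr (fun t => N t A y) H s t))%:E =
  \int[mu]_(z in (box H s t A : set PS)) (B z y y)%:E.

Local Open Scope ring_scope.

Let J1 (r : R) : horizon T r -> 0 <= r. Proof. by case/andP. Qed.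

Let mN A y : rA A -> L2_martingale P F (horizon T) (fun t => N t A y).
Proof. by case: hN => _ _ + _ _; apply. Qed.

Let sN t A y : rA A -> horizon T t -> sqint P (N t A y).
Proof. by move=> rA' ht; exact: (L2_martingale_sqint usual J1 (mN y rA')). Qed.

Let B0 z y : 0 <= B z y y. Proof. by have [p _] := psB z; exact: p. Qed.

Section fixed_block.
Context (y : E) (H : set Omega) (s t : R).
Hypothesis s0 : 0 <= s.
Hypothesis st : s < t.
Hypothesis tT : t <= T.
Hypothesis FH : F s H.

Let hs : horizon T s. Proof. by rewrite /horizon/= s0 (le_trans (ltW st)). Qed.
Let ht : horizon T t. Proof. by rewrite /horizon/= tT (le_trans s0 (ltW st)). Qed.
Let mH : measurable H. Proof. exact: (filtration_sub usual s0 FH). Qed.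
Let iN A (x : E) := incr (fun t => N t A x) H s t.
Let siN A x : rA A -> sqint P (iN A x).
Proof. by move=> rA'; apply: sqint_incr => //; exact: sN. Qed.

Let scale_block A (c : R) (x : E) : rA A -> ip P (iN A (c *: x)) (iN A (c *: x)) = c ^+ 2 * ip P (iN A x) (iN A x).
Proof.
move=> rA'; have [cN _ _ _ _] := hN.
have h r : horizon T r -> {ae P, forall w, N r A (c *: x) w = c * N r A x w}.
  by move=> hr; exact: (cylindrical_scale (cN r A hr rA')).
have ae : {ae P, forall w, iN A (c *: x) w = c * iN A x w}.
  by move: (h s hs) (h t ht); apply: filterS2 => w e1 e2; rewrite /iN /incr e1 e2 -mulrBr mulrCA.
have si := siN x rA'; have sc := sqintZ c si.
rewrite (ip_ae ae ae) ?(siN _ rA').1 ?sc.1//; try exact: (siN _ rA').1; try exact: sc.1.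
by rewrite ipZl// ipC ipZl// mulrA expr2.
Qed.

Let block_all k A : measurable (A : set (borelType U)) -> A `<=` U_ k ->
  ((ip P (iN A y) (iN A y))%:E = \int[mu]_(z in (box H s t A : set PS)) (B z y y)%:E)%E.
Proof.
move=> mA AU; have rA' : rA A by case: exh => _ _ _; apply; eauto.
pose c := Num.max 1 `|y|; have c0 : 0 < c by rewrite lt_max ltr01.
pose x := c^-1 *: y; have yE : y = c *: x by rewrite /x scalerA divff ?scale1r// gt_eqF.
have x1 : `|x| <= 1 by rewrite normrZ normfV (ger0_norm (ltW c0)) mulrC ler_pdivrMr// mul1r le_max lexx orbT.
rewrite {1 2}yE scale_block// EFinM (block mA AU x1 s0 (ltW st) tT FH) -ge0_integralZl_EFin//.
- have scaleB z : B z y y = c ^+ 2 * B z x x.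
    by rewrite yE [LHS](contlin_argZ (B z (c *: x)) c x) bilinear_argZl expr2 -mulrA.
  by apply: eq_integral => z _; rewrite scaleB EFinM.
- by apply: (measurable_box rA_measurable).
- by move=> z _; rewrite lee_fin.
- by apply: measurable_funTS; apply/measurable_EFinP; exact: mB.
- exact: sqr_ge0.
Qed.

Lemma ito_strict A : rA A ->
  ((ip P (iN A y) (iN A y))%:E = \int[mu]_(z in (box H s t A : set PS)) (B z y y)%:E)%E.
Proof.
move=> rA'; have [ndU bigU mU ex] := exh; have [_ _ _ sig ortho] := hN.
have mA := rA_measurable rA'.
pose A1 n := A `&` U_ n; pose A2 n := A `\` A1 n.
have mA1 n : measurable (A1 n : set (borelType U)) by exact: measurableI.
have sub n : A1 n `<=` U_ n by move=> u [].
have rA1 n : rA (A1 n) by apply: (ex n).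
have rA2 n : rA (A2 n) by case: ringA => _ _; apply.
have disj n : A1 n `&` A2 n = set0 by rewrite -subset0 => u [? []].
have uni n : A1 n `|` A2 n = A by rewrite /A2 setDUK// => u [].
have t0 : 0 < t by exact: le_lt_trans st.
have add n r : horizon T r -> {ae P, forall w, N r A y w = N r (A1 n) y w + N r (A2 n) y w}.
  by move=> hr; have := mvm_additive ringA y J1 hN hr (rA1 n) (rA2 n) (disj n); rewrite uni.
have pyth n : ip P (iN A y) (iN A y) = ip P (iN (A1 n) y) (iN (A1 n) y) + ip P (iN (A2 n) y) (iN (A2 n) y).
  have s1 := siN y (rA1 n); have s2 := siN y (rA2 n); have s12 := sqintD s1 s2.
  have ae : {ae P, forall w, iN A y w = iN (A1 n) y w + iN (A2 n) y w}.
    by move: (add n s hs) (add n t ht); apply: filterS2 => w e1 e2; rewrite /iN /incr e1 e2; ring.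
  rewrite (ip_ae ae ae (siN y rA').1 s12.1 (siN y rA').1 s12.1).
  have cross : ip P (iN (A1 n) y) (iN (A2 n) y) = 0.
    have cov := ortho _ _ y (rA1 n) (rA2 n) (disj n).
    have [_ _] := covariation_incr usual J1 (mN y (rA1 n)) (mN y (rA2 n)) cov hs ht (ltW st) FH.
    by rewrite subrr.
  by rewrite ip_sqD// cross mulr0 addr0.
have small n (e : R) : (L2norm P (fun w => (N t A y w - N t (A1 n) y w)%R) <= e%:E)%E ->
    ip P (iN (A2 n) y) (iN (A2 n) y) <= e ^+ 2.
  move=> he; have sd := sqintB (sN y rA' ht) (sN y (rA1 n) ht).
  have ae : {ae P, forall w, N t (A2 n) y w = N t A y w - N t (A1 n) y w}.
    by move: (add n t ht); apply: filterS => w ->; rewrite addrC addKr.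
  apply: le_trans (ip_le_L2norm sd he).
  rewrite -(ip_ae ae ae (sN y (rA2 n) ht).1 sd.1 (sN y (rA2 n) ht).1 sd.1).
  have [mart _ _ _] := mN y (rA2 n).
  set m1 := N t (A2 n) y; set m0 := N s (A2 n) y.
  have sm1 : sqint P m1 by exact: sN.
  have sm0 : sqint P m0 by exact: sN.
  have sm := sqintB sm1 sm0.
  apply: le_trans (ip_indic_le mH sm) _.
  have orth : ip P m0 (fun w => m1 w - m0 w) = 0.
    apply: (martingale_orthogonal usual J1 mart hs ht (ltW st)) => //.
    exact: (martingale_measurable usual J1 mart hs).
  have -> : ip P m1 m1 = ip P (fun w => m1 w - m0 w) (fun w => m1 w - m0 w) + ip P m0 m0.
    have := ip_sqD sm sm0; rewrite ipC orth mulr0 addr0.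
    by rewrite (_ : (fun w => _) = m1)//; apply/funext => w; rewrite subrK.
  by rewrite lerDl ip_ge0.
have cvgI : (\int[mu]_(z in (box H s t (A1 n) : set PS)) (B z y y)%:E @[n --> \oo] -->
    \int[mu]_(z in (box H s t A : set PS)) (B z y y)%:E)%E.
  have -> : (box H s t A : set PS) = \bigcup_n (box H s t (A1 n)).
    apply/seteqP; split=> [z [h Az]|z [n _ [h [Az _]]]]; last by split.
    have : (\bigcup_n U_ n) z.2 by rewrite bigU.
    by move=> [n _ Un]; exists n => //; split.
  apply: ge0_nondecreasing_set_cvg_integral.
  - by move=> n m nm; apply/subsetPset => z [h [Az Un]]; split=> //; split=> //; exact: ndU nm _ Un.
  - by move=> n; apply: (measurable_box rA_measurable).
  - by move=> n; apply: measurable_funTS; apply/measurable_EFinP; exact: mB.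
  - by move=> n z _; rewrite lee_fin.
have IE n : (\int[mu]_(z in (box H s t (A1 n) : set PS)) (B z y y)%:E)%E = (ip P (iN (A1 n) y) (iN (A1 n) y))%:E.
  by rewrite -(block_all (mA1 n) (sub n)).
apply/eqP; rewrite eq_le; apply/andP; split; last first.
  rewrite -(cvg_lim _ cvgI)//; apply: lime_le; first by apply/cvg_ex; eexists; exact: cvgI.
  by apply: nearW => n; rewrite IE lee_fin (pyth n) lerDl ip_ge0.
apply/lee_addgt0Pr => e e0; pose r := Num.sqrt e.
have r0 : 0 < r by rewrite sqrtr_gt0.
have [_ _ _ _ /(_ A rA')] := sig t y ht t0.
move=> /fine_cvgP[ffin /cvgrPdist_le/(_ r r0)]; move: ffin; rewrite !nearE => -[n1 _ h1] [n2 _ h2].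
pose n := maxn n1 n2.
have ln : (L2norm P (fun w => (N t A y w - N t (A1 n) y w)%R) <= r%:E)%E.
  have f1 := h1 n (leq_maxl _ _); have := h2 n (leq_maxr _ _); rewrite /= sub0r normrN.
  by move=> h; rewrite -(fineK f1) lee_fin; apply: le_trans h; exact: ler_norm.
rewrite (pyth n) EFinD; apply: leeD; last first.
  by rewrite lee_fin -(sqr_sqrtr (ltW e0)); exact: small.
rewrite -IE; apply: ge0_subset_integral.
- by apply: (measurable_box rA_measurable).
- by apply: (measurable_box rA_measurable).
- by apply: measurable_funTS; apply/measurable_EFinP; exact: mB.
- by move=> z _; rewrite lee_fin.
- by move=> z [h [Az _]]; split.
Qed.

Lemma ito_polar_strict A x : rA A -> 4 * ip P (iN A y) (iN A x) =
  ip P (iN A (y + x)) (iN A (y + x)) - ip P (iN A (y - x)) (iN A (y - x)).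
Proof.
move=> rA'; have [cN _ _ _ _] := hN.
have s1 := siN y rA'; have s2 := siN x rA'; have sp := sqintD s1 s2; have sm := sqintB s1 s2.
have aep : {ae P, forall w, iN A (y + x) w = iN A y w + iN A x w}.
  move: (cylindrical_add (cN s A hs rA') y x) (cylindrical_add (cN t A ht rA') y x).
  by apply: filterS2 => w e1 e2; rewrite /iN /incr e1 e2; ring.
have aem : {ae P, forall w, iN A (y - x) w = iN A y w - iN A x w}.
  move: (cylindrical_sub (cN s A hs rA') y x) (cylindrical_sub (cN t A ht rA') y x).
  by apply: filterS2 => w e1 e2; rewrite /iN /incr e1 e2; ring.
have sp' := siN (y + x) rA'; have sm' := siN (y - x) rA'.
rewrite (ip_ae aep aep sp'.1 sp.1 sp'.1 sp.1) (ip_ae aem aem sm'.1 sm.1 sm'.1 sm.1).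
exact: ip_polar.
Qed.

End fixed_block.

(** The two parts of a set cut by [U_ n] give orthogonal martingales, and the
    outer one tends to 0. *)
Lemma ito_isometry_ring A y s t H : rA A -> 0 <= s -> s <= t -> t <= T -> F s H ->
  ((ip P (incr (fun t => N t A y) H s t) (incr (fun t => N t A y) H s t))%:E =
  \int[mu]_(z in (box H s t A : set PS)) (B z y y)%:E)%E.
Proof.
move=> rA' s0; rewrite le_eqVlt => /predU1P[<- sT FH|st tT FH]; last exact: ito_strict.
rewrite (_ : box H s s A = set0) ?integral_set0; last first.
  by rewrite -subset0 => z [[_ /= /andP[a b]] _]; move: (lt_le_trans a b); rewrite ltxx.
rewrite (_ : incr _ H s s = fun=> 0) ?ip0l//.
by apply/funext => w; rewrite /incr subrr mulr0.
Qed.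

Lemma ito_polarization A x y s t H : rA A -> 0 <= s -> s <= t -> t <= T -> F s H ->
  4 * ip P (incr (fun t => N t A x) H s t) (incr (fun t => N t A y) H s t) =
  ip P (incr (fun t => N t A (x + y)) H s t) (incr (fun t => N t A (x + y)) H s t) -
  ip P (incr (fun t => N t A (x - y)) H s t) (incr (fun t => N t A (x - y)) H s t).
Proof.
move=> rA' s0; rewrite le_eqVlt => /predU1P[<- sT FH|st tT FH]; last exact: ito_polar_strict.
have z (m : R -> Omega -> R) : incr m H s s = fun=> 0.
  by apply/funext => w; rewrite /incr subrr mulr0.
by rewrite !z ip0l mulr0 subrr.
Qed.

End ito_extension.

(** * Brackets and intensity measures of the integral *)

Lemma bounded_variation_sub (R : realType) (a b : R) (f g : R -> R) : (a <= b)%R ->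
  bounded_variation a b f -> bounded_variation a b g -> bounded_variation a b (fun t => f t - g t)%R.
Proof.
rewrite le_eqVlt => /predU1P[<- _ _|ab bf bg]; first exact: bounded_variationxx.
by have := bounded_variationD ab bf (bounded_variationN bg).
Qed.

Lemma cadlag_sub (R : realType) (J : set R) (f g : R -> R) : cadlag J f -> cadlag J g ->
  cadlag J (fun t => f t - g t)%R.
Proof.
move=> cf cg t Jt; have [f1 [lf f2]] := cf t Jt; have [g1 [lg g2]] := cg t Jt; split.
  exact: cvgB f1 g1.
by exists (lf - lg)%R; exact: cvgB f2 g2.
Qed.

Lemma integral_difference (R : realType) d (Omega : measurableType d) (P : probability Omega R)
    (H : set Omega) (f g : Omega -> R) (h : Omega -> \bar R) : measurable H ->
  P.-integrable setT (EFin \o f) -> P.-integrable setT (EFin \o g) -> (forall w, (0 <= g w)%R) ->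
  measurable_fun setT h -> (forall w, 0 <= h w) -> {ae P, forall w, (f w)%:E = (g w)%:E + h w} ->
  \int[P]_(w in H) h w = ((\int[P]_(w in H) f w)%R - (\int[P]_(w in H) g w)%R)%:E.
Proof.
move=> mH /(integrableS measurableT mH (@subsetT _ _)) jf /(integrableS measurableT mH (@subsetT _ _)) jg g0 mh h0 fgh.
have mf : measurable_fun H (EFin \o f) by have /integrableP[] := jf.
have mg : measurable_fun H (EFin \o g) by have /integrableP[] := jg.
have mhH : measurable_fun H h by exact: measurable_funTS.
rewrite EFinB /Rintegral !fineK; [|exact: integrable_fin_num|exact: integrable_fin_num].
have -> : \int[P]_(w in H) (f w)%:E = \int[P]_(w in H) (g w)%:E + \int[P]_(w in H) h w.
  rewrite -ge0_integralD//; last by move=> w _; rewrite lee_fin.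
  apply: ae_eq_integral => //; first exact: emeasurable_funD.
  by apply: filterS fgh => w -> _.
by rewrite addeAC subee ?add0e//; exact: integrable_fin_num.
Qed.

Section brackets.
Context (R : realType) (d : measure_display) (Omega : measurableType d).
Context (P : probability Omega R) (F : R -> set (set Omega)) (T : R).
Context (U : ptopologicalType) (rA : set (set (borelType U))).
Context (E : normedModType R) (N : R -> set U -> E -> Omega -> R).
Hypothesis usual : usual_conditions P F.
Hypothesis T0 : (0 < T)%R.
Hypothesis rA_measurable : rA `<=` measurable.
Hypothesis mN : forall A y, rA A -> L2_martingale P F (horizon T) (fun t => N t A y).
Local Notation PT := (g_sigma_algebraType (predictable_rect F (horizon T))).
Local Notation PS := (PT * borelType U)%type.
Local Notation S := (R * borelType U)%type.
Local Notation slabT := ([set z | horizon T z.2] : set PT).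
Local Notation hor := (horizon T `*` setT : set S).
Context (zeta : R.-ker Omega ~> S).
Hypothesis pz : predictable_random_measure F (horizon T) zeta.
Hypothesis car : carried_by (horizon T) zeta.
Hypothesis time_zero : {ae P, forall w, zeta w ([set 0%R] `*` setT) = 0}.
Context (B : Omega * R * U -> contlin E (dual E)).
Hypothesis mB : forall x y, measurable_fun setT (fun z : PS => B z x y : R).
Hypothesis B0 : forall y z, (0 <= B z y y)%R.

(** The density is the value of the quadratic form of [B] at [y]; this turns
    out to be the intensity of [N] at [y]. *)
Definition form_measure (y : E) : R.-ker Omega ~> S :=
  weighted usual (mB y y) (B0 y) usual T0 pz car.
Local Notation k y := (form_measure y).

Lemma form_measureE y w C : k y w C = \int[zeta w]_(p in C) (B (w, p.1, p.2) y y)%:E.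
Proof. by []. Qed.

Lemma carried_form y : carried_by (horizon T) (k y).
Proof. exact: carried_weighted. Qed.

Lemma predictable_form y : predictable_random_measure F (horizon T) (k y).
Proof. exact: predictable_weighted. Qed.

Hypothesis iso : forall A y s t H, rA A -> (0 <= s)%R -> (s <= t)%R -> (t <= T)%R -> F s H ->
  (ip P (incr (fun t => N t A y) H s t) (incr (fun t => N t A y) H s t))%:E =
  \int[P]_(w in H) k y w ([set r | (s < r <= t)%R] `*` A).
Hypothesis polar : forall A x y s t H, rA A -> (0 <= s)%R -> (s <= t)%R -> (t <= T)%R -> F s H ->
  (4 * ip P (incr (fun t => N t A x) H s t) (incr (fun t => N t A y) H s t) =
  ip P (incr (fun t => N t A (x + y)%R) H s t) (incr (fun t => N t A (x + y)%R) H s t) -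
  ip P (incr (fun t => N t A (x - y)%R) H s t) (incr (fun t => N t A (x - y)%R) H s t))%R.

Let J1 (r : R) : horizon T r -> (0 <= r)%R. Proof. by case/andP. Qed.
Let h0 : horizon T 0%R. Proof. by rewrite /horizon/= lexx ltW. Qed.
Let hT : horizon T T. Proof. by rewrite /horizon/= lexx ltW. Qed.

Let msec y w (D : set S) : measurable_fun D (fun p => (B (w, p.1, p.2) y y)%:E).
Proof. by apply: measurable_funTS; apply/measurable_EFinP; exact: (measurable_section usual w (mB y y)). Qed.

Let mk y C : measurable C -> measurable_fun setT (k y ^~ C).
Proof. exact: measurable_kernel. Qed.

Lemma form_measure_zero y : {ae P, forall w, k y w ([set 0%R] `*` setT) = 0}.
Proof.
apply: filterS time_zero => w z0; rewrite form_measureE; apply: null_set_integral => //.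
  by apply: measurableX => //; exact: measurable_set1.
Qed.

Let k_zero y : {ae P, forall w, forall A, measurable A -> k y w ([set 0%R] `*` A) = 0}.
Proof.
apply: filterS (form_measure_zero y) => w z0 A mA.
apply: (@subset_measure0 _ _ _ (k y w) _ ([set 0%R] `*` setT)) => //.
- by apply: measurableX => //; exact: measurable_set1.
- by apply: measurableX => //; exact: measurable_set1.
- by move=> p [].
Qed.

Let k_split y A s t : rA A -> (0 <= s)%R -> (s <= t)%R -> forall w,
  k y w (`[0%R, t]%classic `*` A) = k y w (`[0%R, s]%classic `*` A) + k y w ([set r | (s < r <= t)%R] `*` A).
Proof. by move=> rA' s0 st w; apply: measure_cylinder_split => //; exact: rA_measurable. Qed.

Let k_upto y A t : rA A -> horizon T t ->
  {ae P, forall w, k y w (`[0%R, t]%classic `*` A) = k y w ([set r | (0 < r <= t)%R] `*` A)}.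
Proof.
move=> rA' /andP[t0 tT]; apply: filterS (k_zero y) => w z.
rewrite (k_split y rA' (lexx 0) t0) set_itv1 z ?add0e//; exact: rA_measurable.
Qed.

Lemma form_measure_integrable y A : rA A -> \int[P]_w k y w (horizon T `*` A) < +oo.
Proof.
move=> rA'; have mA := rA_measurable rA'; have [F0 _] := usual; have FT := filtrationT usual (lexx 0%R).
rewrite (ae_eq_integral (fun w => k y w ([set r | (0 < r <= T)%R] `*` A)))//.
- by rewrite -(iso y rA' (lexx 0%R) (ltW T0) (lexx T) FT) ltry.
- by apply: mk; apply: (measurable_marks T mA).
- by apply: mk; exact: measurable_strip.
by apply: filterS (k_upto y rA' hT) => w + _ => <-; congr (k y w _).
Qed.

Lemma form_measure_finite y A : rA A -> {ae P, forall w, k y w (horizon T `*` A) < +oo}.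
Proof.
move=> rA'; have mA := rA_measurable rA'; have mH := measurable_marks T mA.
have : P.-integrable setT (fun w => k y w (horizon T `*` A)).
  apply/integrableP; split; first exact: mk.
  rewrite (eq_integral (fun w => k y w (horizon T `*` A))) => [|w _]; first exact: form_measure_integrable.
  by rewrite gee0_abs.
move=> /(integrable_ae measurableT); apply: filterS => w /(_ I) h.
by rewrite ltey_eq h.
Qed.

Section one_set.
Context (A : set U) (rA' : rA A).
Let mA : measurable (A : set (borelType U)). Proof. exact: rA_measurable. Qed.
Let mH : measurable (horizon T `*` A : set S). Proof. exact: measurable_marks. Qed.

Definition form_bracket (y : E) (t : R) (w : Omega) : R := fine (k y w (`[0%R, t]%classic `*` A)).
Local Notation v := form_bracket.

Let v_fin y : {ae P, forall w, forall t, (v y t w)%:E = k y w (`[0%R, t]%classic `*` A)}.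
Proof.
apply: filterS (form_measure_finite y rA') => w fin t; rewrite fineK// ge0_fin_numE//.
rewrite [ltLHS](_ : _ = k y w (`[0%R, t]%classic `*` A `&` hor)).
  apply: le_lt_trans fin; apply: le_measure; rewrite ?inE//.
  - by apply: measurableI; [exact: measurable_cylinder|exact: (measurable_marks T measurableT)].
  - by move=> p [[_ Ap] [hp _]]; split.
rewrite !form_measureE (integral_carried car) ?form_measureE//; first exact: measurable_cylinder.
by move=> p _; rewrite lee_fin.
Qed.

Let v_mass y w t : v y t w = fine (mass_upto (mrestr (k y w) mH) setT t).
Proof.
rewrite /v /mass_upto /mrestr setTI; congr fine.
have mC : measurable ([set p | (p.1 <= t)%R] `&` (horizon T `*` A) : set S).
  by apply: measurableI => //; exact: measurable_time_le.
rewrite !form_measureE [LHS](integral_carried car).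
- congr (integral _ _ _); apply/seteqP; split=> -[r u] /=; rewrite in_itv/= /horizon/=.
    by move=> [[/andP[-> ->] Au] [/andP[_ ->] _]].
  by move=> [-> [/andP[-> ->] Au]].
- exact: measurable_cylinder.
- exact: msec.
- by move=> p _; rewrite lee_fin.
Qed.

Lemma form_bracket_paths y : {ae P, forall w, cadlag (horizon T) (v y ^~ w) /\
  forall t, horizon T t -> bounded_variation 0%R t (v y ^~ w)}.
Proof.
apply: filterS (form_measure_finite y rA') => w fin.
have mfin : mrestr (k y w) mH setT < +oo by rewrite /mrestr setTI.
have -> : v y ^~ w = fun t => fine (mass_upto (mrestr (k y w) mH) setT t).
  by apply/funext => t; rewrite v_mass.
split; first exact: (cadlag_mass_upto measurableT mfin).
by move=> t _; exact: (bounded_variation_mass_upto measurableT mfin).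
Qed.

Lemma predictable_form_bracket y : measurable_fun slabT (fun z : PT => v y z.2 z.1 : R).
Proof.
pose E2 : set PS := [set z | A z.2].
have mE2 : measurable E2 by rewrite -[X in measurable X]setTI; exact: measurable_snd.
have W0 (z : PS) : 0 <= (\1_E2 z : R)%:E by rewrite lee_fin indicE.
have mW : measurable_fun ([set z | horizon T z.1.2] : set PS) (fun z : PS => (\1_E2 z : R)%:E).
  by apply/measurable_EFinP; apply: measurable_funTS; exact: measurable_indic.
have := predictable_form y mW W0.
rewrite /predictable_process => mv.
have mf : measurable_fun slabT (fun z : PT => k y z.1 (`[0%R, z.2]%classic `*` A)).
  move: mv; apply: eq_measurable_fun => z _.
  have mA2 : measurable ([set p | A p.2] : set S) by rewrite -[X in measurable X]setTI; exact: measurable_snd.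
  transitivity (\int[k y z.1]_(p in `[0%R, z.2]%classic `*` setT) (\1_([set p | A p.2] : set S) p)%:E).
    by apply: eq_integral => p _; rewrite !indicE.
  rewrite integral_indic//; last by apply: measurable_cylinder; exact: measurableT.
  by congr (k y z.1 _); apply/seteqP; split=> -[r u] /= [] // ? [].
by apply: (measurableT_comp _ mf); exact: fine_measurable.
Qed.

Let v_adapted y t : horizon T t -> measurable_fun setT (v y t : g_sigma_algebraType (F t) -> R).
Proof.
move=> ht; apply: (measurable_comp (F := slabT) (measurable_slabT usual T0) _ (predictable_form_bracket y)
  (measurable_time_section usual ht)).
by move=> _ [w _ <-].
Qed.

Let v_ge0 y t w : (0 <= v y t w)%R. Proof. by rewrite fine_ge0. Qed.

Let v_measurable y t : horizon T t -> measurable_fun setT (v y t).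
Proof. by move=> ht; apply: (adapted_measurable usual (J1 ht)); exact: v_adapted. Qed.

Let v_integrable y t : horizon T t -> P.-integrable setT (EFin \o v y t).
Proof.
move=> ht; apply/integrableP; split; first by apply/measurable_EFinP; exact: v_measurable.
apply: le_lt_trans (form_measure_integrable y rA').
apply: ae_ge0_le_integral => //.
- by apply: measurableT_comp => //; apply/measurable_EFinP; exact: v_measurable.
- exact: mk.
move: (v_fin y) ; apply: filterS => w vf _; rewrite /= ger0_norm// vf.
apply: le_measure; rewrite ?inE//; first exact: measurable_cylinder.
exact: cylinder_marks.
Qed.

Let v_incr y s t H : horizon T s -> horizon T t -> (s <= t)%R -> F s H ->
  ip P (incr (fun t => N t A y) H s t) (incr (fun t => N t A y) H s t) =
  (\int[P]_(w in H) v y t w - \int[P]_(w in H) v y s w)%R.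
Proof.
move=> hs ht st FH; have s0 := J1 hs; have tT : (t <= T)%R by case/andP: ht.
have mHs := filtration_sub usual s0 FH.
apply: EFin_inj; apply: (eq_trans (iso y rA' s0 st tT FH)).
apply: (integral_difference mHs (v_integrable y ht) (v_integrable y hs) (v_ge0 y s)) => //.
  by apply: mk; exact: measurable_strip.
by move: (v_fin y); apply: filterS => w vf; rewrite !vf (k_split y rA' s0 st).
Qed.

(** Polarisation writes the covariation as a difference of two increasing
    processes; the factor 1/4 is put inside the form so that both of them are
    brackets. *)
Lemma covariation_polar y1 y2 : covariation P F (horizon T) (fun t => N t A y1) (fun t => N t A y2)
  (fun t w => v (2^-1 *: (y1 + y2)) t w - v (2^-1 *: (y1 - y2)) t w)%R.
Proof.
set y := 2^-1 *: _; set y' := 2^-1 *: _.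
have iso4 x s t H : horizon T s -> horizon T t -> (s <= t)%R -> F s H ->
    (ip P (incr (fun t => N t A x) H s t) (incr (fun t => N t A x) H s t) =
     4 * ip P (incr (fun t => N t A (2^-1 *: x)) H s t) (incr (fun t => N t A (2^-1 *: x)) H s t))%R.
  move=> hs ht st FH; have := polar (2^-1 *: x) (2^-1 *: x) rA' (J1 hs) st (andP ht).2 FH.
  rewrite -scalerDl -[in X in (X *: x)%R](mul1r 2^-1%R) -mulrDl divff ?pnatr_eq0// scale1r subrr => ->.
  suff -> : ip P (incr (fun t => N t A 0%R) H s t) (incr (fun t => N t A 0%R) H s t) = 0%R by rewrite subr0.
  apply: EFin_inj; rewrite (iso 0%R rA' (J1 hs) st (andP ht).2 FH) integral0_eq// => w _.
  by rewrite form_measureE integral0_eq// => p _; rewrite linear0.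
split.
- apply/measurable_EFinP; apply: measurable_funB; exact: predictable_form_bracket.
- move: (k_zero y) (k_zero y'); apply: filterS2 => w z z'.
  by rewrite /v set_itv1 z// z'// subrr.
- move: (form_bracket_paths y) (form_bracket_paths y'); apply: filterS2 => w [c b] [c' b']; split.
    exact: cadlag_sub.
  by move=> t ht; apply: bounded_variation_sub; [exact: J1|exact: b|exact: b'].
apply: (covariation_of_incr usual J1 (mN y1 rA') (mN y2 rA')).
- move=> t ht C mC; rewrite -(filtration_measurableE usual _ (J1 ht)) -[X in measurable X]setTI.
  by apply: measurable_funB => //; exact: v_adapted.
- move=> t ht; have := integrableB measurableT (v_integrable y ht) (v_integrable y' ht).
  by apply: eq_integrable => // w _; rewrite /= EFinB.
move=> s t H hs ht st FH; have mHs := filtration_sub usual (J1 hs) FH.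
have iS x r : horizon T r -> P.-integrable H (EFin \o v x r).
  by move=> hr; exact: integrableS measurableT mHs (@subsetT _ _) (v_integrable x hr).
rewrite !RintegralB//; try exact: iS.
have := polar y1 y2 rA' (J1 hs) st (andP ht).2 FH.
rewrite (iso4 (y1 + y2)%R s t H)// (iso4 (y1 - y2)%R s t H)// -/y -/y' (v_incr y hs ht st FH) (v_incr y' hs ht st FH).
have cancel4 (a p q r r' : R) : (4 * a = 4 * (p - q) - 4 * (r - r') -> a = p - r - (q - r'))%R by lra.
exact: cancel4.
Qed.

Lemma form_bracketE y : {ae P, forall w, forall t, (v y t w)%:E = k y w (`[0%R, t]%classic `*` A)}.
Proof. exact: v_fin. Qed.

End one_set.
End brackets.

(** * The quadratic variation of the integral *)

(** On the set where [f_ n] is the largest of [f_ 0], ..., [f_ n] the measure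
    whose density is this maximum has the bound of [f_ n]; the maxima increase
    to the supremum. *)
Lemma sup_density_le d (S : measurableType d) (R : realType) (mu m : {measure set S -> \bar R})
    (f_ : nat -> S -> R) (f : S -> R) :
  (forall n, measurable_fun setT (f_ n)) -> (forall n x, (0 <= f_ n x)%R) ->
  (forall n x, (f_ n x <= f x)%R) -> (forall x (e : R), (0 < e)%R -> exists n, (f x - e <= f_ n x)%R) ->
  (forall n C, measurable C -> \int[mu]_(x in C) (f_ n x)%:E <= m C) ->
  forall C, measurable C -> \int[mu]_(x in C) (f x)%:E <= m C.
Proof.
move=> mf f0 fub flub fm.
pose g := fix g n x : R := if n is n'.+1 then Num.max (g n' x) (f_ n x) else f_ 0%N x.
have mg n : measurable_fun setT (g n).
  by elim: n => [|n IH]; [exact: mf|exact: measurable_maxr].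
have g0 n x : (0 <= g n x)%R.
  by elim: n => [|n IH]; [exact: f0|rewrite /= le_max IH].
have gnd x n m' : (n <= m')%N -> (g n x <= g m' x)%R.
  by elim: m' => [|m' IH]; [rewrite leqn0 => /eqP ->|
    rewrite leq_eqVlt ltnS => /predU1P[->//|/IH h]; rewrite /= le_max h].
have fg n x : (f_ n x <= g n x)%R by case: n => //= n; rewrite le_max lexx orbT.
have gf n x : (g n x <= f x)%R by elim: n => [|n IH] /=; rewrite ?ge_max ?IH ?fub.
have mge n (D : set S) : measurable_fun D (fun x => (g n x)%:E).
  by apply: measurable_funTS; exact/measurable_EFinP.
have mfe n (D : set S) : measurable_fun D (fun x => (f_ n x)%:E).
  by apply: measurable_funTS; exact/measurable_EFinP.
have gm n : forall C, measurable C -> \int[mu]_(x in C) (g n x)%:E <= m C.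
  elim: n => [C mC|n IH C mC]; first exact: fm.
  pose D := [set x | (g n x < f_ n.+1 x)%R].
  have mD : measurable D.
    rewrite (_ : D = (fun x => f_ n.+1 x - g n x)%R @^-1` `]0%R, +oo[); last first.
      by apply/seteqP; split=> x /=; rewrite in_itv/= andbT subr_gt0.
    rewrite -[X in measurable X]setTI; apply: (measurable_funB (mf n.+1) (mg n)) => //.
  have m1 : measurable (C `&` D) by exact: measurableI.
  have m2 : measurable (C `\` D) by exact: measurableD.
  rewrite -(setUIDK C D) ge0_integral_setU//; first last.
  - by apply/disj_setPS => x [[_ Dx] [_]].
  - by move=> x _; rewrite lee_fin.
  rewrite measureU//; last by apply/seteqP; split=> x // [[_ Dx] [_]].
  apply: leeD.
    rewrite (eq_integral (fun x => (f_ n.+1 x)%:E)); first exact: fm.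
    by move=> x /set_mem[_ Dx]; rewrite /= (max_idPr (ltW Dx)).
  rewrite (eq_integral (fun x => (g n x)%:E)); first exact: IH.
  by move=> x /set_mem[_ /negP]; rewrite -leNgt => Dx; rewrite /= (max_idPl Dx).
move=> C mC.
have cvgg : \int[mu]_(x in C) (g n x)%:E @[n --> \oo] --> \int[mu]_(x in C) (f x)%:E.
  have lim x : (fun n => (g n x)%:E) @ \oo --> (f x)%:E.
    apply: cvg_EFin; first by apply: nearW.
    apply/cvgrPdist_le => e e0; have [n0 hn] := flub x e e0.
    exists n0 => // n /= n0n; rewrite ger0_norm ?subr_ge0 ?gf//.
    by rewrite lerBlDl -lerBlDr (le_trans hn)// (le_trans (fg n0 x))// gnd.
  have -> : \int[mu]_(x in C) (f x)%:E = \int[mu]_(x in C) limn (fun n => (g n x)%:E).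
    by apply: eq_integral => x _; apply/esym/cvg_lim.
  apply: cvg_monotone_convergence => //.
  - by move=> n x _; rewrite lee_fin.
  - by move=> x _ n m' nm; rewrite lee_fin gnd.
rewrite -(cvg_lim _ cvgg)//; apply: lime_le; first by apply/cvg_ex; eexists; exact: cvgg.
by apply: nearW => n; exact: gm.
Qed.

Section norm_density.
Context (R : realType) d (S : measurableType d) (E : normedModType R) (B : S -> contlin E (dual E)).
Hypothesis mB : forall x y, measurable_fun setT (fun z => B z x y : R).
Hypothesis psB : forall z, positive_symmetric (B z).
Context (v_ : nat -> E).
Hypothesis v1 : forall n, (`|v_ n| <= 1)%R.
Hypothesis dv : forall (v : E) (e : R), (`|v| <= 1)%R -> (0 < e)%R -> exists n, (`|v - v_ n| < e)%R.

Lemma diag_le_norm z n : (B z (v_ n) (v_ n) <= `|B z|)%R.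
Proof. exact: bilinear_le_norm. Qed.

Lemma norm_diag_approx z (e : R) : (0 < e)%R -> exists n, (`|B z| - e <= B z (v_ n) (v_ n))%R.
Proof.
move=> e0; apply: contrapT => /forallNP h.
have : (`|B z| <= `|B z| - e)%R.
  apply: (norm_le_dense_diag dv (psB z)) => n.
  by rewrite ltW// ltNge; apply/negP; exact: h.
by rewrite lerBrDl gerDr leNgt e0.
Qed.

Lemma measurable_norm_form : measurable_fun setT (fun z => `|B z|%R).
Proof.
apply: (measurability _ (RGenOInfty.measurableE R)) => _ [_ [r ->] <-]; rewrite setTI.
rewrite (_ : _ @^-1` _ = \bigcup_n (fun z => B z (v_ n) (v_ n) : R) @^-1` `]r, +oo[).
  apply: bigcupT_measurable => n; rewrite -[X in measurable X]setTI.
  by apply: mB => //; exact: measurable_itv.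
apply/seteqP; split=> [z|z [n _]] /=; rewrite !in_itv/= !andbT => h; last exact: lt_le_trans (diag_le_norm z n).
have [n hn] := @norm_diag_approx z ((`|B z| - r) / 2)%R ltac:(by rewrite divr_gt0// subr_gt0).
by exists n => //=; rewrite in_itv/= andbT; apply: lt_le_trans hn; lra.
Qed.

End norm_density.

Section variation.
Context (R : realType) (d : measure_display) (Omega : measurableType d).
Context (P : probability Omega R) (F : R -> set (set Omega)) (T : R).
Context (U : ptopologicalType) (rA : set (set (borelType U))) (U_ : (set U)^nat).
Context (E : normedModType R) (N : R -> set U -> E -> Omega -> R).
Hypothesis usual : usual_conditions P F.
Hypothesis T0 : (0 < T)%R.
Hypothesis rA_measurable : rA `<=` measurable.
Hypothesis exh : exhausting rA U_.
Hypothesis homeoU : homeomorphic_to_borel R U.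
Hypothesis mN : forall A y, rA A -> L2_martingale P F (horizon T) (fun t => N t A y).
Local Notation PT := (g_sigma_algebraType (predictable_rect F (horizon T))).
Local Notation PS := (PT * borelType U)%type.
Local Notation S := (R * borelType U)%type.
Local Notation hor := (horizon T `*` setT : set S).
Context (zeta : R.-ker Omega ~> S).
Hypothesis pz : predictable_random_measure F (horizon T) zeta.
Hypothesis car : carried_by (horizon T) zeta.
Hypothesis time_zero : {ae P, forall w, zeta w ([set 0%R] `*` setT) = 0}.
Context (B : Omega * R * U -> contlin E (dual E)).
Hypothesis mB : forall x y, measurable_fun setT (fun z : PS => B z x y : R).
Hypothesis psB : forall z, positive_symmetric (B z).
Context (v_ : nat -> E).
Hypothesis v1 : forall n, (`|v_ n| <= 1)%R.
Hypothesis dv : forall (v : E) (e : R), (`|v| <= 1)%R -> (0 < e)%R -> exists n, (`|v - v_ n| < e)%R.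

Let B0 y z : (0 <= B z y y)%R. Proof. by have [p _] := psB z; exact: p. Qed.
Local Notation k y := (form_measure usual T0 pz car mB B0 y).

Hypothesis iso : forall A y s t H, rA A -> (0 <= s)%R -> (s <= t)%R -> (t <= T)%R -> F s H ->
  (ip P (incr (fun t => N t A y) H s t) (incr (fun t => N t A y) H s t))%:E =
  \int[P]_(w in H) \int[zeta w]_(p in [set r | (s < r <= t)%R] `*` A) (B (w, p.1, p.2) y y)%:E.
Hypothesis polar : forall A x y s t H, rA A -> (0 <= s)%R -> (s <= t)%R -> (t <= T)%R -> F s H ->
  (4 * ip P (incr (fun t => N t A x) H s t) (incr (fun t => N t A y) H s t) =
  ip P (incr (fun t => N t A (x + y)%R) H s t) (incr (fun t => N t A (x + y)%R) H s t) -
  ip P (incr (fun t => N t A (x - y)%R) H s t) (incr (fun t => N t A (x - y)%R) H s t))%R.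

Let iso' : forall A y s t H, rA A -> (0 <= s)%R -> (s <= t)%R -> (t <= T)%R -> F s H ->
  (ip P (incr (fun t => N t A y) H s t) (incr (fun t => N t A y) H s t))%:E =
  \int[P]_(w in H) k y w ([set r | (s < r <= t)%R] `*` A).
Proof. exact: iso. Qed.

Let J1 (r : R) : horizon T r -> (0 <= r)%R. Proof. by case/andP. Qed.
Let rU n : rA (U_ n). Proof. by have [_ _ mU ex] := exh; apply: (ex n). Qed.
Let mhor : measurable hor. Proof. exact: (measurable_marks T measurableT). Qed.

Let finite_k y A : rA A -> {ae P, forall w, k y w (horizon T `*` A) < +oo}.
Proof. by move=> rA'; exact: (form_measure_finite rA_measurable time_zero iso' y rA'). Qed.

Lemma intensity_measure_form y : intensity_measure P F rA (horizon T) N y (k y).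
Proof.
split; first exact: carried_form.
- exact: predictable_form.
- have : {ae P, forall w, forall n, k y w (horizon T `*` U_ n) < +oo}.
    by apply: ae_foralln => n; exact: finite_k.
  apply: filterS => w fin; have [_ bigU mU _] := exh.
  exists (fun n => (horizon T `*` U_ n) `|` ~` hor : set S).
    apply/esym; rewrite -subTset => -[r u] _; have : (\bigcup_n U_ n) u by rewrite bigU.
    move=> [n _ Un]; exists n => //; have [hr|nh] := pselect (horizon T r); [by left|].
    by right => -[].
  move=> n; have m1 := measurable_marks T (mU n); have m2 := measurableC mhor.
  split; first exact: measurableU.
  have sub : k y w ((horizon T `*` U_ n) `|` ~` hor) <= k y w (horizon T `*` U_ n) + k y w (~` hor).
    exact: (@measureU2 _ _ _ (k y w)).
  apply: le_lt_trans sub _; have -> : k y w (~` hor) = 0 by exact: carried_form.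
  by rewrite adde0.
move=> A rA'.
have := covariation_polar rA_measurable mN time_zero iso' polar rA' y y.
have yy : (2^-1 *: (y + y) = y)%R by rewrite -mulr2n -(scaler_nat 2 y) scalerA mulVf ?scale1r// pnatr_eq0.
rewrite yy subrr scaler0.
move=> cov; eexists; first exact: cov.
move=> t ht; apply: filterS (form_bracketE rA_measurable time_zero iso' rA' y) => w vE.
rewrite -vE [form_bracket _ _ _ _ _ _ _ 0%R _ _](_ : _ = 0%R) ?subr0//.
rewrite /form_bracket form_measureE integral0_eq// => p _.
by rewrite (linear0 (B (w, p.1, p.2) 0%R)).
Qed.

(** The expected masses of predictable rectangles are second moments of
    increments, hence common to all intensity measures at [y]. *)
Lemma intensity_measure_unique y nu : intensity_measure P F rA (horizon T) N y nu ->
  {ae P, forall w, forall C, measurable C -> k y w C = nu w C}.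
Proof.
move=> [carnu pnu _ Vnu]; have [ndU bigU mU ex] := exh.
have pk : predictable_random_measure F (horizon T) (k y) by exact: predictable_form.
have fin n : \int[P]_w k y w (horizon T `*` U_ n) < +oo.
  exact: (form_measure_integrable rA_measurable time_zero iso' y (rU n)).
apply: (predictable_random_measure_unique usual T0 (carried_form usual T0 pz car mB B0 y) carnu
  pk pnu ndU bigU mU homeoU fin) => n G mG G0.
apply: (equal_doleans usual T0 pk pnu (mU n) (fin n) _ _ mG G0).
  move=> A C FA mC CU; have rC : rA C by apply: (ex n).
  have mA := filtration_sub usual (lexx 0%R) FA.
  have [V [_ V0 _ _] VE] := Vnu C rC.
  have h0 : horizon T 0%R by rewrite /horizon/= lexx ltW.
  have mz : measurable ([set 0%R] `*` C : set S) by apply: measurableX => //; exact: measurable_set1.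
  apply: ae_eq_integral => //; try by apply: measurable_funTS; exact: measurable_kernel.
  move: (form_measure_zero usual T0 pz car time_zero mB B0 y) V0 (VE 0%R h0).
  apply: filterS3 => w z0 -> + _; rewrite set_itv1 => ->.
  apply: (@subset_measure0 _ _ _ (k y w) _ ([set 0%R] `*` setT)) => //.
    by apply: measurableX => //; exact: measurable_set1.
  by move=> p [].
move=> s t A C /andP[s0 /ltW st] tT FA mC CU; have rC : rA C by apply: (ex n).
have mA := filtration_sub usual s0 FA.
have [V covV VE] := Vnu C rC.
have hs : horizon T s by rewrite /horizon/= s0 (le_trans st).
have ht : horizon T t by rewrite /horizon/= tT (le_trans s0).
have [iVs iVt ipE] := covariation_incr usual J1 (mN y rC) (mN y rC) covV hs ht st FA.
rewrite -(iso' y rC s0 st tT FA) ipE; apply/esym.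
have V_nu r : horizon T r -> {ae P, forall w, V r w = fine (nu w (`[0%R, r]%classic `*` C))}.
  by move=> hr; apply: filterS (VE r hr) => w ->.
pose f r w := fine (nu w (`[0%R, r]%classic `*` C)).
have VfI r : horizon T r -> P.-integrable setT (EFin \o V r) ->
    P.-integrable setT (EFin \o f r) /\ (\int[P]_(w in A) V r w = \int[P]_(w in A) f r w)%R.
  move=> hr iV; have mf : measurable_fun setT (f r).
    apply: measurableT_comp; first exact: fine_measurable.
    by apply: measurable_kernel; exact: measurable_cylinder.
  split.
    have /integrableP[mV finV] := iV.
    apply/integrableP; split; first exact/measurable_EFinP.
    rewrite (ae_eq_integral (fun w => `|(V r w)%:E|))//.
    - by apply: measurableT_comp => //; exact/measurable_EFinP.
    - exact: measurableT_comp.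
    - by apply: filterS (V_nu r hr) => w e _; rewrite /= e.
  rewrite /Rintegral; congr fine; apply: ae_eq_integral => //.
  - by apply: measurable_funTS; have /integrableP[] := iV.
  - by apply: measurable_funTS; exact/measurable_EFinP.
  - by apply: filterS (V_nu r hr) => w e _; rewrite e.
have [ifs es] := VfI s hs iVs; have [ift et] := VfI t ht iVt.
rewrite es et.
apply: (integral_difference mA ift ifs) => //.
- by move=> w; exact: fine_ge0.
- by apply: measurable_kernel; exact: measurable_strip.
move: (VE s hs) (VE t ht); apply: filterS2 => w es' et'.
rewrite /f !fineK ?es' ?et'//.
rewrite -es' -et'; apply: (@measure_cylinder_split _ _ (nu w)) => //; exact: rA_measurable.
Qed.

Let h (z : PS) : R := `|B z|%R.
Let mh : measurable_fun setT h. Proof. exact: (measurable_norm_form mB psB v1 dv). Qed.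
Let h0 z : (0 <= h z)%R. Proof. exact: normr_ge0. Qed.

Definition norm_measure : R.-ker Omega ~> S := weighted usual mh h0 usual T0 pz car.
Local Notation zetaN := norm_measure.

Lemma norm_measureE w C : zetaN w C = \int[zeta w]_(p in C) (`|B (w, p.1, p.2)|%R)%:E.
Proof. by []. Qed.

Let mh_sec w (D : set S) : measurable_fun D (fun p => (h (w, p.1, p.2))%:E).
Proof. by apply: measurable_funTS; apply/measurable_EFinP; exact: (measurable_section usual w mh). Qed.

Let mB_sec y w (D : set S) : measurable_fun D (fun p => (B (w, p.1, p.2) y y)%:E).
Proof. by apply: measurable_funTS; apply/measurable_EFinP; exact: (measurable_section usual w (mB y y)). Qed.

Hypothesis integrable_norm : forall A, rA A -> \int[P]_w zetaN w (horizon T `*` A) < +oo.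

Lemma norm_measure_majorant : intensity_majorant P F rA (horizon T) N zetaN.
Proof.
split; first exact: carried_weighted.
move=> y y1; exists (k y); first exact: intensity_measure_form.
apply: aeW => w C mC; rewrite norm_measureE form_measureE; apply: ge0_le_integral => //.
- by move=> p _; rewrite lee_fin.
- exact: mh_sec.
- by move=> p _; rewrite lee_fin; apply: bilinear_le_norm; rewrite y1.
Qed.

(** A majorant dominates the intensities at the countably many points of a
    dense sequence of the ball, simultaneously for almost every scenario,
    hence the measure whose density is the supremum of theirs. *)
Lemma norm_measure_least zeta' : intensity_majorant P F rA (horizon T) N zeta' -> rm_le P zetaN zeta'.
Proof.
move=> [_ maj].
have le_n n : {ae P, forall w, forall C, measurable C -> k (v_ n) w C <= zeta' w C}.
  have [v0|v0] := eqVneq (v_ n) 0%R.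
    apply: aeW => w C mC; rewrite form_measureE integral0_eq// => p _.
    by rewrite v0 (linear0 (B (w, p.1, p.2) 0%R)).
  have nv : (0 < `|v_ n|)%R by rewrite normr_gt0.
  pose e : E := (`|v_ n|^-1 *: v_ n)%R.
  have e1 : (`|e| = 1)%R by rewrite normrZ normfV normr_id mulVf// gt_eqF.
  have vE : v_ n = (`|v_ n| *: e)%R by rewrite /e scalerA divff ?scale1r// gt_eqF.
  have [nu inu lenu] := maj e e1.
  move: (intensity_measure_unique inu) lenu; apply: filterS2 => w eqnu le C mC.
  apply: le_trans (le C mC); rewrite -eqnu// !form_measureE; apply: ge0_le_integral => //.
  - by move=> p _; rewrite lee_fin.
  - move=> p _; rewrite lee_fin {1 2}vE.
    rewrite [leLHS](contlin_argZ (B (w, p.1, p.2) (`|v_ n| *: e)%R) `|v_ n|%R e) bilinear_argZl.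
    rewrite -[leLHS]/(`|v_ n| * (`|v_ n| * B (w, p.1, p.2) e e))%R mulrA ler_piMl//.
    by rewrite mulr_ile1.
have : {ae P, forall w, forall n C, measurable C -> k (v_ n) w C <= zeta' w C}.
  by apply: ae_foralln => n; exact: le_n.
apply: filterS => w le C mC; rewrite norm_measureE.
apply: (@sup_density_le _ _ _ (zeta w) (zeta' w) (fun n p => B (w, p.1, p.2) (v_ n) (v_ n))) => //.
- by move=> n; exact: (measurable_section usual w (mB (v_ n) (v_ n))).
- by move=> n p; exact: diag_le_norm.
- by move=> p e e0; exact: (@norm_diag_approx R _ PS E B psB v_ dv).
Qed.

Let norm_measure_finite t A : horizon T t -> rA A -> {ae P, forall w, zetaN w (`[0%R, t]%classic `*` A) < +oo}.
Proof.
move=> ht rA'; have mA := rA_measurable rA'; have mH := measurable_marks T mA.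
have : P.-integrable setT (fun w => zetaN w (horizon T `*` A)).
  apply/integrableP; split; first exact: measurable_kernel.
  rewrite (eq_integral (fun w => zetaN w (horizon T `*` A))) => [|w _]; first exact: integrable_norm.
  by rewrite gee0_abs.
move=> /(integrable_ae measurableT); apply: filterS => w /(_ I) fin.
apply: (@le_lt_trans _ _ (zetaN w (horizon T `*` A))); last by rewrite ltey_eq fin.
apply: le_measure; rewrite ?inE//; first exact: measurable_cylinder.
exact: cylinder_marks.
Qed.

Lemma norm_measure_variation : unique_quadratic_variation P F rA (horizon T) N zetaN.
Proof.
have qv : quadratic_variation P F rA (horizon T) N zetaN.
  by split; [exact: norm_measure_finite|exact: norm_measure_majorant|exact: norm_measure_least].
split=> // zeta' [_ maj' least'].
move: (norm_measure_least maj') (least' _ norm_measure_majorant); apply: filterS2 => w le1 le2 C mC.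
by apply/eqP; rewrite eq_le le1// le2.
Qed.

End variation.

(** * Densities and the normalised operator *)

Section operator.
Context (R : realType) (d : measure_display) (Omega : measurableType d).
Context (P : probability Omega R) (F : R -> set (set Omega)) (T : R).
Context (U : ptopologicalType) (rA : set (set (borelType U))) (U_ : (set U)^nat).
Context (E : normedModType R) (N : R -> set U -> E -> Omega -> R).
Hypothesis usual : usual_conditions P F.
Hypothesis T0 : (0 < T)%R.
Hypothesis rA_measurable : rA `<=` measurable.
Hypothesis exh : exhausting rA U_.
Hypothesis homeoU : homeomorphic_to_borel R U.
Hypothesis mN : forall A y, rA A -> L2_martingale P F (horizon T) (fun t => N t A y).
Local Notation PT := (g_sigma_algebraType (predictable_rect F (horizon T))).
Local Notation PS := (PT * borelType U)%type.
Local Notation S := (R * borelType U)%type.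
Local Notation hor := (horizon T `*` setT : set S).
Local Notation cut Z w := ([set p : S | Z (w, p.1, p.2)]).
Context (zetaM zeta : R.-ker Omega ~> S).
Hypothesis pz : predictable_random_measure F (horizon T) zeta.
Hypothesis car : carried_by (horizon T) zeta.
Hypothesis time_zero : {ae P, forall w, zeta w ([set 0%R] `*` setT) = 0}.
Hypothesis kz : {ae P, forall w, forall C, measurable C -> C `<=` hor -> zetaM w C = zeta w C}.
Context (B B' : Omega * R * U -> contlin E (dual E)) (Exc : set PS).
Hypothesis mB : forall x y, measurable_fun setT (fun z : PS => B z x y : R).
Hypothesis psB : forall z, positive_symmetric (B z).
Hypothesis mB' : forall x y, measurable_fun (slab T setT : set PS) (fun z : PS => B' z x y : R).
Hypothesis mExc : measurable Exc.
Hypothesis nullExc : forall w, zeta w (cut Exc w) = 0.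
Hypothesis BB' : forall z : Omega * R * U, horizon T z.1.2 -> ~ Exc z -> B z = B' z.
Context (u_ v_ : nat -> E).
Hypothesis du : dense_seq u_.
Hypothesis v1 : forall n, (`|v_ n| <= 1)%R.
Hypothesis dv : forall (v : E) (e : R), (`|v| <= 1)%R -> (0 < e)%R -> exists n, (`|v - v_ n| < e)%R.

Let B0 y z : (0 <= B z y y)%R. Proof. by have [p _] := psB z; exact: p. Qed.
Local Notation k y := (form_measure usual T0 pz car mB B0 y).
Local Notation zetaN := (norm_measure usual T0 pz car mB psB v1 dv).
Local Notation muM := (doleans P F T zetaM).
Local Notation muN := (doleans P F T zetaN).
Let mu : {measure set PS -> \bar R} := doleans_measure usual T0 pz kz.

Hypothesis iso : forall A y s t H, rA A -> (0 <= s)%R -> (s <= t)%R -> (t <= T)%R -> F s H ->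
  (ip P (incr (fun t => N t A y) H s t) (incr (fun t => N t A y) H s t))%:E =
  \int[P]_(w in H) \int[zeta w]_(p in [set r | (s < r <= t)%R] `*` A) (B (w, p.1, p.2) y y)%:E.
Hypothesis polar : forall A x y s t H, rA A -> (0 <= s)%R -> (s <= t)%R -> (t <= T)%R -> F s H ->
  (4 * ip P (incr (fun t => N t A x) H s t) (incr (fun t => N t A y) H s t) =
  ip P (incr (fun t => N t A (x + y)%R) H s t) (incr (fun t => N t A (x + y)%R) H s t) -
  ip P (incr (fun t => N t A (x - y)%R) H s t) (incr (fun t => N t A (x - y)%R) H s t))%R.

Let iso' : forall A y s t H, rA A -> (0 <= s)%R -> (s <= t)%R -> (t <= T)%R -> F s H ->
  (ip P (incr (fun t => N t A y) H s t) (incr (fun t => N t A y) H s t))%:E =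
  \int[P]_(w in H) k y w ([set r | (s < r <= t)%R] `*` A).
Proof. exact: iso. Qed.

Let h (z : PS) : R := `|B z|%R.
Let h' (z : PS) : R := `|B' z|%R.
Let mh : measurable_fun setT h. Proof. exact: (measurable_norm_form mB psB v1 dv). Qed.
Let h0 z : (0 <= h z)%R. Proof. exact: normr_ge0. Qed.
Let mslab : measurable (slab T setT : set PS). Proof. exact: (measurable_slab usual T0). Qed.
Let mhor : measurable hor. Proof. exact: (measurable_marks T measurableT). Qed.
Let hh' z : horizon T z.1.2 -> ~ Exc z -> h z = h' z. Proof. by move=> hz nz; rewrite /h /h' BB'. Qed.

(** On the exceptional set the form need not be positive, so that its norm is
    a supremum over pairs of points. *)
Lemma measurable_norm_slab : measurable_fun (slab T setT : set PS) h'.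
Proof.
apply: (measurability _ (RGenOInfty.measurableE R)) => _ [_ [r ->] <-].
rewrite (_ : _ `&` _ = \bigcup_n \bigcup_m
    (slab T setT `&` (fun z : PS => B' z (v_ n) (v_ m) : R) @^-1` `]r, +oo[)).
  apply: bigcupT_measurable => n; apply: bigcupT_measurable => m.
  by apply: mB' => //; exact: measurable_itv.
apply/seteqP; split=> [z [hz]|z [n _ [m _ [hz]]]] /=; rewrite !in_itv/= !andbT => hr; last first.
  by split=> //; apply: lt_le_trans hr _; exact: bilinear_le_norm.
apply: contrapT => H; move: hr; rewrite ltNge => /negP; apply.
apply: (norm_le_dense dv) => n m; rewrite leNgt; apply/negP => lt_nm; apply: H.
by exists n => //; exists m => //; split=> //=; rewrite in_itv/= andbT.
Qed.

Let sec_slab d' (V : measurableType d') (f : PS -> V) w (D : set S) : D `<=` hor ->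
  measurable_fun (slab T setT : set PS) f -> measurable_fun D (fun p => f (w, p.1, p.2)).
Proof.
move=> Dh mf; apply: measurable_funS mhor Dh _.
apply: (measurable_comp (F := slab T setT : set PS) mslab _ mf); first by move=> _ [p [hp _] <-].
by apply: measurable_funTS; exact: (measurable_predSpace_section usual).
Qed.

Let cutE w : measurable (cut Exc w). Proof. exact: (measurable_sectionS usual w mExc). Qed.

Let ae_form w (D : set S) : D `<=` hor ->
  {ae zeta w, forall p, D p -> B (w, p.1, p.2) = B' (w, p.1, p.2)}.
Proof.
move=> Dh; exists (cut Exc w); split => // p /= np; apply: contrapT => nE; apply: np => Dp.
by apply: BB' => //; have [] := Dh _ Dp.
Qed.

Lemma norm_measure_density : {ae P, forall w, forall C, measurable C -> C `<=` hor ->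
  zetaN w C = \int[zetaM w]_(p in C) (`|B' (w, p.1, p.2)|%R)%:E}.
Proof.
apply: filterS kz => w eqz C mC Ch; rewrite norm_measureE.
transitivity (\int[zeta w]_(p in C) (h' (w, p.1, p.2))%:E).
  apply: ae_eq_integral => //.
  - by apply: measurable_funTS; apply/measurable_EFinP; exact: (measurable_section usual w mh).
  - by apply/measurable_EFinP; exact: sec_slab measurable_norm_slab.
  - by have := ae_form w Ch; apply: (@filterS _ _ (ae_filter_ringOfSetsType (zeta w))) => p e Cp; rewrite e.
apply: eq_measure_integral => D mD DC; apply/esym; apply: eqz => //.
exact: subset_trans DC Ch.
Qed.

Lemma norm_measure_is_density :
  {ae P, forall w, is_density hor (zetaN w) (zetaM w) (fun p => `|B' (w, p.1, p.2)|%R)}.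
Proof.
apply: filterS norm_measure_density => w E1; split=> //.
exact: sec_slab measurable_norm_slab.
Qed.

Let muN_E (Z : set PS) : measurable Z -> muN Z = \int[mu]_(z in Z) (h z)%:E.
Proof.
move=> mZ; rewrite /mu (integral_doleans_in usual T0 pz kz mZ mh h0).
apply: eq_integral => w _.
have mcZ : measurable (cut Z w) by exact: (measurable_sectionS usual w mZ).
have mi1 : measurable_fun setT (\1_Z : PS -> R) by exact: measurable_indic.
have mi : measurable_fun hor (fun p => (\1_Z (w, p.1, p.2) : R)%:E).
  by apply: measurable_funTS; apply/measurable_EFinP; exact: (measurable_section usual w mi1).
have i0 p : hor p -> 0 <= (\1_Z (w, p.1, p.2) : R)%:E by rewrite lee_fin indicE.
rewrite (integral_weighted _ _ _ _ _ _ _ mhor mi i0).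
rewrite [RHS]integral_mkcondr; apply: eq_integral => p _; rewrite patchE indicE.
have [Zp|nZ] := pselect (Z (w, p.1, p.2)); first by rewrite !mem_set// mule1.
by rewrite !memNset// mule0.
Qed.

Let mu_Exc : mu Exc = 0.
Proof.
apply: doleans_null => // w; apply: (@subset_measure0 _ _ _ (zeta w) _ (cut Exc w)) => //.
  by apply: measurableI => //; exact: cutE.
exact: nullExc.
Qed.

Let mu_out : mu (~` slab T setT) = 0.
Proof.
apply: doleans_null; first exact: measurableC.
move=> w; rewrite [X in zeta w X](_ : _ = set0) ?measure0// -subset0 => p [[hp _]].
by apply; split.
Qed.

Lemma norm_measure_doleans_density : is_density (slab T setT : set PS) muN muM h'.
Proof.
split=> [|C mC Cs]; first exact: measurable_norm_slab.
rewrite muN_E// -[RHS]/(\int[mu]_(z in C) (h' z)%:E); apply: ae_eq_integral => //.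
- by apply: measurable_funTS; exact/measurable_EFinP.
- by apply/measurable_EFinP; exact: measurable_funS mslab Cs measurable_norm_slab.
exists Exc; split; [exact: mExc|exact: mu_Exc|move=> z /= nz].
apply: contrapT => nE; apply: nz => Cz.
by rewrite (hh' (Cs _ Cz).1 nE).
Qed.

(** The Doleans measure of [N] has the norm of the form as its density, so
    that null sets of the Doleans measure of [M] and points where the form
    vanishes do not count. *)
Let ae_muN (prop : set PS) : {ae mu, forall z, horizon T z.1.2 -> ~ Exc z -> h z != 0%R -> prop z} ->
  {ae muN, forall z, prop z}.
Proof.
move=> [Z [mZ Z0 sub]].
have mh0 : measurable [set z : PS | h z = 0%R].
  rewrite (_ : [set z | _] = h @^-1` [set 0%R])//.
  by rewrite -[X in measurable X]setTI; apply: mh => //; exact: measurable_set1.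
have mZE : measurable (Z `|` Exc `|` ~` slab T setT).
  by apply: measurableU; [exact: measurableU|exact: measurableC].
exists ((Z `|` Exc `|` ~` slab T setT) `|` [set z | h z = 0%R]); split.
- exact: measurableU.
- have mZ' : measurable ((Z `|` Exc `|` ~` slab T setT) `|` [set z | h z = 0%R]) by exact: measurableU.
  have nZE : mu (Z `|` Exc `|` ~` slab T setT) = 0.
    apply: (@negligibleP _ _ _ mu _ mZE).1; apply: negligibleU; first apply: negligibleU.
    + by exists Z; split.
    + by exists Exc; split; [exact: mExc|exact: mu_Exc|].
    + by exists (~` slab T setT); split; [exact: measurableC|exact: mu_out|].
  rewrite muN_E//; transitivity (\int[mu]_(z in (Z `|` Exc `|` ~` slab T setT) `|` [set z | h z = 0%R]) (0 : \bar R)).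
    apply: ae_eq_integral => //; first by apply: measurable_funTS; exact/measurable_EFinP.
    exists (Z `|` Exc `|` ~` slab T setT); split=> // z /= nz; apply: contrapT => nZ; apply: nz => -[//|->//].
  exact: integral0.
move=> z nz; apply: contrapT => /not_orP[/not_orP[/not_orP[nZ nE] /contrapT sz] hz].
apply: nz; apply: contrapT => np; apply: nZ; apply: sub => /(_ sz.1 nE) H.
by apply: np; apply: H; apply/eqP.
Qed.

Let QN z : contlin E (dual E) := ((h' z)^-1 *: B' z)%R.

Let QN_E z x1 x2 : QN z x1 x2 = ((h' z)^-1 * B' z x1 x2)%R.
Proof. by rewrite /QN contlinZ [LHS]contlinZ. Qed.

Let QN_B z : horizon T z.1.2 -> ~ Exc z -> QN z = ((h z)^-1 *: B z)%R.
Proof. by move=> hz nz; rewrite /QN -hh'// BB'. Qed.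

Let mQN x1 x2 : measurable_fun (slab T setT : set PS) (fun z => QN z x1 x2 : R).
Proof.
have mi := measurable_fun_inv measurable_norm_slab (fun z => normr_ge0 (B' z)).
apply: eq_measurable_fun (measurable_funM mi (mB' x1 x2)) => z _.
by rewrite QN_E.
Qed.

Let QN_psd : {ae muN, forall z, slab T setT z -> [/\ forall x, (0 <= QN z x x)%R,
  forall x1 x2, QN z x1 x2 = QN z x2 x1 & `|QN z|%R = 1%R]}.
Proof.
apply: ae_muN; apply: aeW => z hz nz hz0 _; rewrite QN_B//; have [p sym] := psB z.
have scale a b : ((h z)^-1 *: B z)%R a b = ((h z)^-1 * B z a b)%R.
  by rewrite contlinZ [LHS]contlinZ.
split=> [x|x1 x2|]; first by rewrite scale mulr_ge0// invr_ge0.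
  by rewrite !scale sym.
by rewrite normrZ normfV normr_id mulVf.
Qed.

(** The quadratic form of the normalised operator; since [B z = 0] when its
    norm is 0, multiplying by the norm gives the form back. *)
Let quot x (z : PS) : R := ((h z)^-1 * B z x x)%R.

Let mquot x : measurable_fun setT (quot x).
Proof. exact: (measurable_funM (measurable_fun_inv mh h0) (mB x x)). Qed.

Let quot0 x z : (0 <= quot x z)%R.
Proof. by rewrite mulr_ge0// invr_ge0. Qed.

Let quotK x z : (h z * quot x z)%R = B z x x.
Proof.
rewrite /quot; have [hz|hz] := eqVneq (h z) 0%R; last by rewrite mulrA divff// mul1r.
have B00 : B z = 0%R by apply/eqP; rewrite -normr_eq0; apply/eqP.
rewrite hz mul0r B00 (_ : (0%R : contlin E (dual E)) x = 0%R); last exact: contlin0.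
by symmetry; exact: contlin0.
Qed.

Let integral_quot x w (D : set S) : measurable D ->
  \int[zetaN w]_(p in D) (quot x (w, p.1, p.2))%:E = k x w D.
Proof.
move=> mD; rewrite form_measureE.
have mq : measurable_fun D (fun p => (quot x (w, p.1, p.2))%:E).
  by apply: measurable_funTS; apply/measurable_EFinP; exact: (measurable_section usual w (mquot x)).
have q0 p : D p -> 0 <= (quot x (w, p.1, p.2))%:E by move=> _; rewrite lee_fin.
rewrite (integral_weighted _ _ _ _ _ _ _ mD mq q0).
by apply: eq_integral => p _; rewrite -EFinM -(quotK x (w, p.1, p.2)).
Qed.

Let form_polar z x1 x2 : B z x1 x2 =
  (B z (2^-1 *: (x1 + x2)) (2^-1 *: (x1 + x2)) - B z (2^-1 *: (x1 - x2)) (2^-1 *: (x1 - x2)))%R.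
Proof.
have [_ sym] := psB z; have e (a : E) : B z (2^-1 *: a)%R (2^-1 *: a)%R = (4^-1 * B z a a)%R.
  rewrite bilinear_argZl (contlin_argZ (B z a)) -[(2^-1 *: _)%R]/(2^-1 * B z a a)%R; by field.
rewrite !e bilinear_argDl bilinear_argBl !(contlin_argD, contlin_argB) (sym x2 x1).
by field.
Qed.

Let zetaN_Exc w : zetaN w (cut Exc w) = 0.
Proof.
rewrite norm_measureE; apply: null_set_integral; [exact: cutE| |exact: nullExc].
by apply: measurable_funTS; apply/measurable_EFinP; exact: (measurable_section usual w mh).
Qed.

Let QN_covariation A x1 x2 : rA A -> exists2 V,
  covariation P F (horizon T) (fun t => N t A x1) (fun t => N t A x2) V &
  forall t, horizon T t -> {ae P, forall w, (V t w)%:E =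
    \int[zetaN w]_(p in `[0%R, t]%classic `*` A) (QN (w, p.1, p.2) x1 x2)%:E}.
Proof.
move=> rA'; have mA := rA_measurable rA'.
eexists; first exact: (covariation_polar rA_measurable mN time_zero iso' polar rA' x1 x2).
move=> t ht; set y := (2^-1 *: (x1 + x2))%R; set y' := (2^-1 *: (x1 - x2))%R.
move: (form_bracketE rA_measurable time_zero iso' rA' y) (form_bracketE rA_measurable time_zero iso' rA' y').
apply: filterS2 => w vy vy'; rewrite EFinB (vy t) (vy' t).
set D := (`[0%R, t]%classic `*` A : set S).
have mD : measurable D by exact: measurable_cylinder.
have Dh : D `<=` hor by exact: cylinder_horizon.
have mq x : measurable_fun D (fun p => (quot x (w, p.1, p.2))%:E).
  by apply: measurable_funTS; apply/measurable_EFinP; exact: (measurable_section usual w (mquot x)).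
have iq x v : v%:E = k x w D -> (zetaN w).-integrable D (fun p => (quot x (w, p.1, p.2))%:E).
  move=> fin; apply/integrableP; split; first exact: mq.
  rewrite (eq_integral (fun p => (quot x (w, p.1, p.2))%:E)) => [|p _]; last by rewrite gee0_abs// lee_fin.
  by rewrite integral_quot// -fin ltry.
rewrite -(integral_quot y w mD) -(integral_quot y' w mD).
rewrite -(integralB mD (iq y _ (vy t)) (iq y' _ (vy' t))).
apply: ae_eq_integral => //.
- by apply: emeasurable_funB; exact: mq.
- by apply/measurable_EFinP; exact: sec_slab (mQN x1 x2).
exists (cut Exc w); split; [exact: cutE|exact: zetaN_Exc|move=> p np].
apply: contrapT => nE; apply: np => Dp; have [hp _] := Dh _ Dp.
rewrite QN_E -(@BB' (w, p.1, p.2) hp nE) -hh'// -EFinB; congr EFin.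
by rewrite [in RHS]form_polar mulrBr.
Qed.

Lemma normalised_operator : variation_operator P F rA T (fun (x'' : dual E) (x : E) => x'' x : R)
  (fun prop => {ae muN, forall z, prop z}) (horizon T) N zetaN QN.
Proof. by split; [exact: mQN|exact: QN_psd|move=> A x1 x2; exact: QN_covariation]. Qed.

(** An operator with the same covariations gives, at each [x], an intensity
    measure of [N] at [x]; as this measure is unique, so is the quadratic
    form. *)
Let diagonal_unique Q' x : variation_operator P F rA T (fun (x'' : dual E) (x : E) => x'' x : R)
    (fun prop => {ae muN, forall z, prop z}) (horizon T) N zetaN Q' ->
  {ae mu, forall z : PS, horizon T z.1.2 -> (h z != 0 -> Num.max 0 (Q' z x x) = quot x z)%R}.
Proof.
move=> [mQ' posQ' covQ']; have [ndU bigU mU ex] := exh.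
have [Z0 [mZ0 Z00 subZ0]] := posQ'.
pose f : PS -> R := (fun z => Num.max 0 (Q' z x x))%R \_ (slab T setT : set PS).
have mf : measurable_fun setT f.
  by apply/(measurable_restrictT _ mslab); apply: measurable_maxr => //; exact: mQ'.
have f0 z : (0 <= f z)%R by rewrite /f patchE; case: ifPn => // _; rewrite le_max lexx.
have mhf : measurable_fun setT (fun z : PS => h z * f z)%R by exact: measurable_funM.
have hf0 z : (0 <= h z * f z)%R by exact: mulr_ge0.
pose m : R.-ker Omega ~> S := weighted usual mhf hf0 usual T0 pz car.
have mE w C : m w C = \int[zeta w]_(p in C) (h (w, p.1, p.2) * f (w, p.1, p.2))%:E by [].
have mN0 : {ae P, forall w, zetaN w (hor `&` cut Z0 w) = 0}.
  pose phi w := \int[zetaN w]_(p in hor) (\1_Z0 (w, p.1, p.2) : R)%:E.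
  have phi0 w : 0 <= phi w by apply: integral_ge0 => p _; rewrite lee_fin indicE.
  have mphi : measurable_fun setT phi.
    apply: (measurable_kernel_integral usual T0 (predictable_weighted usual T0 pz car mh h0)
      (W := fun z => (\1_Z0 z : R)%:E)); last by move=> z; rewrite lee_fin indicE.
    by apply/measurable_EFinP; exact: measurable_indic.
  have : \int[P]_w `|phi w| = 0.
    by rewrite -[RHS]Z00; apply: eq_integral => w _; rewrite gee0_abs.
  move=> /(ae_eq_integral_abs P measurableT mphi).1; apply: filterS => w /(_ I) e.
  apply: eq_trans (e : phi w = 0).
  have mcZ : measurable (cut Z0 w) by exact: (measurable_sectionS usual w mZ0).
  rewrite setIC -integral_indic//; by apply: eq_integral => p _; congr EFin.
have m_cyl A t V : rA A -> horizon T t -> {ae P, forall w, (V t w)%:E =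
      \int[zetaN w]_(p in `[0%R, t]%classic `*` A) (Q' (w, p.1, p.2) x x)%:E} ->
    {ae P, forall w, m w (`[0%R, t]%classic `*` A) = (V t w)%:E}.
  move=> rA' ht; apply: filterS2 mN0 => w n0 ->; have mA := rA_measurable rA'.
  set D := (`[0%R, t]%classic `*` A : set S).
  have mD : measurable D by exact: measurable_cylinder.
  have Dh : D `<=` hor by exact: cylinder_horizon.
  have mfs : measurable_fun D (fun p => (f (w, p.1, p.2))%:E).
    by apply: measurable_funTS; apply/measurable_EFinP; exact: (measurable_section usual w mf).
  have fs0 p : D p -> 0 <= (f (w, p.1, p.2))%:E by move=> _; rewrite lee_fin.
  transitivity (\int[zetaN w]_(p in D) (f (w, p.1, p.2))%:E).
    rewrite (integral_weighted _ _ _ _ _ _ _ mD mfs fs0) mE.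
    by apply: eq_integral => p _; rewrite EFinM.
  apply: ae_eq_integral => //.
    by apply/measurable_EFinP; exact: sec_slab (mQ' x x).
  exists (hor `&` cut Z0 w); split; [|exact: n0|move=> p np].
    by apply: measurableI => //; exact: (measurable_sectionS usual w mZ0).
  apply: contrapT => nZ; apply: np => Dp; have [hp _] := Dh _ Dp.
  have sp : slab T setT (w, p.1, p.2) by split.
  have [pos _ _] : [/\ forall a, (0 <= Q' (w, p.1, p.2) a a)%R,
      forall a b, Q' (w, p.1, p.2) a b = Q' (w, p.1, p.2) b a & `|Q' (w, p.1, p.2)|%R = 1%R].
    by apply: contrapT => nH; apply: nZ; split; [split|apply: subZ0 => H; apply: nH; exact: H].
  by rewrite /f patchE mem_set// (max_idPr (pos x)).
have inm : intensity_measure P F rA (horizon T) N x m.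
  split; [exact: carried_weighted|exact: predictable_weighted| |].
    have hT : horizon T T by rewrite /horizon/= lexx ltW.
    have : {ae P, forall w, forall n, m w (`[0%R, T]%classic `*` U_ n) < +oo}.
      apply: ae_foralln => n; have rU : rA (U_ n) by apply: (ex n).
      have [V _ VE] := covQ' _ x x rU.
      by apply: filterS (m_cyl _ _ _ rU hT (VE T hT)) => w ->; rewrite ltry.
    apply: filterS => w fin.
    exists (fun n => (`[0%R, T]%classic `*` U_ n) `|` ~` hor : set S).
      apply/esym; rewrite -subTset => -[r u] _; have : (\bigcup_n U_ n) u by rewrite bigU.
      move=> [n _ Un]; exists n => //; have [hr|nh] := pselect (horizon T r); last by right => -[].
      by left; split=> //=; rewrite in_itv.
    move=> n; have m1 : measurable (`[0%R, T]%classic `*` U_ n : set S).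
      by apply: measurableX => //; exact: measurable_itv.
    have m2 := measurableC mhor.
    split; first exact: measurableU.
    have sub : m w ((`[0%R, T]%classic `*` U_ n) `|` ~` hor) <= m w (`[0%R, T]%classic `*` U_ n) + m w (~` hor).
      exact: (@measureU2 _ _ _ (m w)).
    apply: le_lt_trans sub _; have -> : m w (~` hor) = 0 by exact: carried_weighted.
    by rewrite adde0.
  move=> A rA'; have [V covV VE] := covQ' A x x rA'; exists V => // t ht.
  exact: m_cyl (VE t ht).
have uniq := intensity_measure_unique usual T0 rA_measurable exh homeoU mN pz car time_zero mB psB iso inm.
have fkm : {ae P, forall w, forall C, measurable C -> k x w C = m w C} by exact: uniq.
have slabU n : measurable (slab T (U_ n) : set PS) by exact: (measurable_slab usual T0).
have intI (C : set PS) : measurable C ->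
    \int[mu]_(z in C) (B z x x)%:E = \int[mu]_(z in C) (h z * f z)%:E.
  move=> mC; rewrite /mu (integral_doleans_in usual T0 pz kz mC (mB x x) (B0 x)).
  rewrite (integral_doleans_in usual T0 pz kz mC mhf hf0).
  have mcC w : measurable (hor `&` cut C w).
    by apply: measurableI => //; exact: (measurable_sectionS usual w mC).
  have mker (g : PS -> R) : measurable_fun setT g -> (forall z, (0 <= g z)%R) ->
      measurable_fun setT (fun w => \int[zeta w]_(p in hor `&` cut C w) (g (w, p.1, p.2))%:E).
    move=> mg g0; have mi : measurable_fun setT (fun z : PS => (\1_C z * g z)%:E).
      by apply/measurable_EFinP; apply: measurable_funM => //; exact: measurable_indic.
    have i0 (z : PS) : 0 <= (\1_C z * g z)%:E by rewrite lee_fin mulr_ge0// indicE.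
    apply: eq_measurable_fun (measurable_kernel_integral usual T0 pz mi i0) => w _.
    rewrite [RHS]integral_mkcondr; apply: eq_integral => p _; rewrite patchE indicE.
    have [Cp|nC] := pselect (C (w, p.1, p.2)); first by rewrite !mem_set// mul1r.
    by rewrite !memNset// mul0r.
  apply: ae_eq_integral => //; [exact: mker (mB x x) (B0 x)|exact: mker mhf hf0|].
  by apply: filterS fkm => w e _; have := e _ (mcC w); rewrite mE form_measureE.
have aen n : {ae mu, forall z, (slab T (U_ n) : set PS) z -> (B z x x)%:E = (h z * f z)%:E}.
  have ig : mu.-integrable (slab T (U_ n)) (fun z => (B z x x)%:E).
    apply/integrableP; split; first by apply: measurable_funTS; apply/measurable_EFinP; exact: mB.
    rewrite (eq_integral (fun z : PS => (B z x x)%:E)) => [|z _]; last by rewrite gee0_abs// lee_fin.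
    rewrite /mu (integral_doleans_in usual T0 pz kz (slabU n) (mB x x) (B0 x)).
    have rU : rA (U_ n) by apply: (ex n).
    apply: le_lt_trans (form_measure_integrable rA_measurable time_zero iso' x rU).
    rewrite le_eqVlt; apply/orP; left; apply/eqP; apply: eq_integral => w _; rewrite form_measureE.
    rewrite (_ : hor `&` _ = horizon T `*` U_ n)//.
    by apply/seteqP; split=> -[r u] /= => [[[hr _] [_ Un]]|[hr Un]].
  apply: (integral_ae_eq (slabU n) ig); first by apply: measurable_funTS; exact/measurable_EFinP.
  by move=> C _ mC; exact: intI.
have : {ae mu, forall z : PS, forall n, (slab T (U_ n) : set PS) z -> (B z x x)%:E = (h z * f z)%:E}.
  by apply: ae_foralln => n; exact: aen.
apply: (@filterS _ _ (ae_filter_ringOfSetsType mu)) => z H hz hz0.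
have : (\bigcup_n U_ n) z.2 by rewrite bigU.
move=> [n _ Un]; have := H n (conj hz Un) => -[e].
have sz : slab T setT z by split.
rewrite /quot e mulrA mulVf// mul1r /f patchE mem_set//.
Qed.

(** The quadratic forms agree at the sums and differences of a dense sequence
    outside one null set; polarisation and continuity recover the operators. *)
Lemma normalised_operator_unique Q' : variation_operator P F rA T (fun (x'' : dual E) (x : E) => x'' x : R)
    (fun prop => {ae muN, forall z, prop z}) (horizon T) N zetaN Q' ->
  {ae muN, forall z, Q' z = QN z}.
Proof.
move=> vQ'; have [_ posQ' _] := vQ'.
have pzN := predictable_weighted usual T0 pz car mh h0.
have kzN : {ae P, forall w, forall C, measurable C -> C `<=` hor -> zetaN w C = zetaN w C} by exact: aeW.
pose m : {measure set PS -> \bar R} := doleans_measure usual T0 pzN kzN.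
have diag x : {ae m, forall z, slab T setT z -> Num.max 0 (Q' z x x) = QN z x x}%R.
  apply: ae_muN; have := diagonal_unique x vQ'.
  apply: (@filterS _ _ (ae_filter_ringOfSetsType mu)) => z H hz nz hz0 _.
  by rewrite (H hz hz0) QN_E -hh'// -(BB' hz nz).
have out : {ae m, forall z, slab T setT z}.
  by apply: ae_muN; apply: aeW => z hz _ _; split.
have all_nm : {ae m, forall z, forall n m, slab T setT z ->
    (Num.max 0 (Q' z (u_ n + u_ m) (u_ n + u_ m)) = QN z (u_ n + u_ m) (u_ n + u_ m) /\
     Num.max 0 (Q' z (u_ n - u_ m) (u_ n - u_ m)) = QN z (u_ n - u_ m) (u_ n - u_ m))%R}.
  apply: ae_foralln => n; apply: ae_foralln => j.
  move: (diag (u_ n + u_ j)%R) (diag (u_ n - u_ j)%R).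
  by apply: (@filterS2 _ _ (ae_filter_ringOfSetsType m)) => z H1 H2 sz; split; [exact: H1|exact: H2].
have psQ' : {ae m, forall z, slab T setT z -> [/\ forall a, (0 <= Q' z a a)%R,
  forall a b, Q' z a b = Q' z b a & `|Q' z|%R = 1%R]} by exact: posQ'.
have psQN : {ae m, forall z, slab T setT z -> [/\ forall a, (0 <= QN z a a)%R,
  forall a b, QN z a b = QN z b a & `|QN z|%R = 1%R]} by exact: QN_psd.
have goal : {ae m, forall z, Q' z = QN z}.
  have both : {ae m, forall z, slab T setT z /\ forall n m,
    (Q' z (u_ n + u_ m) (u_ n + u_ m) = QN z (u_ n + u_ m) (u_ n + u_ m) /\
     Q' z (u_ n - u_ m) (u_ n - u_ m) = QN z (u_ n - u_ m) (u_ n - u_ m))%R}.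
    move: out all_nm psQ'; apply: (@filterS3 _ _ (ae_filter_ringOfSetsType m)) => z sz H pq; split=> // n j.
    have [pos _ _] := pq sz; have [] := H n j sz.
    by rewrite !(max_idPr (pos _)).
  move: both psQ' psQN; apply: (@filterS3 _ _ (ae_filter_ringOfSetsType m)) => z [sz H] pq pn.
  have [_ sym1 _] := pq sz; have [_ sym2 _] := pn sz.
  have expand (C : contlin E (dual E)) a b : (forall a b, C a b = C b a) ->
      C (a + b)%R (a + b)%R = (C a a + C a b + (C a b + C b b))%R /\
      C (a - b)%R (a - b)%R = (C a a - C a b - (C a b - C b b))%R.
    move=> sym; rewrite bilinear_argDl bilinear_argBl !(contlin_argD (C _)) (sym b a).
    by rewrite !(contlin_argN (C _)).
  apply: (bilinear_eq_dense du) => n j; have [] := H n j.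
  have [-> ->] := expand _ (u_ n) (u_ j) sym1; have [-> ->] := expand _ (u_ n) (u_ j) sym2.
  have gen (a b c a' b' c' : R) : (a + b + (b + c) = a' + b' + (b' + c') ->
    a - b - (b - c) = a' - b' - (b' - c') -> b = b')%R by move=> *; lra.
  exact: gen.
exact: goal.
Qed.

End operator.

(** * The quadratic variation of a stochastic integral *)

Theorem theorem3p11
  (R : realType) (d : measure_display) (Omega : measurableType d)
  (P : probability Omega R) (F : R -> set (set Omega))
  (T : R)
  (U : ptopologicalType) (rA : set (set (borelType U))) (U_ : (set U)^nat)
  (X Y : completeNormedModType R)
  (M : R -> set U -> dual X -> Omega -> R)
  (zetaM : R.-ker Omega ~> (R * borelType U)%type)
  (Q : Omega * R * U -> contlin (dual X) X)
  (Phi : Omega * R * U -> contlin X Y)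
  (N : R -> set U -> dual Y -> Omega -> R) :
  let muM := doleans P F T zetaM in
  let pairM := fun (x : X) (x' : dual X) => x' x : R in
  let pairN := fun (y'' : dual (dual Y)) (y' : dual Y) => y'' y' : R in
  let h := fun z => `|PhiQPhi Q Phi z|%R in
  usual_conditions P F ->
  (0 < T)%R ->
  hausdorff_space U ->
  homeomorphic_to_borel R U ->
  borel_ring rA ->
  exhausting rA U_ ->
  reflexive_space X ->
  separable X ->
  separable (dual Y) ->
  orthogonal_mvm P F rA U_ (@halfline R) M ->
  unique_quadratic_variation P F rA (@halfline R) M zetaM ->
  {ae P, forall w,
    ereal_sup [set zetaM w (horizon T `*` A) | A in rA] < +oo} ->
  variation_operator P F rA T pairM (ae_random P zetaM) (@halfline R) M zetaM
    Q ->
  integrable_family rA U_ muM Q Phi ->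
  stochastic_integral P rA U_ M muM Q Phi N ->
  orthogonal_mvm P F rA U_ (horizon T) N ->
  (forall A, rA A -> \int[muM]_(z in slab T A) (h z)%:E < +oo) ->
  exists zetaN : R.-ker Omega ~> (R * borelType U)%type,
    let muN := doleans P F T zetaN in
    let aeN := fun prop : set (Omega * R * U) =>
      {ae muN, forall z, prop z} in
    let QN := fun z =>
      ((h z)^-1 *: contlin_comp (to_bidual Y) (PhiQPhi Q Phi z))%R in
    [/\ unique_quadratic_variation P F rA (horizon T) N zetaN,
      {ae P, forall w, forall C, measurable C -> C `<=` horizon T `*` setT ->
        zetaN w C = \int[zetaM w]_(p in C) (h (w, p.1, p.2))%:E},
      {ae P, forall w, is_density (horizon T `*` setT) (zetaN w) (zetaM w)
        (fun p => h (w, p.1, p.2))},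
      is_density (slab T setT : set (predSpace F T U)) muN muM h &
      variation_operator P F rA T pairN aeN (horizon T) N zetaN QN /\
      forall Q', variation_operator P F rA T pairN aeN (horizon T) N zetaN Q' ->
        {ae muN, forall z, Q' z = QN z}].
Proof.
move=> muM pairM pairN h usual T0 _ homeoU [ringA rA_measurable] exh reflX sepX sepY hM _ bounded varQ
  [intPhi [Phi_ apprPhi]] intN hN integrable_h.
have [x_ dx] := dual_dense_seq reflX sepX.
have [u_ du] := separable_dense_seq sepY.
have [v_ [v1 dv]] := ball_dense_seq (ex_intro _ u_ du).
have mM A x : rA A -> L2_martingale P F (@halfline R) (fun t => M t A x) by case: hM => _ _ + _ _; apply.
have mN A y : rA A -> L2_martingale P F (horizon T) (fun t => N t A y) by case: hN => _ _ + _ _; apply.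
have [zeta [[car pz kz nullE time_zero] [mE isoM]]] :=
  regular_quadratic_variation usual T0 rA_measurable exh dx mM bounded varQ.
pose mu : {measure set (predSpace F T U) -> \bar R} := doleans_measure usual T0 pz kz.
pose Exc : set (predSpace F T U) := exceptional Q x_.
pose Qr := regular_operator F T Q x_.
have mslab := measurable_slab usual T0 (@measurableT _ (borelType U)).
have mu_Exc : mu Exc = 0.
  apply: doleans_null => // w; apply: (@subset_measure0 _ _ _ (zeta w) _ [set p | Exc (w, p.1, p.2)]).
  - apply: measurableI; first exact: (measurable_marks T measurableT).
    exact: (measurable_sectionS usual w mE).
  - exact: (measurable_sectionS usual w mE).
  - by move=> p [].
  - exact: nullE.
have psQ := regular_operator_psd F T Q dx.
have QE (z : Omega * R * U) : horizon T z.1.2 -> ~ Exc z -> Qr z = Q z by exact: regular_operatorE.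
have [mPhi0 _] := intPhi.
have mPhi (y1 y2 : dual Y) : measurable_fun setT (qform Qr Phi y1 y2 : predSpace F T U -> R).
  have mD : measurable (slab T setT `\` Exc : set (predSpace F T U)) by exact: measurableD.
  rewrite (_ : qform _ _ _ _ = qform Q Phi y1 y2 \_ (slab T setT `\` Exc)).
    by apply/(measurable_restrictT _ mD); apply: (measurable_funS mslab _ (mPhi0 y1 y2)); exact: subDsetl.
  apply/funext => z; rewrite patchE.
  have [[hz nz]|nz] := pselect (horizon T z.1.2 /\ ~ Exc z).
    by rewrite mem_set// /qform QE.
  rewrite memNset; last by case=> -[h1 _] h2; exact: nz.
  rewrite /qform /Qr regular_operator0// contlin0; exact: linear0.
pose B z : contlin (dual Y) (dual (dual Y)) := contlin_comp (to_bidual Y) (PhiQPhi Qr Phi z).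
pose B' z : contlin (dual Y) (dual (dual Y)) := contlin_comp (to_bidual Y) (PhiQPhi Q Phi z).
have BE z y1 y2 : B z y1 y2 = qform Qr Phi y1 y2 z by [].
have BE' z y1 y2 : B' z y1 y2 = qform Q Phi y1 y2 z by [].
have BB' z : horizon T z.1.2 -> ~ Exc z -> B z = B' z.
  by move=> hz nz; rewrite /B /PhiQPhi QE.
have mB x y : measurable_fun setT (fun z : predSpace F T U => B z x y : R) by exact: mPhi.
have mB' x y : measurable_fun (slab T setT : set (predSpace F T U)) (fun z : predSpace F T U => B' z x y : R).
  exact: mPhi0.
have psB z : positive_symmetric (B z).
  have [p sym] := psQ z; split=> [a|a b]; first exact: (p (adjoint (Phi z) a)).
  exact: (sym (adjoint (Phi z) a) (adjoint (Phi z) b)).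
have block k A (y : dual Y) s t H : measurable (A : set (borelType U)) -> A `<=` U_ k -> (`|y| <= 1)%R ->
    (0 <= s)%R -> (s <= t)%R -> (t <= T)%R -> F s H ->
    (ip P (incr (fun t => N t A y) H s t) (incr (fun t => N t A y) H s t))%:E =
    \int[mu]_(z in (box H s t A : set (predSpace F T U))) (B z y y)%:E.
  move=> mA AU y1 s0 st tT FH.
  exact: (ito_block usual ringA rA_measurable exh (mu := mu) (Q0 := Q) (Q := Qr) (N0 := Exc)
    (measurable_regular_operator usual T0 x_ varQ) psQ mE mu_Exc QE hM hN isoM intPhi mPhi apprPhi intN
    mA AU y1 s0 st tT FH).
have B0 y z : (0 <= B z y y)%R by have [p _] := psB z; exact: p.
have iso A y s t H : rA A -> (0 <= s)%R -> (s <= t)%R -> (t <= T)%R -> F s H ->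
    (ip P (incr (fun t => N t A y) H s t) (incr (fun t => N t A y) H s t))%:E =
    \int[P]_(w in H) \int[zeta w]_(p in [set r | (s < r <= t)%R] `*` A) (B (w, p.1, p.2) y y)%:E.
  move=> rA' s0 st tT FH.
  rewrite (ito_isometry_ring usual ringA rA_measurable exh hN mB psB block y rA' s0 st tT FH).
  exact: (integral_doleans_box usual T0 pz kz s0 st tT FH (rA_measurable _ rA') (mB y y) (B0 y)).
have polar A x y s t H : rA A -> (0 <= s)%R -> (s <= t)%R -> (t <= T)%R -> F s H ->
    (4 * ip P (incr (fun t => N t A x) H s t) (incr (fun t => N t A y) H s t) =
    ip P (incr (fun t => N t A (x + y)%R) H s t) (incr (fun t => N t A (x + y)%R) H s t) -
    ip P (incr (fun t => N t A (x - y)%R) H s t) (incr (fun t => N t A (x - y)%R) H s t))%R.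
  exact: (ito_polarization usual hN).
have hE z : `|B' z|%R = h z by exact: norm_to_bidual.
pose zetaN : R.-ker Omega ~> (R * borelType U)%type := norm_measure usual T0 pz car mB psB v1 dv.
have integrable_norm A : rA A -> \int[P]_w zetaN w (horizon T `*` A) < +oo.
  move=> rA'; apply: le_lt_trans (integrable_h A rA').
  have mA := rA_measurable _ rA'.
  have mAs : measurable (slab T A : set (predSpace F T U)) by exact: (measurable_slab usual T0).
  have mnB : measurable_fun setT (fun z : predSpace F T U => `|B z|%R) by exact: (measurable_norm_form mB psB v1 dv).
  have e1 : \int[muM]_(z in slab T A) (h z)%:E = \int[mu]_(z in slab T A) (`|B z|%R)%:E.
    rewrite -[LHS]/(\int[mu]_(z in slab T A) (h z)%:E).
    apply: ae_eq_integral => //.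
    - apply/measurable_EFinP; apply: (measurable_funS mslab); first by move=> z [hz _]; split.
      by apply: eq_measurable_fun (measurable_norm_slab usual T0 mB' v1 dv) => z _; exact: hE.
    - by apply: measurable_funTS; exact/measurable_EFinP.
    exists Exc; split; [exact: mE|exact: mu_Exc|move=> z nz].
    apply: contrapT => nE; apply: nz => -[hz _]; by rewrite BB'// hE.
  rewrite e1 /mu (integral_doleans_in usual T0 pz kz mAs mnB (fun z => normr_ge0 (B z))).
  rewrite le_eqVlt; apply/orP; left; apply/eqP; apply: eq_integral => w _; rewrite norm_measureE.
  rewrite (_ : (horizon T `*` setT) `&` _ = horizon T `*` A)//.
  by apply/seteqP; split=> -[r u] /= => [[[hr _] [_ Un]]|[hr Un]].
exists zetaN.
have QNE : (fun z => (`|B' z|^-1 *: B' z)%R) = (fun z => (h z)^-1 *: contlin_comp (to_bidual Y) (PhiQPhi Q Phi z))%R.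
  by apply/funext => z; rewrite hE.
split.
- exact: (norm_measure_variation rA_measurable exh homeoU mN time_zero iso polar integrable_norm).
- move: (norm_measure_density usual T0 pz car kz mB psB mB' mE nullE BB' v1 dv).
  apply: filterS => w E C mC Ch; apply: eq_trans (E C mC Ch) _.
  by apply: eq_integral => p _; rewrite hE.
- move: (norm_measure_is_density usual T0 pz car kz mB psB mB' mE nullE BB' v1 dv).
  by apply: filterS => w; rewrite (_ : (fun p => _) = (fun p => h (w, p.1, p.2)))//; apply/funext => p; exact: hE.
- have := norm_measure_doleans_density usual T0 pz car kz mB psB mB' mE nullE BB' v1 dv.
  by rewrite (_ : (fun z => _) = h)//; apply/funext => z; exact: hE.
- rewrite -QNE; split.
    exact: (normalised_operator usual T0 rA_measurable mN pz car time_zero kz mB psB mB' mE nullE BB' v1 dv iso polar).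
  move=> Q' vQ'; have := normalised_operator_unique rA_measurable exh homeoU mN time_zero kz mE nullE BB' du iso vQ'.
  move=> [A [mA A0 sub]]; exists A; split; [exact: mA|exact: A0|move=> z nz].
  by apply: sub => e; apply: nz; apply: eq_trans e _; rewrite hE.
Qed.
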